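(* Let $1<p<2$ and let $(\varepsilon_n)$ be a sequence of positive reals with $\varepsilon_n\to0$. Let $$L_n=\mathsf a(\mathbf x,\boldsymbol\lambda)\cdot\nabla_{\mathbf x}+\sigma\!\left(\mathbf x,\tfrac{\mathbf x}{\varepsilon_n},\boldsymbol\lambda\right)\mathcal K,\qquad \tilde L=\mathsf a(\mathbf x,\boldsymbol\lambda)\cdot\nabla_{\mathbf x}+\hat\sigma(\mathbf x,\mathbf 0,\boldsymbol\lambda)\,\mathcal K$$ on $\Omega\times\mathcal V$, with $\mathsf a,\sigma,\mathcal K$ as described in the context. Suppose that for every $\mathbf q\in\mathbf Z^d\setminus\{\mathbf 0\}$ $$\hat\sigma(\cdot,\mathbf q,\cdot)\not\equiv0\ \Longrightarrow\ \mathsf a\cdot\mathbf q\not\equiv0$$ (both as functions on $\Omega\times\mathcal V$). Then for any sequence $(u_n)$ such that $u_n\rightharpoonup u$ weakly in $L^p(\Omega\times\mathcal V)$ and $L_nu_n=f_n\to f$ (strongly) in $W^{-1,p}_{\mathrm{loc}}(\Omega\times\mathcal V)$, one has $\tilde Lu=f$.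
   Context: $\Omega\subseteq\mathbf R^d$ is a nonempty connected open set (not necessarily bounded), $\mathcal V\subseteq\mathbf R^d$ is a nonempty bounded domain, $\mathrm T^d=\mathbf R^d/\mathbf Z^d$ is the $d$-dimensional torus with its Haar probability measure; functions on $\mathrm T^d$ are identified with $1$-periodic functions on $\mathbf R^d$, so $\sigma(\mathbf x,\mathbf x/\varepsilon_n,\boldsymbol\lambda)$ means evaluation at the class of $\mathbf x/\varepsilon_n$ in $\mathrm T^d$. Data: $\mathsf a:\Omega\times\mathcal V\to\mathbf R^d$ is a vector function with (real-)analytic components; $\sigma\in C(\Omega\times\mathrm T^d\times\mathcal V)$ is real valued; $\mathcal K:L^p(\mathcal V)\to L^p(\mathcal V)$ is a continuous linear operator whose restriction to $L^{p'}(\mathcal V)$ takes values in $L^{p'}(\mathcal V)$ ($\frac1p+\frac1{p'}=1$), and $\int_{\mathcal V}v\,\mathcal Ku\,d\boldsymbol\lambda=\int_{\mathcal V}u\,\mathcal Kv\,d\boldsymbol\lambda$ for all $u\in L^p(\mathcal V)$, $v\in L^{p'}(\mathcal V)$. The operator $\mathcal K$ acts on functions on $\Omega\times\mathcal V$ in the variable $\boldsymbol\lambda$ (for a.e. fixed $\mathbf x$). Functions $u_n,u$ are complex valued and equations are understood in the sense of distributions on $\Omega\times\mathcal V$. Fourier coefficients are taken in the second (torus) variable: $\hat\sigma(\mathbf x,\mathbf q,\boldsymbol\lambda)=\int_{\mathrm T^d}\sigma(\mathbf x,\mathbf y,\boldsymbol\lambda)e^{-2\pi i\mathbf q\cdot\mathbf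 y}\,d\mathbf y$, $\mathbf q\in\mathbf Z^d$. $W^{-1,p}_{\mathrm{loc}}$ is the space of distributions $f$ with $\varphi f\in W^{-1,p}$ for every $\varphi\in C_c^\infty$; $f_n\to f$ in $W^{-1,p}_{\mathrm{loc}}$ means $\varphi f_n\to\varphi f$ in the norm of $W^{-1,p}$ for every such $\varphi$. *)

(* Defs.v *)
From HB Require Import structures.
From mathcomp Require Import all_boot all_order all_algebra.
From mathcomp Require Import all_classical all_reals all_analysis.
From mathcomp.real_closed Require Import complex.
Set Implicit Arguments.
Unset Strict Implicit.
Unset Printing Implicit Defensive.
Import Order.TTheory GRing.Theory Num.Theory numFieldNormedType.Exports.
Local Open Scope classical_set_scope.
Local Open Scope ring_scope.
Local Open Scope complex_scope.
Import Normc.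

Definition rV_display : measure_display. Proof. exact. Qed.

(* The sigma-algebra of R^n generated by the coordinates, i.e. the Borel one. *)
Section measurable_rV.
Context {R : realType} (n : nat).

Definition rV_cylinder : set (set 'rV[R]_n) :=
  [set A | exists i, exists2 B : set (measurableTypeR R),
     measurable B & A = [set x : 'rV[R]_n | B (x ord0 i)]].

Let rV_set0 : <<s rV_cylinder >> set0.
Proof. exact: sigma_algebra0. Qed.

Let rV_setC A : <<s rV_cylinder >> A -> <<s rV_cylinder >> (~` A).
Proof. exact: sigma_algebraC. Qed.

Let rV_bigcup (F : (set 'rV[R]_n)^nat) :
  (forall i, <<s rV_cylinder >> (F i)) -> <<s rV_cylinder >> (\bigcup_i (F i)).
Proof. exact: sigma_algebra_bigcup. Qed.

HB.instance Definition _ := @isMeasurable.Build rV_display 'rV[R]_n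
  <<s rV_cylinder >> rV_set0 rV_setC rV_bigcup.

Lemma measurable_fun_coord (i : 'I_n) : measurable_fun [set: 'rV[R]_n]
  (fun x => x ord0 i : measurableTypeR R).
Proof.
move=> _ B mB; rewrite setTI; apply: sub_sigma_algebra.
by exists i, B.
Qed.

Lemma measurable_fun_rV d (T : measurableType d) (f : T -> 'rV[R]_n) :
  (forall i, measurable_fun [set: T] (fun t => f t ord0 i : measurableTypeR R)) ->
  measurable_fun [set: T] f.
Proof.
move=> mf; apply: (@measurability _ _ _ _ setT f rV_cylinder) => //.
move=> _ [A [i [B mB ->]] <-]; exact: (mf i measurableT B mB).
Qed.

End measurable_rV.

(* Lebesgue measure on R^n, by recursion on n: the image of the product measure
   on R x R^n under the concatenation R x R^n -> R^(n+1). *)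
Section lebesgue_rV.
Context {R : realType}.
Local Notation leb1 := (@lebesgue_measure R).

Definition rV_cons n (z : measurableTypeR R * 'rV[R]_n) : 'rV[R]_n.+1 :=
  row_mx (z.1)%:M z.2.

Lemma rV_cons0 n z : (@rV_cons n z) ord0 ord0 = z.1.
Proof.
rewrite /rV_cons /row_mx mxE; case: splitP => [j _|k /= ] //.
by rewrite mxE (ord1 j) eqxx.
Qed.

Lemma rV_consS n z (i : 'I_n) : (@rV_cons n z) ord0 (lift ord0 i) = z.2 ord0 i.
Proof.
rewrite /rV_cons /row_mx mxE; case: splitP => [j|k] /=; rewrite /bump /=.
  by move=> jE; have := ltn_ord j; rewrite -jE.
by rewrite !add1n => -[ik]; congr (z.2 _ _); apply/val_inj.
Qed.

Lemma row_rV_cons n z : \row_i (@rV_cons n z) ord0 (lift ord0 i) = z.2.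
Proof. by apply/rowP => i; rewrite mxE rV_consS. Qed.

Lemma measurable_rV_cons n : measurable_fun setT (@rV_cons n).
Proof.
apply: measurable_fun_rV => i; case: (unliftP ord0 i) => [j|] ->.
  under eq_fun do rewrite rV_consS.
  apply: (measurableT_comp (@measurable_fun_coord _ _ j)); exact: measurable_snd.
under eq_fun do rewrite rV_cons0; exact: measurable_fst.
Qed.

Definition lebesgue_rVS n
  (mu : {sigma_finite_measure set 'rV[R]_n -> \bar R}) :
  set 'rV[R]_n.+1 -> \bar R := pushforward (leb1 \x mu)%E (@rV_cons n).

Section instances.
Variables (n : nat) (mu : {sigma_finite_measure set 'rV[R]_n -> \bar R}).

Let lebesgue_rVS0 : lebesgue_rVS mu set0 = 0%E.
Proof. by rewrite /lebesgue_rVS /pushforward preimage_set0 measure0. Qed.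

Let lebesgue_rVS_ge0 A : (0 <= lebesgue_rVS mu A)%E.
Proof. by rewrite /lebesgue_rVS /pushforward; exact: measure_ge0. Qed.

Let lebesgue_rVS_sigma_additive : semi_sigma_additive (lebesgue_rVS mu).
Proof.
rewrite /lebesgue_rVS /pushforward => F mF tF _; rewrite preimage_bigcup.
have mpF k : measurable (@rV_cons n @^-1` F k).
  by rewrite -[X in measurable X]setTI; exact: measurable_rV_cons.
apply: measure_semi_sigma_additive => //; last exact: bigcup_measurable.
apply/trivIsetP => i j _ _ ij; rewrite -preimage_setI.
by move/trivIsetP : tF => /(_ _ _ _ _ ij) ->//; rewrite preimage_set0.
Qed.

HB.instance Definition _ := isMeasure.Build _ _ _ (lebesgue_rVS mu)
  lebesgue_rVS0 lebesgue_rVS_ge0 lebesgue_rVS_sigma_additive.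

Lemma lebesgue_rVSE (A : set R) (B : set 'rV[R]_n) :
  measurable (A : set (measurableTypeR R)) -> measurable B ->
  lebesgue_rVS mu
    [set x : 'rV[R]_n.+1 | A (x ord0 ord0) /\ B (\row_i x ord0 (lift ord0 i))] =
  (leb1 A * mu B)%E.
Proof.
move=> mA mB; rewrite -product_measure1E// /lebesgue_rVS /pushforward; congr (product_measure1 _ _ _).
apply/seteqP; split => -[a b] /=; rewrite rV_cons0;
  by rewrite row_rV_cons => -[].
Qed.

Let sigma_finite_lebesgue_rVS : sigma_finite setT (lebesgue_rVS mu).
Proof.
have /sigma_finiteP[F [FT ndF Foo]] := sigma_finiteT leb1.
have /sigma_finiteP[G [GT ndG Goo]] := sigma_finiteT mu.
exists (fun k => [set x : 'rV[R]_n.+1 |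
    F k (x ord0 ord0) /\ G k (\row_i x ord0 (lift ord0 i))]).
  apply/esym; rewrite -subTset => x _.
  have : setT (x ord0 ord0) by [].
  rewrite FT => -[k _ Fk].
  have : setT (\row_i x ord0 (lift ord0 i)) by [].
  rewrite GT => -[l _ Gl].
  exists (maxn k l) => //; split.
    by move: Fk; exact/subsetPset/ndF/leq_maxl.
  by move: Gl; exact/subsetPset/ndG/leq_maxr.
move=> k; have [mF Fk] := Foo k; have [mG Gk] := Goo k; split.
  apply: measurableI.
    rewrite -[X in measurable X]setTI.
    exact: (measurable_fun_coord (ord0 : 'I_n.+1) measurableT mF).
  have mrow : measurable_fun setT
      (fun x : 'rV[R]_n.+1 => (\row_i x ord0 (lift ord0 i) : 'rV[R]_n)).
    apply: measurable_fun_rV => i; under eq_fun do rewrite mxE.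
    exact: measurable_fun_coord.
  by rewrite -[X in measurable X]setTI; exact: mrow.
by rewrite lebesgue_rVSE// lte_mul_pinfty// ge0_fin_numE.
Qed.

HB.instance Definition _ := Measure_isSigmaFinite.Build _ _ _ (lebesgue_rVS mu)
  sigma_finite_lebesgue_rVS.

End instances.

Fixpoint lebesgue_rV n : {sigma_finite_measure set 'rV[R]_n -> \bar R} :=
  if n is m.+1 then lebesgue_rVS (lebesgue_rV m)
  else @dirac _ 'rV[R]_0 0 R.

Lemma measurable_rV_box n (a b : 'rV[R]_n) :
  measurable [set x : 'rV[R]_n | forall i, a ord0 i <= x ord0 i <= b ord0 i].
Proof.
rewrite [X in measurable X](_ : _ = \bigcap_(i in [set: 'I_n])
    [set x : 'rV[R]_n | x ord0 i \in `[a ord0 i, b ord0 i]]); last first.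
  apply/seteqP; split => x /= xab i; first by move=> _; rewrite /= in_itv /=.
  by have := xab i I; rewrite /= in_itv /=.
apply: fin_bigcap_measurable => // i _.
rewrite -[X in measurable X]setTI.
exact: (@measurable_fun_coord _ _ i measurableT
  _ (measurable_itv `[a ord0 i, b ord0 i])).
Qed.

Lemma lebesgue_rV_box n (a b : 'rV[R]_n) :
  (forall i, a ord0 i <= b ord0 i) ->
  lebesgue_rV n [set x | forall i, a ord0 i <= x ord0 i <= b ord0 i] =
  (\prod_(i < n) (b ord0 i - a ord0 i))%:E.
Proof.
elim: n a b => [|n IH] a b ab.
  by rewrite big_ord0 /= diracE mem_set//= => -[].
pose a' : 'rV[R]_n := \row_i a ord0 (lift ord0 i).
pose b' : 'rV[R]_n := \row_i b ord0 (lift ord0 i).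
rewrite [X in lebesgue_rV _ X](_ : _ = [set x : 'rV[R]_n.+1 |
  `[a ord0 ord0, b ord0 ord0]%classic (x ord0 ord0) /\
  [set y | forall i, a' ord0 i <= y ord0 i <= b' ord0 i]
     (\row_i x ord0 (lift ord0 i))]); last first.
  apply/seteqP; split => x /=.
    by move=> xab; split=> [|i]; [rewrite in_itv /=|rewrite !mxE].
  rewrite in_itv /= => -[x0 xS] i; case: (unliftP ord0 i) => [j|] -> //.
  by have := xS j; rewrite !mxE.
have mB := measurable_rV_box a' b'.
have mA : measurable
    (`[a ord0 ord0, b ord0 ord0]%classic : set (measurableTypeR R)).
  exact: measurable_itv.
transitivity (lebesgue_measure
    (`[a ord0 ord0, b ord0 ord0]%classic : set (measurableTypeR R)) *
  lebesgue_rV n [set y | forall i, (a' ord0 i <= y ord0 i <= b' ord0 i)%R])%E.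
  exact: lebesgue_rVSE.
rewrite IH; last by move=> i; rewrite !mxE.
rewrite big_ord_recl EFinM; congr (_ * _)%E; last first.
  by congr (_%:E); apply: eq_bigr => i _; rewrite !mxE.
rewrite lebesgue_measure_itv /= lte_fin.
have := ab ord0; rewrite le_eqVlt => /predU1P[->|->]; last by rewrite EFinB.
by rewrite ltxx subrr.
Qed.

End lebesgue_rV.

Section complex_Lp.
Context {R : realType} d (T : measurableType d) (mu : {measure set T -> \bar R}).
Implicit Types (D : set T) (f : T -> R[i]).

Definition cintegral D f : R[i] :=
  Complex (\int[mu]_(x in D) complex.Re (f x)) (\int[mu]_(x in D) complex.Im (f x)).

Definition cLnorm D (q : R) f : \bar R :=
  'N[mu]_(q%:E)[(fun x => (normc (f x))%:E) \_ D].

(* Elements of L^q(D) are represented by functions defined everywhere, only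
   their values on D being relevant; no quotient by a.e. equality is taken. *)
Definition cLfun D (q : R) f : Prop :=
  [/\ measurable_fun D (@complex.Re R \o f), measurable_fun D (@complex.Im R \o f) &
      (cLnorm D q f < +oo)%E].

(* [q] is the conjugate exponent of [p]: weak convergence is tested against
   L^q, the dual of L^p for 1 < p < oo. *)
Definition weak_Lp_cvg D (p q : R) (u_ : nat -> T -> R[i]) (u : T -> R[i]) :=
  [/\ forall n, cLfun D p (u_ n), cLfun D p u &
      forall v, cLfun D q v ->
        normc (cintegral D (fun x => u_ n x * v x) -
               cintegral D (fun x => u x * v x)) @[n --> \oo] --> (0 : R)].

(* The operator acts on representatives; continuity forces it to respect a.e.
   equality on D, so it descends to the classes. *)
Definition cts_linear_Lp D (p : R) (K : (T -> R[i]) -> T -> R[i]) : Prop :=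
  [/\ forall u, cLfun D p u -> cLfun D p (K u),
      forall (c : R[i]) u v, cLfun D p u -> cLfun D p v ->
        {ae mu, forall x, D x ->
          K (fun y => c * u y + v y) x = c * K u x + K v x} &
      forall u, cLfun D p u -> forall e : R, 0 < e ->
        exists2 r : R, 0 < r & forall v, cLfun D p v ->
          (cLnorm D p (fun x => (v x - u x)%R) < r%:E)%E ->
          (cLnorm D p (fun x => (K v x - K u x)%R) < e%:E)%E].

Definition symmetric_Lp D (p q : R) (K : (T -> R[i]) -> T -> R[i]) : Prop :=
  forall u v, cLfun D p u -> cLfun D q v ->
    cintegral D (fun x => v x * K u x) = cintegral D (fun x => u x * K v x).

End complex_Lp.

(* The phase space R^d x R^d, with variables z = (x, lambda); its coordinates
   are indexed by 'I_d + 'I_d. *)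
Section phase_space.
Context {R : realType} (d : nat).
Local Notation E := 'rV[R]_d.
Local Notation Z := (E * E)%type.
Local Notation J := ('I_d + 'I_d)%type.
Implicit Types (D : set Z) (phi psi : Z -> R[i]) (f : (Z -> R[i]) -> R[i]).

Definition phase_measure : {measure set Z -> \bar R} :=
  (lebesgue_rV d \x lebesgue_rV d)%E.

Definition coord (j : J) (z : Z) : R :=
  match j with inl i => z.1 0 i | inr i => z.2 0 i end.

Definition basis (j : J) : Z :=
  match j with inl i => (delta_mx 0 i, 0) | inr i => (0, delta_mx 0 i) end.

(* Real analyticity: near every point of D, f is the sum of an absolutely
   convergent power series, summed along the boxes [0, N)^(2d) of
   multi-indices. *)
Definition real_analytic D (g : Z -> R) : Prop :=
  forall z0, D z0 -> exists c : (J -> nat) -> R, exists2 r : R, 0 < r &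
    forall z, ball z0 r z ->
    let term (al : J -> nat) := c al * \prod_j coord j (z - z0) ^+ al j in
    cvgn (fun N => \sum_(al : {ffun J -> 'I_N}) `|term (fun j => al j)|) /\
    (fun N => \sum_(al : {ffun J -> 'I_N}) term (fun j => al j)) @ \oo --> g z.

Definition partial (j : J) phi : Z -> R[i] := fun z =>
  Complex ('D_(basis j) (@complex.Re R \o phi) z) ('D_(basis j) (@complex.Im R \o phi) z).

Definition partials (js : seq J) phi : Z -> R[i] := foldr partial phi js.

Definition smooth phi : Prop := forall js : seq J,
  [/\ continuous (@complex.Re R \o partials js phi),
      continuous (@complex.Im R \o partials js phi),
      forall j z, derivable (@complex.Re R \o partials js phi) z (basis j) &
      forall j z, derivable (@complex.Im R \o partials js phi) z (basis j)].

Definition test_fun D phi : Prop :=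
  let S := closure [set z | phi z != 0] in
  [/\ smooth phi, compact S & S `<=` D].

(* In the continuity estimate, M runs over the upper bounds of the derivatives
   of order at most N. *)
Definition distribution_on D f : Prop :=
  (forall (c : R[i]) phi psi, test_fun D phi -> test_fun D psi ->
     f (fun z => c * phi z + psi z) = c * f phi + f psi) /\
  (forall A, compact A -> A `<=` D ->
     exists N : nat, exists B : R, forall phi, test_fun D phi ->
       (forall z, ~ A z -> phi z = 0) ->
       forall M : R,
         (forall js : seq J, (size js <= N)%N ->
            forall z, normc (partials js phi z) <= M) ->
         normc (f phi) <= B * M).

Definition W1_norm D (q : R) psi : \bar R :=
  (cLnorm phase_measure D q psi +
   \sum_(j : J) cLnorm phase_measure D q (partial j psi))%E.

(* W^{-1,p}(D) is the dual of W^{1,q}_0(D), the closure of the test functions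
   in W^{1,q}(D), where 1/p + 1/q = 1; hence the supremum over test functions.
   The parameter is the exponent q of the predual. *)
Definition Wm1_norm D (q : R) f : \bar R :=
  ereal_sup [set (normc (f psi))%:E | psi in
    [set psi | test_fun D psi /\ (W1_norm D q psi <= 1)%E]].

Definition mul_distribution phi f : (Z -> R[i]) -> R[i] :=
  fun psi => f (fun z => phi z * psi z).

Definition Wm1_loc D (q : R) f : Prop :=
  distribution_on D f /\
  forall phi, test_fun D phi ->
    (Wm1_norm D q (mul_distribution phi f) < +oo)%E.

Definition Wm1_loc_cvg D (q : R) (f_ : nat -> (Z -> R[i]) -> R[i]) f : Prop :=
  [/\ forall n, Wm1_loc D q (f_ n), Wm1_loc D q f &
      forall phi, test_fun D phi ->
        Wm1_norm D q (fun psi => mul_distribution phi (f_ n) psi -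
                                 mul_distribution phi f psi)
          @[n --> \oo] --> 0%E].

(* w is (a jointly measurable representative of) the result of applying K to u
   in the variable lambda, for a.e. fixed x. *)
Definition fiberwise (O V : set E) (p : R) (K : (E -> R[i]) -> E -> R[i])
    (u w : Z -> R[i]) : Prop :=
  cLfun phase_measure (O `*` V) p w /\
  {ae lebesgue_rV d, forall x, O x ->
    {ae lebesgue_rV d, forall l, V l -> w (x, l) = K (fun k => u (x, k)) l}}.

(* The equation a . grad_x u + s K u = f in D'(O x V), where a . grad_x u is
   the distribution phi |-> - \int u div_x (a phi). *)
Definition transport_eq (O V : set E) (p : R) (a : E -> E -> E)
    (s : E -> E -> R[i]) (K : (E -> R[i]) -> E -> R[i])
    (u : Z -> R[i]) f : Prop :=
  exists2 w : Z -> R[i], fiberwise O V p K u w &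
    forall phi, test_fun (O `*` V) phi ->
      f phi =
        - cintegral phase_measure (O `*` V) (fun z => u z *
            \sum_(i < d)
              partial (inl i) (fun y => (a y.1 y.2 0 i)%:C * phi y) z)
        + cintegral phase_measure (O `*` V) (fun z =>
            s z.1 z.2 * w z * phi z).

Definition dotz (v : E) (q : 'rV[int]_d) : R := \sum_(i < d) v 0 i * (q 0 i)%:~R.

(* [sigma] is 1-periodic in its second argument; T^d is identified with the
   unit cube. *)
Definition fourier_coef (sigma : E -> E -> E -> R) (x : E) (q : 'rV[int]_d)
    (l : E) : R[i] :=
  cintegral (lebesgue_rV d) [set y | forall i, 0 <= y 0 i < 1]
    (fun y => (sigma x y l)%:C *
       Complex (cos (- (2 * pi * dotz y q))) (sin (- (2 * pi * dotz y q)))).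

End phase_space.

(* Main.v *)
(* Let e_n(x) = exp(2 pi i q.x / eps_n) with q <> 0.  Testing the n-th equation
   against eps_n e_n phi, the 1 / eps_n produced by the transport term cancels
   and leaves the integral of e_n u_n (a.q) phi plus terms of size eps_n.  The
   left-hand side tends to 0: eps_n e_n phi is bounded in W^{1,p'} and tends
   weakly to 0, while f_n converges strongly.  If a.q is not identically zero,
   its zero set is null by analyticity, so e_n u_n tends weakly to 0.  By
   symmetry K may be moved onto the test function, a function of lambda alone,
   so e_n K u_n tends weakly to 0 as well.  Finally sigma phi is uniformly
   approximated by finite sums of cell indicators times trigonometric
   polynomials in x / eps_n (Fejer): the frequencies q <> 0 with nonzero Fourier
   coefficient vanish in the limit, and q = 0 gives the coefficient of the
   limit equation. *)
Require Import Defs.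
From HB Require Import structures.
From mathcomp Require Import all_boot all_order all_algebra.
From mathcomp Require Import all_classical all_reals all_analysis.
From mathcomp Require Import measurable_realfun ring lra.
From mathcomp.real_closed Require Import complex.
Set Implicit Arguments.
Unset Strict Implicit.
Unset Printing Implicit Defensive.
Import Order.TTheory GRing.Theory Num.Theory numFieldNormedType.Exports.
Local Open Scope classical_set_scope.
Local Open Scope ring_scope.
Local Open Scope complex_scope.
Import Normc HBNNSimple.
Local Notation coord := Defs.coord.
Local Notation basis := Defs.basis.

(** * Complex-valued functions and L^p norms *)

(** [K] is an abstract operator in lambda alone, and this shapes the proof. Symmetry moves it only
    onto factors depending on lambda, everything in x, oscillation included, acting as a scalar on
    each fibre. Hence [sigma phi] is reduced to cells that are products A x B, with the coefficient
    frozen at one point of D per cell. Freezing also localizes the hypothesis: a nonzero coefficient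
    at that point is what yields a.q not identically zero. Moreover the image of [u] under [K] must
    be measurable in both variables jointly, which fibrewise application does not provide; it is
    built by density from tensor products.

    The transport term controls e_n u_n only against functions of the form (a.q) phi. These reach
    all of L^{p'} because 1 / (a.q) can be regularized off a null set, but passing to the limit in
    the test function requires norms of u_n bounded uniformly in n, hence a uniform boundedness
    argument.

    Distributions converge only after multiplication by a cut-off, so every test function is first
    factored into two. *)

Section normc_facts.
Context {R : realType}.
Implicit Types z w : R[i].

Lemma normc_ge0 z : 0 <= normc z.
Proof. by case: z => a b; exact: sqrtr_ge0. Qed.

Lemma cReD z w : complex.Re (z + w) = complex.Re z + complex.Re w.
Proof. by case: z w => [? ?] [? ?]. Qed.
Lemma cImD z w : complex.Im (z + w) = complex.Im z + complex.Im w.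
Proof. by case: z w => [? ?] [? ?]. Qed.
Lemma cReN z : complex.Re (- z) = - complex.Re z.
Proof. by case: z => [? ?]. Qed.
Lemma cImN z : complex.Im (- z) = - complex.Im z.
Proof. by case: z => [? ?]. Qed.
Lemma cReM z w : complex.Re (z * w) =
  complex.Re z * complex.Re w - complex.Im z * complex.Im w.
Proof. by case: z w => [? ?] [? ?]. Qed.
Lemma cImM z w : complex.Im (z * w) =
  complex.Re z * complex.Im w + complex.Im z * complex.Re w.
Proof. by case: z w => [? ?] [? ?]. Qed.

Lemma normc_sqrtE z : normc z = Num.sqrt (complex.Re z ^+ 2 + complex.Im z ^+ 2).
Proof. by case: z. Qed.

Lemma normr_Re_le z : `|complex.Re z| <= normc z.
Proof. by rewrite normc_sqrtE -sqrtr_sqr ler_wsqrtr// lerDl sqr_ge0. Qed.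
Lemma normr_Im_le z : `|complex.Im z| <= normc z.
Proof. by rewrite normc_sqrtE -sqrtr_sqr ler_wsqrtr// lerDr sqr_ge0. Qed.

Lemma le_normcD z w : normc (z + w) <= normc z + normc w.
Proof.
by have := ler_normD z w; rewrite !normc_def -rmorphD lecR -!normc_sqrtE.
Qed.

Lemma normc_le z : normc z <= `|complex.Re z| + `|complex.Im z|.
Proof.
rewrite normc_sqrtE -(@ler_pXn2r _ 2)// ?nnegrE ?sqrtr_ge0 ?addr_ge0//.
rewrite sqr_sqrtr ?addr_ge0 ?sqr_ge0// sqrrD !real_normK ?num_real//.
by rewrite lerD2r lerDl mulrn_wge0// mulr_ge0.
Qed.

Lemma normcR (a : R) : normc a%:C = `|a|.
Proof. by rewrite normc_sqrtE/= expr0n/= addr0 sqrtr_sqr. Qed.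

Lemma normcN z : normc (- z) = normc z.
Proof. by case: z => a b; rewrite /normc/= !sqrrN. Qed.

Lemma normcB z w : normc (z - w) = normc (w - z).
Proof. by rewrite -normcN opprB. Qed.

Lemma ler_normcB z w : `|normc z - normc w| <= normc (z - w).
Proof.
rewrite ler_norml; apply/andP; split.
  by rewrite lerNl opprB lerBlDr -{1}(subrK z w) (normcB z) le_normcD.
by rewrite lerBlDr -{1}(subrK w z) le_normcD.
Qed.

Lemma normc_eq0 z : (normc z == 0) = (z == 0).
Proof. by apply/eqP/eqP => [/eq0_normc//|->]; rewrite normc0. Qed.

Lemma cRe_sum (I : Type) (r : seq I) (P : pred I) (F : I -> R[i]) :
  complex.Re (\sum_(i <- r | P i) F i) = \sum_(i <- r | P i) complex.Re (F i).
Proof. by elim/big_ind2 : _ => // x1 x2 y1 y2 <- <-; rewrite cReD. Qed.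
Lemma cIm_sum (I : Type) (r : seq I) (P : pred I) (F : I -> R[i]) :
  complex.Im (\sum_(i <- r | P i) F i) = \sum_(i <- r | P i) complex.Im (F i).
Proof. by elim/big_ind2 : _ => // x1 x2 y1 y2 <- <-; rewrite cImD. Qed.

Lemma eq_complexP z w :
  complex.Re z = complex.Re w -> complex.Im z = complex.Im w -> z = w.
Proof. by case: z w => [? ?] [? ?] /= -> ->. Qed.

End normc_facts.

Section cmeas.
Context {R : realType} d (T : measurableType d).
Implicit Types (D : set T) (f g : T -> R[i]).

Definition cmeas D f := measurable_fun D (@complex.Re R \o f) /\
  measurable_fun D (@complex.Im R \o f).

Lemma cmeasD D f g : cmeas D f -> cmeas D g -> cmeas D (fun x => f x + g x).
Proof.
move=> [f1 f2] [g1 g2]; split.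
  by rewrite (_ : _ \o _ = (@complex.Re R \o f) \+ (@complex.Re R \o g)); [exact: measurable_funD|apply/funext => x /=; rewrite cReD].
by rewrite (_ : _ \o _ = (@complex.Im R \o f) \+ (@complex.Im R \o g)); [exact: measurable_funD|apply/funext => x /=; rewrite cImD].
Qed.

Lemma cmeasM D f g : cmeas D f -> cmeas D g -> cmeas D (fun x => f x * g x).
Proof.
move=> [f1 f2] [g1 g2]; split.
  rewrite (_ : _ \o _ = ((@complex.Re R \o f) \* (@complex.Re R \o g)) \- ((@complex.Im R \o f) \* (@complex.Im R \o g))); last by apply/funext => x /=; rewrite cReM.
  by apply: measurable_funB; exact: measurable_funM.
rewrite (_ : _ \o _ = ((@complex.Re R \o f) \* (@complex.Im R \o g)) \+ ((@complex.Im R \o f) \* (@complex.Re R \o g))); last by apply/funext => x /=; rewrite cImM.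
by apply: measurable_funD; exact: measurable_funM.
Qed.

Lemma cmeas_cst D (c : R[i]) : cmeas D (fun=> c).
Proof. by split; exact: measurable_cst. Qed.

Lemma cmeasZ D c f : cmeas D f -> cmeas D (fun x => c * f x).
Proof. by move=> ?; apply: cmeasM => //; exact: cmeas_cst. Qed.

Lemma cmeasN D f : cmeas D f -> cmeas D (fun x => - f x).
Proof.
by move=> /(cmeasZ (-1)); under eq_fun do rewrite mulN1r.
Qed.

Lemma cmeasB D f g : cmeas D f -> cmeas D g -> cmeas D (fun x => f x - g x).
Proof. by move=> mf mg; apply: cmeasD => //; exact: cmeasN. Qed.

Lemma cmeas_real D (h : T -> R) : measurable_fun D h -> cmeas D (fun x => (h x)%:C).
Proof. by move=> mh; split => //; exact: measurable_cst. Qed.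

Lemma cmeas_sub D E f : measurable D -> E `<=` D -> cmeas D f -> cmeas E f.
Proof. by move=> mD ED [f1 f2]; split; exact: (measurable_funS mD). Qed.

Lemma cmeas_eq D f g : (forall x, D x -> f x = g x) -> cmeas D f -> cmeas D g.
Proof.
move=> fg [f1 f2]; split.
  by apply: eq_measurable_fun f1 => x /set_mem Dx /=; rewrite fg.
by apply: eq_measurable_fun f2 => x /set_mem Dx /=; rewrite fg.
Qed.

Lemma measurable_sqrt : measurable_fun setT (@Num.sqrt R).
Proof. by apply: continuous_measurable_fun; exact: sqrt_continuous. Qed.

Lemma measurable_normc D f : cmeas D f -> measurable_fun D (fun x => normc (f x)).
Proof.
move=> [f1 f2].
rewrite (_ : (fun x => _) = @Num.sqrt R \o ((fun x => (complex.Re (f x)) ^+ 2) \+ (fun x => (complex.Im (f x)) ^+ 2))); last first.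
  by apply/funext => x /=; rewrite normc_sqrtE.
apply: measurableT_comp; first exact: measurable_sqrt.
by apply: measurable_funD; exact: measurable_funX.
Qed.

Definition cind (E : set T) : T -> R[i] := fun x => (\1_E x)%:C.

Lemma cmeas_ind D E : measurable E -> cmeas D (cind E).
Proof. by move=> mE; apply: cmeas_real; exact: measurable_indic. Qed.

End cmeas.

Section ccvg.
Context {R : realType}.
(** Convergence of complex sequences is stated through the modulus [normc], as in [weak_Lp_cvg], so
    that no topology on [R[i]] is involved. *)
Definition ccvg (c_ : nat -> R[i]) (c : R[i]) :=
  forall e : R, 0 < e -> \forall n \near \oo, normc (c_ n - c) < e.

Lemma ccvgP c_ c : normc (c_ n - c) @[n --> \oo] --> (0 : R) <-> ccvg c_ c.
Proof.
split.
  move=> /cvgrPdist_lt h e e0; have := h e e0; apply: filterS => n.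
  by rewrite sub0r normrN ger0_norm// normc_ge0.
move=> h; apply/cvgrPdist_lt => e e0; have := h e e0; apply: filterS => n.
by rewrite sub0r normrN ger0_norm// normc_ge0.
Qed.

Lemma ccvg_cst c : ccvg (fun=> c) c.
Proof. by move=> e e0; near=> n; rewrite subrr normc0. Unshelve. all: by end_near. Qed.

Lemma ccvgD a_ a b_ b : ccvg a_ a -> ccvg b_ b -> ccvg (fun n => a_ n + b_ n) (a + b).
Proof.
move=> ha hb e e0; have e2 : 0 < e / 2 by rewrite divr_gt0.
near=> n; rewrite opprD addrACA (le_lt_trans (le_normcD _ _))//.
rewrite (splitr e) ltrD//; near: n; [exact: ha|exact: hb].
Unshelve. all: by end_near. Qed.

Lemma ccvgZ k a_ a : ccvg a_ a -> ccvg (fun n => k * a_ n) (k * a).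
Proof.
move=> ha e e0; have k1 : 0 < normc k + 1 by rewrite ltr_wpDl// normc_ge0.
near=> n; rewrite -mulrBr normcM.
apply: (@le_lt_trans _ _ ((normc k + 1) * normc (a_ n - a))).
  by rewrite ler_wpM2r ?normc_ge0// lerDl.
rewrite mulrC -ltr_pdivlMr//; near: n; apply: ha; exact: divr_gt0.
Unshelve. all: by end_near. Qed.

Lemma ccvgN a_ a : ccvg a_ a -> ccvg (fun n => - a_ n) (- a).
Proof. by move=> /(ccvgZ (-1)); rewrite mulN1r; under eq_fun do rewrite mulN1r. Qed.

Lemma ccvg_sum (I : Type) (r : seq I) (A : I -> nat -> R[i]) (b : I -> R[i]) :
  (forall i, ccvg (A i) (b i)) ->
  ccvg (fun n => \sum_(i <- r) A i n) (\sum_(i <- r) b i).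
Proof.
move=> h; elim: r => [|i r IH].
  by rewrite big_nil; under eq_fun do rewrite big_nil; exact: ccvg_cst.
by rewrite big_cons; under eq_fun do rewrite big_cons; exact: ccvgD.
Qed.

(** The approximating sequence may depend on e but is close to [a_] uniformly in n, so limits can be
    exchanged. Passages from simple test functions to general ones go through this rule. *)
Lemma ccvg_approx a_ a : (forall e : R, 0 < e -> exists b_, exists b,
    [/\ ccvg b_ b, forall n, normc (a_ n - b_ n) <= e & normc (a - b) <= e]) ->
  ccvg a_ a.
Proof.
move=> h e e0; have e4 : 0 < e / 4 by rewrite divr_gt0.
have [b_ [b [bb ab_ ab]]] := h _ e4.
near=> n.
have -> : a_ n - a = (a_ n - b_ n) + ((b_ n - b) - (a - b)).
  by ring.
apply: (le_lt_trans (le_normcD _ _)).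
apply: (@le_lt_trans _ _ (e / 4 + (normc (b_ n - b) + e / 4))).
  rewrite lerD//= (le_trans (le_normcD _ _))// normcN lerD//.
have : normc (b_ n - b) < e / 4 by near: n; exact: bb.
move=> hh; have eE : e = e / 4 + e / 4 + e / 4 + e / 4.
  by lra.
by lra.
Unshelve. all: by end_near. Qed.

Lemma ccvg_unique a_ a b : ccvg a_ a -> ccvg a_ b -> a = b.
Proof.
move=> ha hb; apply/eqP; rewrite -subr_eq0 -normc_eq0 eq_le normc_ge0 andbT.
apply/ler_addgt0Pl => e e0; rewrite addr0; have e2 : 0 < e / 2 by rewrite divr_gt0.
near \oo => n.
have -> : a - b = (a_ n - b) - (a_ n - a) by ring.
rewrite (le_trans (le_normcD _ _))// normcN (splitr e) ltW// ltrD//; near: n; [exact: hb|exact: ha].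
Unshelve. all: by end_near. Qed.

End ccvg.

Section Lp.
Context {R : realType} d (T : measurableType d) (mu : {measure set T -> \bar R}).
Variable D : set T.
Hypothesis mD : measurable D.
Implicit Types (f g : T -> R[i]) (q : R).

(** The q-th power of the norm, to which Tonelli, Fatou and dominated convergence apply directly;
    the norm itself serves for the triangle inequality. *)
Definition Lint q f : \bar R := (\int[mu]_(x in D) ((normc (f x)) `^ q)%:E)%E.

(** Real-valued for the sake of arithmetic. [fine] sends an infinite norm to 0, so bounds on [nrm]
    are meaningful only together with [cLfun]. *)
Definition nrm q f : R := fine (cLnorm mu D q f).

Let gn f : T -> R := (fun x => normc (f x)) \_ D.

Let mgn f : cmeas D f -> measurable_fun setT (gn f).
Proof. by move=> mf; apply/(measurable_restrictT _ mD); exact: measurable_normc. Qed.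

Let cLnorm_gn q f : cLnorm mu D q f = ('N[mu]_(q%:E)[EFin \o gn f])%E.
Proof. by rewrite /cLnorm -restrict_EFin. Qed.

Lemma cLnorm_ge0 q f : (0 <= cLnorm mu D q f)%E.
Proof. exact: Lnorm_ge0. Qed.

Lemma Lint_ge0 q f : (0 <= Lint q f)%E.
Proof. by apply: integral_ge0 => x _; rewrite lee_fin powR_ge0. Qed.

Lemma nrm_ge0 q f : 0 <= nrm q f.
Proof. by rewrite fine_ge0// cLnorm_ge0. Qed.

Lemma cLnormE q f : q != 0 -> cLnorm mu D q f = (Lint q f `^ q^-1)%E.
Proof.
move=> q0; rewrite /cLnorm unlock /Lint [in RHS]integral_mkcond.
congr (_ `^ _)%E; apply: eq_integral => x _.
rewrite /patch; case: ifPn => _ /=; first by rewrite ger0_norm ?normc_ge0.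
by rewrite normr0 powR0.
Qed.

Lemma measurable_normc_powR q f : cmeas D f ->
  measurable_fun D (fun x => ((normc (f x)) `^ q)%:E).
Proof.
move=> mf; apply/measurable_EFinP.
apply: (@measurableT_comp _ _ _ _ _ _ (@powR R ^~ q)); first exact: measurable_powR.
exact: measurable_normc.
Qed.

Lemma cLfunP q f : 0 < q ->
  cLfun mu D q f <-> cmeas D f /\ (Lint q f < +oo)%E.
Proof.
move=> q0; rewrite /cLfun cLnormE ?gt_eqF//; split.
  move=> [m1 m2 h]; split => //; rewrite ltey; apply/eqP => e.
  by move: h; rewrite e poweRyr ?ltxx// gt_eqF// invr_gt0.
by move=> [[m1 m2] h]; split => //; rewrite poweR_lty.
Qed.

Lemma cLfun_meas q f : cLfun mu D q f -> cmeas D f.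
Proof. by case. Qed.

Lemma nrmE q f : cLfun mu D q f -> cLnorm mu D q f = (nrm q f)%:E.
Proof. by move=> [_ _ h]; rewrite /nrm fineK// ge0_fin_numE// cLnorm_ge0. Qed.

Lemma LintE q f : 0 < q -> cLfun mu D q f -> Lint q f = (nrm q f `^ q)%:E.
Proof.
move=> q0 h; rewrite -poweR_EFin -nrmE// cLnormE ?gt_eqF// -poweRrM mulVf ?gt_eqF//.
by rewrite poweRe1// Lint_ge0.
Qed.

Lemma le_Lint q f (h : T -> R) : 0 < q -> cmeas D f -> measurable_fun D h ->
  (forall x, D x -> normc (f x) <= h x) ->
  (Lint q f <= \int[mu]_(x in D) ((h x) `^ q)%:E)%E.
Proof.
move=> q0 mf mh fh; apply: ge0_le_integral => //.
- by move=> x _; rewrite lee_fin powR_ge0.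
- exact: measurable_normc_powR.
- apply/measurable_EFinP; apply: (@measurableT_comp _ _ _ _ _ _ (@powR R ^~ q)) => //.
- move=> x Dx; rewrite lee_fin ge0_ler_powR ?nnegrE ?(ltW q0) ?normc_ge0 ?fh//.
  exact: le_trans (normc_ge0 _) (fh _ Dx).
Qed.

Lemma Lint_le q f (M : R) : 0 < q -> 0 <= M -> cmeas D f ->
  (Lint q f <= (M `^ q)%:E)%E -> cLfun mu D q f /\ nrm q f <= M.
Proof.
move=> q0 M0 mf h.
have Lf : cLfun mu D q f by apply/cLfunP => //; split => //; rewrite (le_lt_trans h)// ltry.
split => //; move: h; rewrite LintE// lee_fin => h.
rewrite leNgt; apply/negP => /(gt0_ltr_powR q0).
rewrite !nnegrE nrm_ge0 => /(_ M0 isT); by rewrite ltNge h.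
Qed.

Lemma cLfun_le q f g : 0 < q -> cmeas D f -> cLfun mu D q g ->
  (forall x, D x -> normc (f x) <= normc (g x)) ->
  cLfun mu D q f /\ nrm q f <= nrm q g.
Proof.
move=> q0 mf Lg fg; apply: Lint_le => //; first exact: nrm_ge0.
rewrite -LintE//; apply: (@le_Lint _ _ (fun x => normc (g x))) => //.
exact/measurable_normc/cLfun_meas/Lg.
Qed.

Lemma cLfun_eq q f g : 0 < q -> (forall x, D x -> f x = g x) ->
  cLfun mu D q f -> cLfun mu D q g /\ nrm q g = nrm q f.
Proof.
move=> q0 fg Lf.
have mg : cmeas D g by apply: (cmeas_eq fg); exact: cLfun_meas Lf.
have [Lg h] : cLfun mu D q g /\ nrm q g <= nrm q f.
  by apply: cLfun_le => // x Dx; rewrite fg.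
split => //; apply/eqP; rewrite eq_le h/=.
by apply: (cLfun_le q0 (cLfun_meas Lf) Lg _).2 => x Dx; rewrite fg.
Qed.

Lemma cLfunD q f g : 1 <= q -> cLfun mu D q f -> cLfun mu D q g ->
  cLfun mu D q (fun x => f x + g x) /\
  nrm q (fun x => f x + g x) <= nrm q f + nrm q g.
Proof.
move=> q1 Lf Lg; have q0 : 0 < q by rewrite (lt_le_trans ltr01).
have mf := cLfun_meas Lf; have mg := cLfun_meas Lg.
have mh : cmeas D (fun x => f x + g x) by exact: cmeasD.
have h : (cLnorm mu D q (fun x => (f x + g x)%R) <= (nrm q f + nrm q g)%:E)%E.
  rewrite EFinD -!nrmE// !cLnorm_gn.
  (* Minkowski is applied to the real functions |f| and |g|; |f + g| is then compared with |f| + |g|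
     pointwise. *)
  apply: le_trans (minkowski_EFin mu (mgn mf) (mgn mg) q1).
  rewrite unlock; apply: gt0_ler_poweR; first by rewrite invr_ge0 ltW.
  - by rewrite in_itv/= leey andbT; apply: integral_ge0 => x _; rewrite /= lee_fin powR_ge0.
  - by rewrite in_itv/= leey andbT; apply: integral_ge0 => x _; rewrite /= lee_fin powR_ge0.
  apply: ge0_le_integral => //=.
  - by apply/measurable_EFinP; apply: (@measurableT_comp _ _ _ _ _ _ (@powR R ^~ q)); [exact: measurable_powR|apply: measurableT_comp => //; exact: mgn].
  - apply/measurable_EFinP; apply: (@measurableT_comp _ _ _ _ _ _ (@powR R ^~ q)); first exact: measurable_powR.
    by apply: measurableT_comp => //; apply: measurable_funD; exact: mgn.
  - move=> x _; rewrite lee_fin ge0_ler_powR ?nnegrE ?normr_ge0 ?(ltW q0)//.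
    rewrite /gn /patch; case: ifPn => _; last by rewrite addr0.
    by rewrite !ger0_norm ?addr_ge0 ?normc_ge0//; exact: le_normcD.
have L : cLfun mu D q (fun x => f x + g x).
  by case: mh => ? ?; split => //; rewrite (le_lt_trans h)// ltry.
by split => //; rewrite -lee_fin -nrmE.
Qed.

Lemma cLfunZ q (c : R[i]) f : 0 < q -> cLfun mu D q f ->
  cLfun mu D q (fun x => c * f x) /\ nrm q (fun x => c * f x) = normc c * nrm q f.
Proof.
move=> q0 Lf.
have mf := cLfun_meas Lf; have mh : cmeas D (fun x => c * f x) by exact: cmeasZ.
have E : Lint q (fun x => c * f x) = ((normc c * nrm q f) `^ q)%:E.
  rewrite powRM ?normc_ge0 ?nrm_ge0// EFinM -LintE// /Lint -ge0_integralZl//.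
  - by apply: eq_integral => x _; rewrite normcM powRM ?normc_ge0// EFinM.
  - exact: measurable_normc_powR.
  - by move=> x _; rewrite lee_fin powR_ge0.
  - by rewrite lee_fin powR_ge0.
have L : cLfun mu D q (fun x => c * f x).
  by apply/cLfunP => //; split => //; rewrite E ltry.
split => //; move: E; rewrite LintE// => -[] /(powR_injective q0).
by apply; rewrite nnegrE ?mulr_ge0 ?normc_ge0 ?nrm_ge0.
Qed.

Lemma cLfunN q f : 0 < q -> cLfun mu D q f ->
  cLfun mu D q (fun x => - f x) /\ nrm q (fun x => - f x) = nrm q f.
Proof.
move=> q0 /(cLfunZ (-1) q0); under eq_fun do rewrite mulN1r.
by rewrite normcN normc1 mul1r.
Qed.

Lemma cLfunB q f g : 1 <= q -> cLfun mu D q f -> cLfun mu D q g ->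
  cLfun mu D q (fun x => f x - g x) /\
  nrm q (fun x => f x - g x) <= nrm q f + nrm q g.
Proof.
move=> q1 Lf Lg; have q0 : 0 < q by rewrite (lt_le_trans ltr01).
have [LN <-] := cLfunN q0 Lg; exact: cLfunD.
Qed.

Lemma cLfun0 q : 0 < q -> cLfun mu D q (fun=> 0) /\ nrm q (fun=> 0) = 0.
Proof.
move=> q0; have [] := @Lint_le q (fun=> 0) 0 q0 (lexx _) (cmeas_cst D 0).
  rewrite /Lint; under eq_integral do rewrite normc0 powR0 ?gt_eqF//.
  by rewrite integral0 powR0 ?gt_eqF.
by move=> ? h; split => //; apply/eqP; rewrite eq_le h nrm_ge0.
Qed.

Lemma cLfun_sum q (I : Type) (r : seq I) (F : I -> T -> R[i]) : 1 <= q ->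
  (forall i, cLfun mu D q (F i)) ->
  cLfun mu D q (fun x => \sum_(i <- r) F i x) /\
  nrm q (fun x => \sum_(i <- r) F i x) <= \sum_(i <- r) nrm q (F i).
Proof.
move=> q1 LF; have q0 : 0 < q by rewrite (lt_le_trans ltr01).
elim: r => [|i r [IH1 IH2]].
  rewrite big_nil; under eq_fun do rewrite big_nil.
  by have [? ->] := cLfun0 q0.
rewrite big_cons; under eq_fun do rewrite big_cons.
have [L1 L2] := cLfunD q1 (LF i) IH1; split => //.
by rewrite (le_trans L2)// lerD2l.
Qed.

Lemma cLfunMb q (M : R) b f : 0 < q -> 0 <= M -> cmeas D b ->
  (forall x, D x -> normc (b x) <= M) -> cLfun mu D q f ->
  cLfun mu D q (fun x => b x * f x) /\ nrm q (fun x => b x * f x) <= M * nrm q f.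
Proof.
move=> q0 M0 mb bM Lf.
have [LZ EZ] := cLfunZ (M%:C) q0 Lf.
rewrite -[M in M * _]ger0_norm// -normcR -EZ; apply: cLfun_le => //.
  by apply: cmeasM => //; exact: cLfun_meas Lf.
by move=> x Dx; rewrite !normcM normcR ger0_norm// ler_wpM2r ?normc_ge0// bM.
Qed.

Lemma cLfun_ind q E : 0 < q -> measurable E -> (mu E < +oo)%E ->
  cLfun mu D q (cind E) /\ (Lint q (cind E) <= mu E)%E.
Proof.
move=> q0 mE fE.
have h : (Lint q (cind E) <= mu E)%E.
  rewrite /Lint (_ : (\int[mu]_(x in D) _)%E = (\int[mu]_(x in D) (\1_E x)%:E)%E); last first.
    apply: eq_integral => x _; rewrite /cind normcR ger0_norm ?indic_ge0//.
    rewrite indicE; case: (_ \in _) => /=; first by rewrite powR1.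
    by rewrite powR0 ?gt_eqF.
  by rewrite integral_indic// le_measure ?inE//; exact: measurableI.
split => //; apply/cLfunP => //; split; last exact: le_lt_trans fE.
exact: cmeas_ind.
Qed.

End Lp.

Section cintegral.
Context {R : realType} d (T : measurableType d) (mu : {measure set T -> \bar R}).
Variable D : set T.
Hypothesis mD : measurable D.
Implicit Types (f g : T -> R[i]) (q : R).

Definition cintegrable f :=
  mu.-integrable D (EFin \o (@complex.Re R \o f)) /\
  mu.-integrable D (EFin \o (@complex.Im R \o f)).

Lemma cintegrable_meas f : cintegrable f -> cmeas D f.
Proof.
by move=> [/measurable_int/measurable_EFinP ? /measurable_int/measurable_EFinP ?].
Qed.

Lemma cintegrableP f : cmeas D f ->
  (\int[mu]_(x in D) (normc (f x))%:E < +oo)%E -> cintegrable f.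
Proof.
move=> mf h; have mn : mu.-integrable D (EFin \o (fun x => normc (f x))).
  apply/integrableP; split; first exact/measurable_EFinP/measurable_normc.
  by under eq_integral do rewrite /= ger0_norm ?normc_ge0//.
split; apply: (le_integrable mD _ _ mn).
- by apply/measurable_EFinP; case: mf.
- by move=> x Dx /=; rewrite lee_fin [leRHS]ger0_norm ?normc_ge0// normr_Re_le.
- by apply/measurable_EFinP; case: mf.
- by move=> x Dx /=; rewrite lee_fin [leRHS]ger0_norm ?normc_ge0// normr_Im_le.
Qed.

Lemma cintegrable_normc f : cintegrable f ->
  mu.-integrable D (EFin \o (fun x => normc (f x))).
Proof.
move=> cf; have mf := cintegrable_meas cf; case: cf => f1 f2.
apply: (le_integrable mD _ _ (integrableD mD (integrable_abse f1) (integrable_abse f2))).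
  exact/measurable_EFinP/measurable_normc.
move=> x Dx /=; rewrite lee_fin [leLHS]ger0_norm ?normc_ge0//.
by rewrite (le_trans (normc_le _))// ler_norm.
Qed.

Lemma cintegrable_le f (h : T -> R) : cmeas D f -> mu.-integrable D (EFin \o h) ->
  (forall x, D x -> normc (f x) <= h x) -> cintegrable f.
Proof.
move=> mf /integrableP[mh hoo] fh; apply: cintegrableP => //; apply: le_lt_trans hoo.
apply: ge0_le_integral => //.
- by move=> x _; rewrite lee_fin normc_ge0.
- exact/measurable_EFinP/measurable_normc.
- exact: measurableT_comp.
- by move=> x Dx; rewrite /= lee_fin (le_trans (fh _ Dx))// ler_norm.
Qed.

Lemma cintegrableD f g : cintegrable f -> cintegrable g ->
  cintegrable (fun x => f x + g x).
Proof.
move=> [f1 f2] [g1 g2]; split.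
  rewrite (_ : _ \o _ = (EFin \o (@complex.Re R \o f)) \+ (EFin \o (@complex.Re R \o g)))%E; first exact: integrableD.
  by apply/funext => x /=; rewrite cReD EFinD.
rewrite (_ : _ \o _ = (EFin \o (@complex.Im R \o f)) \+ (EFin \o (@complex.Im R \o g)))%E; first exact: integrableD.
by apply/funext => x /=; rewrite cImD EFinD.
Qed.

Lemma cintegralD f g : cintegrable f -> cintegrable g ->
  cintegral mu D (fun x => f x + g x) = cintegral mu D f + cintegral mu D g.
Proof.
move=> [f1 f2] [g1 g2]; apply: eq_complexP; rewrite /= ?cReD ?cImD/=.
  by rewrite -RintegralD//; apply: eq_Rintegral => x _; rewrite cReD.
by rewrite -RintegralD//; apply: eq_Rintegral => x _; rewrite cImD.
Qed.

Lemma cintegrableZ c f : cintegrable f -> cintegrable (fun x => c * f x).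
Proof.
move=> cf; have [f1 f2] := cf; apply: (@cintegrable_le _ (fun x => normc c * normc (f x))).
- by apply: cmeasZ; exact: cintegrable_meas.
- rewrite (_ : _ \o _ = (fun x => (normc c)%:E * (EFin \o (fun x => normc (f x))) x)%E)//.
  by apply: integrableZl => //; exact: cintegrable_normc.
- by move=> x _; rewrite normcM.
Qed.

Lemma cintegralZ c f : cintegrable f ->
  cintegral mu D (fun x => c * f x) = c * cintegral mu D f.
Proof.
move=> [f1 f2]; case: c => a b.
have zl (k : R) (h : T -> R) : mu.-integrable D (EFin \o h) ->
    mu.-integrable D (EFin \o (fun x => k * h x)).
  move=> ih; rewrite (_ : _ \o _ = (fun x => k%:E * (EFin \o h) x)%E)//.
  exact: integrableZl.
apply: eq_complexP; rewrite ?cReM ?cImM/=.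
  rewrite -RintegralZl// -RintegralZl// -RintegralB//; [|exact: zl|exact: zl].
  by apply: eq_Rintegral => x _; rewrite cReM.
rewrite -RintegralZl// -RintegralZl// -RintegralD//; [|exact: zl|exact: zl].
by apply: eq_Rintegral => x _; rewrite cImM.
Qed.

Lemma cintegrableN f : cintegrable f -> cintegrable (fun x => - f x).
Proof. by move=> /(cintegrableZ (-1)); under eq_fun do rewrite mulN1r. Qed.

Lemma cintegralN f : cintegrable f ->
  cintegral mu D (fun x => - f x) = - cintegral mu D f.
Proof. by move=> /(cintegralZ (-1)); under eq_fun do rewrite mulN1r; rewrite mulN1r. Qed.

Lemma cintegrableB f g : cintegrable f -> cintegrable g ->
  cintegrable (fun x => f x - g x).
Proof. by move=> cf cg; apply: cintegrableD => //; exact: cintegrableN. Qed.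

Lemma cintegralB f g : cintegrable f -> cintegrable g ->
  cintegral mu D (fun x => f x - g x) = cintegral mu D f - cintegral mu D g.
Proof.
by move=> cf cg; rewrite cintegralD ?cintegralN//; exact: cintegrableN.
Qed.

Lemma eq_cintegral f g : (forall x, D x -> f x = g x) ->
  cintegral mu D f = cintegral mu D g.
Proof.
by move=> fg; congr Complex; apply: eq_Rintegral => x /set_mem Dx; rewrite fg.
Qed.

Lemma cintegral0 : cintegral mu D (fun=> 0) = 0.
Proof. by rewrite /cintegral/= /Rintegral integral0. Qed.

Lemma cintegrable0 : cintegrable (fun=> 0).
Proof. by split; exact: integrable0. Qed.

Lemma cintegrable_sum (I : Type) (r : seq I) (F : I -> T -> R[i]) :
  (forall i, cintegrable (F i)) -> cintegrable (fun x => \sum_(i <- r) F i x).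
Proof.
move=> h; elim: r => [|i r IH].
  by under eq_fun do rewrite big_nil; exact: cintegrable0.
by under eq_fun do rewrite big_cons; exact: cintegrableD.
Qed.

Lemma cintegral_sum (I : Type) (r : seq I) (F : I -> T -> R[i]) :
  (forall i, cintegrable (F i)) ->
  cintegral mu D (fun x => \sum_(i <- r) F i x) = \sum_(i <- r) cintegral mu D (F i).
Proof.
move=> h; elim: r => [|i r IH].
  by rewrite big_nil; under eq_fun do rewrite big_nil; exact: cintegral0.
rewrite big_cons; under eq_fun do rewrite big_cons.
by rewrite cintegralD ?IH//; exact: cintegrable_sum.
Qed.

Lemma ae_eq_cintegral f g : cmeas D f -> cmeas D g ->
  {ae mu, forall x, D x -> f x = g x} -> cintegral mu D f = cintegral mu D g.
Proof.
move=> [f1 f2] [g1 g2] fg; congr Complex; congr fine; apply: ae_eq_integral => //.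
- exact/measurable_EFinP.
- exact/measurable_EFinP.
- by apply: filterS fg => x h Dx; rewrite h.
- exact/measurable_EFinP.
- exact/measurable_EFinP.
- by apply: filterS fg => x h Dx; rewrite h.
Qed.

(* The factor 2 spares the rotation argument needed for the sharp constant. *)
Lemma normc_cintegral f : cintegrable f ->
  ((normc (cintegral mu D f))%:E <= 2%:E * \int[mu]_(x in D) (normc (f x))%:E)%E.
Proof.
move=> cf; have [f1 f2] := cf; have cn := cintegrable_normc cf.
have fn : (\int[mu]_(x in D) (normc (f x))%:E)%E \is a fin_num by exact: integrable_fin_num cn.
rewrite -(fineK fn) -EFinM lee_fin mulr_natl mulr2n.
have key h : mu.-integrable D (EFin \o h) -> (forall x, `|h x| <= normc (f x)) ->
    `|\int[mu]_(x in D) h x| <= fine (\int[mu]_(x in D) (normc (f x))%:E).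
  move=> ih hn; apply: (le_trans (le_normr_Rintegral mD ih)).
  apply: le_Rintegral => //; first exact: integrable_norm.
rewrite (le_trans (normc_le _))//= lerD//; apply: key => // x /=.
  exact: normr_Re_le.
exact: normr_Im_le.
Qed.

Lemma hoelder_cLfun p q f g : 0 < p -> 0 < q -> p^-1 + q^-1 = 1 ->
  cLfun mu D p f -> cLfun mu D q g ->
  cintegrable (fun x => f x * g x) /\
  (\int[mu]_(x in D) (normc (f x * g x))%:E <= (nrm mu D p f * nrm mu D q g)%:E)%E.
Proof.
move=> p0 q0 pq Lf Lg; have mf := cLfun_meas Lf; have mg := cLfun_meas Lg.
have mr (h : T -> R[i]) : cmeas D h -> measurable_fun setT ((fun x => normc (h x)) \_ D).
  by move=> mh; apply/(measurable_restrictT _ mD); exact: measurable_normc.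
have h : (\int[mu]_(x in D) (normc (f x * g x))%:E <= (nrm mu D p f * nrm mu D q g)%:E)%E.
  have E k h : cLnorm mu D k h = ('N[mu]_k%:E[EFin \o ((fun x => normc (h x)) \_ D)])%E.
    by rewrite /cLnorm -restrict_EFin.
  rewrite EFinM -!nrmE// !E.
  apply: le_trans (hoelder mu (mr _ mf) (mr _ mg) p0 q0 pq).
  rewrite Lnorm1 integral_mkcond; apply: ge0_le_integral => //.
  - move=> x _; rewrite /patch; case: ifPn => // _; by rewrite lee_fin normc_ge0.
  - apply/(measurable_restrictT _ mD)/measurable_EFinP.
    by apply: measurable_normc; exact: cmeasM.
  - apply: measurableT_comp => //; apply/measurable_EFinP; apply: measurable_funM; exact: mr.
  - move=> x _; rewrite /patch /=; case: ifPn => _; last by rewrite mul0r normr0.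
    by rewrite lee_fin normcM ger0_norm ?mulr_ge0 ?normc_ge0.
split => //; apply: cintegrableP; first exact: cmeasM.
by rewrite (le_lt_trans h)// ltry.
Qed.

Lemma normc_cintegral_hoelder p q f g : 0 < p -> 0 < q -> p^-1 + q^-1 = 1 ->
  cLfun mu D p f -> cLfun mu D q g ->
  normc (cintegral mu D (fun x => f x * g x)) <= 2 * (nrm mu D p f * nrm mu D q g).
Proof.
move=> p0 q0 pq Lf Lg; have [ci h] := hoelder_cLfun p0 q0 pq Lf Lg.
by rewrite -lee_fin (le_trans (normc_cintegral ci))// EFinM lee_pmul2l.
Qed.

End cintegral.

(** * Completeness and dominated convergence in L^p *)

Section Lp_limits.
Context {R : realType} d (T : measurableType d) (mu : {measure set T -> \bar R}).
Variable D : set T.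
Hypothesis mD : measurable D.
Implicit Types (f g : T -> R[i]) (q : R).

Lemma limn_einf_le (u : (\bar R)^nat) (M : \bar R) (k : nat) :
  (forall n, (k <= n)%N -> (u n <= M)%E) -> (limn_einf u <= M)%E.
Proof.
move=> h; rewrite limn_einf_lim; apply: lime_le; first exact: is_cvg_einfs.
near=> n; apply: (@le_trans _ _ (u n)); first by apply: ereal_inf_lbound; exists n => /=.
by apply: h; near: n; exists k.
Unshelve. all: by end_near. Qed.

Lemma cvge0_lt (u : (\bar R)^nat) (c : R) : 0 < c -> u @ \oo --> 0%E ->
  \forall n \near \oo, (u n < c%:E)%E.
Proof.
move=> c0 /fine_cvgP[ufin /cvgrPdist_lt/(_ _ c0)]; apply: filterS2 ufin => n un.
by rewrite sub0r normrN => /(le_lt_trans (ler_norm _)); rewrite -lte_fin fineK.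
Qed.

Lemma cvg_powR (u : R^nat) (l q : R) : 0 < q -> (forall n, 0 <= u n) ->
  u @ \oo --> l -> (u n `^ q) @[n --> \oo] --> l `^ q.
Proof.
move=> q0 u0 ul; have : 0 <= l.
  by rewrite -(cvg_lim (@Rhausdorff R) ul); apply: limr_ge; [apply/cvg_ex; exists l|exact: nearW].
rewrite le_eqVlt => /predU1P[l0|l0].
  (* At the limit 0 the formula x^q = exp (q ln x) is of no use; instead u_n < e^(1/q) gives u_n^q <
     e. *)
  rewrite -l0 powR0 ?gt_eqF//; apply/cvgrPdist_lt => e e0.
  have eq0 : 0 < e `^ q^-1 by rewrite powR_gt0.
  move: ul => /cvgrPdist_lt/(_ _ eq0); apply: filterS => n.
  rewrite -l0 !sub0r !normrN !ger0_norm ?powR_ge0// => un.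
  rewrite -[ltRHS](_ : (e `^ q^-1) `^ q = e); last first.
    by rewrite -powRrM mulVf ?gt_eqF// powRr1 ?ltW.
  by rewrite gt0_ltr_powR ?nnegrE ?powR_ge0.
have -> : l `^ q = expR (q * ln l) by rewrite /powR gt_eqF.
have : expR (q * ln (u n)) @[n --> \oo] --> expR (q * ln l).
  apply: (@cvg_comp _ _ _ (fun n => q * ln (u n)) expR); last exact: continuous_expR.
  apply: cvgM; first exact: cvg_cst.
  by apply: (@cvg_comp _ _ _ u (@ln R)); [exact: ul|exact: continuous_ln].
apply: cvg_trans; apply: near_eq_cvg; near=> n.
rewrite /powR gt_eqF//; near: n.
exact: (cvgr_gt _ ul).
Unshelve. all: by end_near. Qed.

(** Completeness in quantitative form: [r] bounds the tails of the series of norms, and the same [r]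
    bounds the distance from the partial sums to the sum [h]. The series of moduli is finite almost
    everywhere by monotone convergence, and Fatou transfers the bounds to the limit. *)
Lemma riesz_fischer q (g : nat -> T -> R[i]) (r : nat -> R) : 1 <= q ->
  (forall j, cLfun mu D q (g j)) ->
  (forall k n, \sum_(k <= j < n) nrm mu D q (g j) <= r k) ->
  exists h, cLfun mu D q h /\
    forall k, nrm mu D q (fun x => h x - \sum_(0 <= j < k) g j x) <= r k.
Proof.
move=> q1 Lg gr; have q0 : 0 < q by rewrite (lt_le_trans ltr01).
have r0 k : 0 <= r k by have := gr k k; rewrite big_geq.
have Lsum k n : cLfun mu D q (fun x => \sum_(k <= j < n) g j x) /\
   nrm mu D q (fun x => \sum_(k <= j < n) g j x) <= r k.
  have [? h] := cLfun_sum mD (index_iota k n) q1 Lg; split => //.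
  exact: le_trans h (gr k n).
pose G n x := \sum_(0 <= j < n) normc (g j x).
have G0 n x : 0 <= G n x by apply: sumr_ge0 => j _; exact: normc_ge0.
have LG n : cLfun mu D q (fun x => (G n x)%:C) /\ nrm mu D q (fun x => (G n x)%:C) <= r 0%N.
  have Ln j : cLfun mu D q (fun x => (normc (g j x))%:C) /\
      nrm mu D q (fun x => (normc (g j x))%:C) <= nrm mu D q (g j).
    apply: cLfun_le => //; first by apply: cmeas_real; apply: measurable_normc; exact: cLfun_meas (Lg j).
    by move=> x _; rewrite normcR ger0_norm ?normc_ge0.
  have [] := cLfun_sum mD (index_iota 0 n) q1 (fun j => (Ln j).1).
  have -> : (fun x => \sum_(i <- index_iota 0 n) (normc (g i x))%:C) = (fun x => (G n x)%:C).
    by apply/funext => x; rewrite /G rmorph_sum.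
  move=> ? h; split => //; apply: (le_trans h); apply: le_trans (gr 0%N n).
  by apply: ler_sum => j _; exact: (Ln j).2.
pose Gq n x : \bar R := ((G n x) `^ q)%:E.
have mGq n : measurable_fun D (Gq n).
  have := measurable_normc_powR q (cLfun_meas (LG n).1).
  by apply: eq_measurable_fun => x _; rewrite /Gq normcR ger0_norm.
have Gq0 n x : D x -> (0 <= Gq n x)%E by move=> _; rewrite lee_fin powR_ge0.
have Gqnd x : D x -> {homo Gq^~ x : n m / (n <= m)%N >-> (n <= m)%E}.
  move=> _ n m nm; rewrite lee_fin ge0_ler_powR ?nnegrE ?(ltW q0)//.
  rewrite /G [leRHS](@big_cat_nat _ _ _ n)//= lerDl.
  by apply: sumr_ge0 => j _; exact: normc_ge0.
have intG n : (\int[mu]_(x in D) Gq n x <= (r 0%N `^ q)%:E)%E.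
  have [L1 L2] := LG n.
  rewrite (_ : (\int[mu]_(x in D) Gq n x)%E = Lint mu D q (fun x => (G n x)%:C)); last first.
    by apply: eq_integral => x _; rewrite normcR ger0_norm.
  by rewrite LintE// lee_fin ge0_ler_powR ?nnegrE ?nrm_ge0 ?(ltW q0).
pose Goo x := limn (Gq^~ x).
have cGoo x : D x -> cvgn (Gq^~ x) by move=> Dx; apply: ereal_nondecreasing_is_cvgn; exact: Gqnd.
have mGoo : measurable_fun D Goo.
  by apply: (emeasurable_fun_cvg Gq) => // x Dx; exact: cGoo.
have Goo0 x : D x -> (0 <= Goo x)%E.
  by move=> Dx; apply: lime_ge; [exact: cGoo|apply: nearW => n; exact: Gq0].
have iGoo : mu.-integrable D Goo.
  apply/integrableP; split => //; apply: (@le_lt_trans _ _ ((r 0%N) `^ q)%:E); last exact: ltry.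
  under eq_integral => x /set_mem Dx do rewrite gee0_abs ?Goo0//.
  have cM := @cvg_monotone_convergence _ _ _ mu D mD Gq mGq Gq0 Gqnd.
  rewrite -(cvg_lim _ cM)//; apply: lime_le; first by apply/cvg_ex; eexists; exact: cM.
  exact: nearW.
(* Off [E] the series may diverge; [h] is set to 0 there, which keeps it measurable, and D minus [E]
   is null. *)
pose E := D `&` [set x | (Goo x < +oo)%E].
have mE : measurable E.
  by apply: emeasurable_fun_infty_o.
have aeE : {ae mu, forall x, D x -> E x}.
  apply: filterS (integrable_ae mD iGoo) => x h Dx; split => //=.
  by rewrite ltey_eq h.
have cvG x : E x -> cvgn (series (fun j => normc (g j x))).
  move=> [Dx /= Goolt]; apply: nondecreasing_is_cvgn.
    by apply/nondecreasing_seqP => n; rewrite /series/= big_nat_recr//= lerDl normc_ge0.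
  have Gf : Goo x \is a fin_num by rewrite ge0_fin_numE// Goo0.
  exists ((fine (Goo x)) `^ q^-1) => _ [n _ <-].
  have le1 : (G n x) `^ q <= fine (Goo x).
    rewrite -lee_fin fineK//; apply: (@lime_ge _ _ _ _ (Gq n x)); first exact: cGoo.
    by exists n => // m /= nm; exact: Gqnd.
  rewrite -[leLHS](_ : ((G n x) `^ q) `^ q^-1 = _); last first.
    by rewrite -powRrM divff ?gt_eqF// powRr1.
  by apply: ge0_ler_powR; rewrite ?invr_ge0 ?nnegrE ?powR_ge0 ?(ltW q0) ?fine_ge0 ?Goo0.
have cvRI (p : R[i] -> R) : (forall z, `|p z| <= normc z) ->
    forall x, E x -> cvgn (series (fun j => p (g j x))).
  move=> hp x Ex; apply: normed_cvg; apply: series_le_cvg (cvG x Ex) => n //=.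
  exact: normc_ge0.
pose s n x := \sum_(0 <= j < n) g j x.
pose h x : R[i] := if x \in E then Complex (limn (series (fun j => complex.Re (g j x))))
  (limn (series (fun j => complex.Im (g j x)))) else 0.
have hRe x : E x -> complex.Re (s n x) @[n --> \oo] --> complex.Re (h x).
  move=> Ex; rewrite /h mem_set//=.
  under eq_fun do rewrite /s cRe_sum.
  exact: cvRI (@normr_Re_le R) _ Ex.
have hIm x : E x -> complex.Im (s n x) @[n --> \oo] --> complex.Im (h x).
  move=> Ex; rewrite /h mem_set//=.
  under eq_fun do rewrite /s cIm_sum.
  exact: cvRI (@normr_Im_le R) _ Ex.
have ms n : cmeas D (s n) by exact: cLfun_meas (Lsum 0%N n).1.
have mh : cmeas D h.
  have mi : measurable_fun D (\1_E : T -> R) by exact: measurable_indic.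
  split.
    apply: (@measurable_fun_cvg _ _ _ _ (fun n x => complex.Re (s n x) * \1_E x)).
      by move=> n; apply: measurable_funM => //; exact: (ms n).1.
    move=> x Dx /=; rewrite indicE; have [xE|xE] := boolP (x \in E).
      by under eq_fun do rewrite mulr1; apply: hRe; exact: set_mem.
    under eq_fun do rewrite mulr0.
    by rewrite /h (negbTE xE); exact: cvg_cst.
  apply: (@measurable_fun_cvg _ _ _ _ (fun n x => complex.Im (s n x) * \1_E x)).
    by move=> n; apply: measurable_funM => //; exact: (ms n).2.
  move=> x Dx /=; rewrite indicE; have [xE|xE] := boolP (x \in E).
    by under eq_fun do rewrite mulr1; apply: hIm; exact: set_mem.
  under eq_fun do rewrite mulr0.
  by rewrite /h (negbTE xE); exact: cvg_cst.
have hn k x : E x -> normc (s n x - s k x) @[n --> \oo] --> normc (h x - s k x).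
  move=> Ex; apply/cvgrPdist_lt => e e0; have e2 : 0 < e / 2 by rewrite divr_gt0.
  have /cvgrPdist_lt/(_ _ e2) h1 := hRe _ Ex.
  have /cvgrPdist_lt/(_ _ e2) h2 := hIm _ Ex.
  near=> n.
  apply: (@le_lt_trans _ _ (normc (h x - s n x))).
    by rewrite (le_trans (ler_normcB _ _))// opprB addrA subrK.
  rewrite (le_lt_trans (normc_le _))// cReD cImD cReN cImN (splitr e) ltrD//; near: n => //.
have bnd k : cLfun mu D q (fun x => h x - s k x) /\ nrm mu D q (fun x => h x - s k x) <= r k.
  apply: Lint_le => //; first exact: cmeasB.
  pose F n x : \bar R := (normc (s n x - s k x) `^ q)%:E.
  have mF n : measurable_fun D (F n) by apply: measurable_normc_powR; exact: cmeasB.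
  (* Pointwise convergence holds on [E] only, so the integrand is replaced almost everywhere by a
     limit inferior, the form in which Fatou applies. *)
  have eqF : (Lint mu D q (fun x => (h x - s k x)%R) = \int[mu]_(x in D) limn_einf (F^~ x))%E.
    apply: ge0_ae_eq_integral => //.
    - by apply: measurable_normc_powR; exact: cmeasB.
    - rewrite /limn_einf; apply: measurableT_comp => //.
      by apply: measurable_fun_limn_esup => n; exact: measurableT_comp.
    - by move=> x _; rewrite lee_fin powR_ge0.
    - move=> x _; rewrite limn_einf_lim; apply: lime_ge; first exact: is_cvg_einfs.
      apply: nearW => n; apply: le_ereal_inf_tmp => _ [m _ <-].
      by rewrite lee_fin powR_ge0.
    - apply: filterS aeE => x hx Dx; apply/esym.
      have cF : F^~ x @ \oo --> (normc (h x - s k x) `^ q)%:E.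
        apply: cvg_EFin; first exact: nearW.
        by apply: cvg_powR => // [n|]; [exact: normc_ge0|exact: hn (hx Dx)].
      rewrite is_cvg_limn_einfE; first exact: cvg_lim cF.
      by apply/cvg_ex; eexists; exact: cF.
  rewrite eqF; apply: le_trans (fatou mu mD mF _) _; first by move=> n x _; rewrite lee_fin powR_ge0.
  apply: (@limn_einf_le _ _ k) => n kn.
  have E2 : (fun x => s n x - s k x) = (fun x => \sum_(k <= j < n) g j x).
    by apply/funext => x; rewrite /s (@big_cat_nat _ _ _ k)//= [LHS]addrC addKr.
  have [L1 L2] := Lsum k n.
  rewrite [leLHS](_ : _ = Lint mu D q (fun x => \sum_(k <= j < n) g j x)); last first.
    by rewrite -E2.
  by rewrite LintE// lee_fin ge0_ler_powR ?nnegrE ?nrm_ge0 ?(ltW q0).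
exists h; split; last by move=> k; exact: (bnd k).2.
have [L0 _] := bnd 0%N; apply: (cLfun_eq mD q0 _ L0).1 => x _.
by rewrite /s big_geq// subr0.
Unshelve. all: by end_near. Qed.

Lemma nrm_lt q f (e : R) : 0 < q -> 0 < e -> cmeas D f ->
  (Lint mu D q f < (e `^ q)%:E)%E -> cLfun mu D q f /\ nrm mu D q f < e.
Proof.
move=> q0 e0 mf h.
have L : cLfun mu D q f by apply/cLfunP => //; split => //; rewrite (lt_trans h)// ltry.
split => //; move: h; rewrite LintE// lte_fin ltNge => h.
rewrite ltNge; apply: contra h => h.
by apply: ge0_ler_powR; rewrite ?nnegrE ?nrm_ge0 ?(ltW q0) ?(ltW e0).
Qed.

Lemma nrm_dct q (g_ : nat -> T -> R[i]) (G : T -> R[i]) : 0 < q ->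
  (forall n, cmeas D (g_ n)) -> cLfun mu D q G ->
  (forall n x, D x -> normc (g_ n x) <= normc (G x)) ->
  {ae mu, forall x, D x -> normc (g_ n x) @[n --> \oo] --> (0 : R)} ->
  forall e : R, 0 < e ->
    \forall n \near \oo, cLfun mu D q (g_ n) /\ nrm mu D q (g_ n) < e.
Proof.
move=> q0 mg LG gG g0 e e0.
have [mG GG] : _ /\ _ := (cLfunP mu D G q0).1 LG.
have iG : mu.-integrable D (fun x => ((normc (G x)) `^ q)%:E).
  apply/integrableP; split; first exact: measurable_normc_powR.
  by under eq_integral do rewrite gee0_abs ?lee_fin ?powR_ge0//.
have mFn n : measurable_fun D (fun x => ((normc (g_ n x)) `^ q)%:E) by exact: measurable_normc_powR.
have aecv : {ae mu, forall x, D x -> ((normc (g_ n x)) `^ q)%:E @[n --> \oo] --> 0%E}.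
  apply: filterS g0 => x h Dx; apply: cvg_EFin; first exact: nearW.
  rewrite -(@powR0 _ q) ?gt_eqF//; apply: cvg_powR => //; last exact: h.
  by move=> n; exact: normc_ge0.
have aele : {ae mu, forall x n, D x -> (`|((normc (g_ n x)) `^ q)%:E| <= ((normc (G x)) `^ q)%:E)%E}.
  apply/nearW => x n Dx; rewrite gee0_abs ?lee_fin ?powR_ge0//.
  by apply: ge0_ler_powR; rewrite ?nnegrE ?normc_ge0 ?(ltW q0) ?gG.
have [_ _] := dominated_convergence mD mFn (measurable_cst _) aecv iG aele.
rewrite integral0 => h.
have {}h : \forall n \near \oo, (Lint mu D q (g_ n) < (e `^ q)%:E)%E.
  by apply: cvge0_lt h; rewrite powR_gt0.
near=> n; apply: nrm_lt => //; near: n; exact: h.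
Unshelve. all: by end_near. Qed.

End Lp_limits.

(** * Fubini and Tonelli on product sets *)

Section cfubini.
Context {R : realType} d1 d2 (T1 : measurableType d1) (T2 : measurableType d2).
Variables (m1 : {sigma_finite_measure set T1 -> \bar R})
          (m2 : {sigma_finite_measure set T2 -> \bar R}).
Variables (A : set T1) (B : set T2).
Hypotheses (mA : measurable A) (mB : measurable B).
Local Notation m12 := (m1 \x m2)%E.

Let mAB : measurable (A `*` B). Proof. exact: measurableX. Qed.

Lemma measurable_section d' (T' : measurableType d') (f : T1 * T2 -> T') x : A x ->
  measurable_fun (A `*` B) f -> measurable_fun B (fun y => f (x, y)).
Proof.
move=> Ax mf; apply: (@measurable_comp _ _ _ _ _ _ (A `*` B) f) => //.
- by move=> _ [y By <-].
- exact: measurable_funTS (pair1_measurable x).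
Qed.

Lemma cmeas_section (f : T1 * T2 -> R[i]) x : A x -> cmeas (A `*` B) f ->
  cmeas B (fun y => f (x, y)).
Proof. by move=> Ax [f1 f2]; split; [exact: (measurable_section Ax f1)|exact: (measurable_section Ax f2)]. Qed.

Lemma tonelliX (f : T1 * T2 -> \bar R) : measurable_fun (A `*` B) f ->
  (forall z, (0 <= f z)%E) ->
  (\int[m12]_(z in A `*` B) f z = \int[m1]_(x in A) \int[m2]_(y in B) f (x, y))%E.
Proof.
move=> mf f0; rewrite [LHS]integral_mkcond fubini_tonelli1; last 2 first.
- exact/(measurable_restrictT _ mAB).
- by move=> z; rewrite /patch; case: ifP.
rewrite [RHS]integral_mkcond; apply: eq_integral => x _.
rewrite /fubini_F /patch; case: ifPn => xA.
  rewrite [RHS]integral_mkcond; apply: eq_integral => y _.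
  by rewrite /patch in_setX xA.
apply: integral0_eq => y _; by rewrite in_setX (negbTE xA).
Qed.

Lemma measurable_tonelliX (f : T1 * T2 -> \bar R) : measurable_fun (A `*` B) f ->
  (forall z, (0 <= f z)%E) ->
  measurable_fun A (fun x => \int[m2]_(y in B) f (x, y))%E.
Proof.
move=> mf f0.
have mg : measurable_fun setT (f \_ (A `*` B)) by exact/(measurable_restrictT _ mAB).
have g0 z : (0 <= (f \_ (A `*` B)) z)%E by rewrite /patch; case: ifP.
have : measurable_fun A (fubini_F m2 (f \_ (A `*` B))).
  by apply: measurable_funTS; exact: measurable_fun_fubini_tonelli_F.
apply: eq_measurable_fun => x xA.
rewrite /fubini_F [RHS]integral_mkcond; apply: eq_integral => y _.
by rewrite /patch in_setX xA.
Qed.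

Lemma cfubini (f : T1 * T2 -> R[i]) : cintegrable m12 (A `*` B) f ->
  [/\ {ae m1, forall x, A x -> cintegrable m2 B (fun y => f (x, y))},
    cmeas A (fun x => cintegral m2 B (fun y => f (x, y))) &
    cintegral m12 (A `*` B) f = cintegral m1 A (fun x => cintegral m2 B (fun y => f (x, y)))].
Proof.
have key (h : T1 * T2 -> R) : m12.-integrable (A `*` B) (EFin \o h) ->
   [/\ {ae m1, forall x, A x -> m2.-integrable B (EFin \o (fun y => h (x, y)))},
   measurable_fun A (fun x => \int[m2]_(y in B) h (x, y)) &
   \int[m12]_(z in A `*` B) h z = \int[m1]_(x in A) \int[m2]_(y in B) h (x, y)].
  move=> ih; pose g := (EFin \o h) \_ (A `*` B).
  have ig : m12.-integrable setT g by exact/(integrable_mkcond _ mAB).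
  have gE x : A x -> (fun y => g (x, y)) = (EFin \o (fun y => h (x, y))) \_ B.
    move=> Ax; apply/funext => y; rewrite /g /patch in_setX (mem_set Ax)/=.
    by [].
  have gF x : A x -> fubini_F m2 g x = (\int[m2]_(y in B) (h (x, y))%:E)%E.
    by move=> Ax; rewrite /fubini_F gE// -integral_mkcond.
  have gN x : ~ A x -> fubini_F m2 g x = 0%E.
    move=> Ax; apply: integral0_eq => y _; rewrite /g /patch in_setX.
    by rewrite (memNset Ax).
  have iF := integrable_fubini_F ig.
  have mF : measurable_fun A (fun x => \int[m2]_(y in B) h (x, y)).
    have : measurable_fun A (fine \o fubini_F m2 g).
      by apply: measurableT_comp => //; apply: measurable_funTS; exact: measurable_int iF.
    by apply: eq_measurable_fun => x /set_mem Ax /=; rewrite gF.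
  split => //.
    apply: filterS (ae_integrable1 ig) => x + Ax.
    by rewrite gE// => /(integrable_mkcond _ mB).
  rewrite /Rintegral; congr fine.
  rewrite integral_mkcond -/g -integral12_prod_meas1// [RHS]integral_mkcond.
  apply: ae_eq_integral => //.
  - exact: measurable_int iF.
  - by apply/(measurable_restrictT _ mA)/measurable_EFinP.
  - apply: filterS (integrable_ae measurableT iF) => x /(_ I) hf _.
    rewrite /patch; case: ifPn => xA; last by rewrite gN//; move: xA; rewrite notin_setE.
    by move: hf; rewrite gF ?inE//; [move=> /fineK ->|exact: set_mem].
move=> [f1 f2]; have [h1 m1' e1] := key _ f1; have [h2 m2' e2] := key _ f2.
split => //; first by apply: filterS2 h1 h2 => x a1 a2 Ax; split; [exact: a1|exact: a2].
by rewrite /cintegral e1 e2.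
Qed.

End cfubini.

(** * Density of box indicators in L^p *)

Section density.
Context {R : realType} d (T : measurableType d) (mu : {measure set T -> \bar R}).
Variable D : set T.
Hypothesis mD : measurable D.
Variables (q : R) (G : set (set T)) (Q : (set T)^nat).
Hypothesis q1 : 1 <= q.
Hypothesis GE : @measurable _ T = <<s G >>.
Hypothesis GI : setI_closed G.
Hypothesis GQ : forall k, G (Q k).
Hypothesis ndQ : nondecreasing_seq Q.
Hypothesis QT : \bigcup_k Q k = setT.
Hypothesis foo : forall k, (mu (Q k) < +oo)%E.
Variable C : (T -> R[i]) -> Prop.
Hypothesis C_lin : forall c f g, C f -> C g -> C (fun x => c * f x + g x).
Hypothesis C_cl : forall f, cLfun mu D q f -> (forall e : R, 0 < e ->
  exists g, [/\ cLfun mu D q g, C g & nrm mu D q (fun x => f x - g x) < e]) -> C f.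
Hypothesis C_gen : forall B, G B -> (mu B < +oo)%E -> C (cind B).

Let q0 : 0 < q. Proof. exact: lt_le_trans q1. Qed.

Let mG B : G B -> measurable B.
Proof. by move=> GB; rewrite GE; exact: sub_sigma_algebra. Qed.

Let mQ k : measurable (Q k). Proof. exact: mG. Qed.

Let C0 : C (fun=> 0).
Proof.
have h := C_gen (GQ 0) (foo 0); have := C_lin (-1) h h.
by congr C; apply/funext => x; rewrite mulN1r addNr.
Qed.

Let CZ c f : C f -> C (fun x => c * f x).
Proof.
by move=> Cf; have := C_lin c Cf C0; congr C; apply/funext => x; rewrite addr0.
Qed.

Let CD f g : C f -> C g -> C (fun x => f x + g x).
Proof.
by move=> Cf /(C_lin 1 Cf); congr C; apply/funext => x; rewrite mul1r.
Qed.

Let C_sum (I : Type) (r : seq I) (F : I -> T -> R[i]) :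
  (forall i, C (F i)) -> C (fun x => \sum_(i <- r) F i x).
Proof.
move=> h; elim: r => [|i r IH].
  by move: C0; congr C; apply/funext => x; rewrite big_nil.
by have := CD (h i) IH; congr C; apply/funext => x; rewrite big_cons.
Qed.

Let C_dct (g_ : nat -> T -> R[i]) f F : cLfun mu D q f -> cLfun mu D q F ->
  (forall n, C (g_ n)) -> (forall n, cLfun mu D q (g_ n)) ->
  (forall n x, D x -> normc (f x - g_ n x) <= normc (F x)) ->
  (forall x, D x -> normc (f x - g_ n x) @[n --> \oo] --> (0 : R)) -> C f.
Proof.
move=> Lf LF Cg Lg gF gf; apply: C_cl => // e e0.
have := @nrm_dct _ _ _ mu D mD q (fun n x => f x - g_ n x) F q0 _ LF _ _ e e0.
case.
- by move=> n; apply: cmeasB; [exact: cLfun_meas Lf|exact: cLfun_meas (Lg n)].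
- by move=> n x Dx; exact: gF.
- exact: nearW.
- by move=> n _ /(_ n (leqnn n)) [_ h]; exists (g_ n).
Qed.

Let LindQ E k : measurable E -> cLfun mu D q (cind (E `&` Q k)).
Proof.
move=> mE; apply: (cLfun_ind mD q0 _ _).1; first exact: measurableI.
by apply: le_lt_trans (foo k); apply: le_measure; rewrite ?inE//; exact: measurableI.
Qed.

(** The pi-lambda theorem for the class of sets E such that the indicator of E intersected with
    [Q k] is in [C]. Cutting by [Q k], of finite measure, keeps complements and countable unions in
    L^q. *)
Let C_ind E k : measurable E -> C (cind (E `&` Q k)).
Proof.
move=> mE; move: (mE); rewrite GE.
apply: (@dynkin_induction _ T G (fun E => C (cind (E `&` Q k)))) => //.
- by rewrite setTI; apply: C_gen => //; exact: foo.
- move=> B GB; apply: C_gen; first exact: GI.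
  by apply: le_lt_trans (foo k); apply: le_measure; rewrite ?inE//; apply: measurableI => //; exact: mG.
- move=> S mS CS; have := C_lin (-1) CS (C_gen (GQ k) (foo k)).
  congr C; apply/funext => x; rewrite /cind mulN1r !indicE !in_setI in_setC.
  by case: (x \in S); case: (x \in Q k) => /=; rewrite ?addNr ?oppr0 ?add0r.
- move=> F mF tF CF.
  have key n x : (\1_(\bigcup_(i < n) F i `&` Q k) x : R)%:C =
      \sum_(i <- index_iota 0 n) cind (F i `&` Q k) x.
    elim: n => [|n IH]; first by rewrite big_geq// bigcup_mkord big_ord0 set0I indic0.
    rewrite big_nat_recr//= -IH /cind -rmorphD/=; congr (_%:C).
    rewrite bigcup_mkord big_ord_recr/= -bigcup_mkord setIUl !indicE in_setU.
    have [xn|//] := boolP (x \in F n `&` Q k); last by rewrite orbF addr0.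
    rewrite orbT /=; have [xm|_] := boolP (x \in _ `&` _); last by rewrite add0r.
    move: xm xn; rewrite !inE => -[[i /= iltn Fix] _] [Fnx _].
    have /trivIsetP/(_ i n I I) := tF; rewrite neq_ltn iltn => /(_ isT) /seteqP[+ _].
    by move=> /(_ x); case; split.
  have mU : measurable (\bigcup_i F i) by exact: bigcup_measurable.
  pose gg (n : nat) (x : T) : R[i] := (\1_(\bigcup_(i < n) F i `&` Q k) x)%:C.
  apply: (@C_dct gg _ (cind (Q k))).
  + exact: LindQ.
  + by rewrite -[Q k]setTI; exact: LindQ.
  + move=> n; rewrite (_ : gg n = (fun x => \sum_(i <- index_iota 0 n) cind (F i `&` Q k) x)).
      exact: C_sum.
    by apply/funext => x; exact: key.
  + move=> n; apply: LindQ; exact: bigcup_measurable.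
  + move=> n x _; rewrite [X in normc X <= _](_ : _ = (\1_(\bigcup_i F i `&` Q k) x - \1_(\bigcup_(i < n) F i `&` Q k) x)%:C); last by rewrite rmorphB.
    rewrite !normcR !indicE !in_setI.
    by do ![case: (_ \in _)] => /=; rewrite ?subrr ?subr0 ?sub0r ?normrN ?normr0 ?normr1 ?ler01.
  + move=> x Dx.
    have E2 n : cind (\bigcup_i F i `&` Q k) x - gg n x = (\1_(\bigcup_i F i `&` Q k) x - \1_(\bigcup_(i < n) F i `&` Q k) x)%:C.
      by rewrite rmorphB.
    under eq_fun do rewrite E2 normcR.
    apply: cvg_near_cst.
    have [[i _ Fix]|nx] := pselect ((\bigcup_i F i) x).
      exists i.+1 => // n /= ilen; rewrite !indicE !in_setI.
      rewrite (mem_set (_ : (\bigcup_i F i) x)); last by exists i.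
      by rewrite (mem_set (_ : (\bigcup_(i < n) F i) x)) ?subrr ?normr0//; exists i.
    apply: nearW => n; rewrite !indicE !in_setI.
    rewrite (memNset nx) (memNset (_ : ~ (\bigcup_(i < n) F i) x)) ?subrr ?normr0//.
    by move=> [i _ Fix]; apply: nx; exists i.
Qed.

Let C_nneg (h : T -> R) : (forall x, 0 <= h x) -> cLfun mu D q (fun x => (h x)%:C) ->
  C (fun x => (h x)%:C).
Proof.
move=> h0 Lh; have mh : measurable_fun D (EFin \o h).
  apply/measurable_EFinP; have [+ _] := cLfun_meas Lh.
  by apply: eq_measurable_fun.
pose a : nat -> {nnsfun T >-> R} := nnsfun_approx mD mh.
have acv x : D x -> a n x @[n --> \oo] --> h x.
  move=> Dx; have := @cvg_nnsfun_approx _ _ _ _ mD _ mh (fun y _ => _) x Dx.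
  by move=> /(_ h0)/fine_cvgP[].
have alh n x : D x -> a n x <= h x.
  move=> Dx; rewrite -(cvg_lim (@Rhausdorff R) (acv _ Dx)).
  apply: nondecreasing_cvgn_le; last by apply/cvg_ex; exists (h x); exact: acv.
  by move=> i j ij; have /lefP := nd_nnsfun_approx mD mh ij; exact.
(* The truncation to [Q n] brings the level sets of the simple function [a n] within the scope of
   [C_ind]; the dominating function is [h] itself. *)
pose gg (n : nat) (x : T) : R[i] := (a n x * \1_(Q n) x)%:C.
have E2 n x : (h x)%:C - gg n x = (h x - a n x * \1_(Q n) x)%:C by rewrite rmorphB.
have agh n x : D x -> 0 <= a n x * \1_(Q n) x <= h x.
  move=> Dx; rewrite mulr_ge0//= (le_trans _ (alh n _ Dx))//.
  by rewrite ler_piMr// indicE; case: (_ \in _).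
apply: (@C_dct gg _ _ Lh Lh).
- move=> n; rewrite (_ : gg n = fun x => \sum_(y <- finmap.enum_fset (fset_set (range (a n))))
      y%:C * cind (a n @^-1` [set y] `&` Q n) x).
    by apply: C_sum => y; apply: CZ; exact: C_ind.
  apply/funext => x; rewrite /gg fimfunE fsbig_finite//= mulr_suml rmorph_sum/=.
  apply: eq_bigr => y _; rewrite /cind -rmorphM/=; congr (_%:C).
  by rewrite -mulrA indicI.
- move=> n; apply: (cLfun_le mD q0 _ Lh _).1.
    by apply: cmeas_real; apply: measurable_funM; [exact: measurable_funTS|exact: measurable_indic].
  move=> x Dx; have /andP[? ?] := agh n _ Dx.
  by rewrite !normcR !ger0_norm.
- move=> n x Dx; have /andP[? ?] := agh n _ Dx.
  by rewrite E2 !normcR ger0_norm ?subr_ge0// ger0_norm// lerBlDr lerDl.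
- move=> x Dx; have -> : (fun n => normc ((h x)%:C - gg n x)) = (fun n => `|h x - a n x * \1_(Q n) x|).
    by apply/funext => n; rewrite E2 normcR.
  apply/norm_cvg0P; rewrite -[X in _ --> X](subrr (h x)); apply: cvgB; first exact: cvg_cst.
  apply: cvg_trans (acv _ Dx); apply: near_eq_cvg.
  have : (\bigcup_k Q k) x by rewrite QT.
  move=> [k _ Qkx]; exists k => // n /= kn; rewrite indicE mem_set ?mulr1//.
  by move: Qkx; exact/subsetPset/ndQ.
Qed.

(** [C] is kept abstract because density is used for two unrelated properties: weak convergence to
    zero of a bounded sequence tested against f, and existence of a jointly measurable image of f
    under [K]. *)
Theorem Lp_density f : cLfun mu D q f -> C f.
Proof.
move=> Lf.
have mf := cLfun_meas Lf.
have key (p : R[i] -> R) : (forall z, `|p z| <= normc z) -> measurable_fun D (p \o f) ->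
    C (fun x => (p (f x))%:C).
  move=> pn mp.
  have L (s : R -> R) : measurable_fun setT s -> (forall y, 0 <= s y <= `|y|) ->
      C (fun x => (s (p (f x)))%:C).
    move=> ms s0; apply: C_nneg; first by move=> x; have /andP[] := s0 (p (f x)).
    apply: (cLfun_le mD q0 _ Lf _).1.
      by apply: cmeas_real; exact: (measurableT_comp ms).
    move=> x Dx; rewrite normcR ger0_norm; last by have /andP[] := s0 (p (f x)).
    by apply: le_trans (pn _); have /andP[] := s0 (p (f x)).
  have m1 : measurable_fun setT (fun y : R => Num.max y 0) by apply: measurable_maxr.
  have m2 : measurable_fun setT (fun y : R => Num.max (- y) 0) by apply: measurable_maxr => //; exact: measurable_funN.
  have C1 := L _ m1; have C2 := L _ m2.
  have := C_lin (-1) (C2 _) (C1 _).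
  have E : (fun x => -1 * (Num.max (- p (f x)) 0)%:C + (Num.max (p (f x)) 0)%:C) = (fun x => (p (f x))%:C).
    apply/funext => x; rewrite mulN1r -rmorphN -rmorphD/=; congr (_%:C).
    by have [|] := leP (p (f x)) 0; have [|] := leP (- p (f x)) 0; lra.
  rewrite E; apply; move=> y; rewrite le_max lexx orbT/= ge_max normr_ge0 andbT.
    by rewrite -normrN ler_norm.
  exact: ler_norm.
have := C_lin 'i (key _ (@normr_Im_le R) mf.2) (key _ (@normr_Re_le R) mf.1).
congr C; apply/funext => x; apply: eq_complexP; rewrite ?cReD ?cImD ?cReM ?cImM/=; ring.
Qed.

End density.

(** * Boxes in R^n and in phase space *)

Section rV_boxes.
Context {R : realType}.

Definition obox n (a b : 'rV[R]_n) : set 'rV[R]_n :=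
  [set x | forall i, a ord0 i < x ord0 i < b ord0 i].

Definition cbox n (a b : 'rV[R]_n) : set 'rV[R]_n :=
  [set x | forall i, a ord0 i <= x ord0 i <= b ord0 i].

Lemma measurable_obox n (a b : 'rV[R]_n) : measurable (obox a b).
Proof.
rewrite [X in measurable X](_ : _ = \bigcap_(i in [set: 'I_n])
    [set x : 'rV[R]_n | x ord0 i \in `]a ord0 i, b ord0 i[]); last first.
  apply/seteqP; split => x /= xab i; first by move=> _; rewrite /= in_itv /=.
  by have := xab i I; rewrite /= in_itv /=.
apply: fin_bigcap_measurable => // i _.
rewrite -[X in measurable X]setTI.
exact: (@measurable_fun_coord _ _ i measurableT _ (measurable_itv `]a ord0 i, b ord0 i[)).
Qed.

Lemma lebesgue_cbox_fin n (a b : 'rV[R]_n) : (lebesgue_rV n (cbox a b) < +oo)%E.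
Proof.
have [ab|/existsNP[i nab]] := pselect (forall i, a ord0 i <= b ord0 i).
  by rewrite lebesgue_rV_box// ltry.
rewrite (_ : cbox a b = set0) ?measure0//; apply/seteqP; split => // x /(_ i).
by move=> /andP[h1 h2]; apply: nab; exact: le_trans h1 h2.
Qed.

Lemma obox_cbox n (a b : 'rV[R]_n) : obox a b `<=` cbox a b.
Proof. by move=> x h i; have /andP[/ltW-> /ltW->] := h i. Qed.

Lemma lebesgue_obox_fin n (a b : 'rV[R]_n) : (lebesgue_rV n (obox a b) < +oo)%E.
Proof.
apply: le_lt_trans (lebesgue_cbox_fin a b); apply: le_measure; rewrite ?inE.
- exact: measurable_obox.
- exact: measurable_rV_box.
- exact: obox_cbox.
Qed.

Lemma oboxI n (a b a' b' : 'rV[R]_n) : obox a b `&` obox a' b' =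
  obox (\row_i Num.max (a ord0 i) (a' ord0 i)) (\row_i Num.min (b ord0 i) (b' ord0 i)).
Proof.
apply/seteqP; split => x.
  move=> [h1 h2] i; have /andP[h3 h4] := h1 i; have /andP[h5 h6] := h2 i.
  by rewrite !mxE gt_max lt_min h3 h4 h5 h6.
move=> h; split => i; have := h i; rewrite !mxE gt_max lt_min.
  by move=> /andP[/andP[-> _] /andP[-> _]].
by move=> /andP[/andP[_ ->] /andP[_ ->]].
Qed.

Lemma rV_ballP n (x y : 'rV[R]_n) r : 0 < r ->
  ball x r y <-> forall i, `|x ord0 i - y ord0 i| < r.
Proof.
move=> r0; split.
  by move=> h i; have [_ h'] := h; have := h' ord0 i; rewrite -ball_normE.
by move=> h; split => // i j; rewrite (ord1 i) -ball_normE/=.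
Qed.

(** Open cubes of side 2/(m+1) centred at the points k/(m+1). They overlap, so that at each scale
    they cover the space although they are open; being countably many, they express open sets as
    countable unions. *)
Definition cell n (m : nat) (k : 'rV[int]_n) : set 'rV[R]_n :=
  obox (\row_i ((k ord0 i - 1)%:~R / m.+1%:R)) (\row_i ((k ord0 i + 1)%:~R / m.+1%:R)).

Lemma cell_ball n m (k : 'rV[int]_n) x y :
  cell m k x -> cell m k y -> ball x (2 / m.+1%:R) y.
Proof.
move=> hx hy; apply/rV_ballP; first by rewrite divr_gt0// ltr0n.
move=> i; have := hx i; have := hy i; rewrite !mxE.
set u := (k ord0 i)%:~R : R; have m0 : (0 : R) < m.+1%:R by rewrite ltr0n.
have -> : (k ord0 i - 1)%:~R = u - 1 :> R by rewrite rmorphB.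
have -> : (k ord0 i + 1)%:~R = u + 1 :> R by rewrite rmorphD.
rewrite !mulrDl ltr_distl => /andP[h1 h2] /andP[h3 h4]; move: h1 h2 h3 h4.
by rewrite mulN1r; set w := _^-1; set v := u * w; move=> *; apply/andP; split; lra.
Qed.

Lemma cell_mem n m (x : 'rV[R]_n) :
  cell m (\row_i Num.floor (x ord0 i * m.+1%:R)) x.
Proof.
move=> i; rewrite !mxE; have m0 : (0 : R) < m.+1%:R by rewrite ltr0n.
rewrite ltr_pdivrMr// ltr_pdivlMr// rmorphB/= ltrBlDr.
rewrite floorD1_gt andbT (le_lt_trans (floor_le_tmp _))// ltrDl//.
Qed.

End rV_boxes.

Lemma measurable_bigcup_countType d (T : measurableType d) (I : countType)
    (P : set I) (F : I -> set T) :
  (forall i, measurable (F i)) -> measurable (\bigcup_(i in P) F i).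
Proof.
move=> mF; rewrite bigcup_mkcond; apply: countable_bigcupT_measurable => [|i].
  exact: countableP.
by case: ifP.
Qed.

Section Z_boxes.
Context {R : realType} (d : nat).
Local Notation E := 'rV[R]_d.
Local Notation Z := (E * E)%type.

Definition zobox (a b a' b' : E) : set Z := obox a b `*` obox a' b'.

Definition zboxes : set (set Z) :=
  [set B | exists a b a' b', B = zobox a b a' b'].

Lemma measurable_zobox a b a' b' : measurable (zobox a b a' b').
Proof. by apply: measurableX; exact: measurable_obox. Qed.

Lemma zboxes_setI : setI_closed zboxes.
Proof.
move=> _ _ [a [b [a' [b' ->]]]] [c [e [c' [e' ->]]]].
by rewrite /zobox -setXI !oboxI; do 4 eexists.
Qed.

Lemma zobox_fin a b a' b' : (phase_measure d (zobox a b a' b') < +oo)%E.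
Proof.
have -> : phase_measure d (zobox a b a' b') =
    (lebesgue_rV d (obox a b) * lebesgue_rV d (obox a' b'))%E.
  by apply: product_measure1E; exact: measurable_obox.
by rewrite lte_mul_pinfty// ?ge0_fin_numE ?lebesgue_obox_fin.
Qed.

Definition Qbox (k : nat) : set Z :=
  zobox (const_mx (- k%:R)) (const_mx k%:R) (const_mx (- k%:R)) (const_mx k%:R).

Lemma QboxP k z : Qbox k z <-> forall j, `|Defs.coord j z| < k%:R.
Proof.
split.
  by move=> [h1 h2] [i|i] /=; [have := h1 i|have := h2 i]; rewrite !mxE ltr_norml.
by move=> h; split => i; [have := h (inl i)|have := h (inr i)]; rewrite !mxE ltr_norml.
Qed.

Lemma zboxes_Qbox k : zboxes (Qbox k).
Proof. by do 4 eexists. Qed.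

Lemma nd_Qbox : nondecreasing_seq Qbox.
Proof.
move=> k l kl; apply/subsetPset => z /QboxP h; apply/QboxP => j.
by rewrite (lt_le_trans (h j))// ler_nat.
Qed.

Lemma coord_bound (z : Z) : exists k : nat, forall j, `|Defs.coord j z| < k%:R.
Proof.
pose M := \sum_j `|Defs.coord j z|; exists (Num.bound M) => j.
have M0 : 0 <= M by apply: sumr_ge0 => i _.
apply: le_lt_trans (archi_boundP M0).
by rewrite /M (bigD1 j)//= lerDl sumr_ge0.
Qed.

Lemma bigcup_Qbox : \bigcup_k Qbox k = setT.
Proof.
apply/seteqP; split => // z _; have [k hk] := coord_bound z; exists k => //.
exact/QboxP.
Qed.

(** The identity, seen as a map from the sigma-algebra of boxes, is measurable because each
    coordinate is: the slab of points with coordinate [j] in an open interval is a countable union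
    of boxes whose other sides are (-k, k). *)
Lemma measurable_zboxes : @measurable _ Z = <<s zboxes >>.
Proof.
apply/seteqP; split; last first.
  apply: smallest_sub; first exact: sigma_algebra_measurable.
  by move=> _ [a [b [a' [b' ->]]]]; exact: measurable_zobox.
pose T0 : measurableType _ := g_sigma_algebraType zboxes.
pose f : T0 -> Z := id.
suff mf : measurable_fun setT f.
  by move=> A mA; have := mf measurableT A mA; rewrite setTI.
have mc j : measurable_fun setT (fun z : T0 => Defs.coord j (f z) : measurableTypeR R).
  apply: (measurability _ (RGenOpens.measurableE R)) => //.
  move=> _ [_ [x [y ->]] <-]; rewrite setTI.
  have zbm B : zboxes B -> measurable (B : set T0) by move=> hB; exact: sub_sigma_algebra.
  pose lo (k : nat) (l : 'I_d + 'I_d) : R := if l == j then Num.max x (- k%:R) else - k%:R.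
  pose hi (k : nat) (l : 'I_d + 'I_d) : R := if l == j then Num.min y k%:R else k%:R.
  rewrite (_ : _ @^-1` _ = \bigcup_k (zobox (\row_i lo k (inl i)) (\row_i hi k (inl i))
       (\row_i lo k (inr i)) (\row_i hi k (inr i)) : set T0)); last first.
    have zE k (z : Z) : zobox (\row_i lo k (inl i)) (\row_i hi k (inl i))
       (\row_i lo k (inr i)) (\row_i hi k (inr i)) z <-> forall l, lo k l < Defs.coord l z < hi k l.
      split; first by move=> [h1 h2] [i|i]; [have := h1 i|have := h2 i]; rewrite !mxE.
      by move=> h; split => i; rewrite !mxE; [exact: (h (inl i))|exact: (h (inr i))].
    apply/seteqP; split => z /=.
      rewrite in_itv/= => /andP[h1 h2]; have [k hk] := coord_bound (f z).
      exists k => //; apply/zE => l; have := hk l; rewrite ltr_norml => /andP[h3 h4].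
      rewrite /lo /hi; case: eqP => [->|_]; last by rewrite h3 h4.
      by rewrite gt_max lt_min h1 h2/=; have := hk j; rewrite ltr_norml.
    move=> [k _ /zE/(_ j)]; rewrite /lo /hi eqxx gt_max lt_min in_itv/=.
    by move=> /andP[/andP[-> _] /andP[-> _]].
  by apply: bigcupT_measurable => k; apply: zbm; do 4 eexists.
have -> : f = fun z : T0 => ((f z).1, (f z).2) by apply/funext => z /=; case: (f z).
apply: measurable_fun_pair; apply: measurable_fun_rV => i; [exact: (mc (inl i))|exact: (mc (inr i))].
Qed.

Definition zcell (m : nat) (k : 'rV[int]_d * 'rV[int]_d) : set Z :=
  cell m k.1 `*` cell m k.2.

Lemma measurable_zcell m k : measurable (zcell m k).
Proof. by apply: measurableX; exact: measurable_obox. Qed.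

Lemma open_zcell (D : set Z) z : open D -> D z -> exists mk : nat * ('rV[int]_d * 'rV[int]_d),
  zcell mk.1 mk.2 z /\ zcell mk.1 mk.2 `<=` D.
Proof.
move=> oD Dz; have /nbhs_ballP[r /= r0 rD] : nbhs z D by exact: open_nbhs_nbhs.
pose m := Num.bound (2 / r).
have hm : 2 / m.+1%:R < r.
  rewrite ltr_pdivrMr ?ltr0n// mulrC -ltr_pdivrMr//.
  rewrite (lt_le_trans (archi_boundP _))//; first by rewrite divr_ge0// ltW.
  by rewrite ler_nat.
exists (m, (\row_i Num.floor (z.1 ord0 i * m.+1%:R), \row_i Num.floor (z.2 ord0 i * m.+1%:R))).
split; first by split; exact: cell_mem.
move=> y [y1 y2]; apply: rD; apply: (le_ball (ltW hm)).
by split; [apply: cell_ball y1|apply: cell_ball y2]; exact: cell_mem.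
Qed.

(** The sigma-algebra on the phase space is the product one, so an open set is exhibited as the
    union of the countably many cells it contains. *)
Lemma open_measurableZ (D : set Z) : open D -> measurable D.
Proof.
move=> oD; rewrite (_ : D = \bigcup_(mk in [set mk : nat * ('rV[int]_d * 'rV[int]_d) | zcell mk.1 mk.2 `<=` D]) zcell mk.1 mk.2).
  apply: measurable_bigcup_countType => mk; exact: measurable_zcell.
apply/seteqP; split; last by move=> z [mk /= h /h].
by move=> z /(open_zcell oD)[mk [h1 h2]]; exists mk.
Qed.

Lemma open_measurable_rV n (A : set 'rV[R]_n) : open A -> measurable A.
Proof.
move=> oA; rewrite (_ : A = \bigcup_(mk in [set mk : nat * 'rV[int]_n | cell mk.1 mk.2 `<=` A]) cell mk.1 mk.2).
  apply: measurable_bigcup_countType => mk; exact: measurable_obox.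
apply/seteqP; split; last by move=> z [mk /= h /h].
move=> x Ax; have /nbhs_ballP[r /= r0 rA] : nbhs x A by exact: open_nbhs_nbhs.
pose m := Num.bound (2 / r).
have hm : 2 / m.+1%:R < r.
  rewrite ltr_pdivrMr ?ltr0n// mulrC -ltr_pdivrMr//.
  rewrite (lt_le_trans (archi_boundP _))//; first by rewrite divr_ge0// ltW.
  by rewrite ler_nat.
exists (m, \row_i Num.floor (x ord0 i * m.+1%:R)); last exact: cell_mem.
move=> y /= hy; apply: rA; apply: (le_ball (ltW hm)).
by apply: cell_ball hy; exact: cell_mem.
Qed.

Lemma continuous_within_measurable (D : set Z) (g : Z -> R) : open D ->
  {within D, continuous g} -> measurable_fun D g.
Proof.
move=> oD; rewrite continuous_open_subspace// => cg.
apply: (measurability _ (RGenOpens.measurableE R)) => //.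
move=> _ [_ [x [y ->]] <-]; apply: open_measurableZ.
rewrite openE => z [Dz gz]; apply: filterI; first exact: open_nbhs_nbhs.
apply: cg; first exact: mem_set.
by apply: open_nbhs_nbhs; split => //; exact: interval_open.
Qed.

Lemma coord_le_norm j (z : Z) : `|Defs.coord j z| <= `|z|.
Proof.
have key (x : E) i : `|x ord0 i| <= `|x|.
  by rewrite /Num.norm/= mx_normrE (le_trans _ (le_bigmax _ _ (ord0, i))).
rewrite prod_normE le_max; case: j => i /=; first by rewrite key.
by rewrite key orbT.
Qed.

Lemma compact_Qbox (S : set Z) : compact S -> exists k, S `<=` Qbox k.
Proof.
move=> /compact_bounded[M [_ hM]]; pose m := `|M| + 1.
have m0 : 0 <= m by rewrite addr_ge0.
exists (Num.bound m) => z Sz; apply/QboxP => j.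
apply: le_lt_trans (coord_le_norm _ _) _; apply: le_lt_trans (archi_boundP m0).
by apply: hM => //; rewrite (le_lt_trans (ler_norm _))// ltrDl.
Qed.

End Z_boxes.

(** * Weakly convergent sequences are bounded *)

Section uniform_boundedness.
Context {R : realType} d (T : measurableType d) (mu : {measure set T -> \bar R}).
Variable D : set T.
Hypothesis mD : measurable D.
Variables p q : R.
Hypotheses (p1 : 1 < p) (pq : p^-1 + q^-1 = 1).

Let p0 : 0 < p. Proof. exact: lt_trans p1. Qed.

Lemma conj_gt1 : 1 < q.
Proof.
have ip : p^-1 < 1 by rewrite invf_lt1.
have iq : q^-1 = 1 - p^-1 by rewrite -pq addrC addKr.
have iq0 : 0 < q^-1 by rewrite iq subr_gt0.
rewrite -invf_lt1 ?iq ?ltrBlDr ?ltrDl ?invr_gt0//.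
by rewrite -invr_gt0.
Qed.

Let q1 : 1 < q. Proof. exact: conj_gt1. Qed.
Let q0 : 0 < q. Proof. exact: lt_trans q1. Qed.

Lemma conj_mulB1 : (p - 1) * q = p.
Proof.
have p0' : p != 0 by rewrite gt_eqF. have q0' : q != 0 by rewrite gt_eqF.
have : (p^-1 + q^-1) * (p * q) = p * q by rewrite pq mul1r.
rewrite mulrDl mulrA mulVf// mul1r mulrCA mulVf// mulr1 => h.
by rewrite mulrBl mul1r -h addrC addKr.
Qed.

(** The equality case of Hoelder: v = |h|^(p-2) conj(h) / N^(p-1) with N the norm of h. Since (p-1)
    q = p, |v|^q = |h|^p / N^p has integral 1, and h v = |h|^p / N^(p-1) has integral N. *)
Lemma norming h : cLfun mu D p h -> exists v, [/\ cLfun mu D q v,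
  nrm mu D q v <= 1 & cintegral mu D (fun x => h x * v x) = (nrm mu D p h)%:C].
Proof.
move=> Lh; have mh := cLfun_meas Lh; pose N := nrm mu D p h.
have [N0|N0] := eqVneq N 0.
  exists (fun=> 0); have [L0 n0] := cLfun0 mu D q0; split => //; first by rewrite n0 ler01.
  rewrite -/N N0 /=; under eq_fun do rewrite mulr0.
  exact: cintegral0.
have {}N0 : 0 < N by rewrite lt_neqAle eq_sym N0 nrm_ge0.
pose v x : R[i] := ((normc (h x)) `^ (p - 2) / N `^ (p - 1))%:C * (h x)^*%C.
have mpow s : measurable_fun D (fun x => (normc (h x)) `^ s).
  apply: (@measurableT_comp _ _ _ _ _ _ (@powR R ^~ s)); first exact: measurable_powR.
  exact: measurable_normc.
have mv : cmeas D v.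
  apply: cmeasM; first by apply: cmeas_real; apply: measurable_funM.
  case: mh => m1 m2; split.
    by apply: eq_measurable_fun m1 => x _ /=; case: (h x).
  by apply: eq_measurable_fun (measurable_funN m2) => x _ /=; case: (h x).
have nconj z : normc (z^*)%C = normc z :> R by case: z => a b; rewrite /normc/= sqrrN.
have nv x : normc (v x) = (normc (h x)) `^ (p - 1) / N `^ (p - 1).
  rewrite /v normcM normcR nconj ger0_norm; last by rewrite divr_ge0 ?powR_ge0.
  have [->|hx0] := eqVneq (normc (h x)) 0.
    by rewrite mulr0 powR0 ?mul0r// subr_eq0 gt_eqF.
  rewrite mulrAC; congr (_ / _).
  rewrite -[X in _ * X](@powRr1 _ (normc (h x))) ?normc_ge0// -powRD ?hx0 ?implybT//.
  by congr (_ `^ _); ring.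
have Lv : (Lint mu D q v <= (1 `^ q)%:E)%E.
  rewrite powR1 /Lint (_ : (\int[mu]_(x in D) _)%E =
     (\int[mu]_(x in D) ((N `^ p)^-1%:E * ((normc (h x)) `^ p)%:E))%E).
    rewrite ge0_integralZl//; last 3 first.
    - exact: measurable_normc_powR.
    - by move=> x _; rewrite lee_fin powR_ge0.
    - by rewrite lee_fin invr_ge0 powR_ge0.
    rewrite -/(Lint mu D p h) LintE// -EFinM mulVf//.
    by rewrite gt_eqF// powR_gt0.
  apply: eq_integral => x _; rewrite nv -EFinM powRM ?invr_ge0 ?powR_ge0//.
  rewrite -powRrM conj_mulB1 mulrC; congr (_ * _)%:E.
  by rewrite -powRN -powRrM mulNr conj_mulB1 powRN.
have [Lv1 nv1] := Lint_le q0 ler01 mv Lv; exists v; split => //.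
have hv x : h x * v x = ((normc (h x)) `^ p / N `^ (p - 1))%:C.
  have hh : h x * (h x)^*%C = ((normc (h x)) ^+ 2)%:C.
    case: (h x) => a b; rewrite normc_sqrtE/= sqr_sqrtr ?addr_ge0 ?sqr_ge0//.
    by apply: eq_complexP => /=; ring.
  rewrite /v mulrCA hh -rmorphM/=; congr (_%:C).
  rewrite mulrAC; congr (_ / _); have [->|hx0] := eqVneq (normc (h x)) 0.
    by rewrite expr2 !mulr0 powR0 ?gt_eqF.
  rewrite -powR_mulrn ?normc_ge0// -powRD ?hx0 ?implybT//.
  by rewrite subrK.
rewrite (eq_cintegral mu (fun x _ => hv x)) /cintegral/=.
rewrite [X in _ +i* X](_ : _ = 0); last by rewrite /Rintegral integral0.
congr Complex; under eq_Rintegral do rewrite mulrC.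
have ih : mu.-integrable D (EFin \o (fun x => normc (h x) `^ p)).
  apply/integrableP; split; first exact: measurable_normc_powR.
  under eq_integral do rewrite /= ger0_norm ?powR_ge0//.
  by have [_] := (cLfunP mu D h p0).1 Lh.
rewrite RintegralZl// /Rintegral -/(Lint mu D p h) LintE//= -/N.
rewrite -(@mulr_powRB1 _ N p) ?(ltW N0)// mulrCA mulVf ?mulr1//.
by rewrite gt_eqF// powR_gt0.
Qed.

(* Gliding hump: a series of norming functionals with weights 8^-k along a
   subsequence of rapidly growing norms contradicts weak convergence. *)
Lemma weak_cvg_bounded u_ u : weak_Lp_cvg mu D p q u_ u ->
  exists M : R, forall n, nrm mu D p (u_ n) <= M.
Proof.
move=> [Lu_ Lu wc]; have p1' := ltW p1.
pose h n x := u_ n x - u x.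
have Lh n : cLfun mu D p (h n) by exact: (cLfunB mD p1' (Lu_ n) Lu).1.
have hc v : cLfun mu D q v -> ccvg (fun n => cintegral mu D (fun x => h n x * v x)) 0.
  move=> Lv; have /ccvgP c := wc v Lv => e e0.
  apply: filterS (c e e0) => n; rewrite subr0; congr (normc _ < _).
  rewrite -(cintegralB mD).
  - by congr cintegral; apply/funext => x; rewrite /h mulrBl.
  - exact: (hoelder_cLfun mD p0 q0 pq (Lu_ n) Lv).1.
  - exact: (hoelder_cLfun mD p0 q0 pq Lu Lv).1.
suff [M hM] : exists M : R, forall n, nrm mu D p (h n) <= M.
  exists (M + nrm mu D p u) => n.
  have := (cLfunD mD p1' (Lh n) Lu).2.
  rewrite (_ : (fun x => h n x + u x) = u_ n); last by apply/funext => x; rewrite /h subrK.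
  by move=> /le_trans; apply; rewrite lerD2r.
apply: contrapT => nb.
have big (M : R) (N : nat) : exists n, (N <= n)%N /\ M < nrm mu D p (h n).
  apply: contrapT => hh; apply: nb.
  exists (\sum_(i < N) nrm mu D p (h i) + `|M|) => n.
  have [nN|Nn] := ltnP n N.
    rewrite (bigD1 (Ordinal nN))//= -addrA lerDl addr_ge0// sumr_ge0// => i _.
    exact: nrm_ge0.
  rewrite (@le_trans _ _ `|M|)// ?lerDr ?sumr_ge0// => [|i _]; last exact: nrm_ge0.
  apply: le_trans (ler_norm _); rewrite leNgt; apply/negP => hM.
  by apply: hh; exists n.
(* The hump X = c_k times the norm of h_n will exceed 4. Later terms have total norm at most 8/7
   c_(k+1) = c_k / 7, hence contribute at most 2/7 X after the factor 2 of the complex Hoelder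
   bound; earlier terms contribute less than 1. What remains exceeds 5/7 * 4 - 1 > 1. *)
pose c (k : nat) : R := 8%:R^-1 ^+ k.
have c0 k : 0 < c k by rewrite exprn_gt0// invr_gt0.
(* From a stage k and a partial sum s: an index at least k where h is large but nearly blind to s,
   with its norming functional. The pair (0, s) is a default value for s outside L^q. *)
have step (ks : nat * (T -> R[i])) : exists nv : nat * (T -> R[i]),
   cLfun mu D q ks.2 -> [/\ (ks.1 <= nv.1)%N, 4 / c ks.1 < nrm mu D p (h nv.1),
     normc (cintegral mu D (fun x => h nv.1 x * ks.2 x)) < 1 /\ cLfun mu D q nv.2,
     nrm mu D q nv.2 <= 1 & cintegral mu D (fun x => h nv.1 x * nv.2 x) = (nrm mu D p (h nv.1))%:C].
  case: ks => k s /=; have [Ls|nLs] := pselect (cLfun mu D q s); last by exists (0%N, s).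
  have [N _ hN] := hc s Ls 1 ltr01.
  have [n [Nn nbig]] := big (4 / c k) (maxn N k).
  have [v [Lv nv iv]] := norming (Lh n).
  exists (n, v) => _; split => //=.
  - by rewrite (leq_trans _ Nn)// leq_maxr.
  - by split => //; have := hN n (leq_trans (leq_maxl _ _) Nn); rewrite subr0.
have [F hF] := choice step.
pose s := fix s (k : nat) : T -> R[i] := if k is k'.+1
  then (fun x => s k' x + (c k')%:C * (F (k', s k')).2 x) else (fun=> 0).
have Ls k : cLfun mu D q (s k).
  elim: k => [|k IH]; first exact: (cLfun0 mu D q0).1.
  have [_ _ [_ LF] _ _] := hF (k, s k) IH.
  exact: (cLfunD mD (ltW q1) IH (cLfunZ mD (c k)%:C q0 LF).1).1.
pose g k x := (c k)%:C * (F (k, s k)).2 x.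
have Lg k : cLfun mu D q (g k) /\ nrm mu D q (g k) <= c k.
  have [_ _ [_ LF] nF _] := hF (k, s k) (Ls k).
  have [L1 E1] := cLfunZ mD (c k)%:C q0 LF; split => //.
  by rewrite /g E1 normcR gtr0_norm// ler_piMr// ltW.
have sE k x : s k x = \sum_(0 <= j < k) g j x.
  elim: k => [|k IH]; first by rewrite big_geq.
  by rewrite big_nat_recr//= -IH.
have tail k n : \sum_(k <= j < n) nrm mu D q (g j) <= 8 / 7 * c k.
  apply: (@le_trans _ _ (\sum_(k <= j < n) c j)); first by apply: ler_sum => j _; exact: (Lg j).2.
  have [kn|nk] := leqP k n; last by rewrite big_geq ?mulr_ge0 ?(ltW (c0 _)) ?divr_ge0// ltnW.
  apply: (@le_trans _ _ (8 / 7 * (c k - c n))); last first.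
    by rewrite ler_pM2l// lerBlDr lerDl ltW.
  rewrite -(subnKC kn); elim: (n - k)%N => [|m IH]; first by rewrite addn0 big_geq// subrr mulr0.
  rewrite addnS big_nat_recr ?leq_addr//=.
  have := lerD IH (lexx (c (k + m)%N)); move=> /le_trans; apply.
  have -> : c (k + m).+1 = c (k + m)%N / 8 by rewrite /c exprSr.
  by lra.
have [W [LW hW]] := riesz_fischer mD (ltW q1) (fun j => (Lg j).1) tail.
(* The stage number is also a lower bound for the index selected there, so stage N yields an index n
   >= N, at which the pairing with W should already be below 1. *)
have [N _ hN] := hc W LW 1 ltr01.
have [Nn nbig [small LF] nF iF] := hF (N, s N) (Ls N).
rewrite -[(N, s N).1]/N -[(N, s N).2]/(s N) in Nn nbig small; move: nbig small iF; set n := (F (N, s N)).1 in Nn *; set v := (F (N, s N)).2 => nbig small iF.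
have := hN n Nn; rewrite subr0 ltNge => /negP; apply.
have LW' : cLfun mu D q (fun x => W x - s N.+1 x) by exact: (cLfunB mD (ltW q1) LW (Ls N.+1)).1.
have H1 := hoelder_cLfun mD p0 q0 pq (Lh n) (Ls N).
have H2 := hoelder_cLfun mD p0 q0 pq (Lh n) (Lg N).1.
have H3 := hoelder_cLfun mD p0 q0 pq (Lh n) LW'.
have E : cintegral mu D (fun x => h n x * W x) = cintegral mu D (fun x => h n x * s N x) +
   (cintegral mu D (fun x => h n x * g N x) + cintegral mu D (fun x => h n x * (W x - s N.+1 x))).
  rewrite -(cintegralD mD H2.1 H3.1) -(cintegralD mD H1.1 (cintegrableD mD H2.1 H3.1)).
  by congr cintegral; apply/funext => x /=; rewrite /g; ring.
have E2 : cintegral mu D (fun x => h n x * g N x) = (c N * nrm mu D p (h n))%:C.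
  have -> : (c N * nrm mu D p (h n))%:C = (c N)%:C * (nrm mu D p (h n))%:C by rewrite rmorphM.
  rewrite -iF -(cintegralZ mD); last exact: (hoelder_cLfun mD p0 q0 pq (Lh n) LF).1.
  by congr cintegral; apply/funext => x; rewrite /g mulrCA.
have E3 : normc (cintegral mu D (fun x => h n x * (W x - s N.+1 x))) <= 2 / 7 * (c N * nrm mu D p (h n)).
  apply: (le_trans (normc_cintegral_hoelder mD p0 q0 pq (Lh n) LW')).
  have := hW N.+1; under eq_fun do rewrite -sE.
  have -> : c N.+1 = c N / 8 by rewrite /c exprSr.
  move=> hh; apply: (@le_trans _ _ (2 * (nrm mu D p (h n) * (8 / 7 * (c N / 8))))).
    by rewrite ler_pM2l// ler_wpM2l// nrm_ge0.
  by lra.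
have big4 : 4 < c N * nrm mu D p (h n) by rewrite mulrC -ltr_pdivrMr.
rewrite E E2; set A := cintegral _ _ _ in small *; set B := cintegral _ _ _ in E3 *.
set X := c N * _ in E3 big4 *; pose S := A + (X%:C + B); rewrite -/S.
have X0 : 0 < X by exact: lt_trans big4.
have XS : X <= normc S + normc A + normc B.
  have -> : X = normc (S - A - B).
    by rewrite (_ : S - A - B = X%:C); [rewrite normcR gtr0_norm|rewrite /S; ring].
  rewrite (le_trans (le_normcD _ _))// normcN lerD2r (le_trans (le_normcD _ _))//.
  by rewrite normcN.
move: small E3 big4 XS; lra.
Qed.

End uniform_boundedness.

(** * The operator K acting fiberwise *)

Section Lp_ae.
Context {R : realType} d (T : measurableType d) (mu : {measure set T -> \bar R}).
Variable D : set T.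
Hypothesis mD : measurable D.
Implicit Types (f g : T -> R[i]) (q : R).

Lemma ae_eq_Lint q f g : cmeas D f -> cmeas D g ->
  {ae mu, forall x, D x -> f x = g x} -> Lint mu D q f = Lint mu D q g.
Proof.
move=> mf mg fg; apply: ge0_ae_eq_integral => //.
- exact: measurable_normc_powR.
- exact: measurable_normc_powR.
- by move=> x _; rewrite lee_fin powR_ge0.
- by move=> x _; rewrite lee_fin powR_ge0.
- by apply: filterS fg => x h Dx; rewrite h.
Qed.

Lemma ae_eq_nrm q f g : 0 < q -> cmeas D f -> cmeas D g ->
  {ae mu, forall x, D x -> f x = g x} -> nrm mu D q f = nrm mu D q g.
Proof.
move=> /lt0r_neq0 q0 mf mg fg.
by rewrite /nrm (cLnormE _ _ _ q0) (cLnormE _ _ _ q0) (ae_eq_Lint q mf mg fg).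
Qed.

Lemma nrm0_ae q f : 0 < q -> cLfun mu D q f -> nrm mu D q f = 0 ->
  {ae mu, forall x, D x -> f x = 0}.
Proof.
move=> q0 Lf n0; have := LintE q0 Lf; rewrite n0 powR0 ?gt_eqF// => I0.
have mf : measurable_fun D (fun x => ((normc (f x)) `^ q)%:E).
  by apply: measurable_normc_powR; exact: cLfun_meas Lf.
have : (\int[mu]_(x in D) `|((normc (f x)) `^ q)%:E| = 0)%E.
  transitivity (Lint mu D q f); last exact: I0.
  by apply: eq_integral => x _; rewrite gee0_abs// lee_fin powR_ge0.
move=> /(ae_eq_integral_abs mu mD mf); apply: filterS => x h Dx.
by have [/powR_eq0_eq0/eq0_normc] := h Dx.
Qed.

(** By Fatou the limit inferior has integral 0, so it vanishes almost everywhere. The index obtained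
    depends on x; this replaces the extraction of an almost everywhere convergent subsequence. *)
Lemma fatou_ae0 (F : nat -> T -> \bar R) : (forall n, measurable_fun D (F n)) ->
  (forall n x, D x -> 0 <= F n x)%E ->
  (forall e : R, 0 < e -> exists N, forall n, (N <= n)%N -> (\int[mu]_(x in D) F n x <= e%:E)%E) ->
  {ae mu, forall x, D x -> forall e : R, 0 < e -> exists k, (F k x < e%:E)%E}.
Proof.
move=> mF F0 Fe; pose L x := limn_einf (F^~ x).
have mL : measurable_fun D L.
  rewrite /L /limn_einf; apply: measurableT_comp => //.
  by apply: measurable_fun_limn_esup => n; exact: measurableT_comp.
have L0 x : D x -> (0 <= L x)%E.
  move=> Dx; rewrite /L limn_einf_lim; apply: lime_ge; first exact: is_cvg_einfs.
  by apply: nearW => n; apply: le_ereal_inf_tmp => _ [m _ <-]; exact: F0.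
have I0 : (\int[mu]_(x in D) `|L x| = 0)%E.
  apply/eqP; rewrite eq_le integral_ge0// andbT.
  apply/lee_addgt0Pr => e e0; rewrite add0e.
  have -> : (\int[mu]_(x in D) `|L x| = \int[mu]_(x in D) L x)%E.
    by apply: eq_integral => x /set_mem Dx; rewrite gee0_abs ?L0.
  apply: le_trans (fatou mu mD mF F0) _.
  by have [N hN] := Fe e e0; exact: limn_einf_le hN.
move: I0 => /(ae_eq_integral_abs mu mD mL); apply: filterS => x h Dx e e0.
have Lx : L x = 0%E by rewrite h.
have : (ereal_inf (range (F^~ x)) < e%:E)%E.
  apply: le_lt_trans (_ : (_ <= 0)%E) _; last by rewrite lte_fin.
  rewrite -Lx /L limn_einf_lim; apply: lime_ge; first exact: is_cvg_einfs.
  apply: nearW => n; apply: le_ereal_inf => _ [m _ <-]; by exists m.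
by move=> /ereal_inf_lt[_ [k _ <-] hk]; exists k.
Qed.

End Lp_ae.

Lemma Z_density {R : realType} (d : nat) (D : set ('rV[R]_d * 'rV[R]_d)) (q : R)
    (C : ('rV[R]_d * 'rV[R]_d -> R[i]) -> Prop) : measurable D -> 1 <= q ->
  (forall c f g, C f -> C g -> C (fun x => c * f x + g x)) ->
  (forall f, cLfun (phase_measure d) D q f -> (forall e : R, 0 < e ->
    exists g, [/\ cLfun (phase_measure d) D q g, C g &
      nrm (phase_measure d) D q (fun x => f x - g x) < e]) -> C f) ->
  (forall a b a' b', C (cind (zobox a b a' b'))) ->
  forall f, cLfun (phase_measure d) D q f -> C f.
Proof.
move=> mD q1 Cl Cc Cg; apply: (Lp_density mD q1 (@measurable_zboxes R d)
  (@zboxes_setI R d) (@zboxes_Qbox R d) (@nd_Qbox R d) (@bigcup_Qbox R d) _ Cl Cc).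
- by move=> k; exact: zobox_fin.
- by move=> _ [a [b [a' [b' ->]]]] _; exact: Cg.
Qed.

Section fiberwise_theory.
Context {R : realType} (d : nat).
Local Notation E := 'rV[R]_d.
Local Notation lam := (@lebesgue_rV R d).
Local Notation mu := (@phase_measure R d).
Variables (O V : set E) (p p' : R) (K : (E -> R[i]) -> E -> R[i]).
Hypotheses (mO : measurable O) (mV : measurable V).
Hypotheses (p1 : 1 < p) (pq : p^-1 + p'^-1 = 1).
Hypothesis K_cts : cts_linear_Lp lam V p K.
Local Notation D := (O `*` V).

Let p0 : 0 < p. Proof. exact: lt_trans p1. Qed.
Let p1' : 1 <= p. Proof. exact: ltW. Qed.
Let mD : measurable D. Proof. exact: measurableX. Qed.

Let KL u : cLfun lam V p u -> cLfun lam V p (K u).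
Proof. by case: K_cts => h _ _; exact: h. Qed.

Lemma K_lin (c : R[i]) u v : cLfun lam V p u -> cLfun lam V p v ->
  {ae lam, forall x, V x -> K (fun y => c * u y + v y) x = c * K u x + K v x}.
Proof. by case: K_cts => _ h _; exact: h. Qed.

(** [K] acts on representatives and is linear only almost everywhere, so even this is an almost
    everywhere statement: linearity at zero gives K 0 = K 0 + K 0. *)
Lemma K_zero : {ae lam, forall x, V x -> K (fun=> 0) x = 0}.
Proof.
have L0 := (cLfun0 lam V p0).1.
have := K_lin 1 L0 L0; apply: filterS => x h Vx; have := h Vx.
under eq_fun do rewrite mulr0 addr0.
by rewrite mul1r => /esym/eqP; rewrite -subr_eq0 addrK => /eqP.
Qed.

Lemma K_scale (c : R[i]) u : cLfun lam V p u ->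
  {ae lam, forall x, V x -> K (fun y => c * u y) x = c * K u x}.
Proof.
move=> Lu; have L0 := (cLfun0 lam V p0).1.
have := K_lin c Lu L0; apply: filterS2 K_zero => x h0 h Vx; have := h Vx.
by under eq_fun do rewrite addr0; rewrite h0// addr0.
Qed.

Lemma K_sub u v : cLfun lam V p u -> cLfun lam V p v ->
  {ae lam, forall x, V x -> K (fun y => u y - v y) x = K u x - K v x}.
Proof.
move=> Lu Lv; have := K_lin (-1) Lv Lu; apply: filterS => x h Vx; have := h Vx.
have -> : (fun y => -1 * v y + u y) = (fun y => u y - v y).
  by apply/funext => y; rewrite mulN1r addrC.
by rewrite mulN1r addrC.
Qed.

(** Continuity at 0 with tolerance 1 gives a radius r; rescaling u to norm r / 2 gives the constant
    2 / r. *)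
Lemma K_bounded : exists2 C : R, 0 <= C & forall u, cLfun lam V p u ->
  nrm lam V p (K u) <= C * nrm lam V p u.
Proof.
have L0 := (cLfun0 lam V p0).1; case: K_cts => _ _ /(_ _ L0 1 ltr01)[r r0 hr].
have key u s : cLfun lam V p u -> 0 < s -> s * nrm lam V p u < r ->
    s * nrm lam V p (K u) <= 1.
  move=> Lu s0 su; have [Ls ns] := cLfunZ mV s%:C p0 Lu.
  have [LKs nKs] := cLfunZ mV s%:C p0 (KL Lu).
  have := hr _ Ls; under eq_fun do rewrite subr0.
  rewrite nrmE// lte_fin ns normcR gtr0_norm// => /(_ su).
  rewrite nrmE; last exact: (cLfunB mV p1' (KL Ls) (KL L0)).1.
  rewrite lte_fin => /ltW; apply: le_trans.
  rewrite -[s in leLHS]gtr0_norm// -normcR -nKs.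
  rewrite (@ae_eq_nrm _ _ _ _ V mV p _ (fun x => K (fun y => s%:C * u y) x - K (fun=> 0) x))//.
  - exact: cLfun_meas LKs.
  - exact: cLfun_meas (cLfunB mV p1' (KL Ls) (KL L0)).1.
  - by apply: filterS2 (K_scale s%:C Lu) K_zero => x h1 h2 Vx; rewrite h1// h2// subr0.
exists (2 / r); first by rewrite divr_ge0// ltW.
(* If u has norm 0, all its multiples lie in the ball, and the multiple by 2 / nrm (K u) would give
   2 <= 1. *)
move=> u Lu; have [N0|N0] := eqVneq (nrm lam V p u) 0.
  rewrite N0 mulr0 leNgt; apply/negP => K0.
  have /(key _ _ Lu) : 0 < 2 / nrm lam V p (K u) by rewrite divr_gt0.
  by rewrite N0 mulr0 => /(_ r0); rewrite divfK ?gt_eqF// (ler_nat R 2 1).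
have {}N0 : 0 < nrm lam V p u by rewrite lt_neqAle eq_sym N0 nrm_ge0.
have s0 : 0 < r / 2 / nrm lam V p u by rewrite !divr_gt0.
have := key _ _ Lu s0; rewrite divfK ?gt_eqF// ltr_pdivrMr// ltr_pMr// ltr1n => /(_ isT).
by rewrite -ler_pdivlMl// mulr1 invf_div invf_div mulrC.
Qed.

Lemma section_Lp u : cLfun mu D p u ->
  {ae lam, forall x, O x -> cLfun lam V p (fun k => u (x, k))}.
Proof.
move=> Lu; have mu' := cLfun_meas Lu.
have mF := measurable_normc_powR p mu'.
have F0 z : (0 <= ((normc (u z)) `^ p)%:E)%E by rewrite lee_fin powR_ge0.
have [_ foo] := (cLfunP mu D u p0).1 Lu.
move: foo; rewrite /Lint (tonelliX lam lam mO mV mF F0) => foo.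
have mI := measurable_tonelliX lam mO mV mF F0.
have iI : lam.-integrable O (fun x => \int[lam]_(y in V) ((normc (u (x, y))) `^ p)%:E)%E.
  apply/integrableP; split => //.
  by under eq_integral => x _ do rewrite gee0_abs ?integral_ge0//.
apply: filterS (integrable_ae mO iI) => x h Ox; apply/cLfunP => //; split.
  exact: (cmeas_section mO mV Ox mu').
by rewrite ltey_eq h.
Qed.

Lemma Lint_sections u : cmeas D u ->
  (Lint mu D p u = \int[lam]_(x in O) Lint lam V p (fun k => u (x, k)))%E.
Proof.
move=> mu'; apply: (tonelliX lam lam mO mV (measurable_normc_powR p mu')) => z.
by rewrite lee_fin powR_ge0.
Qed.

Lemma measurable_Lint_sections u : cmeas D u ->
  measurable_fun O (fun x => Lint lam V p (fun k => u (x, k))).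
Proof.
move=> mu'; apply: (measurable_tonelliX lam mO mV (measurable_normc_powR p mu')) => z.
by rewrite lee_fin powR_ge0.
Qed.

(** Tonelli writes the p-th powers of both norms as integrals over x of fibre norms, where the bound
    for [K] applies with the same constant. *)
Lemma fiberwise_bounded : exists2 C : R, 0 <= C & forall u w, cLfun mu D p u ->
  fiberwise O V p K u w -> nrm mu D p w <= C * nrm mu D p u.
Proof.
have [C C0 hC] := K_bounded; exists C => // u w Lu [Lw wK].
have mw := cLfun_meas Lw; have mu' := cLfun_meas Lu.
apply: (Lint_le p0 _ mw _).2; first by rewrite mulr_ge0// nrm_ge0.
rewrite powRM ?nrm_ge0// EFinM -LintE// !Lint_sections//.
rewrite -ge0_integralZl//; last 3 first.
- exact: measurable_Lint_sections.
- by move=> x _; exact: Lint_ge0.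
- by rewrite lee_fin powR_ge0.
apply: ae_ge0_le_integral => //.
- by move=> x _; exact: Lint_ge0.
- exact: measurable_Lint_sections.
- by move=> x _; rewrite mule_ge0 ?lee_fin ?powR_ge0 ?Lint_ge0.
- by apply: emeasurable_funM => //; exact: measurable_Lint_sections.
apply: filterS2 wK (section_Lp Lu) => x h1 h2 Ox.
have Lux := h2 Ox; have wx := h1 Ox.
have mwx := cmeas_section mO mV Ox mw.
rewrite (ae_eq_Lint mV p mwx (cLfun_meas (KL Lux)) wx) !LintE//; last exact: KL.
by rewrite -EFinM lee_fin -powRM ?nrm_ge0// ge0_ler_powR ?nnegrE ?nrm_ge0 ?mulr_ge0 ?nrm_ge0 ?(ltW p0)// hC.
Qed.

Lemma fiberwise_lin c u1 w1 u2 w2 : cLfun mu D p u1 -> cLfun mu D p u2 ->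
  fiberwise O V p K u1 w1 -> fiberwise O V p K u2 w2 ->
  fiberwise O V p K (fun z => c * u1 z + u2 z) (fun z => c * w1 z + w2 z).
Proof.
move=> L1 L2 [Lw1 K1] [Lw2 K2]; split.
  exact: (cLfunD mD p1' (cLfunZ mD c p0 Lw1).1 Lw2).1.
apply: filterS2 (filterI K1 K2) (filterI (section_Lp L1) (section_Lp L2)) => x [h1 h2] [s1 s2] Ox.
apply: filterS2 (filterI (h1 Ox) (h2 Ox)) (K_lin c (s1 Ox) (s2 Ox)) => l [e1 e2] e Vl.
by rewrite e1// e2// e.
Qed.

Lemma tensor_cLfun q A b : 0 < q -> measurable A -> (lam A < +oo)%E -> cLfun lam V q b ->
  cLfun mu D q (fun z => cind A z.1 * b z.2).
Proof.
move=> q0 mA fA Lb; have mb := cLfun_meas Lb.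
have mt : cmeas D (fun z : E * E => cind A z.1 * b z.2).
  apply: cmeasM.
    apply: cmeas_real; apply: measurable_funTS.
    apply: (@measurableT_comp _ _ _ _ _ _ (\1_A : E -> R) _ fst); first exact: measurable_indic.
    exact: measurable_fst.
  case: mb => b1 b2; split.
    apply: (@measurable_comp _ _ _ _ _ _ V (@complex.Re R \o b) _ snd) => //; first by move=> _ [z [_ ?] <-].
    by apply: measurable_funTS; exact: measurable_snd.
  apply: (@measurable_comp _ _ _ _ _ _ V (@complex.Im R \o b) _ snd) => //; first by move=> _ [z [_ ?] <-].
  by apply: measurable_funTS; exact: measurable_snd.
apply/cLfunP => //; split => //.
have mF := measurable_normc_powR q mt.
rewrite /Lint (tonelliX lam lam mO mV mF); last by move=> z; rewrite lee_fin powR_ge0.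
have E1 x : (\int[lam]_(y in V) ((normc (cind A x * b y)) `^ q)%:E = (\1_A x)%:E * Lint lam V q b)%E.
  rewrite /Lint -ge0_integralZl//; last 2 first.
  - exact: measurable_normc_powR.
  - by move=> y _; rewrite lee_fin powR_ge0.
  apply: eq_integral => y _; rewrite normcM /cind normcR ger0_norm ?indic_ge0// indicE.
  case: (_ \in _); first by rewrite mul1r mul1e.
  by rewrite mul0r mul0e powR0// gt_eqF.
under eq_integral do rewrite /= E1.
have [_ Lboo] := (cLfunP lam V b q0).1 Lb.
rewrite ge0_integralZr//; last 2 first.
- by apply/measurable_EFinP; exact: measurable_indic.
- exact: Lint_ge0.
rewrite integral_indic// lte_mul_pinfty//.
- rewrite ge0_fin_numE//; apply: le_lt_trans fA; apply: le_measure; rewrite ?inE//.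
  exact: measurableI.
Qed.

Lemma fiberwise_tensor A b : measurable A -> (lam A < +oo)%E -> cLfun lam V p b ->
  fiberwise O V p K (fun z => cind A z.1 * b z.2) (fun z => cind A z.1 * K b z.2).
Proof.
move=> mA fA Lb; split; first exact: tensor_cLfun (KL Lb).
apply: nearW => x Ox /=; apply: filterS (K_scale (cind A x) Lb) => l h Vl.
by rewrite h.
Qed.

(** The images of fast approximations of u form a Cauchy sequence by [fiberwise_bounded], and their
    limit W is jointly measurable. The work is in showing that W restricted to almost every fibre is
    the image of the restriction of u. *)
Lemma fiberwise_closed u : cLfun mu D p u ->
  (forall e : R, 0 < e -> exists g, [/\ cLfun mu D p g, exists w, fiberwise O V p K g w &
     nrm mu D p (fun z => u z - g z) < e]) ->
  exists w, fiberwise O V p K u w.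
Proof.
move=> Lu happ; have [C C0 hC] := fiberwise_bounded; have [CK CK0 hCK] := K_bounded.
pose e (k : nat) : R := 2^-1 ^+ k.
have e0 k : 0 < e k by rewrite exprn_gt0// invr_gt0.
have eS k : e k.+1 = e k / 2 by rewrite /e exprSr.
have ex k : exists gw : (E * E -> R[i]) * (E * E -> R[i]), [/\ cLfun mu D p gw.1,
    fiberwise O V p K gw.1 gw.2 & nrm mu D p (fun z => u z - gw.1 z) < e k].
  by have [g [Lg [w fw] ng]] := happ _ (e0 k); exists (g, w).
have [F hF] := choice ex.
pose g k := (F k).1; pose w k := (F k).2.
have Lg k : cLfun mu D p (g k) by case: (hF k).
have fw k : fiberwise O V p K (g k) (w k) by case: (hF k).
have ng k : nrm mu D p (fun z => u z - g k z) < e k by case: (hF k).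
have Lw k : cLfun mu D p (w k) by case: (fw k).
have Ld k : cLfun mu D p (fun z => w k.+1 z - w k z) by exact: (cLfunB mD p1' (Lw _) (Lw _)).1.
have nd k : nrm mu D p (fun z => w k.+1 z - w k z) <= C * (2 * e k).
  have Lgg : cLfun mu D p (fun z => g k.+1 z - g k z) by exact: (cLfunB mD p1' (Lg _) (Lg _)).1.
  have fgg : fiberwise O V p K (fun z => g k.+1 z - g k z) (fun z => w k.+1 z - w k z).
    have := fiberwise_lin (-1) (Lg k) (Lg k.+1) (fw k) (fw k.+1).
    by congr fiberwise; apply/funext => z; rewrite mulN1r addrC.
  apply: (le_trans (hC _ _ Lgg fgg)); rewrite ler_wpM2l//.
  have L1 : cLfun mu D p (fun z => u z - g k z) by exact: (cLfunB mD p1' Lu (Lg _)).1.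
  have L2 : cLfun mu D p (fun z => u z - g k.+1 z) by exact: (cLfunB mD p1' Lu (Lg _)).1.
  have := (cLfunB mD p1' L1 L2).2.
  have -> : (fun x => u x - g k x - (u x - g k.+1 x)) = (fun z => g k.+1 z - g k z).
    by apply/funext => z; ring.
  move=> /le_trans; apply; have := ng k; have := ng k.+1; rewrite eS => h1 h2.
  have := e0 k; lra.
have tail k n : \sum_(k <= j < n) nrm mu D p (fun z => w j.+1 z - w j z) <= C * (4 * e k).
  apply: (@le_trans _ _ (\sum_(k <= j < n) C * (2 * e j))); first exact: ler_sum.
  rewrite -mulr_sumr ler_wpM2l// -mulr_sumr (natrM _ 2 2) -mulrA ler_pM2l//.
  have [kn|nk] := leqP k n; last by rewrite big_geq ?mulr_ge0 ?(ltW (e0 _))// ltnW.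
  apply: (@le_trans _ _ (2 * (e k - e n))); last first.
    by rewrite ler_pM2l// lerBlDr lerDl ltW.
  rewrite -(subnKC kn); elim: (n - k)%N => [|m IH]; first by rewrite addn0 big_geq// subrr mulr0.
  rewrite addnS big_nat_recr ?leq_addr//= eS.
  by have := lerD IH (lexx (e (k + m)%N)); move=> /le_trans; apply; lra.
have [h [Lh hh]] := riesz_fischer mD p1' Ld tail.
pose W z := h z + w 0%N z.
have LW : cLfun mu D p W by exact: (cLfunD mD p1' Lh (Lw 0%N)).1.
have nW k : nrm mu D p (fun z => W z - w k z) <= C * (4 * e k).
  have := hh k; congr (nrm _ _ _ _ <= _); apply/funext => z.
  by rewrite telescope_sumr// /W; ring.
exists W; split => //.
(* The integrals over x of [a k] and [b k] are p-th powers of global errors and tend to 0. Hence at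
   almost every x both fibre errors are small for a common index k, depending on x. *)
pose a k x := Lint lam V p (fun l => W (x, l) - w k (x, l)).
pose b k x := Lint lam V p (fun l => u (x, l) - g k (x, l)).
have LWw k : cLfun mu D p (fun z => W z - w k z) by exact: (cLfunB mD p1' LW (Lw k)).1.
have Lug k : cLfun mu D p (fun z => u z - g k z) by exact: (cLfunB mD p1' Lu (Lg k)).1.
have ma k : measurable_fun O (a k) by exact: (measurable_Lint_sections (cLfun_meas (LWw k))).
have mb k : measurable_fun O (b k) by exact: (measurable_Lint_sections (cLfun_meas (Lug k))).
have ae0 : {ae lam, forall x, O x -> forall eps : R, 0 < eps -> exists k, (a k x + b k x < eps%:E)%E}.
  apply: fatou_ae0 => //.
  - by move=> k; exact: emeasurable_funD.
  - by move=> k x _; rewrite adde_ge0 ?Lint_ge0.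
  move=> eps eps0.
  have small (M : R) : 0 <= M -> forall eta : R, 0 < eta -> exists N, forall n, (N <= n)%N -> (M * e n) `^ p <= eta.
    move=> M0 eta eta0; have r0 : 0 < eta `^ p^-1 by rewrite powR_gt0.
    have ce : M * e n @[n --> \oo] --> M * 0.
      by apply: cvgM; [exact: cvg_cst|apply: cvg_expr; rewrite ger0_norm ?invr_ge0// invf_lt1// ltr1n].
    move: ce; rewrite mulr0 => /cvgrPdist_lt/(_ _ r0)[N _ hN]; exists N => n Nn.
    have := hN n Nn; rewrite sub0r normrN ger0_norm ?mulr_ge0 ?(ltW (e0 _))// => h1.
    rewrite -[leRHS](_ : (eta `^ p^-1) `^ p = eta); last first.
      by rewrite -powRrM mulVf ?gt_eqF// powRr1 ?ltW.
    by rewrite ge0_ler_powR ?nnegrE ?powR_ge0 ?mulr_ge0 ?(ltW (e0 _)) ?(ltW p0)// ltW.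
  have eps2 : 0 < eps / 2 by rewrite divr_gt0.
  have [N1 h1] := small (C * 4) (mulr_ge0 C0 (ler0n _ _)) _ eps2.
  have [N2 h2] := small 1 ler01 _ eps2.
  exists (maxn N1 N2) => n; rewrite geq_max => /andP[n1 n2].
  rewrite ge0_integralD//; last 2 first.
  - by move=> x _; exact: Lint_ge0.
  - by move=> x _; exact: Lint_ge0.
  rewrite -(Lint_sections (cLfun_meas (LWw n))) -(Lint_sections (cLfun_meas (Lug n))).
  rewrite (LintE p0 (LWw n)) (LintE p0 (Lug n)) -EFinD lee_fin (splitr eps) lerD//.
    apply: le_trans (h1 n n1); rewrite ge0_ler_powR ?nnegrE ?nrm_ge0 ?(ltW p0)//.
      by rewrite !mulr_ge0 ?(ltW (e0 _)).
    by rewrite -mulrA.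
  apply: le_trans (h2 n n2); rewrite ge0_ler_powR ?nnegrE ?nrm_ge0 ?(ltW p0)//.
    by rewrite mul1r ?(ltW (e0 _)).
  by rewrite mul1r ltW.
have aeW : {ae lam, forall x k, O x -> cLfun lam V p (fun l => W (x, l) - w k (x, l))}.
  by apply: ae_foralln => k; exact: section_Lp (LWw k).
have aeug : {ae lam, forall x k, O x -> cLfun lam V p (fun l => u (x, l) - g k (x, l))}.
  by apply: ae_foralln => k; exact: section_Lp (Lug k).
have aeg : {ae lam, forall x k, O x -> cLfun lam V p (fun l => g k (x, l))}.
  by apply: ae_foralln => k; exact: section_Lp (Lg k).
have aew : {ae lam, forall x k, O x -> {ae lam, forall l, V l -> w k (x, l) = K (fun j => g k (x, j)) l}}.
  by apply: ae_foralln => k; case: (fw k).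
apply: filterS2 (filterI ae0 (filterI aeW aeug)) (filterI (filterI aeg aew) (filterI (section_Lp Lu) (section_Lp LW))).
move=> x [h0 [hW hug]] [[hg hw] [hu hWx]] Ox.
have Lux := hu Ox; have LWx := hWx Ox; have LKu := KL Lux.
have LWK : cLfun lam V p (fun l => W (x, l) - K (fun k => u (x, k)) l).
  exact: (cLfunB mV p1' LWx LKu).1.
suff n0 : nrm lam V p (fun l => W (x, l) - K (fun k => u (x, k)) l) = 0.
  apply: filterS (nrm0_ae mV p0 LWK n0) => l h1 Vl.
  by apply/eqP; rewrite -subr_eq0 h1.
apply/eqP; rewrite eq_le nrm_ge0 andbT.
apply/ler_addgt0Pl => eta eta0; rewrite addr0.
(* On the fibre, W - K u = (W - w_k) - K (u - g_k), so two errors below eta' add up to at most (1 +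
   CK) eta' = eta. *)
pose eta' := eta / (1 + CK).
have CK1 : 0 < 1 + CK by rewrite ltr_pwDl.
have eta'0 : 0 < eta' by rewrite divr_gt0.
have [k hk] := h0 Ox (eta' `^ p) (powR_gt0 _ eta'0).
have ak : nrm lam V p (fun l => W (x, l) - w k (x, l)) < eta'.
  apply: (nrm_lt p0 eta'0 (cLfun_meas (hW k Ox)) _).2.
  by apply: le_lt_trans hk; rewrite leeDl// Lint_ge0.
have bk : nrm lam V p (fun l => u (x, l) - g k (x, l)) < eta'.
  apply: (nrm_lt p0 eta'0 (cLfun_meas (hug k Ox)) _).2.
  by apply: le_lt_trans hk; rewrite leeDr// Lint_ge0.
have Lgk := hg k Ox.
have LKd := KL (hug k Ox).
have -> : nrm lam V p (fun l => W (x, l) - K (fun k => u (x, k)) l) =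
    nrm lam V p (fun l => (W (x, l) - w k (x, l)) - K (fun k0 => u (x, k0) - g k (x, k0)) l).
  apply: (ae_eq_nrm mV p0).
  - exact: cLfun_meas LWK.
  - exact: cLfun_meas (cLfunB mV p1' (hW k Ox) LKd).1.
  - apply: filterS2 (hw k Ox) (K_sub Lux Lgk) => l e1 e2 Vl.
    by rewrite e1// e2//; ring.
apply: le_trans (cLfunB mV p1' (hW k Ox) LKd).2 _.
apply: (@le_trans _ _ (eta' + CK * eta')).
  apply: lerD; first exact: ltW.
  by apply: le_trans (hCK _ (hug k Ox)) _; rewrite ler_wpM2l// ltW.
by rewrite -{1}(mul1r eta') -mulrDl mulrC divfK// gt_eqF.
Qed.

(** Applying [K] on each fibre separately says nothing about measurability in (x, lambda), since the
    representative of each image is arbitrary. For indicators of boxes the image is an explicit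
    tensor product; density does the rest. *)
Lemma fiberwise_ex u : cLfun mu D p u -> exists w, fiberwise O V p K u w.
Proof.
pose Cl u := cLfun mu D p u /\ exists w, fiberwise O V p K u w.
move=> Lu; suff [] : Cl u by [].
apply: (Z_density mD p1' _ _ _ Lu).
- move=> c f g [Lf [wf ff]] [Lg [wg fg]]; split.
    exact: (cLfunD mD p1' (cLfunZ mD c p0 Lf).1 Lg).1.
  by exists (fun z => c * wf z + wg z); exact: fiberwise_lin.
- move=> f Lf happ; split => //; apply: fiberwise_closed => // e e0.
  by have [g [Lg [_ [w fw]] ng]] := happ e e0; exists g; split => //; exists w.
- move=> a b a' b'.
  have E0 : cind (zobox a b a' b') = (fun z : E * E => cind (obox a b) z.1 * cind (obox a' b') z.2) :> (E * E -> R[i]).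
    apply/funext => -[x l]; rewrite /cind -rmorphM/=; congr (_%:C).
    by rewrite !indicE in_setX; do 2 case: (_ \in _) => //=; rewrite ?mulr1 ?mulr0.
  have Lb : cLfun lam V p (cind (obox a' b')).
    by apply: (cLfun_ind mV p0 _ _).1; [exact: measurable_obox|exact: lebesgue_obox_fin].
  rewrite E0; split.
    by apply: tensor_cLfun => //; [exact: measurable_obox|exact: lebesgue_obox_fin].
  eexists; apply: fiberwise_tensor Lb; [exact: measurable_obox|exact: lebesgue_obox_fin].
Qed.

Hypothesis K_symm : symmetric_Lp lam V p p' K.
Hypothesis K_Lp' : forall u, cLfun lam V p' u -> cLfun lam V p' (K u).

Lemma pairing_cLfun (M : R) (th : E -> R[i]) A b : cmeas setT th -> 0 <= M ->
  (forall x, normc (th x) <= M) -> measurable A -> (lam A < +oo)%E -> cLfun lam V p' b ->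
  cLfun mu D p' (fun z => th z.1 * (cind A z.1 * b z.2)).
Proof.
move=> mth M0 thM mA fA Lb; have p'1 := conj_gt1 p1 pq.
have p'0 : 0 < p' by rewrite (lt_trans ltr01).
have mth1 : cmeas D (fun z : E * E => th z.1).
  case: mth => m1 m2; split; apply: measurable_funTS.
    exact: (@measurableT_comp _ _ _ _ _ _ (@complex.Re R \o th) _ fst m1 (@measurable_fst _ _ _ _)).
  exact: (@measurableT_comp _ _ _ _ _ _ (@complex.Im R \o th) _ fst m2 (@measurable_fst _ _ _ _)).
exact: (cLfunMb mD p'0 M0 mth1 (fun z _ => thM z.1) (tensor_cLfun p'0 mA fA Lb)).1.
Qed.

(** On the fibre over x the factor th(x) 1_A(x) is a scalar, so the symmetry of [K] applies to [b]
    alone. The bounded factor [th] is where the oscillating exponential in x will be placed. *)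
Lemma pairing (M : R) (th : E -> R[i]) A b u w : cmeas setT th -> 0 <= M ->
  (forall x, normc (th x) <= M) -> measurable A -> (lam A < +oo)%E -> cLfun lam V p' b ->
  cLfun mu D p u -> fiberwise O V p K u w ->
  cintegral mu D (fun z => th z.1 * (cind A z.1 * b z.2) * w z) =
  cintegral mu D (fun z => th z.1 * (cind A z.1 * K b z.2) * u z).
Proof.
move=> mth M0 thM mA fA Lb Lu [Lw wK]; have p'1 := conj_gt1 p1 pq.
have p'0 : 0 < p' by rewrite (lt_trans ltr01).
have qp : p'^-1 + p^-1 = 1 by rewrite addrC.
have L1 := pairing_cLfun mth M0 thM mA fA Lb.
have L2 := pairing_cLfun mth M0 thM mA fA (K_Lp' Lb).
have [ae1 m1 ->] := cfubini mO mV (hoelder_cLfun mD p'0 p0 qp L1 Lw).1.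
have [ae2 m2 ->] := cfubini mO mV (hoelder_cLfun mD p'0 p0 qp L2 Lu).1.
apply: ae_eq_cintegral => //.
apply: filterS2 (filterI ae1 ae2) (filterI wK (section_Lp Lu)) => x [_ _] [h1 h2] Ox /=.
have Lux := h2 Ox; have Kux := KL Lux.
have c1 := (hoelder_cLfun mV p'0 p0 qp Lb Kux).1.
have c2 := (hoelder_cLfun mV p0 p'0 pq Lux (K_Lp' Lb)).1.
have mwx := cmeas_section mO mV Ox (cLfun_meas Lw).
transitivity (cintegral lam V (fun l => th x * cind A x * (b l * K (fun k => u (x, k)) l))).
  apply: ae_eq_cintegral => //.
  - apply: cmeasM => //; apply: cmeasM; first exact: cmeas_cst.
    by apply: cmeasM; [exact: cmeas_cst|exact: cLfun_meas Lb].
  - by apply: cmeasZ; exact: cintegrable_meas c1.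
  - by apply: filterS (h1 Ox) => l e Vl; rewrite e//; ring.
rewrite (cintegralZ mV _ c1) (K_symm Lux Lb) -(cintegralZ mV _ c2).
by apply: eq_cintegral => l _; ring.
Qed.

End fiberwise_theory.

(** * Smooth functions and cut-offs *)

Section derive_line.
Context {R : realType} (U : normedModType R).

Lemma is_derive_line (f : U -> R) (z v : U) (df : R) :
  is_derive z v f df <-> is_derive (0 : R) 1 (fun t : R => f (t *: v + z)) df.
Proof.
have E : 'D_v f z = 'D_1 (fun t : R => f (t *: v + z)) 0.
  rewrite /derive; set g1 := fun h => h^-1 *: _; set g2 := fun h => h^-1 *: _.
  suff -> : g1 = g2 by [].
  by rewrite funeqE /g1 /g2 => h /=; rewrite addr0 scale0r add0r [_%:A]mulr1.
split => -[d1 d2]; split.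
- exact: (derivable1P f z v).1.
- by rewrite -E.
- exact: (derivable1P f z v).2.
- by rewrite E.
Qed.

(** A chain rule asking only that [l] be affine along the line through z in direction v; coordinates
    and linear phases are of this kind. *)
Lemma is_derive_compl (h : R -> R) (l : U -> R) (z v : U) (c dh : R) :
  (forall t : R, l (t *: v + z) = l z + t * c) -> is_derive (l z) 1 h dh ->
  is_derive z v (h \o l) (dh * c).
Proof.
move=> lc hh; apply/is_derive_line.
have -> : (fun t : R => (h \o l) (t *: v + z)) = h \o (fun t => l z + t * c).
  by apply/funext => t /=; rewrite lc.
have dg : is_derive (0 : R) 1 (fun t => l z + t * c) c.
  have -> : (fun t : R => l z + t * c) = cst (l z) + (c *: id : R -> R).
    by apply/funext => t; rewrite /= mulrC.
  have h1 : is_derive (0 : R) (1 : R) (cst (l z) : R -> R) 0 by exact: is_derive_cst.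
  have h2 : is_derive (0 : R) (1 : R) (c *: id : R -> R) (c *: 1) by exact: is_deriveZ.
  by have := is_deriveD h1 h2; rewrite add0r /GRing.scale/= mulr1.
pose g (t : R) : R := l z + t * c.
have hh' : is_derive (g 0) 1 h dh by rewrite /g mul0r addr0.
exact: (@is_derive1_comp _ h g 0 dh c hh' dg).
Qed.

End derive_line.

Section rsmooth.
Context {R : realType} (d : nat).
Local Notation E := 'rV[R]_d.
Local Notation Z := (E * E)%type.
Local Notation J := ('I_d + 'I_d)%type.
Implicit Types (f g : Z -> R) (phi psi : Z -> R[i]).

Definition rpartial (j : J) f : Z -> R := fun z => 'D_(basis j) f z.

Definition rsmooth f : Prop := forall js : seq J,
  continuous (foldr rpartial f js) /\
  forall j z, derivable (foldr rpartial f js) z (basis j).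

Lemma Re_partials js phi : @complex.Re R \o partials js phi = foldr rpartial (@complex.Re R \o phi) js.
Proof. by elim: js => //= j js <-; apply/funext. Qed.

Lemma Im_partials js phi : @complex.Im R \o partials js phi = foldr rpartial (@complex.Im R \o phi) js.
Proof. by elim: js => //= j js <-; apply/funext. Qed.

Lemma smoothP phi : smooth phi <-> rsmooth (@complex.Re R \o phi) /\ rsmooth (@complex.Im R \o phi).
Proof.
split.
  move=> h; split => js; have [c1 c2 d1 d2] := h js.
    by rewrite -Re_partials; split.
  by rewrite -Im_partials; split.
move=> [h1 h2] js; have [c1 d1] := h1 js; have [c2 d2] := h2 js.
by rewrite Re_partials Im_partials; split.
Qed.

(** Coinduction for smoothness: it suffices to exhibit a class containing f and stable under first
    partial derivatives, so no formula for higher derivatives is ever written. *)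
Lemma rsmooth_coind (C : (Z -> R) -> Prop) :
  (forall f, C f -> [/\ continuous f, forall j z, derivable f z (basis j) &
     forall j, C (rpartial j f)]) -> forall f, C f -> rsmooth f.
Proof.
move=> hC f Cf js.
have CC : C (foldr rpartial f js) by elim: js => //= j js /hC[].
by have [] := hC _ CC.
Qed.

Lemma rsmooth_continuous f : rsmooth f -> continuous f.
Proof. by move=> /(_ [::])[]. Qed.

Lemma rsmooth_derivable f : rsmooth f -> forall j z, derivable f z (basis j).
Proof. by move=> /(_ [::])[]. Qed.

Lemma rsmooth_partial j f : rsmooth f -> rsmooth (rpartial j f).
Proof. by move=> h js; have := h (rcons js j); rewrite foldr_rcons. Qed.

(** A product of smooth functions is not differentiated into a product, but by the Leibniz rule into
    a sum of products; this closure is the stable class that [rsmooth_coind] asks for. *)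
Inductive ralg (S : (Z -> R) -> Prop) : (Z -> R) -> Prop :=
| ralg_in f : S f -> ralg S f
| ralgD f g : ralg S f -> ralg S g -> ralg S (f + g)
| ralgM f g : ralg S f -> ralg S g -> ralg S (f * g).

Lemma ralg_smooth S : (forall f, S f -> [/\ continuous f, forall j z, derivable f z (basis j) &
     forall j, ralg S (rpartial j f)]) -> forall f, ralg S f -> rsmooth f.
Proof.
move=> hS; apply: rsmooth_coind => f; elim => {f}.
- by move=> f /hS.
- move=> f g _ [c1 d1 p1] _ [c2 d2 p2]; split.
  + by move=> z; apply: cvgD; [exact: c1|exact: c2].
  + by move=> j z; exact: derivableD.
  + move=> j; have -> : rpartial j (f + g) = rpartial j f + rpartial j g.
      by apply/funext => z; rewrite /rpartial deriveD.
    exact: ralgD.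
- move=> f g af [c1 d1 p1] ag [c2 d2 p2]; split.
  + by move=> z; apply: cvgM; [exact: c1|exact: c2].
  + by move=> j z; exact: derivableM.
  + move=> j; have -> : rpartial j (f * g) = f * rpartial j g + g * rpartial j f.
      by apply/funext => z; rewrite /rpartial deriveM.
    by apply: ralgD; apply: ralgM.
Qed.

Lemma rsmooth_ralg f : ralg rsmooth f -> rsmooth f.
Proof.
apply: ralg_smooth => g sg; split.
- exact: rsmooth_continuous.
- exact: rsmooth_derivable.
- by move=> j; apply: ralg_in; exact: rsmooth_partial.
Qed.

Lemma rsmoothD f g : rsmooth f -> rsmooth g -> rsmooth (f + g).
Proof. by move=> sf sg; apply: rsmooth_ralg; apply: ralgD; exact: ralg_in. Qed.

Lemma rsmoothM f g : rsmooth f -> rsmooth g -> rsmooth (f * g).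
Proof. by move=> sf sg; apply: rsmooth_ralg; apply: ralgM; exact: ralg_in. Qed.

Lemma rsmooth_cst (c : R) : rsmooth (cst c).
Proof.
apply: (@rsmooth_coind (fun f => exists c, f = cst c)); last by exists c.
move=> _ [{}c ->]; split; first by move=> z; exact: cvg_cst.
  by move=> j z; exact: derivable_cst.
by move=> j; exists 0; apply/funext => z; rewrite /rpartial derive_cst.
Qed.

Lemma rsmoothN f : rsmooth f -> rsmooth (- f).
Proof.
move=> sf; have := rsmoothM (rsmooth_cst (-1)) sf; congr rsmooth.
by apply/funext => z; rewrite /GRing.mul/= /GRing.opp/= mulN1r.
Qed.

Lemma rsmooth_prod (I : Type) (r : seq I) (F : I -> Z -> R) :
  (forall i, rsmooth (F i)) -> rsmooth (fun z => \prod_(i <- r) F i z).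
Proof.
move=> h; elim: r => [|i r IH].
  by under eq_fun do rewrite big_nil; exact: rsmooth_cst.
under eq_fun do rewrite big_cons; exact: (rsmoothM (h i) IH).
Qed.

Lemma rsmooth_sum (I : Type) (r : seq I) (F : I -> Z -> R) :
  (forall i, rsmooth (F i)) -> rsmooth (fun z => \sum_(i <- r) F i z).
Proof.
move=> h; elim: r => [|i r IH].
  by under eq_fun do rewrite big_nil; exact: rsmooth_cst.
under eq_fun do rewrite big_cons; exact: (rsmoothD (h i) IH).
Qed.

Lemma continuous_coord j : continuous (coord j : Z -> R).
Proof.
case: j => i z /=.
  apply: (@cvg_comp _ _ _ fst (fun x : E => x 0 i)); last exact: coord_continuous.
  exact: cvg_fst.
apply: (@cvg_comp _ _ _ snd (fun x : E => x 0 i)); last exact: coord_continuous.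
exact: cvg_snd.
Qed.

Definition lin (k : J -> R) (z : Z) : R := \sum_j k j * coord j z.

Lemma continuous_lin k : continuous (lin k).
Proof.
rewrite /lin; elim: (index_enum J) => [|j r IH] z.
  by under eq_fun do rewrite big_nil; exact: cvg_cst.
rewrite (_ : (fun w => _) = (fun w => k j * coord j w + \sum_(j <- r) k j * coord j w)); last first.
  by apply/funext => w; rewrite big_cons.
apply: cvgD; last exact: IH.
by apply: cvgM; [exact: cvg_cst|exact: continuous_coord].
Qed.

Lemma coord_basisE j j' : coord j (basis j' : Z) = (j == j')%:R.
Proof.
case: j j' => [i|i] [i'|i'] /=; rewrite ?mxE//= ?eqxx/=.
Qed.

Lemma coordD j (z w : Z) : coord j (z + w) = coord j z + coord j w.
Proof. by case: j => i /=; rewrite mxE. Qed.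

Lemma coordZ j (t : R) (z : Z) : coord j (t *: z) = t * coord j z.
Proof. by case: j => i /=; rewrite mxE. Qed.

Lemma lin_line k j (z : Z) (t : R) : lin k (t *: basis j + z) = lin k z + t * k j.
Proof.
have -> : t * k j = \sum_l k l * (t * (l == j)%:R).
  rewrite (bigD1 j)//= eqxx mulr1 mulrC big1 ?addr0// => l /negbTE ->.
  by rewrite !mulr0.
rewrite /lin -big_split/=; apply: eq_bigr => l _.
by rewrite coordD coordZ coord_basisE mulrDr addrC.
Qed.

Lemma is_derive_coord h j j' (z : Z) (dh : R) : is_derive (coord j z) 1 h dh ->
  is_derive z (basis j') (h \o coord j) (dh * (j == j')%:R).
Proof.
apply: is_derive_compl => t; by rewrite coordD coordZ coord_basisE addrC.
Qed.

Lemma derive1_continuous (h : R -> R) x : derivable h x 1 -> {for x, continuous h}.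
Proof. by move=> /derivable1_diffP/differentiable_continuous. Qed.

(** [H] is a class of one-variable functions stable under differentiation. Derivatives in the other
    coordinate directions vanish, which is why the stable class also contains the zero function. *)
Lemma rsmooth_coord (H : (R -> R) -> Prop) :
  (forall h, H h -> (forall x, derivable h x 1) /\ H (fun x => 'D_1 h x)) ->
  forall h j, H h -> rsmooth (h \o coord j).
Proof.
move=> HH h j Hh.
apply: (@rsmooth_coind (fun f => f = cst 0 \/ exists h, H h /\ f = h \o coord j)); last by right; exists h.
move=> f [->|[{}h [{}Hh ->]]].
  split; first by move=> z; exact: cvg_cst.
    by move=> j' z; exact: derivable_cst.
  by move=> j'; left; apply/funext => z; rewrite /rpartial derive_cst.
have [dh H'] := HH h Hh.
have ih j' z : is_derive z (basis j') (h \o coord j) ('D_1 h (coord j z) * (j == j')%:R).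
  by apply: is_derive_coord; apply: derivableP.
split.
- move=> z; apply: (@cvg_comp _ _ _ (coord j) h); first exact: continuous_coord.
  exact: derive1_continuous.
- by move=> j' z; case: (ih j' z).
- move=> j'; have [jj|jj] := eqVneq j j'.
    right; exists (fun x => 'D_1 h x); split => //; apply/funext => z.
    by case: (ih j' z) => _; rewrite /rpartial => ->; rewrite jj eqxx mulr1.
  left; apply/funext => z; case: (ih j' z) => _; rewrite /rpartial => ->.
  by rewrite (negbTE jj) mulr0.
Qed.

(** The span of the cosine and the sine of one linear form is stable under partial derivatives. *)
Lemma rsmooth_trig k : rsmooth (cos \o lin k) /\ rsmooth (sin \o lin k).
Proof.
pose C f := exists a b : R, f = (fun z => a * cos (lin k z) + b * sin (lin k z)).
suff hC : forall f, C f -> rsmooth f.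
  split; apply: hC; [exists 1, 0|exists 0, 1]; apply/funext => z /=; by rewrite mul1r mul0r ?addr0 ?add0r.
apply: rsmooth_coind => f [a [b ->]].
have ih j z : is_derive z (basis j) (fun z => a * cos (lin k z) + b * sin (lin k z))
   ((b * k j) * cos (lin k z) + (- a * k j) * sin (lin k z)).
  have h1 : is_derive z (basis j) (cos \o lin k) (- sin (lin k z) * k j).
    by apply: is_derive_compl => t; exact: lin_line.
  have h2 : is_derive z (basis j) (sin \o lin k) (cos (lin k z) * k j).
    by apply: is_derive_compl => t; exact: lin_line.
  have := is_deriveD (is_deriveZ a h1) (is_deriveZ b h2).
  by move=> h; apply: is_derive_eq; rewrite /GRing.scale/=; ring.
split.
- move=> z; apply: cvgD; (apply: cvgM; first exact: cvg_cst).
    by apply: (@cvg_comp _ _ _ (lin k) cos); [exact: continuous_lin|exact: continuous_cos].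
  by apply: (@cvg_comp _ _ _ (lin k) sin); [exact: continuous_lin|exact: continuous_sin].
- by move=> j z; case: (ih j z).
- move=> j; exists (b * k j), (- a * k j); apply/funext => z.
  by case: (ih j z).
Qed.

(* The functions [a / chi ^ n] with [a] vanishing off [S] are stable under
   differentiation; inverses of zero only occur where [a] vanishes nearby. *)
Lemma rsmooth_div (S : set Z) a chi : closed S -> rsmooth chi ->
  (forall z, S z -> 0 < chi z) -> rsmooth a -> (forall z, ~ S z -> a z = 0) ->
  rsmooth (fun z => a z / chi z).
Proof.
move=> cS schi chi0.
pose C f := exists a n, [/\ rsmooth a, forall z, ~ S z -> a z = 0 & f = (fun z => a z * (chi z)^-1 ^+ n)].
move=> sa a0; apply: (@rsmooth_coind C); last by exists a, 1%N; split.
move=> _ [{sa a0}a [n [sa a0 ->]]].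
have off z : ~ S z -> \forall w \near z, ~ S w.
  move=> nS; have : open (~` S) by exact: closed_openC.
  by rewrite openE => /(_ z nS).
have ca z : {for z, continuous a} by exact: rsmooth_continuous.
have cchi z : {for z, continuous chi} by exact: rsmooth_continuous.
have a0' j z : ~ S z -> rpartial j a z = 0.
  move=> nS; rewrite /rpartial (@near_eq_derive _ _ _ _ (cst 0)) ?derive_cst//.
  by apply: filterS (off z nS) => w /a0.
have ih j z : is_derive z (basis j) (fun z => a z * (chi z)^-1 ^+ n)
   ((rpartial j a z * chi z - n%:R * a z * rpartial j chi z) * (chi z)^-1 ^+ n.+1).
  have [Sz|nSz] := pselect (S z); last first.
    rewrite a0'// a0// mul0r mulr0 mul0r subr0 mul0r.
    have h0 : is_derive z (basis j) (cst (0 : R)) 0 by exact: is_derive_cst.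
    apply: (near_eq_is_derive _ h0).
    by apply: filterS (off z nSz) => w /a0 ->; rewrite mul0r.
  have cz0 := chi0 z Sz; have cz : chi z != 0 by rewrite gt_eqF.
  have da : is_derive z (basis j) a (rpartial j a z) by apply: derivableP; exact: rsmooth_derivable.
  have dc : is_derive z (basis j) chi (rpartial j chi z) by apply: derivableP; exact: rsmooth_derivable.
  have dci : is_derive z (basis j) (fun z => (chi z)^-1) (- (chi z) ^- 2 *: rpartial j chi z).
    by split; [exact: derivableV|rewrite deriveV].
  have h := is_deriveM da (is_deriveX n dci).
  pose ic (z : Z) : R := (chi z)^-1.
  have pw w m : (ic ^+ m) w = ic w ^+ m by elim: m => [|m IH]; rewrite ?expr0// !exprS -IH.
  have -> : (fun z0 => a z0 * (chi z0)^-1 ^+ n) = a * ic ^+ n.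
    by apply/funext => w; rewrite /GRing.mul/= pw.
  apply: (is_derive_eq h); rewrite -/ic pw /ic /GRing.scale/=.
  case: n {h} => [|n]; first by rewrite !expr0 expr1; field.
  by rewrite -[n.+1.-1]/n !exprVn !exprS; field; rewrite cz expf_neq0.
split.
- move=> z; have [Sz|nSz] := pselect (S z); last first.
    have h0 : cst (0 : R) w @[w --> z] --> (0 : R) by exact: cvg_cst.
    rewrite /continuous_at a0// mul0r; apply: cvg_trans h0.
    by apply: near_eq_cvg; apply: filterS (off z nSz) => w /a0 ->; rewrite mul0r.
  have cz : chi z != 0 by rewrite gt_eqF// chi0.
  apply: cvgM; first exact: ca.
  apply: (@cvg_comp _ _ _ (fun z => (chi z)^-1) (fun x : R => x ^+ n)); last exact: exprn_continuous.
  exact: (cvgV cz (cchi z)).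
- by move=> j z; case: (ih j z).
- move=> j; exists (rpartial j a * chi - cst n%:R * a * rpartial j chi), n.+1; split.
  + apply: rsmoothD; first by apply: rsmoothM => //; exact: rsmooth_partial.
    apply: rsmoothN; apply: rsmoothM; last exact: rsmooth_partial.
    by apply: rsmoothM => //; exact: rsmooth_cst.
  + by move=> z nS; rewrite /GRing.add/= /GRing.opp/= /GRing.mul/= a0'// a0// mul0r mulr0 mul0r subrr.
  + by apply/funext => z; case: (ih j z).
Qed.

End rsmooth.

(** * The flat functions t^(-m) exp (-1/t) *)

Section flat_function.
Context {R : realType}.

(** The power t^(-m) is included so that the family is closed under differentiation: the derivative
    of [flat m] is a combination of [flat m.+2] and [flat m.+1], also at 0. *)
Definition flat (m : nat) (t : R) : R := if 0 < t then t^-1 ^+ m * expR (- t^-1) else 0.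

Lemma flat_ge0 m t : 0 <= flat m t.
Proof.
rewrite /flat; case: ifPn => // t0.
by rewrite mulr_ge0 ?expR_ge0// exprn_ge0// invr_ge0 ltW.
Qed.

(** With s = 1/t, exp s dominates s^(m+1) / (m+1)!; one power more than needed is kept, which leaves
    the factor t. *)
Lemma flat_le m t : 0 <= t -> flat m t <= m.+1`!%:R * t.
Proof.
move=> t0; rewrite /flat; case: ifPn => [t0'|_]; last by rewrite mulr_ge0.
have s0 : 0 < t^-1 by rewrite invr_gt0.
have := expR_ge1Dxn m (ltW s0); set e := expR t^-1 => he.
have e0 : 0 < e by exact: expR_gt0.
have f0 : (0 : R) < m.+1`!%:R by rewrite ltr0n fact_gt0.
rewrite expRN -/e ler_pdivrMr// mulrAC.
have h1 : t^-1 ^+ m.+1 <= e * m.+1`!%:R.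
  by rewrite -ler_pdivrMr// (le_trans _ he)// lerDr.
have -> : t^-1 ^+ m = t^-1 ^+ m.+1 * t by rewrite exprSr -mulrA mulVf ?gt_eqF// mulr1.
by rewrite ler_wpM2r// mulrC.
Qed.

Lemma is_derive_flat m (t : R) :
  is_derive t 1 (flat m) (flat m.+2 t - m%:R * flat m.+1 t).
Proof.
have [t0|t0|<-] := ltgtP 0 t.
- pose g : R -> R := fun t => t^-1 ^+ m * expR (- t^-1).
  have dg : is_derive t 1 g (flat m.+2 t - m%:R * flat m.+1 t).
    have tn0 : t != 0 by rewrite gt_eqF.
    have dV : is_derive t 1 (fun x : R => x^-1) (- t ^- 2).
      split; first exact: derivableV.
      rewrite (@deriveV _ _ id)//; first by rewrite derive_id /GRing.scale/= mulr1.
    have dN : is_derive t 1 (fun x : R => - x^-1) (t ^- 2).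
      by have := is_deriveN dV; rewrite opprK.
    have dE : is_derive t 1 (fun x : R => expR (- x^-1)) (t ^- 2 * expR (- t^-1)).
      have h := @is_derive1_comp _ expR (fun x : R => - x^-1) t _ _ (is_derive_expR _) dN.
      by apply: (is_derive_eq h); rewrite mulrC.
    have h := is_deriveM (is_deriveX m dV) dE.
    pose ic (z : R) : R := z^-1.
    have pw w k : (ic ^+ k) w = ic w ^+ k by elim: k => [|k IH]; rewrite ?expr0// !exprS -IH.
    have -> : g = ic ^+ m * (fun x => expR (- x^-1)).
      by apply/funext => w; rewrite /g {2}/GRing.mul/= pw.
    apply: (is_derive_eq h); rewrite -/ic pw /ic /flat t0 /GRing.scale/=.
    case: m {g h} => [|m]; first by rewrite !expr0 mul0r expr1; field.
    by rewrite -[m.+1.-1]/m !exprVn !exprS; field; rewrite tn0 expf_neq0.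
  apply: (near_eq_is_derive _ dg).
  near=> x; rewrite /flat ifT//; near: x; exact: lt_nbhsr.
- have d0 : is_derive t 1 (cst (0 : R)) (0 : R) by exact: is_derive_cst.
  rewrite /flat !ifF ?mulr0 ?subr0; [|by rewrite ltNge ltW..].
  apply: (near_eq_is_derive _ d0).
  near=> x; rewrite /flat ifF//; apply/negbTE; rewrite -leNgt ltW//.
  by near: x; exact: lt_nbhsl.
(* At 0 the difference quotient is 0 on the left and [flat m.+1] on the right, which is O(h) by
   [flat_le]. *)
- rewrite /flat ltxx mulr0 subr0 -/(flat m).
  have cv : (fun h : R => h^-1 *: ((flat m \o shift (0 : R)) (h *: (1 : R)) - flat m 0)) @ 0^' --> (0 : R).
    apply/cvgrPdist_le => e e0; near=> h.
    rewrite /= addr0 [h *: 1]mulr1 [flat m 0]/flat ltxx subr0 sub0r normrN normrZ.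
    have h0 : h != 0 by near: h; exact: nbhs_dnbhs_neq.
    have [hp|hn] := ltP 0 h; last by rewrite /flat ltNge hn/= normr0 mulr0 ltW.
    rewrite gtr0_norm ?invr_gt0// ger0_norm ?flat_ge0//.
    rewrite (_ : h^-1 * flat m h = flat m.+1 h); last by rewrite /flat hp exprS mulrA.
    rewrite (le_trans (flat_le _ (ltW hp)))// mulrC -ler_pdivlMr ?ltr0n ?fact_gt0//.
    rewrite (le_trans (ler_norm _))//; near: h.
    by apply: dnbhs0_le; rewrite divr_gt0// ltr0n fact_gt0.
  by split; [apply/cvg_ex; exists 0|exact: cvg_lim cv].
Unshelve. all: by end_near. Qed.

(** The span of the [flat m] precomposed with one affine map, stable under differentiation as
    [rsmooth_coord] requires. *)
Inductive flat_class (al be : R) : (R -> R) -> Prop :=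
| flat_class_in m : flat_class al be (fun t => flat m (al * t + be))
| flat_class_lin c f g : flat_class al be f -> flat_class al be g -> flat_class al be (c *: f + g).

Lemma flat_class_stable al be h : flat_class al be h ->
  (forall x, derivable h x 1) /\ flat_class al be (fun x => 'D_1 h x).
Proof.
elim => {h} [m|c f g _ [df Cf] _ [dg Cg]].
  have dm (t : R) : is_derive t (1 : R) (fun t : R => flat m (al * t + be))
      ((flat m.+2 (al * t + be) - m%:R * flat m.+1 (al * t + be)) * al).
    have := @is_derive_compl R _ (flat m) (fun t : R => al * t + be) t 1 al
       (flat m.+2 (al * t + be) - m%:R * flat m.+1 (al * t + be)).
    apply; last exact: is_derive_flat.
    by move=> s; rewrite [s *: 1]mulr1; ring.
  split; first by move=> x; case: (dm x).
  have -> : (fun x => 'D_1 (fun t => flat m (al * t + be)) x) =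
      al *: (fun t => flat m.+2 (al * t + be)) + ((- al * m%:R - 1) *: (fun t => flat m.+1 (al * t + be)) + (fun t => flat m.+1 (al * t + be))).
    apply/funext => x; case: (dm x) => _ ->.
    set a2 := flat m.+2 _; set a1 := flat m.+1 _.
    change ((a2 - m%:R * a1) * al = al * a2 + ((- al * m%:R - 1) * a1 + a1)); ring.
  exact: (flat_class_lin al (flat_class_in _ _ m.+2) (flat_class_lin (- al * m%:R - 1) (flat_class_in _ _ m.+1) (flat_class_in _ _ m.+1))).
split; first by move=> x; apply: derivableD => //; exact: derivableZ.
have -> : (fun x => 'D_1 (c *: f + g) x) = c *: (fun x => 'D_1 f x) + (fun x => 'D_1 g x).
  apply/funext => x; rewrite deriveD//; last exact: derivableZ.
  by rewrite deriveZ.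
exact: flat_class_lin.
Qed.

End flat_function.

(** * Bump functions, cut-offs and test functions *)

Section bumps.
Context {R : realType} (d : nat).
Local Notation E := 'rV[R]_d.
Local Notation Z := (E * E)%type.
Local Notation J := ('I_d + 'I_d)%type.
Implicit Types (D S : set Z) (phi psi : Z -> R[i]).

Definition jbox (A B : Z) : set Z := [set z | forall j, coord j A < coord j z < coord j B].
Definition jcbox (A B : Z) : set Z := [set z | forall j, coord j A <= coord j z <= coord j B].

Lemma jboxE A B : jbox A B = zobox A.1 B.1 A.2 B.2.
Proof.
apply/seteqP; split => z.
  by move=> h; split => i; [exact: (h (inl i))|exact: (h (inr i))].
by move=> [h1 h2] [i|i]; [exact: h1|exact: h2].
Qed.

Lemma jcboxE A B : jcbox A B = cbox A.1 B.1 `*` cbox A.2 B.2.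
Proof.
apply/seteqP; split => z.
  by move=> h; split => i; [exact: (h (inl i))|exact: (h (inr i))].
by move=> [h1 h2] [i|i]; [exact: h1|exact: h2].
Qed.

Lemma compact_cbox n (a b : 'rV[R]_n) : compact (cbox a b).
Proof.
have := @rV_compact R n (fun i => `[a ord0 i, b ord0 i]%classic) (fun i => @segment_compact R _ _).
by congr compact.
Qed.

Lemma compact_jcbox A B : compact (jcbox A B).
Proof. by rewrite jcboxE; apply: compact_setX; exact: compact_cbox. Qed.

Lemma ZhausdorffT : hausdorff_space Z.
Proof. exact: norm_hausdorff. Qed.

Lemma compact_closedZ S : compact S -> closed S.
Proof. by apply: compact_closed; exact: ZhausdorffT. Qed.

Lemma test_fun_support D S phi : smooth phi -> compact S -> S `<=` D ->
  (forall z, ~ S z -> phi z = 0) -> test_fun D phi.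
Proof.
move=> sphi cS SD p0.
have cl : closure [set z | phi z != 0] `<=` S.
  have /closure_id -> := compact_closedZ cS; apply: closure_subset => z /= pz.
  by apply: contrapT => nS; move: pz; rewrite p0 ?eqxx.
split => //; last exact: subset_trans SD.
by apply: subclosed_compact cl => //; exact: closed_closure.
Qed.

Lemma test_fun_off D phi z : test_fun D phi -> ~ closure [set z | phi z != 0] z -> phi z = 0.
Proof.
move=> _ nz; apply/eqP; apply: contrapT => /negP pz; apply: nz.
exact: subset_closure.
Qed.

(** A smooth function with values in [0, 1], positive exactly on the open box. The scaling by k+1
    makes it tend to the indicator of the box, since exp (-1 / ((k+1) t)) tends to 1 for t > 0. *)
Definition zbump (A B : Z) (k : nat) (z : Z) : R :=
  \prod_j (flat 0 (k.+1%:R * coord j z + - (k.+1%:R * coord j A)) *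
           flat 0 (- k.+1%:R * coord j z + k.+1%:R * coord j B)).

Lemma rsmooth_bump A B k : rsmooth (zbump A B k).
Proof.
apply: rsmooth_prod => j; apply: rsmoothM.
  exact: (@rsmooth_coord R d _ (@flat_class_stable R k.+1%:R (- (k.+1%:R * coord j A)))
    _ j (flat_class_in _ _ 0)).
exact: (@rsmooth_coord R d _ (@flat_class_stable R (- k.+1%:R) (k.+1%:R * coord j B))
  _ j (flat_class_in _ _ 0)).
Qed.

Lemma flat0E (t : R) : flat 0 t = if 0 < t then expR (- t^-1) else 0.
Proof. by rewrite /flat expr0 mul1r. Qed.

Lemma flat0_le1 (t : R) : flat 0 t <= 1.
Proof.
rewrite flat0E; case: ifPn => // t0.
by rewrite -expR0 ler_expR oppr_le0 invr_ge0 ltW.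
Qed.

Lemma bump_ge0 A B k z : 0 <= zbump A B k z.
Proof. by apply: prodr_ge0 => j _; rewrite mulr_ge0// flat_ge0. Qed.

Lemma bump_le1 A B k z : zbump A B k z <= 1.
Proof.
apply: prodr_ile1 => j; rewrite mulr_ge0 ?flat_ge0//=.
by rewrite mulr_ile1 ?flat_ge0// flat0_le1.
Qed.

Let argA A j (z : Z) k : k.+1%:R * coord j z + - (k.+1%:R * coord j A) = k.+1%:R * (coord j z - coord j A).
Proof. by rewrite mulrBr. Qed.
Let argB B j (z : Z) k : - k.+1%:R * coord j z + k.+1%:R * coord j B = k.+1%:R * (coord j B - coord j z).
Proof. by rewrite mulrBr mulNr addrC. Qed.

Lemma bump_gt0 A B k z : jbox A B z -> 0 < zbump A B k z.
Proof.
move=> h; apply: prodr_gt0 => j _; have /andP[h1 h2] := h j.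
by apply: mulr_gt0; rewrite ?argA ?argB flat0E pmulr_rgt0 ?ltr0n// subr_gt0 ?h1 ?h2 expR_gt0.
Qed.

Lemma bump_off A B k z : ~ jbox A B z -> zbump A B k z = 0.
Proof.
move=> /existsNP[j hj]; rewrite /zbump (bigD1 j)//=.
rewrite argA argB !flat0E !pmulr_rgt0 ?ltr0n// !subr_gt0.
have [h1|h1] := ltP (coord j A) (coord j z); last by rewrite mul0r mul0r.
have [h2|h2] := ltP (coord j z) (coord j B); last by rewrite mulr0 mul0r.
by case: hj; rewrite h1 h2.
Qed.

Lemma bump_cvg A B z : zbump A B k z @[k --> \oo] --> (\1_(jbox A B) z : R).
Proof.
have [h|h] := pselect (jbox A B z); last first.
  rewrite indicE memNset//; under eq_fun do rewrite bump_off//.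
  exact: cvg_cst.
rewrite indicE mem_set//.
have key (t : R) : 0 < t -> flat 0 (k.+1%:R * t) @[k --> \oo] --> (1 : R).
  move=> t0; have -> : (fun k => flat 0 (k.+1%:R * t)) = (fun k : nat => expR (- t^-1 * k.+1%:R^-1)).
    by apply/funext => k; rewrite flat0E pmulr_rgt0 ?ltr0n// t0 invfM mulNr mulrC.
  rewrite -[X in _ --> X]expR0; apply: (@cvg_comp _ _ _ (fun k : nat => - t^-1 * k.+1%:R^-1) expR); last exact: continuous_expR.
  have h0 : (fun k : nat => - t^-1 * k.+1%:R^-1) @ \oo --> (- t^-1 * 0 : R).
    by apply: cvgM; [exact: cvg_cst|exact: cvg_harmonic].
  by move: h0; rewrite mulr0.
rewrite /zbump; elim: (index_enum J) => [|j r IH].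
  by under eq_fun do rewrite big_nil; exact: cvg_cst.
under eq_fun do rewrite big_cons argA argB.
have /andP[h1 h2] := h j.
have k1 := key (coord j z - coord j A); have k2 := key (coord j B - coord j z).
have := cvgM (cvgM (k1 _) (k2 _)) IH; rewrite !subr_gt0 !mulr1; exact.
Qed.

Lemma smooth_real (g : Z -> R) : rsmooth g -> smooth (fun z => (g z)%:C).
Proof. by move=> sg; apply/smoothP; split; [exact: sg|exact: (rsmooth_cst 0)]. Qed.

Lemma test_fun_bump D A B k : jcbox A B `<=` D -> test_fun D (fun z => (zbump A B k z)%:C).
Proof.
move=> h; apply: (@test_fun_support D (jcbox A B)) => //.
- exact/smooth_real/rsmooth_bump.
- exact: compact_jcbox.
- move=> z nz; rewrite bump_off// => hz; apply: nz => j.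
  by have /andP[/ltW-> /ltW->] := hz j.
Qed.

Lemma smoothM phi psi : smooth phi -> smooth psi -> smooth (fun z => phi z * psi z).
Proof.
move=> /smoothP[p1 p2] /smoothP[q1 q2]; apply/smoothP; split.
  have -> : @complex.Re R \o (fun z => phi z * psi z) = (@complex.Re R \o phi) * (@complex.Re R \o psi) + - ((@complex.Im R \o phi) * (@complex.Im R \o psi)).
    by apply/funext => z /=; rewrite cReM.
  by apply: rsmoothD; [|apply: rsmoothN]; exact: rsmoothM.
have -> : @complex.Im R \o (fun z => phi z * psi z) = (@complex.Re R \o phi) * (@complex.Im R \o psi) + (@complex.Im R \o phi) * (@complex.Re R \o psi).
  by apply/funext => z /=; rewrite cImM.
by apply: rsmoothD; exact: rsmoothM.
Qed.

Lemma test_funM D phi psi : smooth phi -> test_fun D psi -> test_fun D (fun z => phi z * psi z).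
Proof.
move=> sphi tp; have [s c i] := tp; apply: (test_fun_support _ c i); first exact: smoothM.
by move=> z nz; rewrite (test_fun_off tp nz) mulr0.
Qed.

Lemma smooth_cst (c : R[i]) : smooth (fun _ : Z => c).
Proof. by apply/smoothP; split; exact: rsmooth_cst. Qed.

Lemma ball_jcbox D z : open D -> D z -> exists A B, jbox A B z /\ jcbox A B `<=` D.
Proof.
move=> oD Dz; have /nbhs_ballP[r /= r0 rD] : nbhs z D by exact: open_nbhs_nbhs.
have r2 : 0 < r / 2 by rewrite divr_gt0.
exists (z.1 - const_mx (r / 2), z.2 - const_mx (r / 2)), (z.1 + const_mx (r / 2), z.2 + const_mx (r / 2)).
split; first by move=> [i|i] /=; rewrite !mxE ltrDl gtrBl r2.
move=> y hy; apply: rD.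
have rr : r / 2 < r by rewrite ltr_pdivrMr// ltr_pMr// ltr1n.
split; apply/rV_ballP => // i; rewrite distrC (le_lt_trans _ rr)//.
  by have := hy (inl i); rewrite /= !mxE ler_distl.
by have := hy (inr i); rewrite /= !mxE ler_distl.
Qed.

Lemma open_jbox A B : open (jbox A B).
Proof.
rewrite openE => z hz; apply: (@filter_forall _ J (fun j w => coord j A < coord j w < coord j B) (nbhs z)) => j.
have h : coord j @ z --> coord j z by exact: continuous_coord.
by have /andP[h1 h2] := hz j; near=> w; apply/andP; split; near: w;
  [exact: (cvgr_gt (coord j z) h)|exact: (cvgr_lt (coord j z) h)].
Unshelve. all: by end_near. Qed.

(** A finite sum of bumps over a cover of S by boxes. Positivity on S is enough, rather than the
    value 1, because [cutoff_factor] divides by it. *)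
Lemma cutoff_pos D S : open D -> compact S -> S `<=` D ->
  exists chi : Z -> R, [/\ rsmooth chi, forall z, S z -> 0 < chi z & test_fun D (fun z => (chi z)%:C)].
Proof.
move=> oD cS SD.
have /choice[F hF] : forall z, exists AB : Z * Z, S z -> jbox AB.1 AB.2 z /\ jcbox AB.1 AB.2 `<=` D.
  move=> z; have [Sz|nSz] := pselect (S z); last by exists (z, z).
  by have [A [B h]] := ball_jcbox oD (SD z Sz); exists (A, B).
pose pZ : ptopologicalType := HB.pack Z (isPointed.Build Z 0).
have := cS; rewrite -[compact S]/(@compact pZ S) compact_cover.
move=> /(_ Z S (fun z => jbox (F z).1 (F z).2)); case.
- by move=> z _; exact: open_jbox.
- by move=> z Sz; exists z => //; case: (hF z Sz).
move=> X XS Xcov.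
pose X' : seq Z := finmap.enum_fset X.
exists (fun z => \sum_(x <- X') zbump (F x).1 (F x).2 0 z); split.
- by apply: rsmooth_sum => x; exact: rsmooth_bump.
- move=> z /Xcov[x /= xX hz]; rewrite (big_rem x)//= ltr_pwDl ?bump_gt0//.
  by apply: sumr_ge0 => y _; exact: bump_ge0.
- pose T := \bigcup_(x in [set x | x \in X']) jcbox (F x).1 (F x).2.
  have TE : T = \big[setU/set0]_(x <- X') jcbox (F x).1 (F x).2 by exact: bigcup_seq.
  apply: (@test_fun_support D T).
  + by apply: smooth_real; apply: rsmooth_sum => x; exact: rsmooth_bump.
  + by rewrite TE; apply: bigsetU_compact => x _; exact: compact_jcbox.
  + move=> z [x /= /XS/set_mem Sx]; have [_] := hF x Sx; apply.
  + move=> z nz; rewrite big_seq big1// => x xX; rewrite bump_off// => hz; apply: nz.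
    by exists x => // j; have /andP[/ltW-> /ltW->] := hz j.
Qed.

(** Convergence in the local negative space concerns chi f_n, not f_n. Writing phi = chi psi with
    psi = phi / chi turns the value of f_n at phi into the value of chi f_n at psi. *)
Lemma cutoff_factor D phi : open D -> test_fun D phi ->
  exists chi psi, [/\ test_fun D chi, test_fun D psi & phi = fun z => chi z * psi z].
Proof.
move=> oD tp; have [sp cp ip] := tp; set S := closure _ in cp ip.
have [chi [schi chi0 tchi]] := cutoff_pos oD cp ip.
have off z : ~ S z -> phi z = 0 by exact: (test_fun_off tp).
have [s1 s2] := (smoothP _).1 sp.
pose psi z : R[i] := Complex (complex.Re (phi z) / chi z) (complex.Im (phi z) / chi z).
exists (fun z => (chi z)%:C), psi; split; first exact: tchi.
  apply: (@test_fun_support D S _ _ cp ip).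
    have cS : closed S by exact: closed_closure.
    apply/smoothP; split.
      by apply: (rsmooth_div cS schi chi0 s1) => z nz /=; rewrite off.
    by apply: (rsmooth_div cS schi chi0 s2) => z nz /=; rewrite off.
  by move=> z nz; rewrite /psi off//= !mul0r.
apply/funext => z; have [Sz|nSz] := pselect (S z).
  have c0 : chi z != 0 by rewrite gt_eqF// chi0.
  by apply: eq_complexP; rewrite ?cReM ?cImM/= mul0r ?subr0 ?addr0 mulrC divfK.
by rewrite /psi off//= !mul0r; apply: eq_complexP; rewrite ?cReM ?cImM/= !mulr0 ?mul0r ?subr0 ?addr0.
Qed.

End bumps.

(** * Zero sets of analytic functions *)

Section pseries_one.
Context {R : realType}.

Lemma cvgn_ubound (v : nat -> R) : cvgn v -> exists M, forall n, v n <= M.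
Proof.
move=> /cvg_seq_bounded[M [_ hM]]; exists (M + 1) => n.
by rewrite (le_trans (ler_norm _))//; apply: hM => //; rewrite ltrDl.
Qed.

Definition pseries_at (f : R -> R) (c : nat -> R) (r : R) :=
  0 < r /\ forall t, `|t| < r ->
    cvgn (fun N : nat => \sum_(k < N) `|c k * t ^+ k|) /\
    (fun N : nat => \sum_(k < N) c k * t ^+ k) @ \oo --> f t.

(** Absolute convergence at radius r / 2 bounds the remainder by the absolute sum there times (|t| /
    (r / 2))^m. The value at 0, the derivative at 0 and the isolation of zeros all follow, with m =
    1, 2 and one more than the order of vanishing. *)
Lemma pseries_remainder f c r m : pseries_at f c r ->
  exists2 S, 0 <= S & forall t, `|t| <= r / 2 ->
    `|f t - \sum_(k < m) c k * t ^+ k| <= S * `|t| ^+ m.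
Proof.
move=> [r0 h]; have r2 : 0 < r / 2 by rewrite divr_gt0.
have rr : `|r / 2| < r by rewrite gtr0_norm// ltr_pdivrMr// ltr_pMr// ltr1n.
have [cv _] := h _ rr; set A := fun N => _ in cv.
have ndA : nondecreasing_seq A.
  by apply/nondecreasing_seqP => n; rewrite /A big_ord_recr/= lerDl.
have Ale N : A N <= limn A by exact: nondecreasing_cvgn_le.
have A0 : 0 <= limn A by apply: le_trans (Ale 0%N); rewrite /A big_ord0.
exists (limn A * (r / 2)^-1 ^+ m); first by rewrite mulr_ge0// exprn_ge0// invr_ge0 ltW.
move=> t tr; have tr' : `|t| < r by rewrite (le_lt_trans tr)// -[ltLHS]gtr0_norm.
have [_ cf] := h _ tr'.
have cvd : (fun N : nat => `|\sum_(k < N + m) c k * t ^+ k - \sum_(k < m) c k * t ^+ k|) @ \oo -->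
    `|f t - \sum_(k < m) c k * t ^+ k|.
  apply: cvg_norm; apply: cvgB; last exact: cvg_cst.
  by rewrite (cvg_shiftn m (fun N : nat => \sum_(k < N) c k * t ^+ k)).
rewrite -(cvg_lim _ cvd)//; apply: limr_le; [exact: cvgP cvd|near=> N].
rewrite addnC big_split_ord/= addrAC subrr add0r.
rewrite (le_trans (ler_norm_sum _ _ _))// -mulrA -exprMn.
apply: (@le_trans _ _ ((\sum_(i < N) `|c (m + i)%N * (r / 2) ^+ (m + i)|) * ((r / 2)^-1 * `|t|) ^+ m)).
  rewrite mulr_suml; apply: ler_sum => i _.
  have q1 : (r / 2)^-1 * `|t| <= 1 by rewrite mulrC ler_pdivrMr// mul1r.
  have q0 : 0 <= (r / 2)^-1 * `|t| by rewrite mulr_ge0// invr_ge0 ltW.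
  rewrite !normrM -mulrA ler_wpM2l// !normrX (gtr0_norm r2).
  have -> : `|t| ^+ (m + i) = (r / 2) ^+ (m + i) * ((r / 2)^-1 * `|t|) ^+ (m + i).
    by rewrite -exprMn mulrA mulfV ?gt_eqF// mul1r.
  apply: ler_wpM2l; first by rewrite exprn_ge0// ltW.
  by rewrite exprD ler_piMr ?exprn_ge0// exprn_ile1.
rewrite ler_wpM2r ?exprn_ge0 ?mulr_ge0 ?invr_ge0 ?(ltW r2)//.
apply: le_trans (Ale (m + N)%N); rewrite /A big_split_ord/= lerDr.
exact: sumr_ge0.
Unshelve. all: by end_near. Qed.

Lemma pseries_at0 f c r : pseries_at f c r -> f 0 = c 0.
Proof.
move=> h; have [S _ hS] := pseries_remainder 1 h; have [r0 _] := h.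
have /hS : `|0 : R| <= r / 2 by rewrite normr0 divr_ge0// ltW.
by rewrite normr0 expr1 mulr0 big_ord1 expr0 mulr1 normr_le0 subr_eq0 => /eqP.
Qed.

Lemma pseries_derive f c r : pseries_at f c r -> is_derive (0 : R) 1 f (c 1%N).
Proof.
move=> h; have [S S0 hS] := pseries_remainder 2 h; have [r0 _] := h.
have cv : (fun t : R => t^-1 *: ((f \o shift (0 : R)) (t *: (1 : R)) - f 0)) @ 0^' --> (c 1%N : R).
  apply/cvgrPdist_le => e e0; near=> t.
  have t0 : t != 0 by near: t; exact: nbhs_dnbhs_neq.
  rewrite /= addr0 [t *: 1]mulr1 (pseries_at0 h) distrC.
  have tr : `|t| <= r / 2 by near: t; apply: dnbhs0_le; rewrite divr_gt0.
  have := hS t tr; rewrite !big_ord_recr big_ord0/= add0r expr0 mulr1 expr1.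
  move=> ht.
  rewrite (_ : _ - _ = t^-1 * (f t - (c 0%N + c 1%N * t))); last first.
    by rewrite /GRing.scale/=; field.
  rewrite normrM normfV ler_pdivrMl ?normr_gt0//.
  rewrite (le_trans ht)// expr2 mulrA mulrC ler_wpM2l//.
  have tS : `|t| <= e / (S + 1).
    by near: t; apply: dnbhs0_le; rewrite divr_gt0// ltr_wpDl.
  rewrite mulrC (le_trans (ler_wpM2r S0 tS))// -mulrA ler_piMr// ?ltW//.
  by rewrite mulrC ltr_pdivrMr ?mul1r ?ltrDl// ltr_wpDl.
by split; [apply/cvg_ex; exists (c 1%N)|exact: cvg_lim cv].
Unshelve. all: by end_near. Qed.

Lemma pseries_zeros f c r : pseries_at f c r ->
  exists2 e, 0 < e & (forall t, `|t| < e -> f t = 0) \/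
                     (forall t, t != 0 -> `|t| < e -> f t != 0).
Proof.
move=> h; have [r0 hr] := h.
have [c0|/existsNP c0] := pselect (forall k, c k = 0).
  exists r => //; left => t /hr[_]; under eq_fun do under eq_bigr do rewrite c0 mul0r.
  under eq_fun do rewrite big1//.
  by move=> cv; apply: (cvg_unique _ cv); [exact: Rhausdorff|exact: cvg_cst].
have ex : exists k, c k != 0 by have [k /eqP] := c0; exists k.
have [m cm mmin] := ex_minnP ex.
have [S S0 hS] := pseries_remainder m.+1 h.
have S1 : 0 < S + 1 by rewrite ltr_wpDl.
(* Below |c_m| / (S + 1) the remainder S |t|^(m+1) is smaller than the leading term |c_m| |t|^m. *)
exists (Num.min (r / 2) (`|c m| / (S + 1))).
  by rewrite lt_min !divr_gt0// normr_gt0.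
right => t t0; rewrite lt_min => /andP[t1 t2]; apply/negP => /eqP ft.
have := hS t (ltW t1); rewrite ft sub0r normrN big_ord_recr/= big1; last first.
  move=> k _; suff -> : c k = 0 by rewrite mul0r.
  apply/eqP; apply: contraTT (ltn_ord k) => /mmin; by rewrite -leqNgt.
rewrite add0r normrM normrX exprS mulrA ler_pM2r ?exprn_gt0 ?normr_gt0//.
move=> hc; move: t2; rewrite ltr_pdivlMr// ltNge => /negP; apply.
by rewrite (le_trans hc)// mulrC ler_wpM2l// lerDl.
Qed.

Lemma pseries_lin f g c b (k : R) r s : pseries_at f c r -> pseries_at g b s ->
  pseries_at (fun t => k * f t + g t) (fun n => k * c n + b n) (Num.min r s).
Proof.
move=> [r0 hf] [s0 hg]; split; first by rewrite lt_min r0.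
move=> t; rewrite lt_min => /andP[/hf[cf1 cf2] /hg[cg1 cg2]]; split; last first.
  rewrite (_ : (fun N => _) = (fun N : nat => k * (\sum_(i < N) c i * t ^+ i) + \sum_(i < N) b i * t ^+ i)).
    by apply: cvgD => //; apply: cvgM => //; exact: cvg_cst.
  apply/funext => N; rewrite mulr_sumr -big_split/=; apply: eq_bigr => i _; ring.
apply: nondecreasing_is_cvgn.
  by apply/nondecreasing_seqP => n; rewrite big_ord_recr/= lerDl.
have [M1 h1] := cvgn_ubound cf1; have [M2 h2] := cvgn_ubound cg1.
exists (`|k| * M1 + M2) => _ [N _ <-].
apply: le_trans (lerD (ler_wpM2l (normr_ge0 k) (h1 N)) (h2 N)).
rewrite mulr_sumr -big_split/=; apply: ler_sum => i _.
by rewrite mulrDl (le_trans (ler_normD _ _))// -mulrA [`|k * _|]normrM.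
Qed.

End pseries_one.

(** * Real-analytic functions of several variables: lines and Lipschitz bounds *)

Section analytic.
Context {R : realType} (d : nat).
Local Notation E := 'rV[R]_d.
Local Notation Z := (E * E)%type.
Local Notation J := ('I_d + 'I_d)%type.
Implicit Types (D S : set Z) (g : Z -> R).

Lemma coordB j (z w : Z) : coord j (z - w) = coord j z - coord j w.
Proof. by case: j => i; rewrite /= !mxE. Qed.

(** On a coordinate axis only multi-indices supported at [j] contribute, so sums along boxes of
    multi-indices become ordinary partial sums of a power series in one variable. *)
Lemma sum_axis (F : (J -> nat) -> R) (j : J) N :
  (forall al l, l != j -> al l != 0%N -> F al = 0) ->
  \sum_(al : {ffun J -> 'I_N}) F (fun l => al l) =
  \sum_(k < N) F (fun l => if l == j then (k : nat) else 0%N).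
Proof.
move=> h; case: N => [|N].
  rewrite big_ord0; apply: big1 => al _; by case: (al j).
pose P (al : {ffun J -> 'I_N.+1}) := [forall l, (l != j) ==> (al l == ord0)].
rewrite (bigID P)/= [X in _ + X]big1 ?addr0; last first.
  move=> al /forallPn[l]; rewrite negb_imply => /andP[lj al0].
  by apply: (h _ l) => //; apply: contra al0 => /eqP e; apply/eqP/val_inj.
pose inj (k : 'I_N.+1) : {ffun J -> 'I_N.+1} := [ffun l => if l == j then k else ord0].
rewrite (reindex_onto inj (fun al => al j)); last first.
  move=> al /forallP Pal; apply/ffunP => l; rewrite ffunE.
  by have := Pal l; case: eqVneq => //= [->//|_ /eqP].
apply: eq_big => k; first by rewrite ffunE !eqxx andbT; apply/forallP => l; rewrite ffunE; case: eqVneq.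
by move=> _; congr F; apply/funext => l; rewrite ffunE; case: ifP.
Qed.

Lemma ballZ_line (z : Z) j (t r : R) : `|t| < r -> ball z r (t *: basis j + z).
Proof.
move=> tr; have r0 : 0 < r by apply: le_lt_trans tr.
have h (l : J) : `|coord l z - coord l (t *: basis j + z)| < r.
  rewrite coordD coordZ coord_basisE opprD addrCA subrr addr0 normrN normrM.
  by case: eqP; rewrite ?normr1 ?mulr1// normr0 mulr0.
split; apply/rV_ballP => // i; [exact: (h (inl i))|exact: (h (inr i))].
Qed.

Lemma analytic_pseries D g z j : real_analytic D g -> D z ->
  exists c r, pseries_at (fun t => g (t *: basis j + z)) c r.
Proof.
move=> ag Dz; have [c [r r0 h]] := ag z Dz.
exists (fun k => c (fun l => if l == j then k else 0%N)), r; split => // t tr.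
have [] := h _ (ballZ_line z j tr); rewrite addrK.
have pw (k : nat) : \prod_l coord l (t *: basis j : Z) ^+ (if l == j then k else 0%N) = t ^+ k.
  rewrite (bigD1 j)//= eqxx coordZ coord_basisE eqxx mulr1 big1 ?mulr1// => l /negbTE ->.
  by rewrite expr0.
have zz (al : J -> nat) l : l != j -> al l != 0%N -> c al * \prod_j0 coord j0 (t *: basis j) ^+ al j0 = 0.
  move=> lj al0; rewrite (bigD1 l)//= coordZ coord_basisE (negbTE lj) mulr0 expr0n.
  by rewrite (negbTE al0) mul0r mulr0.
set T := fun al => c al * \prod_j0 coord j0 (t *: basis j) ^+ al j0 in zz *.
have TE k : T (fun l => if l == j then k else 0%N) = c (fun l => if l == j then k else 0%N) * t ^+ k.
  by rewrite /T pw.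
have E1 : (fun N => \sum_(al : {ffun J -> 'I_N}) `|T (fun j0 => al j0)|) =
   (fun N => \sum_(k < N) `|c (fun l => if l == j then k : nat else 0%N) * t ^+ k|).
  apply/funext => N; rewrite (@sum_axis (fun al => `|T al|) j); last first.
    by move=> al l lj al0; rewrite (zz al l lj al0 : T al = 0) normr0.
  by apply: eq_bigr => k _; rewrite TE.
have E2 : (fun N => \sum_(al : {ffun J -> 'I_N}) T (fun j0 => al j0)) =
   (fun N => \sum_(k < N) c (fun l => if l == j then k : nat else 0%N) * t ^+ k).
  by apply/funext => N; rewrite (@sum_axis T j)//; apply: eq_bigr => k _; rewrite TE.
by rewrite -E1 -E2; split.
Qed.

(** The product is changed one factor at a time. Errors are measured relative to the bounds [B], so
    that they add up. *)
Lemma prod_lip (I : Type) (r : seq I) (x y B e : I -> R) :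
  (forall i, `|x i| <= B i) -> (forall i, `|y i| <= B i) ->
  (forall i, `|x i - y i| <= e i * B i) ->
  `|\prod_(i <- r) x i - \prod_(i <- r) y i| <= (\sum_(i <- r) e i) * \prod_(i <- r) B i.
Proof.
move=> hx hy hxy; elim: r => [|i r IH]; first by rewrite !big_nil subrr normr0 mul0r.
rewrite !big_cons; set X := \prod_(_ <- _) _; set Y := \prod_(j <- r) y j; set BB := \prod_(j <- r) B j.
have B0 j : 0 <= B j by rewrite (le_trans _ (hx j)).
have hY : `|Y| <= BB.
  rewrite /Y /BB; elim: r {IH X Y BB} => [|k r IH]; first by rewrite !big_nil normr1.
  by rewrite !big_cons normrM ler_pM.
rewrite (_ : _ - _ = x i * (X - Y) + (x i - y i) * Y); last by ring.
rewrite (le_trans (ler_normD _ _))// !normrM mulrDl addrC; apply: lerD.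
  rewrite mulrA; exact: ler_pM.
by rewrite mulrCA; apply: ler_pM.
Qed.

(** Halving the radius absorbs the factor k of the mean value theorem, so the estimate can be summed
    against the series at radius rho. *)
Lemma expr_lip (x y rho : R) k : 0 < rho -> `|x| <= rho / 2 -> `|y| <= rho / 2 ->
  `|x ^+ k - y ^+ k| <= (2 / rho * `|x - y|) * rho ^+ k.
Proof.
move=> r0 hx hy; have r2 : rho / 2 <= rho by lra.
elim: k => [|k IH]; first by rewrite !expr0 subrr normr0 mulr1 mulr_ge0// divr_ge0// ltW.
rewrite (_ : _ - _ = x * (x ^+ k - y ^+ k) + (x - y) * y ^+ k); last by rewrite !exprS; ring.
rewrite (le_trans (ler_normD _ _))//.
have -> : 2 / rho * `|x - y| * rho ^+ k.+1 = `|x - y| * rho ^+ k + `|x - y| * rho ^+ k.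
  by rewrite exprS; field; rewrite gt_eqF.
apply: lerD.
  rewrite normrM (le_trans (ler_pM _ _ hx IH))// le_eqVlt; apply/orP; left; apply/eqP.
  by field; rewrite gt_eqF.
rewrite normrM normrX ler_wpM2l//; apply: lerXn2r; rewrite ?nnegrE ?(ltW r0)//; lra.
Qed.

(** Termwise Lipschitz bounds, summed against the absolutely convergent series at a single point.
    Continuity and local boundedness of the partial derivatives follow without differentiating the
    series. *)
Lemma analytic_lipschitz D g z : real_analytic D g -> D z ->
  exists rho L, [/\ 0 < rho, 0 <= L & forall w w', ball z rho w -> ball z rho w' ->
    `|g w - g w'| <= L * \sum_j `|coord j w - coord j w'|].
Proof.
move=> ag Dz; have [c [r r0 h]] := ag z Dz.
pose rho := r / 2; have rho0 : 0 < rho by rewrite divr_gt0.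
have rhor : rho < r by rewrite ltr_pdivrMr// ltr_pMr// ltr1n.
(* All coordinates of [z1 - z] equal rho, so absolute convergence at [z1] bounds the sums of |c_al|
   rho^|al|. *)
pose z1 : Z := (z.1 + const_mx rho, z.2 + const_mx rho).
have Ez1 : z1 = (const_mx rho, const_mx rho) + z by rewrite addrC /z1; case: (z).
have bz1 : ball z r z1.
  by split; apply/rV_ballP => // i; rewrite !mxE opprD addrA subrr add0r normrN gtr0_norm.
have [cv _] := h _ bz1.
have cz1 al : \prod_j coord j (z1 - z) ^+ al j = \prod_j rho ^+ al j.
  by apply: eq_bigr => j _; rewrite Ez1 addrK; case: j => i; rewrite /= mxE.
have [M hM] : exists M, forall N, \sum_(al : {ffun J -> 'I_N}) `|c (fun j => al j)| * \prod_j rho ^+ al j <= M.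
  have [M hM] := cvgn_ubound cv; exists M => N.
  apply: le_trans (hM N).
  apply: ler_sum => al _; rewrite cz1 normrM ler_wpM2l// ler_norm//.
have M0 : 0 <= M.
  apply: le_trans (hM 0%N); apply: sumr_ge0 => al _.
  by rewrite mulr_ge0// prodr_ge0// => j _; rewrite exprn_ge0// ltW.
have rho20 : 0 < rho / 2 by rewrite divr_gt0.
have rr : rho / 2 < r by lra.
exists (rho / 2), (2 / rho * M); split => //; first by rewrite mulr_ge0// divr_ge0// ltW.
move=> w w' bw bw'.
have bb v : ball z (rho / 2) v -> ball z r v by apply: le_ball; exact: ltW.
have bc v : ball z (rho / 2) v -> forall j, `|coord j (v - z)| <= rho / 2.
  by move=> [/(rV_ballP _ _ rho20) b1 /(rV_ballP _ _ rho20) b2] [i|i];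
    rewrite /= !mxE distrC ltW.
have hB v j k : ball z (rho / 2) v -> `|coord j (v - z) ^+ k| <= rho ^+ k.
  move=> /bc/(_ j) hv; rewrite normrX; apply: lerXn2r; rewrite ?nnegrE ?(ltW rho0)//; lra.
have [_ cw] := h _ (bb _ bw); have [_ cw'] := h _ (bb _ bw').
pose P v (N : nat) := \sum_(al : {ffun J -> 'I_N}) c (fun j => al j) * \prod_j coord j (v - z) ^+ al j.
have cvd : (fun N => `|P w N - P w' N|) @ \oo --> `|g w - g w'|.
  by apply: cvg_norm; apply: cvgB.
rewrite -(cvg_lim _ cvd)//; apply: limr_le; [exact: cvgP cvd|near=> N].
rewrite /P -sumrB (le_trans (ler_norm_sum _ _ _))//.
apply: (@le_trans _ _ (\sum_(al : {ffun J -> 'I_N}) `|c (fun j => al j)| *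
    ((\sum_j 2 / rho * `|coord j w - coord j w'|) * \prod_j rho ^+ al j))).
  apply: ler_sum => al _; rewrite -mulrBr normrM ler_wpM2l//.
  apply: prod_lip => j.
  - exact: hB.
  - exact: hB.
  - have := expr_lip (al j) rho0 (bc w bw j) (bc w' bw' j).
    by rewrite !coordB opprB addrA subrK.
rewrite -mulr_sumr; under eq_bigr do rewrite mulrCA.
rewrite -mulr_sumr [leRHS]mulrAC ler_wpM2l//.
by apply: mulr_ge0; [rewrite divr_ge0// ltW|exact: sumr_ge0].
Unshelve. all: by end_near. Qed.

End analytic.

(** * Sets that are null or full along every line *)

Section null_sets.
Context {R : realType}.

(** If the horizontal line at some height y0 is not full, its trace is negligible. For almost every
    x the point (x, y0) is then outside N, so the vertical line over x is not full either, hence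
    negligible, and N is null by Fubini. *)
Lemma product_null_or_all d1 d2 (T1 : measurableType d1) (T2 : measurableType d2)
  (m1 : {sigma_finite_measure set T1 -> \bar R}) (m2 : {sigma_finite_measure set T2 -> \bar R})
  (A : set T1) (B : set T2) (N : set (T1 * T2)) :
  measurable A -> measurable B -> measurable N ->
  (forall x, A x -> (forall y, B y -> N (x, y)) \/ m2.-negligible [set y | B y /\ N (x, y)]) ->
  (forall y, B y -> (forall x, A x -> N (x, y)) \/ m1.-negligible [set x | A x /\ N (x, y)]) ->
  A `*` B `<=` N \/ (m1 \x m2)%E (A `*` B `&` N) = 0%E.
Proof.
move=> mA mB mN H1 H2.
have [allN|/existsNP[y0 /not_implyP[By0 nall]]] := pselect (forall y, B y -> forall x, A x -> N (x, y)).
  by left => -[x y] [/= Ax By]; exact: allN.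
right; have neg : m1.-negligible [set x | A x /\ N (x, y0)] by case: (H2 y0 By0).
have mM : measurable (A `*` B `&` N) by apply: measurableI => //; exact: measurableX.
rewrite /= /product_measure1 /=.
rewrite (@ae_eq_integral _ _ _ m1 setT (cst 0%E) (m2 \o xsection (A `*` B `&` N)))//.
- by rewrite integral0.
- exact: measurable_fun_xsection.
- apply: (negligibleS _ neg) => x /= /not_implyP[_ hx].
  have Ax : A x.
    apply: contrapT => nAx; apply: hx; rewrite (_ : xsection _ x = set0) ?measure0//.
    by apply/seteqP; split => y // /xsectionP[[/= /nAx]].
  split => //; have [h|h] := H1 x Ax; first exact: h.
  exfalso; apply: hx; apply: measure_negligible; first exact: measurable_xsection.
  apply: (negligibleS _ h) => y /xsectionP[[/= _ By] Nxy]; by split.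
Qed.

(** Each point is the only point of N in some interval with rational ends, so N is countable. *)
Lemma isolated_negligible (N : set R) :
  (forall t, N t -> exists2 e, 0 < e & forall s, s != t -> `|s - t| < e -> ~ N s) ->
  (@lebesgue_measure R).-negligible N.
Proof.
move=> iso.
pose S (pq : rat * rat) : set R := [set t | [/\ N t, ratr pq.1 < t < ratr pq.2 &
   forall s, N s -> ratr pq.1 < s < ratr pq.2 -> s = t]].
have cS : countable (\bigcup_pq S pq).
  apply: bigcup_countable => [|pq _]; first exact: countableP.
  apply: finite_set_countable.
  have [->|/set0P[t [Nt tpq ut]]] := eqVneq (S pq) set0; first exact: finite_set0.
  apply: (@sub_finite_set _ _ [set t]) => // s [Ns spq us] /=.
  by rewrite (us t).
exists (\bigcup_pq S pq); split.
- by apply: countable_measurable.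
- exact: countable_lebesgue_measure0.
- move=> t Nt; have [e e0 he] := iso t Nt.
  have te : t - e < t by rewrite ltrBlDr ltrDl.
  have te' : t < t + e by rewrite ltrDl.
  have [p hp] := rat_in_itvoo te; have [q hq] := rat_in_itvoo te'.
  move: hp hq; rewrite !in_itv/= => /andP[p1 p2] /andP[q1 q2].
  exists (p, q) => //; split => //=; first by rewrite p2.
  move=> s Ns /andP[s1 s2]; apply/eqP; apply: contrapT => /negP st.
  apply: (he s st _ Ns); rewrite ltr_distl; apply/andP; split; [exact: lt_trans s1|exact: lt_trans q2].
Qed.

Definition zero_dichotomy (h : R -> R) (t : R) := exists2 e, 0 < e &
  (forall s, `|s - t| < e -> h s = 0) \/ (forall s, s != t -> `|s - t| < e -> h s != 0).

(** The interior [U] of the zero set is relatively closed in I, so by connectedness it contains I or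
    misses it; in the second case all zeros in I are isolated. *)
Lemma interval_null_or_all (I : set R) (h : R -> R) : is_interval I ->
  (forall t, I t -> zero_dichotomy h t) ->
  (forall t, I t -> h t = 0) \/ (@lebesgue_measure R).-negligible [set t | I t /\ h t = 0].
Proof.
move=> iI hI.
pose U : set R := [set t : R | \forall s \near t, h s = 0].
have oU : open U by rewrite openE => t /nbhs_interior.
(* A limit point t of [U] is not an isolated zero: near t there are points of [U] with a whole
   neighbourhood of zeros, and if the point found is t itself, a half-radius shift gives a zero
   other than t. *)
have clU : I `&` U = I `&` closure U.
  apply/seteqP; split => t [It Ut]; split => //; first exact: subset_closure.
  have [e e0 [h0|h0]] := hI t It.
    by apply/nbhs_ballP; exists e => // s; rewrite -ball_normE/= distrC; exact: h0.
  have bt : nbhs t (ball t e) by exact: nbhsx_ballx.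
  have [s [Us bs]] := Ut _ bt.
  have [r /= r0 rU] : nbhs_ball s (fun w => h w = 0 /\ ball t e w).
    rewrite nbhs_ballE; apply: filterI => //.
    by have := @ball_open R R t e; rewrite openE => /(_ s bs).
  have [st|st] := eqVneq s t; last first.
    have [hs bs'] := rU s (ballxx _ r0).
    by have := h0 s st; rewrite distrC => /(_ bs'); rewrite hs eqxx.
  have bw : ball s r (s + r / 2).
    by rewrite -ball_normE/= opprD addNKr normrN gtr0_norm ?divr_gt0// ltr_pdivrMr// ltr_pMr// ltr1n.
  have [hs bs'] := rU _ bw.
  have := h0 (s + r / 2); rewrite distrC => /(_ _ bs'); rewrite hs eqxx st.
  by rewrite -subr_eq0 addrAC subrr add0r mulf_neq0 ?gt_eqF// => /(_ isT).
have [IU|/set0P/negP/negPn/eqP IU] := pselect (I `&` U !=set0).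
  left; have cI : connected I by apply/connected_intervalP.
  have E : I `&` U = I.
    by apply: cI => //; [exists U|exists (closure U) => //; exact: closed_closure].
  by move=> t; rewrite -E => -[_ /nbhs_singleton].
right; apply: isolated_negligible => t [It ht].
have [e e0 [h0|h0]] := hI t It.
  exfalso; have : (I `&` U) t.
    by split => //; apply/nbhs_ballP; exists e => // s; rewrite -ball_normE/= distrC; exact: h0.
  by rewrite IU.
by exists e => // s st se [_ /eqP]; apply/negP; exact: h0.
Qed.

Lemma rV_consD n (t s : R) (y : 'rV[R]_n) :
  rV_cons (t, y) + s *: delta_mx 0 ord0 = rV_cons (t + s, y).
Proof.
apply/rowP => i; rewrite [LHS]mxE [X in _ + X]mxE [X in _ * X]mxE; case: (unliftP ord0 i) => [j|] ->.
  by rewrite !rV_consS/= mulr0 addr0.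
by rewrite !rV_cons0 eqxx mulr1.
Qed.

Lemma rV_consDS n (t s : R) (y : 'rV[R]_n) i :
  rV_cons (t, y) + s *: delta_mx 0 (lift ord0 i) = rV_cons (t, y + s *: delta_mx 0 i).
Proof.
apply/rowP => k; rewrite [LHS]mxE [X in _ + X]mxE [X in _ * X]mxE; case: (unliftP ord0 k) => [j|] ->.
  by rewrite !rV_consS/= !mxE (inj_eq lift_inj).
by rewrite !rV_cons0/= mulr0 addr0.
Qed.

Lemma rV_cons_surj n (x : 'rV[R]_n.+1) : x = rV_cons (x ord0 ord0, \row_i x ord0 (lift ord0 i)).
Proof.
by apply/rowP => k; case: (unliftP ord0 k) => [j|] ->; rewrite ?rV_consS ?rV_cons0// mxE.
Qed.

(** Induction on the dimension along the recursive construction of Lebesgue measure: the first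
    coordinate line is one factor of [product_null_or_all], the remaining coordinates the other. *)
Lemma rV_null_or_all n (a b : 'rV[R]_n) (N : set 'rV[R]_n) : measurable N ->
  (forall x i, (forall t, obox a b (x + t *: delta_mx 0 i) -> N (x + t *: delta_mx 0 i)) \/
     (@lebesgue_measure R).-negligible [set t | obox a b (x + t *: delta_mx 0 i) /\ N (x + t *: delta_mx 0 i)]) ->
  obox a b `<=` N \/ lebesgue_rV n (obox a b `&` N) = 0%E.
Proof.
elim: n a b N => [|n IH] a b N mN HN.
  have [N0|N0] := pselect (N 0).
    by left => x _; rewrite (_ : x = 0)//; apply/rowP => -[].
  right; rewrite (_ : _ `&` N = set0) ?measure0//.
  by apply/seteqP; split => // x [_]; rewrite (_ : x = 0)//; apply/rowP => -[].
pose a' : 'rV[R]_n := \row_i a ord0 (lift ord0 i).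
pose b' : 'rV[R]_n := \row_i b ord0 (lift ord0 i).
pose A : set (measurableTypeR R) := `]a ord0 ord0, b ord0 ord0[%classic.
have boxE t y : obox a b (rV_cons (t, y)) <-> A t /\ obox a' b' y.
  split.
    move=> h; split; first by have := h ord0; rewrite rV_cons0 /A/= in_itv.
    by move=> i; have := h (lift ord0 i); rewrite rV_consS !mxE.
  move=> [h1 h2] i; case: (unliftP ord0 i) => [j|] ->; last by rewrite rV_cons0; move: h1; rewrite /A/= in_itv.
  by have := h2 j; rewrite rV_consS !mxE.
have mNc : measurable (@rV_cons R n @^-1` N).
  by rewrite -[X in measurable X]setTI; exact: measurable_rV_cons.
have mA : measurable A by exact: measurable_itv.
have := @product_null_or_all _ _ _ _ (@lebesgue_measure R) (lebesgue_rV n) A (obox a' b') (@rV_cons R n @^-1` N) mA (measurable_obox _ _) mNc.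
case.
- move=> t At; have mNt : measurable [set y | N (rV_cons (t, y))].
    rewrite -[X in measurable X]/((fun y => (t, y)) @^-1` (@rV_cons R n @^-1` N)) -[X in measurable X]setTI.
    exact: (@pair1_measurable _ _ _ _ _ measurableT).
  have [] := IH a' b' _ mNt.
  + move=> y i; have := HN (rV_cons (t, y)) (lift ord0 i).
    case=> [h|h]; [left => s hs|right].
      by have := h s; rewrite rV_consDS; apply; apply/boxE.
    apply: negligibleS h => s [h1 h2] /=; rewrite rV_consDS; split => //; exact/boxE.
  + by left.
  + move=> h; right; exists (obox a' b' `&` [set y | N (rV_cons (t, y))]); split => //.
    by apply: measurableI => //; exact: measurable_obox.
- move=> y By; have [h|h] := HN (rV_cons (0, y)) ord0.
    left => t At; have := h t; rewrite rV_consD add0r; apply; exact/boxE.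
  right; apply: negligibleS h => t [At Nt] /=; rewrite rV_consD add0r; split => //; exact/boxE.
- move=> h; left => x; rewrite (rV_cons_surj x) => /boxE[h1 h2]; exact: (h (_, _)).
- move=> h; right; rewrite /= /lebesgue_rVS /pushforward.
  rewrite (_ : _ @^-1` _ = A `*` obox a' b' `&` (@rV_cons R n @^-1` N))//.
  by apply/seteqP; split => -[t y] /= [h1 h2]; (split => //; exact/boxE).
Qed.

End null_sets.

(** * From small boxes to a connected phase space *)

Section analytic_null.
Context {R : realType} (d : nat).
Local Notation E := 'rV[R]_d.
Local Notation Z := (E * E)%type.
Local Notation J := ('I_d + 'I_d)%type.
Implicit Types (D S : set Z) (g : Z -> R).

Lemma jbox_null_or_all (A B : Z) g : measurable_fun (jbox A B) g ->
  (forall z j, jbox A B z -> zero_dichotomy (fun t => g (t *: basis j + z)) 0) ->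
  (forall z, jbox A B z -> g z = 0) \/ phase_measure d (jbox A B `&` g @^-1` [set 0]) = 0%E.
Proof.
move=> mg hg; have mB : measurable (jbox A B) by rewrite jboxE; exact: measurable_zobox.
pose N := jbox A B `&` g @^-1` [set 0].
have mN : measurable N by exact: mg.
have line z j : (forall t, jbox A B (t *: basis j + z) -> N (t *: basis j + z)) \/
   (@lebesgue_measure R).-negligible [set t | jbox A B (t *: basis j + z) /\ N (t *: basis j + z)].
  have [] := @interval_null_or_all R [set t | jbox A B (t *: basis j + z)] (fun t => g (t *: basis j + z)).
  - move=> s t hs ht r /andP[sr rt] l; have := hs l; have := ht l.
    rewrite !coordD !coordZ coord_basisE; case: eqP => _; rewrite ?mulr1 ?mulr0//.
    by move=> /andP[_ t2] /andP[s1 _]; apply/andP; split; lra.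
  - move=> t /= ht; have [e e0 he] := hg _ j ht; exists e => //.
    have E s : s *: basis j + z = (s - t) *: basis j + (t *: basis j + z).
      by rewrite addrA -scalerDl subrK.
    case: he => he; [left => s hs|right => s st hs]; rewrite E; apply: he; rewrite ?subr0//.
    by rewrite subr_eq0.
  - by move=> h; left => t ht; split => //; exact: h.
  - move=> h; right; apply: negligibleS h => t [h1 [_ h2]]; by split.
have := @product_null_or_all _ _ _ _ _ (lebesgue_rV d) (lebesgue_rV d) (obox A.1 B.1) (obox A.2 B.2) N
   (measurable_obox _ _) (measurable_obox _ _) mN.
rewrite -[obox _ _ `*` _]/(zobox A.1 B.1 A.2 B.2) -jboxE.
case.
- move=> x Ax; have mNx : measurable [set y | N (x, y)].
    rewrite -[X in measurable X]setTI.
    exact: (@pair1_measurable _ _ _ _ x measurableT _ mN).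
  have [] := @rV_null_or_all _ _ A.2 B.2 _ mNx.
  + move=> y i; have := line (x, y) (inr i).
    have E t : t *: basis (inr i) + (x, y) = (x, y + t *: delta_mx 0 i) :> Z.
      by congr pair; rewrite /= ?scaler0 ?add0r// addrC.
    case=> [h|h]; [left => t ht|right].
      by have := h t; rewrite E; apply; rewrite jboxE.
    apply: negligibleS h => t [h1 h2] /=; rewrite E; split => //; by rewrite jboxE.
  + by left.
  + move=> h; right; exists (obox A.2 B.2 `&` [set y | N (x, y)]); split => //.
    by apply: measurableI => //; exact: measurable_obox.
- move=> y By; have mNy : measurable [set x | N (x, y)].
    rewrite -[X in measurable X]setTI.
    exact: (@pair2_measurable _ _ _ _ y measurableT _ mN).
  have [] := @rV_null_or_all _ _ A.1 B.1 _ mNy.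
  + move=> x i; have := line (x, y) (inl i).
    have E t : t *: basis (inl i) + (x, y) = (x + t *: delta_mx 0 i, y) :> Z.
      by congr pair; rewrite /= ?scaler0 ?add0r// addrC.
    case=> [h|h]; [left => t ht|right].
      by have := h t; rewrite E; apply; rewrite jboxE.
    apply: negligibleS h => t [h1 h2] /=; rewrite E; split => //; by rewrite jboxE.
  + by left.
  + move=> h; right; exists (obox A.1 B.1 `&` [set x | N (x, y)]); split => //.
    by apply: measurableI => //; exact: measurable_obox.
- by move=> h; left => z /h[].
- by rewrite (_ : _ `&` N = N); [right|apply/seteqP; split => z; [case|move=> Nz; split => //; case: Nz]].
Qed.

Lemma jbox_gt0 (A B z : Z) : jbox A B z -> (0 < phase_measure d (jcbox A B))%E.
Proof.
move=> h; rewrite jcboxE.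
have -> : phase_measure d (cbox A.1 B.1 `*` cbox A.2 B.2) =
    (lebesgue_rV d (cbox A.1 B.1) * lebesgue_rV d (cbox A.2 B.2))%E.
  by apply: product_measure1E; exact: measurable_rV_box.
have h1 i : A.1 0 i < B.1 0 i by have /andP[] := h (inl i); exact: lt_trans.
have h2 i : A.2 0 i < B.2 0 i by have /andP[] := h (inr i); exact: lt_trans.
rewrite !lebesgue_rV_box; last 2 first.
- by move=> i; rewrite ltW.
- by move=> i; rewrite ltW.
by rewrite -EFinM lte_fin mulr_gt0// prodr_gt0// => i _; rewrite subr_gt0.
Qed.

(** A Lindelof argument: every point of S lies in a cell contained in some admissible box, and for
    each of the countably many cells one admissible box is chosen. A point of S supplies the default
    box for the other indices. *)
Lemma jbox_cover S (P : Z -> Z -> Prop) : S !=set0 ->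
  (forall z, S z -> exists A B, jbox A B z /\ P A B) ->
  exists F : nat -> Z * Z, (forall k, P (F k).1 (F k).2) /\ S `<=` \bigcup_k jbox (F k).1 (F k).2.
Proof.
move=> [z0 Sz0] h; have [A0 [B0 [_ P0]]] := h z0 Sz0.
have /choice[F hF] : forall k : nat, exists AB : Z * Z, P AB.1 AB.2 /\
    forall mk : nat * ('rV[int]_d * 'rV[int]_d), unpickle k = Some mk ->
    forall A B, P A B -> zcell mk.1 mk.2 `<=` jbox A B -> zcell mk.1 mk.2 `<=` jbox AB.1 AB.2.
  move=> k; case E : (unpickle k) => [mk|]; last by exists (A0, B0).
  have [[A [B [PAB sub]]]|no] := pselect (exists A B, P A B /\ zcell mk.1 mk.2 `<=` jbox A B).
    by exists (A, B); split => // _ [<-].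
  by exists (A0, B0); split => // _ [<-] A B PAB sub; case: no; exists A, B.
exists F; split; first by move=> k; case: (hF k).
move=> z Sz; have [A [B [zAB PAB]]] := h z Sz.
have [mk [zc cs]] := open_zcell (@open_jbox R d A B) zAB.
exists (pickle mk) => //; have [_ /(_ mk)] := hF (pickle mk).
by rewrite pickleK => /(_ erefl A B PAB cs); apply.
Qed.

Lemma connected_dichotomy (T : topologicalType) (A P Q : set T) : connected A ->
  open P -> open Q -> A `<=` P `|` Q -> (forall x, A x -> P x -> Q x -> False) ->
  A `&` P !=set0 -> A `<=` P.
Proof.
move=> cA oP oQ cov dis AP; have <- : A `&` P = A; last by move=> x [].
apply: cA => //; first by exists P.
exists (~` Q); first exact: open_closedC.
apply/seteqP; split => x [Ax hx]; split => //; first exact: dis.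
by have [] := cov x Ax.
Qed.

(** Connectedness is used factor by factor, along one horizontal line and then along the vertical
    lines that meet it. *)
Lemma setX_dichotomy (T U : topologicalType) (A : set T) (B : set U) (P Q : set (T * U)) :
  connected A -> connected B ->
  open P -> open Q -> A `*` B `<=` P `|` Q -> (forall x, (A `*` B) x -> P x -> Q x -> False) ->
  (A `*` B) `&` P !=set0 -> A `*` B `<=` P.
Proof.
move=> cA cB oP oQ cov dis [[x0 y0] [[/= Ax0 By0] P0]].
have s1 (W : set (T * U)) y : open W -> open [set x | W (x, y)].
  rewrite !openE => oW x /oW[[P' Q'] /= [hP hQ] sub].
  by apply: filterS hP => x' hx'; apply: (sub (x', y)); split => //=; exact: nbhs_singleton.
have s2 (W : set (T * U)) x : open W -> open [set y | W (x, y)].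
  rewrite !openE => oW y /oW[[P' Q'] /= [hP hQ] sub].
  by apply: filterS hQ => y' hy'; apply: (sub (x, y')); split => //=; exact: nbhs_singleton.
have AP : A `<=` [set x | P (x, y0)].
  apply: (connected_dichotomy cA (s1 _ y0 oP) (s1 _ y0 oQ)).
  - by move=> x Ax; exact: (cov (x, y0)).
  - by move=> x Ax; exact: (dis (x, y0)).
  - by exists x0.
move=> [x y] [/= Ax By].
apply: (connected_dichotomy cB (s2 _ x oP) (s2 _ x oQ)) By.
- by move=> y' By'; exact: (cov (x, y')).
- by move=> y' By'; exact: (dis (x, y')).
- by exists y0; split => //; exact: AP.
Qed.

(* Along coordinate lines zeros are isolated or fill a neighbourhood; Fubini
   gives the same alternative, null or full, on small boxes. *)
Lemma zero_set_negligible (O V : set E) g : open O -> open V -> connected O -> connected V ->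
  measurable_fun (O `*` V) g ->
  (forall z j, (O `*` V) z -> zero_dichotomy (fun t => g (t *: basis j + z)) 0) ->
  (exists2 z, (O `*` V) z & g z != 0) ->
  (phase_measure d).-negligible ((O `*` V) `&` g @^-1` [set 0]).
Proof.
move=> oO oV cO cV mg hg [z0 Dz0 gz0]; set D := O `*` V in mg hg Dz0 *.
have oD : open D.
  by rewrite openE => z [hO hV]; exists (O, V) => //=; split; exact: open_nbhs_nbhs.
pose null A B := jbox A B `<=` D /\ phase_measure d (jbox A B `&` g @^-1` [set 0]) = 0%E.
pose P := [set z | exists A B, jbox A B z /\ forall w, jbox A B w -> g w = 0].
pose Q := [set z | exists A B, jbox A B z /\ null A B].
have box_open (z A B : Z) : jbox A B z -> nbhs z (jbox A B).
  by move=> h; apply: open_nbhs_nbhs; split => //; exact: open_jbox.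
have oP : open P.
  rewrite openE => z [A [B [h1 h2]]]; apply: filterS (box_open _ _ _ h1) => w hw.
  by exists A, B.
have oQ : open Q.
  rewrite openE => z [A [B [h1 h2]]]; apply: filterS (box_open _ _ _ h1) => w hw.
  by exists A, B.
have jcS A B : jbox A B `<=` jcbox A B by move=> z h j; have /andP[/ltW-> /ltW->] := h j.
have cov : D `<=` P `|` Q.
  move=> z Dz; have [A [B [zAB sub]]] := ball_jcbox oD Dz.
  have sub' : jbox A B `<=` D by exact: subset_trans sub.
  have mB : measurable (jbox A B) by rewrite jboxE; exact: measurable_zobox.
  have [] := @jbox_null_or_all A B g.
  - by apply: measurable_funS mg => //; exact: open_measurableZ.
  - by move=> w j /sub'; exact: hg.
  - by move=> h; left; exists A, B.
  - by move=> h; right; exists A, B.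
(* A common point would have a closed box of positive measure around it, contained in a null set. *)
have dis z : D z -> P z -> Q z -> False.
  move=> Dz [A [B [zAB hAB]]] [A' [B' [zAB' [sub null0]]]].
  have oI : open (jbox A B `&` jbox A' B') by apply: openI; exact: open_jbox.
  have [C [C' [zC subC]]] := ball_jcbox oI (conj zAB zAB').
  have := jbox_gt0 zC; rewrite lt_neqAle => /andP[/eqP + _]; apply; apply/esym/eqP.
  rewrite -measure_le0 -null0 le_measure// ?inE.
  - by rewrite jcboxE; apply: measurableX; exact: measurable_rV_box.
  - suff -> : jbox A' B' `&` g @^-1` [set 0] = jbox A' B' `&` (D `&` g @^-1` [set 0]).
      apply: measurableI; first by rewrite jboxE; exact: measurable_zobox.
      by apply: mg => //; exact: open_measurableZ.
    by apply/seteqP; split => w [h1 h2]; [split => //; split => //; exact: sub|case: h2].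
  - by move=> w /subC[h1 h2]; split => //; exact: hAB.
have DQ : D `<=` Q.
  apply: (setX_dichotomy cO cV oQ oP).
  - by move=> z /cov[]; [right|left].
  - by move=> z Dz Qz Pz; exact: dis Pz Qz.
  - exists z0; split => //; have [[A [B [h1 h2]]]|//] := cov _ Dz0.
    by move: gz0; rewrite h2 ?eqxx.
have [F [hF cF]] := @jbox_cover D null (ex_intro _ z0 Dz0) DQ.
apply: (@negligibleS _ _ _ _ (\bigcup_k (jbox (F k).1 (F k).2 `&` g @^-1` [set 0]))).
  by move=> z [Dz gz]; have [k _ hk] := cF z Dz; exists k.
apply: negligible_bigcup => k; have [sub h0] := hF k.
exists (jbox (F k).1 (F k).2 `&` g @^-1` [set 0]); split => //.
have mB : measurable (jbox (F k).1 (F k).2) by rewrite jboxE; exact: measurable_zobox.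
by apply: (measurable_funS _ sub mg) => //; exact: open_measurableZ.
Qed.

Lemma analytic_derivable D g z j : real_analytic D g -> D z -> derivable g z (basis j).
Proof.
move=> ag Dz; have [c [r h]] := analytic_pseries j ag Dz.
by have [] := (is_derive_line g z (basis j) (c 1%N)).2 (pseries_derive h).
Qed.

Lemma derive_lip g (z v : Z) (L : R) : derivable g z v ->
  (\forall h \near (0 : R), `|g (h *: v + z) - g z| <= L * `|h|) -> `|'D_v g z| <= L.
Proof.
move=> dg hL; have cv : (fun h : R => `|h^-1 *: ((g \o shift z) (h *: v) - g z)|) @ 0^' --> `|'D_v g z|.
  by apply: cvg_norm; exact: dg.
rewrite -(cvg_lim _ cv)//; apply: limr_le; first exact: cvgP cv.
near=> h; have h0 : h != 0 by near: h; exact: nbhs_dnbhs_neq.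
rewrite normrM normfV ler_pdivrMl ?normr_gt0// mulrC /=; near: h.
exact: nbhs_dnbhs.
Unshelve. all: by end_near. Qed.

Lemma analytic_near_lip D g z : open D -> real_analytic D g -> D z -> {for z, continuous g} /\
  exists L, \forall w \near z, forall j, `|'D_(basis j) g w| <= L.
Proof.
move=> oD ag Dz; have [rho [L [rho0 L0 hL]]] := analytic_lipschitz ag Dz.
have nb : nbhs z (ball z rho) by exact: nbhsx_ballx.
split.
  apply/cvgrPdist_le => e e0.
  have cs : (fun w => \sum_j `|coord j z - coord j w|) @ z --> (0 : R).
    have gen r : (fun w => \sum_(j <- r) `|coord j z - coord j w|) @ z -->
        (\sum_(j <- r) `|coord j z - coord j z| : R).
      elim: r => [|j r IH]; first by rewrite big_nil; under eq_fun do rewrite big_nil; exact: cvg_cst.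
      rewrite big_cons; under eq_fun do rewrite big_cons.
      apply: cvgD IH; apply: cvg_norm; apply: cvgB; first exact: cvg_cst.
      exact: continuous_coord.
    by have := gen (index_enum J); under [in X in _ --> X -> _]eq_bigr do rewrite subrr normr0; rewrite big1.
  have L1 : 0 < L + 1 by rewrite ltr_wpDl.
  near=> w.
  have hw : \sum_j `|coord j z - coord j w| <= e / (L + 1).
    near: w; have := (cvgr_le _ cs); apply; by rewrite divr_gt0.
  have bw : ball z rho w by near: w.
  apply: le_trans (hL z w (ballxx _ rho0) bw) _.
  apply: le_trans (ler_wpM2l L0 hw) _.
  by rewrite mulrCA ler_piMr ?(ltW e0)// ltW// ltr_pdivrMr// mul1r ltrDl.
exists L; have := @ball_open R Z z rho; rewrite openE => ob.
have nD : nbhs z D by exact: open_nbhs_nbhs.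
near=> w; move=> j; have Dw : D w by near: w.
have dw : derivable g w (basis j) by exact: analytic_derivable ag Dw.
apply: (derive_lip dw).
have bw : ball z rho w by near: w.
have Bw : nbhs w (ball z rho) by exact: ob.
have /nbhs_ballP[r /= r0 rb] := Bw.
apply/nbhs_ballP; exists r => // h; rewrite -ball_normE/= sub0r normrN => hr.
have bh : ball z rho (h *: basis j + w) by apply: rb; exact: ballZ_line.
apply: le_trans (hL _ _ bh bw) _; rewrite ler_wpM2l//.
rewrite (bigD1 j)//= coordD coordZ coord_basisE eqxx mulr1 addrK big1 ?addr0//.
move=> l /negbTE lj; by rewrite coordD coordZ coord_basisE lj mulr0 add0r subrr normr0.
Unshelve. all: by end_near. Qed.

(** Meant for a.q. The combination is formed after restriction to a coordinate line, where
    one-variable power series add, so no series in several variables is needed for the sum. *)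
Lemma analytic_lin_dichotomy D (I : Type) (r : seq I) (k : I -> R) (g : I -> Z -> R) z j :
  (forall i, real_analytic D (g i)) -> D z ->
  zero_dichotomy (fun t => \sum_(i <- r) k i * g i (t *: basis j + z)) 0.
Proof.
move=> ag Dz.
suff [c [s h]] : exists c s, pseries_at (fun t => \sum_(i <- r) k i * g i (t *: basis j + z)) c s.
  have [e e0 he] := pseries_zeros h; exists e => //.
  by case: he => he; [left => t|right => t t0]; rewrite subr0; exact: he.
elim: r => [|i r [c [s IH]]].
  exists (fun=> 0), 1; split => // t _; split.
    rewrite (_ : (fun N => _) = cst 0); first exact: is_cvg_cst.
    by apply/funext => N; apply: big1 => i _; rewrite mul0r normr0.
  rewrite big_nil (_ : (fun N => _) = cst 0); first exact: cvg_cst.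
  by apply/funext => N; apply: big1 => i _; rewrite mul0r.
have [b [s' h]] := analytic_pseries j (ag i) Dz.
have := pseries_lin (k i) h IH.
set f1 := (f1 in pseries_at f1 _ _); set f2 := fun t => \sum_(_ <- i :: r) _ => h'.
have -> : f2 = f1 by apply/funext => t; rewrite /f2 big_cons.
by eexists; eexists; exact: h'.
Qed.

End analytic_null.

(** * Oscillating exponentials *)

Section cis.
Context {R : realType}.

Definition cis (t : R) : R[i] := Complex (cos t) (sin t).

Lemma cisD s t : cis (s + t) = cis s * cis t.
Proof.
by apply: eq_complexP; rewrite ?cReM ?cImM/= ?cosD ?sinD//; rewrite addrC [cos s * _]mulrC.
Qed.

Lemma cis0 : cis 0 = 1.
Proof. by rewrite /cis cos0 sin0. Qed.

Lemma normc_cis t : normc (cis t) = 1.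
Proof. by rewrite normc_sqrtE/= cos2Dsin2 sqrtr1. Qed.

Lemma cis2piz (k : int) : cis (2 * pi * k%:~R) = 1.
Proof.
have cisn (n : nat) : cis (2 * pi * n%:R) = 1.
  elim: n => [|n IH]; first by rewrite mulr0 cis0.
  by rewrite -(@natr1 R n) mulrDr cisD IH mul1r mulr1 mulr_natl /cis cos2pi sin2pi.
case: k => n; first exact: cisn.
have := cisD (2 * pi * (n.+1)%:R) (2 * pi * (Negz n)%:~R).
rewrite cisn mul1r => <-.
by rewrite NegzE rmorphN/= mulrN subrr cis0.
Qed.

Lemma is_derive_trig (c s : R) :
  is_derive s (1 : R) (fun y => sin (c * y)) (c * cos (c * s)) /\
  is_derive s (1 : R) (fun y => cos (c * y)) (- c * sin (c * s)).
Proof.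
have h (t : R) : c * (t *: (1 : R) + s) = c * s + t * c by rewrite [t *: 1]mulr1; ring.
split.
  have := @is_derive_compl R _ sin (fun y => c * y) s 1 c _ h (is_derive_sin _).
  by move=> h'; apply: (is_derive_eq h'); rewrite mulrC.
have := @is_derive_compl R _ cos (fun y => c * y) s 1 c _ h (is_derive_cos _).
by move=> h'; apply: (is_derive_eq h'); rewrite mulrC mulrN mulNr.
Qed.

Lemma continuous_trig (c : R) :
  continuous (fun y => sin (c * y)) /\ continuous (fun y => cos (c * y)).
Proof.
split => s; have [h1 h2] := is_derive_trig c s; apply: derive1_continuous; [by case: h1|by case: h2].
Qed.

Lemma cmeas_cis (c : R) : cmeas setT (fun y : measurableTypeR R => cis (c * y)).
Proof.
have [h1 h2] := continuous_trig c.
by split; apply: continuous_measurable_fun.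
Qed.

Lemma integral_trig (a b c : R) : c != 0 -> a < b ->
  \int[lebesgue_measure]_(x in `[a, b]) cos (c * x) = (sin (c * b) - sin (c * a)) / c /\
  \int[lebesgue_measure]_(x in `[a, b]) sin (c * x) = - (cos (c * b) - cos (c * a)) / c.
Proof.
move=> c0 ab; have [h1 h2] := continuous_trig c.
have ct (f : R -> R) : continuous f -> {within `[a, b], continuous f}.
  by move=> cf; apply: continuous_subspaceT.
have key (f F : R -> R) : continuous f -> (forall s, is_derive s (1 : R) F (f s)) ->
    \int[lebesgue_measure]_(x in `[a, b]) f x = F b - F a.
  move=> cf dF; rewrite /Rintegral (@continuous_FTC2 R f F a b ab (ct f cf))//.
    have cF x : {for x, continuous F} by apply: derive1_continuous; case: (dF x).
    split; first by move=> x _; case: (dF x).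
      by apply: cvg_at_right_filter; exact: cF.
    by apply: cvg_at_left_filter; exact: cF.
  by move=> x _; rewrite derive1E; case: (dF x).
have d1 s : is_derive s (1 : R) (fun x => c^-1 * sin (c * x)) (cos (c * s)).
  have [d1 _] := is_derive_trig c s.
  by apply: (is_derive_eq (is_deriveZ c^-1 d1)); rewrite /GRing.scale/= mulrA mulVf// mul1r.
have d2 s : is_derive s (1 : R) (fun x => - c^-1 * cos (c * x)) (sin (c * s)).
  have [_ d2] := is_derive_trig c s.
  by apply: (is_derive_eq (is_deriveZ (- c^-1) d2)); rewrite /GRing.scale/= !mulNr mulrN opprK mulrA mulVf// mul1r.
split; first by rewrite (key _ _ h2 d1) -mulrBr mulrC.
by rewrite (key _ _ h1 d2) -mulrBr mulNr mulrC -mulNr.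
Qed.

Lemma cintegral_cis_itv (a b c : R) (b0 b1 : bool) : c != 0 -> a < b ->
  cintegral lebesgue_measure [set` Interval (BSide b0 a) (BSide b1 b)] (fun y => cis (c * y)) =
  Complex ((sin (c * b) - sin (c * a)) / c) (- (cos (c * b) - cos (c * a)) / c).
Proof.
move=> c0 ab; have [i1 i2] := integral_trig c0 ab.
have [h1 h2] := continuous_trig c.
have key (f : R -> R) : continuous f ->
  \int[lebesgue_measure]_(x in [set` Interval (BSide b0 a) (BSide b1 b)]) f x =
  \int[lebesgue_measure]_(x in `[a, b]) f x.
  move=> cf; have mf : measurable_fun `]a, b[ (EFin \o f).
    by apply/measurable_EFinP; apply: measurable_funTS; exact: continuous_measurable_fun.
  rewrite /Rintegral; congr fine.
  rewrite (@integral_itv_bndoo R a b (EFin \o f) b0 b1 mf).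
  exact/esym/(@integral_itv_bndoo R a b (EFin \o f) true false mf).
by apply: eq_complexP => /=; rewrite key.
Qed.

Lemma normc_cintegral_cis (a b c : R) : c != 0 ->
  normc (cintegral lebesgue_measure `]a, b[ (fun y => cis (c * y))) <= 4 / `|c|.
Proof.
move=> c0; have [ab|ba] := ltP a b; last first.
  by rewrite set_itv_ge -?leNgt ?bnd_simp// /cintegral !Rintegral_set0 normc0 divr_ge0.
rewrite (cintegral_cis_itv _ _ c0 ab); apply: le_trans (normc_le _) _ => /=.
have s1 (x : R) : `|sin x| <= 1 by rewrite ler_norml sin_le1 sin_geN1.
have s2 (x : R) : `|cos x| <= 1 by rewrite ler_norml cos_le1 cos_geN1.
rewrite !normrM normrN -mulrDl normfV ler_wpM2r ?invr_ge0//.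
have := ler_normB (sin (c * b)) (sin (c * a)); have := ler_normB (cos (c * b)) (cos (c * a)).
have := s1 (c * b); have := s1 (c * a); have := s2 (c * b); have := s2 (c * a); lra.
Qed.

Lemma cintegral_cis_unit (k : int) :
  cintegral lebesgue_measure `[0, 1[ (fun y : R => cis (2 * pi * k%:~R * y)) = (k == 0)%:R.
Proof.
have [->|k0] := eqVneq k 0.
  rewrite (_ : (fun _ => _) = fun=> (1 : R[i])); last by apply/funext => y; rewrite mulr0 mul0r cis0.
  apply: eq_complexP => /=; rewrite Rintegral_cst//= ?mul0r//.
  by rewrite lebesgue_measure_itv/= lte01 oppr0 addr0 mul1r.
have c0 : 2 * pi * k%:~R != 0 :> R by rewrite !mulf_neq0 ?intr_eq0// gt_eqF// pi_gt0.
rewrite (cintegral_cis_itv _ _ c0 ltr01) mulr1 mulr0 sin0 cos0.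
have := cis2piz k; rewrite /cis => -[-> ->].
by rewrite !subrr oppr0 !mul0r.
Qed.

Lemma cintegral_cis_fin (A : set R) c : measurable A -> (lebesgue_measure A < +oo)%E ->
  cintegrable lebesgue_measure A (fun y => cis (c * y)).
Proof.
move=> mA fA; apply: (@cintegrable_le _ _ _ lebesgue_measure A mA _ (cst 1)).
- apply: cmeas_sub (cmeas_cis c) => //.
- apply/integrableP; split; first by apply/measurable_EFinP; exact: measurable_cst.
  by under eq_integral do rewrite /= normr1; rewrite integral_cst// mul1e.
- by move=> x _; rewrite normc_cis.
Qed.

End cis.

(** * Plane waves integrated over boxes *)

Section waves.
Context {R : realType}.

Definition wave n (c : 'rV[R]_n) (x : 'rV[R]_n) : R[i] := cis (\sum_i c 0 i * x 0 i).

Lemma normc_wave n (c x : 'rV[R]_n) : normc (wave c x) = 1.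
Proof. exact: normc_cis. Qed.

Lemma cmeas_wave n (c : 'rV[R]_n) : cmeas setT (wave c).
Proof.
have ms : measurable_fun setT (fun x : 'rV[R]_n => \sum_i c 0 i * x 0 i).
  apply: measurable_sum => i; apply: measurable_funM => //; exact: measurable_fun_coord.
split.
  apply: (measurableT_comp (f := (cos : R -> R)) _ ms).
  by apply: continuous_measurable_fun; exact: continuous_cos.
apply: (measurableT_comp (f := (sin : R -> R)) _ ms).
by apply: continuous_measurable_fun; exact: continuous_sin.
Qed.

Definition itvbox n (A : 'I_n -> set R) : set 'rV[R]_n := [set x | forall i, A i (x 0 i)].

Lemma itvboxS n (A : 'I_n.+1 -> set R) : @rV_cons R n @^-1` (itvbox A) =
  A ord0 `*` itvbox (fun i => A (lift ord0 i)).
Proof.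
apply/seteqP; split => -[t y] /=.
  move=> h; split; first by have := h ord0; rewrite rV_cons0.
  by move=> i; have := h (lift ord0 i); rewrite rV_consS.
move=> [h1 h2] i; case: (unliftP ord0 i) => [j|] ->; last by rewrite rV_cons0.
by rewrite rV_consS; exact: h2.
Qed.

Lemma measurable_itvbox n (A : 'I_n -> set R) :
  (forall i, measurable (A i : set (measurableTypeR R))) -> measurable (itvbox A).
Proof.
move=> mA; rewrite (_ : itvbox A = \bigcap_(i in [set: 'I_n]) [set x : 'rV[R]_n | A i (x 0 i)]).
  apply: fin_bigcap_measurable => // i _; rewrite -[X in measurable X]setTI.
  exact: (measurable_fun_coord i measurableT (mA i)).
by apply/seteqP; split => [x h i _|x h i]; [exact: h|exact: (h i I)].
Qed.

Lemma lebesgue_itvboxS n (A : 'I_n.+1 -> set R) :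
  (forall i, measurable (A i : set (measurableTypeR R))) ->
  lebesgue_rV n.+1 (itvbox A) =
  (lebesgue_measure (A ord0) * lebesgue_rV n (itvbox (fun i => A (lift ord0 i))))%E.
Proof.
move=> mA; rewrite /= /lebesgue_rVS /pushforward itvboxS product_measure1E//.
exact: measurable_itvbox.
Qed.

Lemma itvbox_fin n (A : 'I_n -> set R) :
  (forall i, measurable (A i : set (measurableTypeR R))) ->
  (forall i, (lebesgue_measure (A i) < +oo)%E) -> (lebesgue_rV n (itvbox A) < +oo)%E.
Proof.
elim: n A => [|n IH] A mA fA.
  rewrite /= diracE; exact: ltry.
rewrite lebesgue_itvboxS// lte_mul_pinfty//; first by rewrite ge0_fin_numE.
exact: IH.
Qed.

Lemma cintegrable_bounded d (T : measurableType d) (mu : {measure set T -> \bar R}) (D : set T)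
  (f : T -> R[i]) (M : R) : measurable D -> (mu D < +oo)%E -> cmeas D f ->
  (forall x, D x -> normc (f x) <= M) -> cintegrable mu D f.
Proof.
move=> mD fD mf fM; apply: (@cintegrable_le _ _ _ mu D mD _ (cst M)) => //.
apply/integrableP; split; first by apply/measurable_EFinP; exact: measurable_cst.
rewrite (_ : (fun _ => _) = cst (`|M|%:E))// integral_cst// lte_mul_pinfty//.
Qed.

Lemma cintegral_rVS n (D : set 'rV[R]_n.+1) (f : 'rV[R]_n.+1 -> R[i]) : measurable D ->
  cmeas setT f -> cintegrable (lebesgue_measure \x lebesgue_rV n)%E (@rV_cons R n @^-1` D) (f \o @rV_cons R n) ->
  cintegral (lebesgue_rV n.+1) D f =
  cintegral (lebesgue_measure \x lebesgue_rV n)%E (@rV_cons R n @^-1` D) (f \o @rV_cons R n).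
Proof.
move=> mD [m1 m2] [i1 i2].
have key (g : 'rV[R]_n.+1 -> R) : measurable_fun setT g ->
   (lebesgue_measure \x lebesgue_rV n)%E.-integrable (@rV_cons R n @^-1` D) (EFin \o (g \o @rV_cons R n)) ->
   (\int[lebesgue_rV n.+1]_(x in D) g x = \int[(lebesgue_measure \x lebesgue_rV n)%E]_(x in @rV_cons R n @^-1` D) (g \o @rV_cons R n) x).
  move=> mg ig; rewrite /Rintegral; congr fine.
  rewrite -[RHS](@integral_pushforward _ _ _ _ _ (@rV_cons R n) (@measurable_rV_cons R n) _ D (EFin \o g))//.
  exact/measurable_EFinP.
by apply: eq_complexP => /=; rewrite key.
Qed.

(** Fubini, peeling off one coordinate. Both the decay over boxes and the orthogonality over the
    unit cube thereby become one-dimensional. *)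
Lemma cintegral_wave n (c : 'rV[R]_n) (A : 'I_n -> set R) :
  (forall i, measurable (A i : set (measurableTypeR R))) ->
  (forall i, (lebesgue_measure (A i) < +oo)%E) ->
  cintegral (lebesgue_rV n) (itvbox A) (wave c) =
  \prod_i cintegral lebesgue_measure (A i) (fun y => cis (c 0 i * y)).
Proof.
elim: n c A => [|n IH] c A mA fA.
  rewrite big_ord0; have ET : itvbox A = setT by apply/seteqP; split => // x _ [].
  rewrite (_ : wave c = fun=> 1); last by apply/funext => x; rewrite /wave big_ord0 cis0.
  rewrite ET; apply: eq_complexP => /=; rewrite Rintegral_cst//= ?mul0r//.
  by rewrite indicE in_setT mulr1.
have mA' i : measurable (A (lift ord0 i) : set (measurableTypeR R)) by [].
have mB := measurable_itvbox mA'.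
have mI : measurable (A ord0 `*` itvbox (fun i => A (lift ord0 i))) by exact: (measurableX (mA ord0) mB).
pose c' : 'rV[R]_n := \row_i c 0 (lift ord0 i).
have wE t y : wave c (rV_cons (t, y)) = cis (c 0 ord0 * t) * wave c' y.
  rewrite /wave big_ord_recl rV_cons0 cisD/=; congr (_ * cis _).
  by apply: eq_bigr => i _; rewrite rV_consS mxE.
have mw : cmeas (A ord0 `*` itvbox (fun i => A (lift ord0 i))) (wave c \o @rV_cons R n).
  have [m1 m2] := cmeas_wave c.
  split; apply: measurable_funTS.
    exact: (measurableT_comp m1 (@measurable_rV_cons R n)).
  exact: (measurableT_comp m2 (@measurable_rV_cons R n)).
have iw : cintegrable (lebesgue_measure \x lebesgue_rV n)%E (A ord0 `*` itvbox (fun i => A (lift ord0 i))) (wave c \o @rV_cons R n).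
  apply: (@cintegrable_bounded _ _ _ _ _ 1) => //.
    by have := itvbox_fin mA fA; rewrite /= /lebesgue_rVS /pushforward itvboxS.
  by move=> x _; rewrite normc_wave.
rewrite (cintegral_rVS (measurable_itvbox mA) (cmeas_wave c)); last by rewrite itvboxS.
rewrite itvboxS big_ord_recl.
have [_ _ ->] := cfubini (mA ord0) mB iw.
under eq_cintegral.
  move=> t _; rewrite (_ : (fun y => _) = (fun y => cis (c 0 ord0 * t) * wave c' y)); last first.
    by apply/funext => y; exact: wE.
  rewrite (cintegralZ mB); last first.
    apply: (@cintegrable_bounded _ _ _ _ _ 1) => //.
    - exact: itvbox_fin.
    - by apply: cmeas_sub (cmeas_wave c').
    - by move=> x _; rewrite normc_wave.
  rewrite IH// mulrC; over.
have ic := cintegral_cis_fin (c 0 ord0) (mA ord0) (fA ord0).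
have e := cintegralZ (mA ord0) (\prod_i cintegral lebesgue_measure (A (lift ord0 i)) (fun y => cis (c' 0 i * y))) ic.
rewrite [LHS]e.
by rewrite mulrC; congr (_ * _); apply: eq_bigr => i _; rewrite mxE.
Qed.

End waves.

(** * Weakly null sequences and the Riemann-Lebesgue lemma *)

Section null_sequences.
Context {R : realType} (d : nat).
Local Notation E := 'rV[R]_d.
Local Notation Z := (E * E)%type.
Local Notation mu := (@phase_measure R d).
Local Notation lam := (@lebesgue_rV R d).

Lemma ccvg_le (c_ : nat -> R[i]) (b_ : nat -> R) : b_ @ \oo --> (0 : R) ->
  (forall n, normc (c_ n) <= b_ n) -> ccvg c_ 0.
Proof.
move=> /cvgr_lt hb h e e0; apply: filterS (hb e e0) => n hn.
by rewrite subr0 (le_lt_trans (h n)).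
Qed.

Section null_sequence.
Variables (D : set Z) (r r' M : R) (w_ : nat -> Z -> R[i]).
Hypotheses (mD : measurable D) (r1 : 1 < r) (rr : r^-1 + r'^-1 = 1).
Hypotheses (Lw : forall n, cLfun mu D r' (w_ n)) (wM : forall n, nrm mu D r' (w_ n) <= M).

Let r'1 : 1 < r' := conj_gt1 r1 rr.
Let r0 : 0 < r. Proof. exact: lt_trans r1. Qed.
Let r'0 : 0 < r'. Proof. exact: lt_trans r'1. Qed.
Let rr' : r'^-1 + r^-1 = 1. Proof. by rewrite addrC. Qed.

Definition null_against h := ccvg (fun n => cintegral mu D (fun z => w_ n z * h z)) 0.

Lemma null_against_lin c f g : cLfun mu D r f -> cLfun mu D r g ->
  null_against f -> null_against g -> null_against (fun z => c * f z + g z).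
Proof.
move=> Lf Lg cf cg; have := ccvgD (ccvgZ c cf) cg; rewrite mulr0 addr0.
congr ccvg; apply/funext => n.
have [if_ _] := hoelder_cLfun mD r'0 r0 rr' (Lw n) Lf.
have [ig _] := hoelder_cLfun mD r'0 r0 rr' (Lw n) Lg.
rewrite -(cintegralZ mD _ if_) -(cintegralD mD)//; last exact: cintegrableZ.
by apply: eq_cintegral => z _; rewrite mulrDr mulrCA.
Qed.

(** The common bound [M] makes the error of replacing f by g uniform in n; the tolerance e / (2 (M +
    1)) accounts for the factor 2 of the complex Hoelder bound. *)
Lemma null_against_closed f : cLfun mu D r f -> (forall e : R, 0 < e ->
  exists g, [/\ cLfun mu D r g, null_against g & nrm mu D r (fun z => f z - g z) < e]) ->
  null_against f.
Proof.
move=> Lf happ; apply: ccvg_approx => e e0.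
have M0 : 0 <= M by apply: le_trans (wM 0%N); exact: nrm_ge0.
have M1 : 0 < 2 * (M + 1) by rewrite mulr_gt0// ltr_wpDl.
have [g [Lg cg fg]] := happ (e / (2 * (M + 1))) (divr_gt0 e0 M1).
exists (fun n => cintegral mu D (fun z => w_ n z * g z)), 0; split => //; last first.
  by rewrite subr0 normc0 ltW.
move=> n; have [if_ _] := hoelder_cLfun mD r'0 r0 rr' (Lw n) Lf.
have [ig _] := hoelder_cLfun mD r'0 r0 rr' (Lw n) Lg.
rewrite -(cintegralB mD if_ ig).
rewrite (_ : cintegral _ _ _ = cintegral mu D (fun z => w_ n z * (f z - g z))); last first.
  by apply: eq_cintegral => z _; rewrite mulrBr.
have Lfg := (cLfunB mD (ltW r1) Lf Lg).1.
apply: le_trans (normc_cintegral_hoelder mD r'0 r0 rr' (Lw n) Lfg) _.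
have w1 : 2 * nrm mu D r' (w_ n) <= 2 * (M + 1).
  by rewrite ler_wpM2l// (le_trans (wM n))// lerDl.
have w0 : 0 <= 2 * nrm mu D r' (w_ n) by rewrite mulr_ge0// nrm_ge0.
rewrite mulrA; apply: le_trans (ler_pM w0 (nrm_ge0 _ _ _ _) w1 (ltW fg)) _.
by rewrite mulrCA divff ?mulr1// gt_eqF.
Qed.

Lemma null_seq_density : (forall a b a' b', null_against (cind (zobox a b a' b'))) ->
  forall h, cLfun mu D r h -> null_against h.
Proof.
move=> hbox; pose C h := cLfun mu D r h /\ null_against h.
move=> h Lh; suff [] : C h by [].
apply: (Z_density mD (ltW r1) _ _ _ Lh).
- move=> c f g [Lf cf] [Lg cg]; split; last exact: null_against_lin.
  exact: (cLfunD mD (ltW r1) (cLfunZ mD c r0 Lf).1 Lg).1.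
- move=> f Lf happ; split => //; apply: null_against_closed => // e /happ[g [Lg [_ cg] fg]].
  by exists g.
- move=> a b a' b'; split; last exact: hbox.
  by apply: (cLfun_ind mD r0 _ _).1; [exact: measurable_zobox|exact: zobox_fin].
Qed.

End null_sequence.

Lemma cintegral_sub d' (T : measurableType d') (m : {measure set T -> \bar R}) (D A : set T) (f : T -> R[i]) :
  A `<=` D -> (forall x, D x -> ~ A x -> f x = 0) -> cintegral m D f = cintegral m A f.
Proof.
move=> AD f0; have key (g : T -> R) : (forall x, D x -> ~ A x -> g x = 0) ->
    \int[m]_(x in D) g x = \int[m]_(x in A) g x.
  move=> g0; rewrite /Rintegral integral_mkcond [in RHS]integral_mkcond; congr (fine (integral _ _ _)).
  apply/funext => x; rewrite /patch.
  case: ifPn => [/set_mem Dx|/negP nD]; case: ifPn => [/set_mem Ax|/negP nA] //.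
    by rewrite g0// => /mem_set.
  by case: nD; apply: mem_set; exact: AD.
by apply: eq_complexP => /=; apply: key => x Dx nAx; rewrite f0.
Qed.

Definition osc (q : 'rV[int]_d) (s : R) (x : E) : R[i] := cis (2 * pi * dotz (s *: x) q).

Lemma oscE q s : osc q s = wave (\row_i (2 * pi * s * (q 0 i)%:~R)).
Proof.
apply/funext => x; rewrite /osc /wave /dotz mulr_sumr; congr cis.
by apply: eq_bigr => i _; rewrite !mxE; ring.
Qed.

Lemma normc_osc q s x : normc (osc q s x) = 1.
Proof. exact: normc_cis. Qed.

Lemma cmeas_osc q s : cmeas setT (osc q s).
Proof. by rewrite oscE; exact: cmeas_wave. Qed.

Lemma cmeas_osc1 q s (D : set Z) : cmeas D (fun z => osc q s z.1).
Proof.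
have [m1 m2] := cmeas_osc q s; split; apply: measurable_funTS.
  exact: (measurableT_comp m1 measurable_fst).
exact: (measurableT_comp m2 measurable_fst).
Qed.

Variables (eps : nat -> R) (eps0 : forall n, 0 < eps n) (epscvg : eps @ \oo --> (0 : R)).

(** The integral factors over the coordinates; the factor of a coordinate with q_i nonzero is of
    order eps_n, the others stay bounded by twice the side lengths. *)
Lemma osc_box q a b : q != 0 ->
  ccvg (fun n => cintegral lam (obox a b) (osc q (eps n)^-1)) 0.
Proof.
move=> q0; have [i0 qi0] : exists i, q 0 i != 0.
  apply/existsP; rewrite -negb_forall; apply: contra q0 => /forallP h.
  by apply/eqP/rowP => i; rewrite mxE; apply/eqP; exact: h.
pose A (i : 'I_d) : set R := `]a 0 i, b 0 i[%classic.
have mA i : measurable (A i : set (measurableTypeR R)) by exact: measurable_itv.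
have fA i : (lebesgue_measure (A i) < +oo)%E.
  by rewrite lebesgue_measure_itv/=; case: ifP => _; rewrite ?ltry// -EFinD ltry.
have AE : obox a b = itvbox A.
  by apply/seteqP; split => x h i; have := h i; rewrite /A /= in_itv.
pose Bd i := 2 * fine (lebesgue_measure (A i)).
have hB i c : normc (cintegral lebesgue_measure (A i) (fun y => cis (c * y))) <= Bd i.
  rewrite -lee_fin; apply: le_trans (normc_cintegral (mA i) (cintegral_cis_fin c (mA i) (fA i))) _.
  under eq_integral do rewrite normc_cis.
  by rewrite (integral_cst _ (mA i)) mul1e EFinM fineK// ge0_fin_numE.
have B0 i : 0 <= Bd i by apply: le_trans (hB i 0); exact: normc_ge0.
have k0 : (0 : R) < `|2 * pi * (q 0 i0)%:~R| by rewrite normr_gt0 !mulf_neq0 ?intr_eq0// gt_eqF// pi_gt0.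
pose M := 4 / `|2 * pi * (q 0 i0)%:~R| * \prod_(i | i != i0) Bd i.
apply: (@ccvg_le _ (fun n => eps n * M)).
  by rewrite -[X in _ --> X](mul0r M); apply: cvgM => //; exact: cvg_cst.
move=> n; rewrite AE oscE (cintegral_wave _ mA fA) (bigD1 i0)//= normcM.
rewrite /M mulrA; apply: ler_pM; rewrite ?normc_ge0//; last first.
  elim/big_ind2 : _ => [|x1 x2 y1 y2 h1 h2|i _]; first by rewrite normc1.
    by rewrite normcM ler_pM ?normc_ge0.
  exact: hB.
have c0 : 2 * pi * (eps n)^-1 * (q 0 i0)%:~R != 0.
  by rewrite !mulf_neq0 ?intr_eq0 ?invr_eq0// ?gt_eqF// pi_gt0.
rewrite mxE; apply: le_trans (normc_cintegral_cis _ _ c0) _.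
rewrite mulrAC normrM [`|(eps n)^-1|]gtr0_norm ?invr_gt0// invfM invrK.
by rewrite mulrA mulrC.
Qed.

Lemma osc_zobox q a b a' b' : q != 0 ->
  ccvg (fun n => cintegral mu (zobox a b a' b') (fun z => osc q (eps n)^-1 z.1)) 0.
Proof.
move=> q0; pose k := cintegral lam (obox a' b') (fun=> 1 : R[i]).
have := ccvgZ k (osc_box a b q0); rewrite mulr0; congr ccvg; apply/funext => n.
have i1 : cintegrable lam (obox a' b') (fun=> 1 : R[i]).
  apply: (@cintegrable_bounded _ _ _ _ _ _ 1).
  - exact: measurable_obox.
  - exact: lebesgue_obox_fin.
  - exact: cmeas_cst.
  - by move=> x _; rewrite normc1.
have iw : cintegrable mu (zobox a b a' b') (fun z => osc q (eps n)^-1 z.1).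
  apply: (@cintegrable_bounded _ _ _ _ _ _ 1).
  - exact: measurable_zobox.
  - exact: zobox_fin.
  - exact: cmeas_osc1.
  - by move=> x _; rewrite normc_osc.
have io : cintegrable lam (obox a b) (osc q (eps n)^-1).
  apply: (@cintegrable_bounded _ _ _ _ _ _ 1).
  - exact: measurable_obox.
  - exact: lebesgue_obox_fin.
  - by apply: cmeas_sub (cmeas_osc _ _).
  - by move=> x _; rewrite normc_osc.
have [_ _ ->] := cfubini (measurable_obox a b) (measurable_obox a' b') iw.
rewrite -(cintegralZ (measurable_obox _ _) k io); apply: eq_cintegral => x _ /=.
rewrite mulrC -(cintegralZ (measurable_obox _ _) _ i1).
by apply: eq_cintegral => y _; rewrite mulr1.
Qed.

(** Working on a bounded box puts the exponentials themselves in the dual space with a common norm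
    bound, so density reduces the claim to [osc_zobox]. *)
Lemma riemann_lebesgue (r : R) q k h : 1 < r -> q != 0 -> cLfun mu (Qbox k) r h ->
  ccvg (fun n => cintegral mu (Qbox k) (fun z => osc q (eps n)^-1 z.1 * h z)) 0.
Proof.
move=> r1 q0; have r0 : 0 < r by exact: lt_trans r1.
pose r' := (1 - r^-1)^-1.
have rr : r^-1 + r'^-1 = 1 by rewrite /r' invrK addrC subrK.
have r'0 : 0 < r' by rewrite invr_gt0 subr_gt0 invf_lt1.
have mQ : measurable (Qbox k : set Z) by exact: measurable_zobox.
have fQ : (mu (Qbox k) < +oo)%E by exact: zobox_fin.
have [L1 _] := cLfun_ind mQ r'0 mQ fQ.
have osc1 n (z : Z) : normc (osc q (eps n)^-1 z.1) <= 1 by rewrite normc_osc.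
have Lw n := cLfunMb mQ r'0 ler01 (cmeas_osc1 q (eps n)^-1 (Qbox k)) (fun z _ => osc1 n z) L1.
have Lw' n : cLfun mu (Qbox k) r' (fun z => osc q (eps n)^-1 z.1) /\
    nrm mu (Qbox k) r' (fun z => osc q (eps n)^-1 z.1) <= nrm mu (Qbox k) r' (cind (Qbox k)).
  have [|L2 e] := @cLfun_eq _ _ _ mu _ mQ r' _ (fun z => osc q (eps n)^-1 z.1) r'0 _ (Lw n).1.
    by move=> z Qz; rewrite /cind indicE mem_set// mulr1.
  by split => //; rewrite e; apply: le_trans (Lw n).2 _; rewrite mul1r.
apply: (@null_seq_density _ r r' _ (fun n z => osc q (eps n)^-1 z.1) mQ r1 rr (fun n => (Lw' n).1) (fun n => (Lw' n).2)).
move=> a b a' b'; rewrite /null_against.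
have [a1 [b1 [a2 [b2 E12]]]] := zboxes_setI (@zboxes_Qbox R d k)
   (ex_intro _ a (ex_intro _ b (ex_intro _ a' (ex_intro _ b' erefl)))).
have := osc_zobox a1 b1 a2 b2 q0; congr ccvg; apply/funext => n.
rewrite (@cintegral_sub _ _ mu (Qbox k) (zobox a1 b1 a2 b2)).
- apply: eq_cintegral => z; rewrite -E12 => -[_ hz].
  by rewrite /cind indicE mem_set// mulr1.
- by rewrite -E12; exact: subIsetl.
- move=> z Qz nz; rewrite /cind indicE memNset ?mulr0// => hz; apply: nz.
  by rewrite -E12.
Qed.

End null_sequences.

(** * Fejer sums on the torus *)

Section uniform.
Context {R : realType}.

(** Only one of the two points is required to lie in the compact set: neighbours of points of the
    unit cube, or of a support, may leave it. *)
Lemma heine (X : pseudoMetricType R) (F : X -> R) (C : set X) : compact C -> continuous F ->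
  forall e, 0 < e -> exists2 r, 0 < r & forall x x', C x -> ball x r x' -> `|F x - F x'| <= e.
Proof.
move=> /compact_near_coveringP cC cF e e0.
have : \forall r \near (0 : R)^'+, C `<=` (fun x => forall x', ball x r x' -> `|F x - F x'| <= e).
  apply: cC => x Cx.
  have e2 : 0 < e / 2 by rewrite divr_gt0.
  have /nbhs_ballP[r /= r0 hr] : \forall x' \near x, `|F x - F x'| < e / 2.
    by apply: (cvgr_dist_lt _ _ (cF x)).
  have r2 : 0 < r / 2 by rewrite divr_gt0.
  exists (ball x (r / 2), [set s | s < r / 2]) => /=.
    by split; [exact: nbhsx_ballx|exact: nbhs_right_lt].
  move=> [x' s] /= [bx sr] x'' bx''.
  have b1 : ball x r x' by apply: le_ball bx; rewrite ler_pdivrMr// ler_pMr// ler1n.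
  have b2 : ball x r x''.
    rewrite (splitr r); apply: ball_triangle bx _; apply: le_ball bx''; exact: ltW.
  rewrite (_ : F x' - F x'' = (F x - F x'') - (F x - F x')); last by ring.
  rewrite (le_trans (ler_normB _ _))// [leRHS]splitr addrC lerD// ltW//; exact: hr.
move=> h; have h0 : \forall r \near (0 : R)^'+, 0 < r by exact: nbhs_right_gt.
have [r [hr r0]] := filter_ex (filterI h h0).
by exists r => // x x' /hr; apply.
Qed.

Lemma compact_fun_bounded (X : topologicalType) (F : X -> R) (C : set X) : compact C -> continuous F ->
  exists2 M, 0 <= M & forall x, C x -> `|F x| <= M.
Proof.
move=> cC cF; have cI : compact (F @` C).
  by apply: continuous_compact => //; exact: continuous_subspaceT.
have [M [_ hM]] := compact_bounded cI.
exists (`|M| + 1); first by rewrite addr_ge0.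
move=> x Cx; apply: hM; last by exists x.
by rewrite (le_lt_trans (ler_norm _))// ltrDl.
Qed.

Lemma continuous_measurable_rV n (h : 'rV[R]_n -> R) : continuous h -> measurable_fun setT h.
Proof.
move=> ch; apply: (measurability _ (RGenOpens.measurableE R)) => //.
move=> _ [_ [x [y ->]] <-]; rewrite setTI; apply: open_measurable_rV.
apply: open_comp; last exact: interval_open.
by move=> z _; exact: ch.
Qed.

End uniform.

Section fejer.
Context {R : realType} (d : nat).
Local Notation E := 'rV[R]_d.
Local Notation lam := (@lebesgue_rV R d).
Implicit Types (q : 'rV[int]_d) (h : E -> R).

Definition tw q (th : E) : R[i] := cis (2 * pi * dotz th q).

Definition ucube : set E := [set y : E | forall i, 0 <= y 0 i < 1].

Lemma ucubeE : ucube = itvbox (fun=> `[0, 1[%classic).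
Proof. by apply/seteqP; split => x h i; have := h i; rewrite /= in_itv. Qed.

Lemma measurable_ucube : measurable ucube.
Proof. by rewrite ucubeE; apply: measurable_itvbox => i; exact: measurable_itv. Qed.

Lemma ucube_fin : (lam ucube < +oo)%E.
Proof.
rewrite ucubeE; apply: itvbox_fin => i; first exact: measurable_itv.
by rewrite lebesgue_measure_itv/= lte01 -EFinB ltry.
Qed.

Lemma twE q : tw q = wave (\row_i (2 * pi * (q 0 i)%:~R)).
Proof.
apply/funext => x; rewrite /tw /wave /dotz mulr_sumr; congr cis.
by apply: eq_bigr => i _; rewrite !mxE; ring.
Qed.

Lemma twD q q' th : tw (q + q') th = tw q th * tw q' th.
Proof.
rewrite /tw -cisD -mulrDr; congr (cis (_ * _)); rewrite /dotz -big_split/=.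
by apply: eq_bigr => i _; rewrite mxE rmorphD mulrDr.
Qed.

Lemma tw0 th : tw 0 th = 1.
Proof. by rewrite /tw /dotz big1 ?mulr0 ?cis0// => i _; rewrite mxE mulr0. Qed.

Lemma twN q th : tw (- q) th = cis (- (2 * pi * dotz th q)).
Proof.
rewrite /tw -mulrN; congr (cis (_ * _)); rewrite /dotz -sumrN.
by apply: eq_bigr => i _; rewrite mxE rmorphN mulrN.
Qed.

Lemma twB q s y : tw q (s - y) = tw q s * tw (- q) y.
Proof.
rewrite twN /tw -cisD -mulrBr; congr (cis (_ * _)); rewrite /dotz -sumrB.
by apply: eq_bigr => i _; rewrite !mxE mulrBl.
Qed.

Lemma normc_tw q th : normc (tw q th) = 1.
Proof. exact: normc_cis. Qed.

Lemma cmeas_tw q (D : set E) : cmeas D (tw q).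
Proof. by rewrite twE; have [m1 m2] := cmeas_wave (\row_i (2 * pi * (q 0 i)%:~R : R)); split; exact: measurable_funTS. Qed.

Lemma cintegral_tw q : cintegral lam ucube (tw q) = (q == 0)%:R.
Proof.
rewrite twE ucubeE cintegral_wave; last 2 first.
- by move=> i; exact: measurable_itv.
- by move=> i; rewrite lebesgue_measure_itv/= lte01 -EFinB ltry.
under eq_bigr do rewrite mxE cintegral_cis_unit.
have [->|q0] := eqVneq q 0; first by rewrite big1// => i _; rewrite mxE eqxx.
have [i qi] : exists i, q 0 i != 0.
  apply/existsP; rewrite -negb_forall; apply: contra q0 => /forallP h.
  by apply/eqP/rowP => i; rewrite mxE; apply/eqP; exact: h.
by rewrite (bigD1 i)//= (negbTE qi) mul0r.
Qed.

Lemma cintegrable_cube (f : E -> R[i]) M : cmeas ucube f -> (forall y, ucube y -> normc (f y) <= M) ->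
  cintegrable lam ucube f.
Proof. exact: cintegrable_bounded measurable_ucube ucube_fin. Qed.

Lemma cintegrable_tw q : cintegrable lam ucube (tw q).
Proof. by apply: (@cintegrable_cube _ 1); [exact: cmeas_tw|move=> y _; rewrite normc_tw]. Qed.

Variable N' : nat.
Local Notation N := N'.+1.
Local Notation I := {ffun 'I_d -> 'I_N}.

Definition zrow (al : I) : 'rV[int]_d := \row_j (al j : nat)%:Z.

Lemma zrow_inj : injective zrow.
Proof.
move=> al be /rowP h; apply/ffunP => j; apply/val_inj.
by have := h j; rewrite !mxE => -[].
Qed.

Definition fwt : R := (N%:R ^+ d)^-1.

(** The d-dimensional Fejer kernel. Summing over pairs of frequencies, instead of over their
    differences with multiplicities, shows it at once as a trigonometric polynomial and as a
    multiple of a squared modulus. *)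
Definition fker (th : E) : R[i] := fwt%:C * \sum_al \sum_be tw (zrow al - zrow be) th.

Definition fcoef h q : R[i] := cintegral lam ucube (fun y => (h y)%:C * tw (- q) y).

Definition fsum h (s : E) : R[i] :=
  fwt%:C * \sum_al \sum_be fcoef h (zrow al - zrow be) * tw (zrow al - zrow be) s.

Lemma fwt_gt0 : 0 < fwt.
Proof. by rewrite invr_gt0 exprn_gt0// ltr0n. Qed.

Definition fkerR (th : E) : R := fwt * normc (\sum_al tw (zrow al) th) ^+ 2.

Lemma fkerE th : fker th = (fkerR th)%:C.
Proof.
rewrite /fker /fkerR; set A := \sum_al tw (zrow al) th.
have -> : \sum_al \sum_be tw (zrow al - zrow be) th = A * \sum_be tw (- zrow be) th.
  rewrite /A mulr_suml; apply: eq_bigr => al _; rewrite mulr_sumr.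
  by apply: eq_bigr => be _; rewrite twD.
have BRe : complex.Re (\sum_be tw (- zrow be) th) = complex.Re A.
  by rewrite !cRe_sum; apply: eq_bigr => be _; rewrite twN /= cosN.
have BIm : complex.Im (\sum_be tw (- zrow be) th) = - complex.Im A.
  by rewrite !cIm_sum -sumrN; apply: eq_bigr => be _; rewrite twN /= sinN.
have -> : A * (\sum_be tw (- zrow be) th) = (normc A ^+ 2)%:C.
  have nA : normc A ^+ 2 = complex.Re A ^+ 2 + complex.Im A ^+ 2.
    by rewrite normc_sqrtE sqr_sqrtr// addr_ge0// sqr_ge0.
  by apply: eq_complexP; rewrite ?cReM ?cImM BRe BIm/= ?nA; ring.
by apply: eq_complexP; rewrite ?cReM ?cImM/=; ring.
Qed.

Lemma fkerR_ge0 th : 0 <= fkerR th.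
Proof. by rewrite mulr_ge0 ?sqr_ge0// ltW// fwt_gt0. Qed.

Let ic_ker q s (f : E -> R[i]) M : cmeas ucube f -> (forall y, ucube y -> normc (f y) <= M) ->
  cintegrable lam ucube (fun y => f y * tw q (s - y)).
Proof.
move=> mf fM; apply: (@cintegrable_cube _ M).
  apply: cmeasM => //; under eq_fun do rewrite twB.
  by apply: cmeasZ; exact: cmeas_tw.
by move=> y Qy; rewrite normcM normc_tw mulr1; exact: fM.
Qed.

Lemma cintegral_fker (f : E -> R[i]) M s : cmeas ucube f -> (forall y, ucube y -> normc (f y) <= M) ->
  cintegrable lam ucube (fun y => f y * fker (s - y)) /\
  cintegral lam ucube (fun y => f y * fker (s - y)) =
  fwt%:C * \sum_al \sum_be cintegral lam ucube (fun y => f y * tw (zrow al - zrow be) (s - y)).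
Proof.
move=> mf fM; have mQ := measurable_ucube.
have E : (fun y => f y * fker (s - y)) =
    (fun y => fwt%:C * \sum_al \sum_be f y * tw (zrow al - zrow be) (s - y)).
  apply/funext => y; rewrite /fker mulrCA mulr_sumr; congr (_ * _).
  by apply: eq_bigr => al _; rewrite mulr_sumr.
have i1 al be := ic_ker (zrow al - zrow be) s mf fM.
have i2 al := cintegrable_sum mQ (index_enum I) (i1 al).
have i3 := cintegrable_sum mQ (index_enum I) i2.
rewrite E; split; first exact: cintegrableZ.
rewrite (cintegralZ mQ _ i3) (cintegral_sum mQ _ i2); congr (_ * _).
by apply: eq_bigr => al _; rewrite (cintegral_sum mQ _ (i1 al)).
Qed.

Lemma fsumE h M s : measurable_fun setT h -> (forall y, `|h y| <= M) ->
  fsum h s = cintegral lam ucube (fun y => (h y)%:C * fker (s - y)).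
Proof.
move=> mh hM; have mQ := measurable_ucube.
have mf : cmeas ucube (fun y => (h y)%:C) by apply: cmeas_real; exact: measurable_funTS.
have fM y : ucube y -> normc ((h y)%:C) <= M by move=> _; rewrite normcR.
have [_ ->] := cintegral_fker s mf fM.
rewrite /fsum; congr (_ * _); apply: eq_bigr => al _; apply: eq_bigr => be _.
set q := _ - _; rewrite /fcoef mulrC -(cintegralZ mQ); last first.
  apply: (@cintegrable_cube _ M); first by apply: cmeasM => //; exact: cmeas_tw.
  by move=> y Qy; rewrite normcM normc_tw mulr1; exact: fM.
by apply: eq_cintegral => y _; rewrite twB mulrCA.
Qed.

Lemma cintegral_twB q s : cintegral lam ucube (fun y => tw q (s - y)) = (q == 0)%:R.
Proof.
under [LHS]eq_cintegral do rewrite twB.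
rewrite (cintegralZ measurable_ucube _ (cintegrable_tw _)) cintegral_tw oppr_eq0.
by case: eqVneq => [->|_]; rewrite ?tw0 ?mul1r ?mulr0.
Qed.

Lemma zrow_diag al : \sum_be ((zrow al - zrow be == 0)%:R : R[i]) = 1.
Proof.
rewrite (bigD1 al)//= subrr eqxx big1 ?addr0// => be be_al.
by rewrite subr_eq0 (inj_eq zrow_inj) eq_sym (negbTE be_al).
Qed.

Lemma fwt_card : fwt%:C * (\sum_(al : I) 1 : R[i]) = 1.
Proof.
rewrite sumr_const card_ffun !card_ord.
have -> : (1 *+ N ^ d : R[i]) = (N%:R ^+ d : R)%:C by rewrite -natrX rmorph_nat.
by rewrite -rmorphM/= mulVf ?rmorph1// expf_neq0// pnatr_eq0.
Qed.

Lemma fker_mass s : cintegral lam ucube (fun y => 1 * fker (s - y)) = 1.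
Proof.
have [|_ ->] := @cintegral_fker (fun=> 1) 1 s (cmeas_cst _ _).
  by move=> y _; rewrite normc1.
rewrite -[RHS]fwt_card; congr (_ * _); apply: eq_bigr => al _; rewrite -[RHS](zrow_diag al).
apply: eq_bigr => be _; rewrite -(cintegral_twB _ s).
by apply: eq_cintegral => y _; rewrite mul1r.
Qed.

Definition zdelta (j : 'I_d) : 'rV[int]_d := delta_mx 0 j.

(** The only candidate for beta is alpha + e_j, which stays in the range of indices iff alpha_j + 1
    < N. *)
Lemma zrow_shift al j :
  \sum_be ((zdelta j + (zrow al - zrow be) == 0)%:R : R[i]) = ((al j).+1 < N)%N%:R.
Proof.
have eqE be : (zdelta j + (zrow al - zrow be) == 0) =
    [forall i, (be i == al i + (i == j) :> nat)%N].
  apply/eqP/forallP => [/rowP h i|h].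
    have := h i; rewrite !mxE eqxx/= => /eqP; rewrite addrA subr_eq add0r => /eqP hi.
    by apply/eqP; move: hi; rewrite natz -PoszD addnC => -[].
  by apply/rowP => i; rewrite !mxE eqxx/= (eqP (h i)) natz PoszD; ring.
case: ltnP => jN.
  pose be0 : I := [ffun i => if i == j then Ordinal jN else al i].
  rewrite (bigD1 be0)//= big1 ?addr0; last first.
    move=> be be_neq; rewrite eqE; case: forallP => // h; case/eqP: be_neq.
    apply/ffunP => i; apply/ord_inj; rewrite (eqP (h i)) ffunE.
    by case: eqP => [->|_] /=; rewrite ?addn1 ?addn0.
  rewrite eqE; case: forallP => // -[]; move=> i; rewrite ffunE.
  by case: (eqVneq i j) => [->|ij]; rewrite /= ?addn1 ?addn0.
rewrite big1// => be _; rewrite eqE; case: forallP => // h.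
by have := h j; rewrite eqxx addn1 => /eqP hj; have := ltn_ord (be j); rewrite hj ltnNge jN.
Qed.

(** This is the Fourier coefficient of the kernel at a unit frequency, 1 - 1/N; its defect 1/N is
    the rate in [fejer_bound]. *)
Lemma zrow_count j : fwt%:C * \sum_(al : I) (((al j).+1 < N)%N%:R : R[i]) = (N'%:R / N%:R : R)%:C.
Proof.
pose G (i : 'I_d) (k : 'I_N) : R := if i == j then ((k.+1 < N)%N%:R) else 1.
have e1 : \sum_(al : I) (((al j).+1 < N)%N%:R : R[i]) = (\prod_i \sum_k G i k)%:C.
  rewrite bigA_distr_bigA rmorph_sum/=; apply: eq_bigr => al _.
  rewrite (bigD1 j)//= big1 ?mulr1 /G ?eqxx ?rmorph_nat// => i /negbTE ij.
  by rewrite ij.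
have G1 i : i != j -> \sum_k G i k = N%:R.
  by move=> /negbTE ij; rewrite /G ij sumr_const card_ord.
have G2 : \sum_k G j k = N'%:R.
  rewrite /G eqxx big_ord_recr/= ltnn addr0.
  rewrite (eq_bigr (fun=> 1)); last by move=> k _; rewrite ltnS ltn_ord.
  by rewrite sumr_const card_ord.
have e2 : N%:R ^+ d = N%:R * \prod_(i | i != j) \sum_k G i k :> R.
  rewrite (eq_bigr (fun=> N%:R)); last by move=> i /G1.
  by rewrite -[in LHS](card_ord d) -prodr_const (bigD1 j).
rewrite e1 -rmorphM/= (bigD1 j)//= G2 /fwt e2; congr (_%:C).
set X := \prod_(i | i != j) _; have X0 : X != 0.
  by apply/prodf_neq0 => i ij; rewrite G1// pnatr_eq0.
by rewrite invfM mulrACA mulVf// mulr1 mulrC.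
Qed.

Lemma fker_moment j s :
  cintegral lam ucube (fun y => tw (zdelta j) (s - y) * fker (s - y)) = (N'%:R / N%:R : R)%:C.
Proof.
have mt : cmeas ucube (fun y => tw (zdelta j) (s - y)).
  by under eq_fun do rewrite twB; apply: cmeasZ; exact: cmeas_tw.
have [|_ ->] := @cintegral_fker _ 1 s mt; first by move=> y _; rewrite normc_tw.
rewrite -(zrow_count j); congr (_ * _); apply: eq_bigr => al _; rewrite -(zrow_shift al j).
apply: eq_bigr => be _; rewrite -(cintegral_twB _ s).
by apply: eq_cintegral => y _; rewrite [RHS]twD.
Qed.

(* Korovkin's argument: the Fejer kernel is a positive unit mass with
   prescribed first trigonometric moments. *)
Lemma fejer_bound h M eta C s : measurable_fun setT h -> (forall y, `|h y| <= M) -> 0 <= C ->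
  (forall y, `|h s - h y| <= eta + C * \sum_j (1 - cos (2 * pi * (s 0 j - y 0 j)))) ->
  normc ((h s)%:C - fsum h s) <= eta + C * d%:R / N%:R.
Proof.
move=> mh hM C0 hs; have mQ := measurable_ucube.
have mf : cmeas ucube (fun y => (h y)%:C) by apply: cmeas_real; exact: measurable_funTS.
have fM y : ucube y -> normc ((h y)%:C) <= M by move=> _; rewrite normcR.
have [ih _] := cintegral_fker s mf fM.
have [|i1 _] := @cintegral_fker (fun=> 1) 1 s (cmeas_cst _ _).
  by move=> y _; rewrite normc1.
have mt j : cmeas ucube (fun y => tw (zdelta j) (s - y)).
  by under eq_fun do rewrite twB; apply: cmeasZ; exact: cmeas_tw.
have nt j y : ucube y -> normc (tw (zdelta j) (s - y)) <= 1 by rewrite normc_tw.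
have it j := (cintegral_fker s (mt j) (nt j)).1.
pose g y := (h s)%:C * (1 * fker (s - y)) - (h y)%:C * fker (s - y).
have ig : cintegrable lam ucube g by apply: cintegrableB => //; exact: cintegrableZ.
have gE y : g y = ((h s - h y) * fkerR (s - y))%:C.
  by rewrite /g fkerE mul1r -mulrBl -rmorphB -rmorphM.
have Eg : (h s)%:C - fsum h s = cintegral lam ucube g.
  rewrite (cintegralB mQ (cintegrableZ mQ _ i1) ih) (cintegralZ mQ _ i1) fker_mass mulr1.
  by rewrite (fsumE _ mh hM).
(* The real part of [B] is the majorant eta + C sum_j (1 - cos ...) times the kernel. By mass and
   moments its integral is eta + C d (1 - N'/N) = eta + C d / N. *)
pose B y := (eta + C * d%:R)%:C * (1 * fker (s - y)) -
   C%:C * \sum_j tw (zdelta j) (s - y) * fker (s - y).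
have is_ := cintegrable_sum mQ (index_enum 'I_d) it.
have iB : cintegrable lam ucube B.
  by apply: cintegrableB => //; exact: cintegrableZ.
have BE : cintegral lam ucube B = (eta + C * d%:R / N%:R)%:C.
  rewrite (cintegralB mQ (cintegrableZ mQ _ i1) (cintegrableZ mQ _ is_)).
  rewrite (cintegralZ mQ _ i1) fker_mass (cintegralZ mQ _ is_) (cintegral_sum mQ _ it).
  under eq_bigr do rewrite fker_moment.
  rewrite sumr_const card_ord mulr1 -rmorphMn -rmorphM -rmorphB; congr (_%:C).
  rewrite -mulr_natr -[N'%:R]/(N'%:R : R).
  have -> : N'%:R = N%:R - 1 :> R by rewrite -natr1 addrK.
  have n0 : N%:R != 0 :> R by rewrite pnatr_eq0.
  by move: n0; set n := N%:R => n0; field.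
have ReB y : complex.Re (B y) = (eta + C * \sum_j (1 - cos (2 * pi * (s 0 j - y 0 j)))) * fkerR (s - y).
  have dE j : dotz (s - y) (zdelta j) = s 0 j - y 0 j.
    rewrite /dotz (bigD1 j)//= !mxE !eqxx mulr1 big1 ?addr0// => i /negbTE ij.
    by rewrite !mxE eqxx ij/= mulr0.
  rewrite /B fkerE mul1r cReD cReN !cReM/= !mul0r !subr0 -mulr_suml cReM/= mulr0 subr0.
  rewrite cRe_sum; have -> : \sum_j complex.Re (tw (zdelta j) (s - y)) = \sum_j cos (2 * pi * (s 0 j - y 0 j)).
    by apply: eq_bigr => j _; rewrite /tw dE.
  rewrite sumrB sumr_const card_ord.
  by rewrite mulrBr -mulr_natr mul1r; ring.
rewrite Eg; apply: le_trans (normc_le _) _.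
have -> : complex.Im (cintegral lam ucube g) = 0.
  rewrite /= (_ : (fun y => complex.Im (g y)) = cst 0) ?Rintegral_cst ?mul0r//.
  by apply/funext => y; rewrite gE.
rewrite normr0 addr0; apply: (@le_trans _ _ (complex.Re (cintegral lam ucube B))); last by rewrite BE.
have [ig1 _] := ig; have [iB1 _] := iB.
apply: le_trans (le_normr_Rintegral mQ ig1) _.
apply: le_Rintegral => //; first exact: integrable_norm.
move=> y _ /=; rewrite ReB gE/= normrM (ger0_norm (fkerR_ge0 _)).
by rewrite ler_wpM2r// fkerR_ge0.
Qed.

(** When all nonzero frequencies drop out, the N^d diagonal pairs remain and the weight of the
    kernel normalizes them. *)
Lemma fwt_diag (a : R[i]) : fwt%:C * (\sum_al \sum_be (zrow al - zrow be == 0)%:R * a) = a.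
Proof.
transitivity (fwt%:C * (\sum_(al : I) 1 : R[i]) * a); last by rewrite fwt_card mul1r.
rewrite -mulrA mulr_suml; congr (_ * _).
by apply: eq_bigr => al _; rewrite -mulr_suml zrow_diag.
Qed.

End fejer.

(** * Uniform Fejer approximation of periodic functions *)

Section fejer_approximation.
Context {R : realType} (d : nat).
Local Notation E := 'rV[R]_d.
Implicit Types (h : E -> R).

Definition zperiodic h := forall y (k : 'rV[int]_d), h (y + map_mx intr k) = h y.

Lemma cos_periodz (t : R) (k : int) : cos (2 * pi * (t - k%:~R)) = cos (2 * pi * t).
Proof.
have := cisD (2 * pi * (t - k%:~R)) (2 * pi * k%:~R).
by rewrite cis2piz mulr1 -mulrDr subrK => -[].
Qed.

Lemma cube_shift (s : E) : exists k : 'rV[int]_d, cbox 0 (const_mx 1) (s + map_mx intr k).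
Proof.
exists (\row_i - Num.floor (s 0 i)) => i; rewrite !mxE rmorphN/=.
have := floorD1_gt (s 0 i); rewrite intrD => h.
by rewrite subr_ge0 floor_le_tmp/= lerBlDr addrC ltW.
Qed.

Lemma periodic_bounded h : continuous h -> zperiodic h -> exists2 M, 0 <= M & forall y, `|h y| <= M.
Proof.
move=> ch ph; have [M M0 hM] := compact_fun_bounded (@compact_cbox R d 0 (const_mx 1)) ch.
exists M => // y; have [k hk] := cube_shift y.
by rewrite -(ph y k); exact: hM.
Qed.

(** When s - y is close to the lattice, uniform continuity gives eta; otherwise some 1 - cos is at
    least c > 0, and C = 2 M / c covers the largest possible oscillation 2 M. *)
Lemma periodic_modulus h : continuous h -> zperiodic h -> forall eta, 0 < eta ->
  exists2 C, 0 <= C & forall s y, `|h s - h y| <= eta + C * \sum_j (1 - cos (2 * pi * (s 0 j - y 0 j))).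
Proof.
move=> ch ph eta eta0; have [M M0 hM] := periodic_bounded ch ph.
have [r0 r00 hr0] := heine (@compact_cbox R d 0 (const_mx 1)) ch eta0.
(* The bound 1/2 keeps 2 pi r in [0, pi], where the cosine decreases, so 1 - cos (2 pi t) >= c for
   all r <= |t| <= 1/2. *)
pose r := Num.min r0 (1 / 2); have rpos : 0 < r by rewrite lt_min r00 divr_gt0.
have rr0 : r <= r0 by rewrite ge_min lexx.
have r12 : r <= 1 / 2 by rewrite ge_min lexx orbT.
have pi0 : (0 : R) < pi by exact: pi_gt0.
pose c := 1 - cos (2 * pi * r).
have mono t : r <= `|t| -> `|t| <= 1 / 2 -> c <= 1 - cos (2 * pi * t).
  move=> h1 h2; rewrite /c lerD2l lerN2.
  have -> : cos (2 * pi * t) = cos (2 * pi * `|t|).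
    by case: (ger0P t) => _ //; rewrite mulrN cosN.
  have i1 : 2 * pi * r \in `[0, pi].
    rewrite in_itv/=; apply/andP; split; first by rewrite !mulr_ge0// ltW.
    by rewrite -mulrA mulrCA ler_piMr ?(ltW pi0)//; lra.
  have i2 : 2 * pi * `|t| \in `[0, pi].
    rewrite in_itv/=; apply/andP; split; first by rewrite !mulr_ge0// ltW.
    by rewrite -mulrA mulrCA ler_piMr ?(ltW pi0)//; lra.
  rewrite leNgt ltr_cos// -leNgt ler_wpM2l// mulr_ge0// ltW//.
have c0 : 0 < c.
  rewrite /c subr_gt0 -[ltRHS]cos0 ltr_cos ?in_itv/=.
  - by rewrite !mulr_gt0.
  - by rewrite lexx ltW.
  - rewrite !mulr_ge0 ?(ltW pi0) ?(ltW rpos)//= -mulrA mulrCA ler_piMr ?(ltW pi0)//; lra.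
exists (2 * M / c); first by rewrite divr_ge0 ?mulr_ge0// ltW.
move=> s y; have [m hm] := cube_shift s.
(* Rounding to a nearest lattice point, so that every remainder [tau j] lies in [-1/2, 1/2]. *)
pose k : 'rV[int]_d := \row_j Num.floor (s 0 j - y 0 j + 1 / 2).
pose tau j := s 0 j - y 0 j - (k 0 j)%:~R.
have tau12 j : `|tau j| <= 1 / 2.
  rewrite /tau mxE ler_norml; have := floor_le_tmp (s 0 j - y 0 j + 1 / 2).
  have := floorD1_gt (s 0 j - y 0 j + 1 / 2); rewrite intrD; set z := _%:~R.
  by move=> h1 h2; apply/andP; split; lra.
have cE j : cos (2 * pi * (s 0 j - y 0 j)) = cos (2 * pi * tau j) by rewrite cos_periodz.
have t0 j : 0 <= 1 - cos (2 * pi * (s 0 j - y 0 j)) by rewrite subr_ge0 cos_le1.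
have C0 : 0 <= 2 * M / c by rewrite divr_ge0 ?mulr_ge0// ltW.
have [small|/existsNP[j hj]] := pselect (forall j, `|tau j| < r).
  rewrite -(ph s m) -(ph y (k + m)); apply: (@le_trans _ _ eta); last first.
    by rewrite lerDl mulr_ge0// sumr_ge0.
  apply: hr0 => //; apply/rV_ballP => // i; rewrite !mxE.
  have := small i; rewrite /tau /k mxE rmorphD/=.
  set a := s 0 i; set b := y 0 i; set f := (Num.floor _)%:~R => hi.
  by apply: lt_le_trans rr0; rewrite (_ : _ - _ = a - b - f)//; ring.
have hjr : r <= `|tau j| by rewrite leNgt; apply/negP.
have h2M : `|h s - h y| <= 2 * M.
  by rewrite (le_trans (ler_normB _ _))// mulr2n mulrDl mul1r lerD.
apply: (le_trans h2M); apply: (@le_trans _ _ (2 * M / c * c)); first by rewrite divfK// gt_eqF.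
apply: (@le_trans _ _ (2 * M / c * \sum_j0 (1 - cos (2 * pi * (s 0 j0 - y 0 j0))))).
  rewrite ler_wpM2l// (bigD1 j)//= cE (le_trans (mono _ hjr (tau12 j)))// lerDl sumr_ge0//.
by rewrite lerDr ltW.
Qed.

Lemma fejer_approx h : continuous h -> zperiodic h -> forall e, 0 < e ->
  exists N', forall s, normc ((h s)%:C - fsum N' h s) <= e.
Proof.
move=> ch ph e e0; have e2 : 0 < e / 2 by rewrite divr_gt0.
have [M M0 hM] := periodic_bounded ch ph.
have [C C0 hC] := periodic_modulus ch ph e2.
exists (Num.bound (C * d%:R / (e / 2))) => s; set N' := Num.bound _.
apply: le_trans (fejer_bound N' (continuous_measurable_rV ch) hM C0 (hC s)) _.
rewrite [leRHS]splitr lerD2l ler_pdivrMr ?ltr0n// [leRHS]mulrC -ler_pdivrMr//.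
have hb : C * d%:R / (e / 2) < N'%:R by rewrite archi_boundP// divr_ge0 ?mulr_ge0// ltW.
by rewrite (le_trans (ltW hb))// ler_nat.
Qed.

End fejer_approximation.

(** * Transport terms *)

Section local_facts.
Context {R : realType}.

Lemma locally_bounded_compact (X : topologicalType) (H : X -> R) (S : set X) : compact S ->
  (forall z, S z -> exists L, \forall w \near z, `|H w| <= L) ->
  exists2 M, 0 <= M & forall z, S z -> `|H z| <= M.
Proof.
move=> /compact_near_coveringP cS hS.
have : \forall M \near (+oo : set_system R), S `<=` (fun z => `|H z| <= M).
  apply: cS => z Sz; have [L hL] := hS z Sz.
  exists ([set w | `|H w| <= L], [set M | L <= M]) => /=.
    by split => //; exact: nbhs_pinfty_ge (num_real L).
  by move=> [w M] /= [h1 h2]; exact: le_trans h2.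
move=> h; have h0 : \forall M \near (+oo : set_system R), 0 <= M by exact: nbhs_pinfty_ge.
have [M [h1 h2]] := filter_ex (filterI h h0).
by exists M.
Qed.

Lemma near_bounded (X : topologicalType) (H : X -> R) z : {for z, continuous H} ->
  \forall w \near z, `|H w| <= `|H z| + 1.
Proof. by move=> cH; apply: (cvgr_norm_le _ cH); rewrite ltrDl. Qed.

Lemma ext_continuous (X : topologicalType) (D S : set X) (H : X -> R) : closed S -> S `<=` D ->
  (forall z, D z -> {for z, continuous H}) -> (forall z, ~ S z -> H z = 0) -> continuous H.
Proof.
move=> cS SD cH H0 z; have [Sz|nSz] := pselect (S z); first exact/cH/SD.
have near0 : \forall w \near z, H w = 0.
  by have := closed_openC cS; rewrite openE => /(_ z nSz); apply: filterS => w /H0.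
rewrite /continuous_at H0//; exact: cvg_near_cst.
Qed.

Lemma sum_continuous_at (X : topologicalType) (z : X) (I : Type) (r : seq I) (F : I -> X -> R) :
  (forall i, {for z, continuous (F i)}) -> {for z, continuous (fun w => \sum_(i <- r) F i w)}.
Proof.
move=> cF; elim: r => [|i r IH].
  by rewrite (_ : (fun w => _) = cst 0); [exact: cvg_cst|apply/funext => w; rewrite big_nil].
rewrite (_ : (fun w => _) = (fun w => F i w + \sum_(j <- r) F j w)); last first.
  by apply/funext => w; rewrite big_cons.
by apply: cvgD; [exact: cF|exact: IH].
Qed.

Lemma pair_continuous_at (X U W : topologicalType) (f : X -> U) (g : X -> W) x :
  {for x, continuous f} -> {for x, continuous g} -> {for x, continuous (fun t => (f t, g t))}.
Proof.
move=> cf cg P [[A B] /= [hA hB] sub].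
have h1 : nbhs x (f @^-1` A) by exact: cf.
have h2 : nbhs x (g @^-1` B) by exact: cg.
suff : nbhs x ((fun t => (f t, g t)) @^-1` P) by [].
by apply: filterS2 h1 h2 => t At Bt; exact: (sub (f t, g t)).
Qed.

End local_facts.

Section products.
Context {R : realType} (d : nat).
Local Notation E := 'rV[R]_d.
Local Notation Z := (E * E)%type.
Local Notation J := ('I_d + 'I_d)%type.
Local Notation mu := (@phase_measure R d).
Implicit Types (D S : set Z) (phi psi : Z -> R[i]).

Lemma bounded_support_cLfun D (r M : R) k (g : Z -> R[i]) : measurable D -> 0 < r -> 0 <= M ->
  cmeas D g -> (forall z, D z -> normc (g z) <= M) -> (forall z, D z -> ~ Qbox k z -> g z = 0) ->
  cLfun mu D r g /\ nrm mu D r g <= M * nrm mu D r (cind (Qbox k)).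
Proof.
move=> mD r0 M0 mg gM g0.
have mQ : measurable (Qbox k : set Z) by exact: measurable_zobox.
have [L1 _] := cLfun_ind mD r0 mQ (zobox_fin _ _ _ _).
have [LM eM] := cLfunZ mD (M%:C) r0 L1.
rewrite normcR ger0_norm// in eM; rewrite -eM.
apply: (cLfun_le mD r0 mg LM _) => z Dz.
have [Qz|nQ] := pselect (Qbox k z).
  by rewrite normcM /cind indicE mem_set// !normcR normr1 mulr1 ger0_norm// gM.
by rewrite g0// normc0 normc_ge0.
Qed.

Lemma cts_support_cLfun D S (r : R) (g : Z -> R[i]) : measurable D -> 0 < r -> compact S ->
  continuous (@complex.Re R \o g) -> continuous (@complex.Im R \o g) ->
  (forall z, ~ S z -> g z = 0) -> cLfun mu D r g.
Proof.
move=> mD r0 cS c1 c2 g0; have [k Sk] := compact_Qbox cS.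
have [M1 M10 h1] := compact_fun_bounded cS c1.
have [M2 M20 h2] := compact_fun_bounded cS c2.
apply: (@bounded_support_cLfun D r (M1 + M2) k _ _ _ _ _ _ _).1 => //.
- by rewrite addr_ge0.
- have mm (f : Z -> R) : continuous f -> measurable_fun D f.
    move=> cf; apply: (@measurable_funS _ _ _ _ setT) => //.
    by apply: continuous_within_measurable; [exact: openT|exact: continuous_subspaceT].
  by split; exact: mm.
- move=> z _; have [Sz|nS] := pselect (S z); last by rewrite g0// normc0 addr_ge0.
  by apply: le_trans (normc_le _) _; apply: lerD; [exact: h1|exact: h2].
- by move=> z _ nQ; apply: g0 => /Sk.
Qed.

Section analytic_product.
Variables (D S : set Z) (a g : Z -> R).
Hypotheses (oD : open D) (cS : compact S) (SD : S `<=` D) (ana : real_analytic D a)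
  (sg : rsmooth g) (g0 : forall z, ~ S z -> g z = 0).
Let G (y : Z) := a y * g y.

Let clS : closed S. Proof. exact: compact_closedZ. Qed.

Lemma ap_continuous : continuous G.
Proof.
apply: (ext_continuous clS SD).
- move=> z Dz; apply: cvgM; first by have [] := analytic_near_lip oD ana Dz.
  exact: rsmooth_continuous.
- by move=> z nS; rewrite /G g0// mulr0.
Qed.

Lemma ap_derive_in z j : D z ->
  is_derive z (basis j) G (a z * 'D_(basis j) g z + g z * 'D_(basis j) a z).
Proof.
move=> Dz; have da : is_derive z (basis j) a ('D_(basis j) a z).
  by apply: derivableP; exact: analytic_derivable ana Dz.
have dg : is_derive z (basis j) g ('D_(basis j) g z).
  by apply: derivableP; exact: rsmooth_derivable.
exact: (is_deriveM da dg).
Qed.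

Lemma ap_derive_out z j : ~ S z -> is_derive z (basis j) G 0.
Proof.
move=> nS; have h0 : is_derive z (basis j) (cst (0 : R)) 0 by exact: is_derive_cst.
apply: (near_eq_is_derive _ h0).
have := closed_openC clS; rewrite openE => /(_ z nS); apply: filterS => w nw.
by rewrite /G g0// mulr0.
Qed.

Lemma ap_derivable z j : derivable G z (basis j).
Proof.
have [Sz|nS] := pselect (S z); first by case: (ap_derive_in j (SD Sz)).
by case: (ap_derive_out j nS).
Qed.

(** The partial derivatives of [a] enter only through the local bound of [analytic_near_lip];
    compactness of S makes it uniform, and G is locally zero off S. *)
Lemma ap_bounded j : exists2 M, 0 <= M & forall z, `|'D_(basis j) G z| <= M.
Proof.
have [|M M0 hM] := @locally_bounded_compact R _ ('D_(basis j) G) S cS.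
  move=> z Sz; have Dz := SD Sz; have [ca [L hL]] := analytic_near_lip oD ana Dz.
  exists ((`|a z| + 1) * (`|'D_(basis j) g z| + 1) + (`|g z| + 1) * L).
  have nD : \forall w \near z, D w by exact: open_nbhs_nbhs.
  have n1 := near_bounded ca.
  have c2 : continuous (rpartial j g) by exact/rsmooth_continuous/rsmooth_partial.
  have c3 : continuous g by exact: rsmooth_continuous.
  have n2 := near_bounded (c2 z); have n3 := near_bounded (c3 z).
  apply: filterS2 (filterI n1 n2) (filterI n3 (filterI nD hL)) => w [h1 h2] [h3 [Dw h4]].
  case: (ap_derive_in j Dw) => _ ->; rewrite (le_trans (ler_normD _ _))// !normrM.
  by apply: lerD; apply: ler_pM.
exists M => // z; have [Sz|nS] := pselect (S z); first exact: hM.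
by case: (ap_derive_out j nS) => _ ->; rewrite normr0.
Qed.

(** The derivative is the pointwise limit of difference quotients of step 1/(n+1), which are
    continuous; continuity of the derivative of [a] is not established. *)
Lemma ap_measurable j : measurable_fun setT ('D_(basis j) G).
Proof.
pose h (n : nat) z := n.+1%:R * (G (n.+1%:R^-1 *: basis j + z) - G z).
have mG : measurable_fun setT G.
  by apply: continuous_within_measurable; [exact: openT|exact: continuous_subspaceT ap_continuous].
have cshift (v : Z) : continuous (fun z : Z => v + z).
  by move=> z; apply: cvgD; [exact: cvg_cst|exact: cvg_id].
apply: (@measurable_fun_cvg _ _ _ setT h).
  move=> n; apply: measurable_funM => //; apply: measurable_funB => //.
  apply: continuous_within_measurable; first exact: openT.
  apply: continuous_subspaceT => z; apply: (@cvg_comp _ _ _ (fun z => n.+1%:R^-1 *: basis j + z) G).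
    exact: cshift.
  exact: ap_continuous.
move=> z _; have dG : derivable G z (basis j) by exact: ap_derivable.
have cv : (fun t : R => t^-1 *: ((G \o shift z) (t *: basis j) - G z)) @ 0^' --> 'D_(basis j) G z by exact: dG.
have cn : (fun n : nat => n.+1%:R^-1 : R) @ \oo --> (0 : R)^'.
  move=> P /= [e /= e0 he].
  have := @cvg_harmonic R; move=> /cvgrPdist_lt/(_ e e0); apply: filterS => n hn.
  by apply: he; rewrite ?invr_eq0 ?pnatr_eq0//.
pose qf (t : R) : R := t^-1 *: ((G \o shift z) (t *: basis j) - G z).
have -> : h ^~ z = qf \o (fun n => n.+1%:R^-1) by apply/funext => n; rewrite /h /qf /= invrK.
exact: (cvg_comp _ qf cn cv).
Qed.

End analytic_product.

Definition cder phi j z (dv : R[i]) := is_derive z (basis j) (@complex.Re R \o phi) (complex.Re dv) /\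
  is_derive z (basis j) (@complex.Im R \o phi) (complex.Im dv).

Lemma cder_partial phi j z dv : cder phi j z dv -> partial j phi z = dv.
Proof. by move=> [[_ h1] [_ h2]]; apply: eq_complexP => /=. Qed.

Lemma cder_smooth phi j z : smooth phi -> cder phi j z (partial j phi z).
Proof.
move=> /smoothP[s1 s2]; split; apply: derivableP; exact: rsmooth_derivable.
Qed.

Lemma cderM phi psi j z dv dw : cder phi j z dv -> cder psi j z dw ->
  cder (fun y => phi y * psi y) j z (phi z * dw + dv * psi z).
Proof.
move=> [p1 p2] [q1 q2]; split.
  have h := is_deriveB (is_deriveM p1 q1) (is_deriveM p2 q2).
  have -> : @complex.Re R \o (fun y => phi y * psi y) =
     (@complex.Re R \o phi) * (@complex.Re R \o psi) - (@complex.Im R \o phi) * (@complex.Im R \o psi).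
    by apply/funext => y /=; rewrite cReM.
  by apply: (is_derive_eq h); rewrite cReD !cReM /GRing.scale/=; ring.
have h := is_deriveD (is_deriveM p1 q2) (is_deriveM p2 q1).
have -> : @complex.Im R \o (fun y => phi y * psi y) =
   (@complex.Re R \o phi) * (@complex.Im R \o psi) + (@complex.Im R \o phi) * (@complex.Re R \o psi).
  by apply/funext => y /=; rewrite cImM.
by apply: (is_derive_eq h); rewrite cImD !cImM /GRing.scale/=; ring.
Qed.

Definition kosc (q : 'rV[int]_d) (s : R) (j : J) : R :=
  match j with inl i => 2 * pi * s * (q 0 i)%:~R | inr _ => 0 end.

Lemma osc_lin q s : (fun z : Z => osc q s z.1) = (fun z => cis (lin (kosc q s) z)).
Proof.
apply/funext => z; rewrite /osc /lin /dotz; congr cis.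
rewrite big_sumType/= [X in _ + X]big1 ?addr0; last by move=> i _; rewrite mul0r.
by rewrite mulr_sumr; apply: eq_bigr => i _; rewrite !mxE; ring.
Qed.

Lemma smooth_osc q s : smooth (fun z : Z => osc q s z.1).
Proof.
by rewrite osc_lin; apply/smoothP; have [h1 h2] := rsmooth_trig (kosc q s); split; [exact: h1|exact: h2].
Qed.

Lemma cder_osc q s j z : cder (fun y : Z => osc q s y.1) j z (Complex 0 (kosc q s j) * osc q s z.1).
Proof.
have := osc_lin q s; move=> /(congr1 (fun f => f z)) /= ->; rewrite osc_lin; split.
  have h := @is_derive_compl R _ cos (lin (kosc q s)) z (basis j) (kosc q s j) _
    (lin_line _ _ _) (is_derive_cos _).
  by apply: (is_derive_eq h); rewrite cReM/=; ring.
have h := @is_derive_compl R _ sin (lin (kosc q s)) z (basis j) (kosc q s j) _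
  (lin_line _ _ _) (is_derive_sin _).
by apply: (is_derive_eq h); rewrite cImM/=; ring.
Qed.

Lemma cts_cmeas D (g : Z -> R[i]) : measurable D ->
  continuous (@complex.Re R \o g) -> continuous (@complex.Im R \o g) -> cmeas D g.
Proof.
move=> mD c1 c2; have mm (f : Z -> R) : continuous f -> measurable_fun D f.
  move=> cf; apply: (@measurable_funS _ _ _ _ setT) => //.
  by apply: continuous_within_measurable; [exact: openT|exact: continuous_subspaceT].
by split; exact: mm.
Qed.

Lemma test_fun_parts D phi : test_fun D phi -> exists S, [/\ compact S, S `<=` D,
  forall z, ~ S z -> phi z = 0, rsmooth (@complex.Re R \o phi) & rsmooth (@complex.Im R \o phi)].
Proof.
move=> tp; have [/smoothP[s1 s2] cS SD] := tp.
by exists (closure [set z | phi z != 0]); split => // z; exact: (test_fun_off tp).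
Qed.

Lemma partial_off D phi S j z : test_fun D phi -> compact S -> (forall z, ~ S z -> phi z = 0) ->
  ~ S z -> partial j phi z = 0.
Proof.
move=> [/smoothP[s1 s2] _ _] cS p0 nS; apply: cder_partial; split.
  have -> : @complex.Re R \o phi = (fun y => 1 * (@complex.Re R \o phi) y) by apply/funext => y; rewrite mul1r.
  by apply: (ap_derive_out _ cS _ j nS) => w nw /=; rewrite p0.
have -> : @complex.Im R \o phi = (fun y => 1 * (@complex.Im R \o phi) y) by apply/funext => y; rewrite mul1r.
by apply: (ap_derive_out _ cS _ j nS) => w nw /=; rewrite p0.
Qed.

Lemma test_fun_cLfun D phi r : measurable D -> 0 < r -> test_fun D phi -> cLfun mu D r phi.
Proof.
move=> mD r0 /test_fun_parts[S [cS SD p0 s1 s2]].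
by apply: (cts_support_cLfun mD r0 cS) => //; exact: rsmooth_continuous.
Qed.

Lemma partial_cLfun D phi r j : measurable D -> 0 < r -> test_fun D phi -> cLfun mu D r (partial j phi).
Proof.
move=> mD r0 tp; have [S [cS SD p0 s1 s2]] := test_fun_parts tp.
apply: (cts_support_cLfun mD r0 cS).
- exact: (rsmooth_continuous (rsmooth_partial j s1)).
- exact: (rsmooth_continuous (rsmooth_partial j s2)).
- by move=> z; exact: partial_off tp cS p0.
Qed.

Section transport.
Variables (D : set Z) (a : E -> E -> E).
Hypotheses (oD : open D) (ana : forall i : 'I_d, real_analytic D (fun z => a z.1 z.2 0 i)).

Definition tdiv phi z : R[i] :=
  \sum_(i < d) partial (inl i) (fun y => (a y.1 y.2 0 i)%:C * phi y) z.

Let mD : measurable D. Proof. exact: open_measurableZ. Qed.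

Lemma cder_ap phi i j z : test_fun D phi ->
  cder (fun y => (a y.1 y.2 0 i)%:C * phi y) j z (partial j (fun y => (a y.1 y.2 0 i)%:C * phi y) z).
Proof.
move=> /test_fun_parts[S [cS SD p0 s1 s2]].
have z1 w : ~ S w -> (@complex.Re R \o phi) w = 0 by move=> nw /=; rewrite p0.
have z2 w : ~ S w -> (@complex.Im R \o phi) w = 0 by move=> nw /=; rewrite p0.
split; apply: derivableP.
  have -> : @complex.Re R \o (fun y => (a y.1 y.2 0 i)%:C * phi y) =
      (fun y => a y.1 y.2 0 i * (@complex.Re R \o phi) y).
    by apply/funext => y /=; rewrite cReM/= mul0r subr0.
  exact: (@ap_derivable D S (fun z => a z.1 z.2 0 i) _ cS SD (ana i) s1 z1 z j).
have -> : @complex.Im R \o (fun y => (a y.1 y.2 0 i)%:C * phi y) =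
    (fun y => a y.1 y.2 0 i * (@complex.Im R \o phi) y).
  by apply/funext => y /=; rewrite cImM/= mul0r addr0.
exact: (@ap_derivable D S (fun z => a z.1 z.2 0 i) _ cS SD (ana i) s2 z2 z j).
Qed.

Lemma tdiv_cLfun phi r : 1 <= r -> test_fun D phi -> cLfun mu D r (tdiv phi).
Proof.
move=> r1 /test_fun_parts[S [cS SD p0 s1 s2]].
have r0 : 0 < r by exact: lt_le_trans r1.
have [k Sk] := compact_Qbox cS.
apply: (cLfun_sum mD (index_enum 'I_d) r1 _).1 => i.
have E1 : @complex.Re R \o (fun y => (a y.1 y.2 0 i)%:C * phi y) =
    (fun y => a y.1 y.2 0 i * (@complex.Re R \o phi) y).
  by apply/funext => y /=; rewrite cReM/= mul0r subr0.
have E2 : @complex.Im R \o (fun y => (a y.1 y.2 0 i)%:C * phi y) =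
    (fun y => a y.1 y.2 0 i * (@complex.Im R \o phi) y).
  by apply/funext => y /=; rewrite cImM/= mul0r addr0.
have z1 w : ~ S w -> (@complex.Re R \o phi) w = 0 by move=> nw /=; rewrite p0.
have z2 w : ~ S w -> (@complex.Im R \o phi) w = 0 by move=> nw /=; rewrite p0.
have [M1 M10 h1] := ap_bounded oD cS SD (ana i) s1 z1 (inl i).
have [M2 M20 h2] := ap_bounded oD cS SD (ana i) s2 z2 (inl i).
apply: (@bounded_support_cLfun D r (M1 + M2) k _ _ _ _ _ _ _).1 => //.
- by rewrite addr_ge0.
- split; apply: measurable_funTS.
    by rewrite /partial E1; exact: (ap_measurable oD cS SD (ana i) s1 z1 (inl i)).
  by rewrite /partial E2; exact: (ap_measurable oD cS SD (ana i) s2 z2 (inl i)).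
- by move=> z _; apply: le_trans (normc_le _) _; rewrite /partial E1 E2; exact: (lerD (h1 z) (h2 z)).
- move=> z _ nQ; have nS : ~ S z by move=> /Sk.
  rewrite /partial E1 E2.
  have [_ ->] := ap_derive_out (fun y => a y.1 y.2 0 i) cS z1 (inl i) nS.
  by have [_ ->] := ap_derive_out (fun y => a y.1 y.2 0 i) cS z2 (inl i) nS.
Qed.

(** The derivative falling on the phase produces 2 pi i s (a.q). With s = 1 / eps_n this is the
    singular term that the oscillating test functions are designed to isolate. *)
Lemma tdiv_osc phi q s z : test_fun D phi ->
  tdiv (fun y => osc q s y.1 * phi y) z =
  osc q s z.1 * tdiv phi z + Complex 0 (2 * pi * s) * (osc q s z.1 * ((dotz (a z.1 z.2) q)%:C * phi z)).
Proof.
move=> tp; rewrite /tdiv mulr_sumr.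
have -> : Complex 0 (2 * pi * s) * (osc q s z.1 * ((dotz (a z.1 z.2) q)%:C * phi z)) =
    \sum_(i < d) Complex 0 (kosc q s (inl i)) * osc q s z.1 * ((a z.1 z.2 0 i)%:C * phi z).
  rewrite /dotz rmorph_sum/= mulr_suml !mulr_sumr; apply: eq_bigr => i _.
  have -> : Complex 0 (2 * pi * s * (q 0 i)%:~R) = Complex 0 (2 * pi * s) * ((q 0 i)%:~R : R)%:C.
    by apply: eq_complexP; rewrite ?cReM ?cImM/=; ring.
  by rewrite rmorphM/=; ring.
rewrite -big_split/=; apply: eq_bigr => i _; apply: cder_partial.
have -> : (fun y : Z => (a y.1 y.2 0 i)%:C * (osc q s y.1 * phi y)) =
   (fun y => osc q s y.1 * ((a y.1 y.2 0 i)%:C * phi y)) by apply/funext => y; rewrite mulrCA.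
exact: cderM (cder_osc q s (inl i) z) (cder_ap i (inl i) z tp).
Qed.

Lemma dotz_continuous q z : D z -> {for z, continuous (fun z => dotz (a z.1 z.2) q)}.
Proof.
move=> Dz; apply: (@sum_continuous_at _ _ _ _ _ (fun i (z : Z) => a z.1 z.2 0 i * (q 0 i)%:~R)) => i.
apply: cvgM; last exact: cvg_cst.
by have [] := analytic_near_lip oD (ana i) Dz.
Qed.

Lemma dotz_phi_cts phi q S : compact S -> S `<=` D -> (forall z, ~ S z -> phi z = 0) ->
  rsmooth (@complex.Re R \o phi) -> rsmooth (@complex.Im R \o phi) ->
  continuous (@complex.Re R \o (fun z => (dotz (a z.1 z.2) q)%:C * phi z)) /\
  continuous (@complex.Im R \o (fun z => (dotz (a z.1 z.2) q)%:C * phi z)).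
Proof.
move=> cS SD p0 s1 s2.
have key (g : Z -> R) : rsmooth g -> (forall z, ~ S z -> g z = 0) ->
    continuous (fun z => dotz (a z.1 z.2) q * g z).
  move=> sg g0; apply: (ext_continuous (compact_closedZ cS) SD); last first.
    by move=> z nS; rewrite g0// mulr0.
  move=> z Dz; apply: cvgM; last exact: rsmooth_continuous.
  exact: dotz_continuous.
split.
  have -> : @complex.Re R \o (fun z => (dotz (a z.1 z.2) q)%:C * phi z) =
      (fun z => dotz (a z.1 z.2) q * (@complex.Re R \o phi) z).
    by apply/funext => y /=; rewrite cReM/= mul0r subr0.
  by apply: key => // z nS /=; rewrite p0.
have -> : @complex.Im R \o (fun z => (dotz (a z.1 z.2) q)%:C * phi z) =
    (fun z => dotz (a z.1 z.2) q * (@complex.Im R \o phi) z).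
  by apply/funext => y /=; rewrite cImM/= mul0r addr0.
by apply: key => // z nS /=; rewrite p0.
Qed.

Lemma dotz_measurable q : measurable_fun D (fun z => dotz (a z.1 z.2) q).
Proof.
apply: continuous_within_measurable => //; rewrite continuous_open_subspace// => z /set_mem Dz.
exact: dotz_continuous.
Qed.

End transport.

Lemma dist_scale D f c phi : distribution_on D f -> test_fun D phi ->
  f (fun z => c * phi z) = c * f phi.
Proof.
move=> [lf _] tp.
have t0 : test_fun D (fun _ : Z => 0 : R[i]).
  have := test_funM (smooth_cst 0) tp; congr test_fun.
  by apply/funext => z; rewrite mul0r.
have f0 : f (fun=> 0) = 0.
  have := lf 1 _ _ t0 t0; under [X in f X]eq_fun do rewrite mulr0 addr0.
  by rewrite mul1r => /esym/eqP; rewrite -subr_eq0 addrK => /eqP.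
have := lf c _ _ tp t0; rewrite f0 addr0 => <-.
by congr f; apply/funext => z; rewrite addr0.
Qed.

(** The dual norm is a supremum over a unit ball, so the convergence is uniform in psi; psi may
    therefore oscillate and vary with the index. *)
Lemma Wm1_loc_cvg_unif D q f_ f chi : Wm1_loc_cvg D q f_ f -> test_fun D chi ->
  forall e, 0 < e -> \forall m \near \oo, forall psi, test_fun D psi ->
    (W1_norm D q psi <= 1)%E ->
    normc (f_ m (fun z => chi z * psi z) - f (fun z => chi z * psi z)) <= e.
Proof.
move=> [_ _ h] /h cv e e0; have := cvge0_lt e0 cv; apply: filterS => m hm psi tpsi npsi.
rewrite -lee_fin; apply: le_trans (ltW hm).
by apply: ereal_sup_ubound; exists psi.
Qed.

Definition cext D (h : Z -> R[i]) : Z -> R[i] := fun z => if z \in D then h z else 0.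

Lemma cLfun_ext D Q r (h : Z -> R[i]) : measurable D -> measurable Q -> cLfun mu D r h ->
  (forall z, D z -> ~ Q z -> h z = 0) -> cLfun mu Q r (cext D h).
Proof.
move=> mD mQ [m1 m2 hoo] h0.
have key (g : Z -> R) : measurable_fun D g -> measurable_fun Q (g \_ D).
  by move=> mg; apply: measurable_funTS; exact/(measurable_restrictT _ mD).
split.
- rewrite (_ : _ \o _ = (@complex.Re R \o h) \_ D); first exact: key.
  by apply/funext => z; rewrite /patch /cext /=; case: ifP.
- rewrite (_ : _ \o _ = (@complex.Im R \o h) \_ D); first exact: key.
  by apply/funext => z; rewrite /patch /cext /=; case: ifP.
- move: hoo; rewrite /cLnorm; congr (_ < _)%E; congr (Lnorm _ _ _).
  apply/funext => z; rewrite /patch /cext; case: ifPn => [/set_mem Dz|nD]; case: ifPn => [/set_mem Qz|nQ] //.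
    by rewrite h0// ?normc0// => /mem_set; apply/negP.
  by rewrite normc0.
Qed.

Section riemann_lebesgue_on.
Variables (eps : nat -> R) (eps0 : forall n, 0 < eps n) (epscvg : eps @ \oo --> (0 : R)).

Lemma riemann_lebesgue_on D r q k h : measurable D -> 1 < r -> q != 0 -> cLfun mu D r h ->
  (forall z, D z -> ~ Qbox k z -> h z = 0) ->
  ccvg (fun n => cintegral mu D (fun z => osc q (eps n)^-1 z.1 * h z)) 0.
Proof.
move=> mD r1 q0 Lh h0; have mQ : measurable (Qbox k : set Z) by exact: measurable_zobox.
have := riemann_lebesgue eps0 epscvg r1 q0 (cLfun_ext mD mQ Lh h0); congr ccvg.
apply/funext => n.
rewrite (@cintegral_sub _ _ _ mu D (D `&` Qbox k)); last 2 first.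
- by move=> z [].
- move=> z Dz nDQ; rewrite h0 ?mulr0// => Qz; exact: nDQ.
rewrite (@cintegral_sub _ _ _ mu (Qbox k) (D `&` Qbox k)); last 2 first.
- by move=> z [].
- move=> z Qz nDQ; rewrite /cext memNset ?mulr0// => Dz; exact: nDQ.
by apply: eq_cintegral => z [Dz _]; rewrite /cext mem_set.
Qed.

Lemma ccvg_eps (c_ : nat -> R[i]) B : (forall n, normc (c_ n) <= B) ->
  ccvg (fun n => (eps n)%:C * c_ n) 0.
Proof.
move=> hB; apply: (@ccvg_le _ _ (fun n => eps n * B)).
  by rewrite -[X in _ --> X](mul0r B); apply: cvgM => //; exact: cvg_cst.
by move=> n; rewrite normcM normcR gtr0_norm// ler_wpM2l// ltW.
Qed.

End riemann_lebesgue_on.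

End products.

(** * Removing a factor with negligible zero set *)

Section from_test_functions.
Context {R : realType} (d : nat).
Local Notation E := 'rV[R]_d.
Local Notation Z := (E * E)%type.
Local Notation J := ('I_d + 'I_d)%type.
Local Notation mu := (@phase_measure R d).
Variables (p p' M : R) (D : set Z) (b : Z -> R) (v_ : nat -> Z -> R[i]).
Hypotheses (p1 : 1 < p) (pq : p^-1 + p'^-1 = 1) (oD : open D).
Hypotheses (cb : forall z, D z -> {for z, continuous b})
  (b_null : mu.-negligible (D `&` b @^-1` [set 0])).
Hypotheses (Lv : forall n, cLfun mu D p (v_ n)) (vM : forall n, nrm mu D p (v_ n) <= M).
Hypothesis null_test : forall phi, test_fun D phi ->
  ccvg (fun n => cintegral mu D (fun z => v_ n z * ((b z)%:C * phi z))) 0.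

Let p0 : 0 < p. Proof. exact: lt_trans p1. Qed.
Let p'1 : 1 < p'. Proof. exact: conj_gt1 p1 pq. Qed.
Let p'0 : 0 < p'. Proof. exact: lt_trans p'1. Qed.
Let qp : p'^-1 + p^-1 = 1. Proof. by rewrite addrC. Qed.
Let mD : measurable D. Proof. exact: open_measurableZ. Qed.
Let mb : measurable_fun D b.
Proof.
apply: continuous_within_measurable => //; rewrite continuous_open_subspace// => z /set_mem Dz.
exact: cb.
Qed.

Let mjbox (A B : Z) : measurable (jbox A B).
Proof. by rewrite jboxE; exact: measurable_zobox. Qed.

Let jcS (A B : Z) : jbox A B `<=` jcbox A B.
Proof. by move=> z h j; have /andP[/ltW-> /ltW->] := h j. Qed.

Let jbox_bound A B : jcbox A B `<=` D -> exists2 Mb, 0 <= Mb & forall z, jcbox A B z -> `|b z| <= Mb.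
Proof.
move=> sub; apply: locally_bounded_compact; first exact: compact_jcbox.
by move=> z /sub Dz; exists (`|b z| + 1); exact: near_bounded (cb Dz).
Qed.

Let jbox_fin A B : (mu (jbox A B) < +oo)%E.
Proof. by rewrite jboxE; exact: zobox_fin. Qed.

Let bmeas : cmeas D (fun z => (b z)%:C). Proof. exact: cmeas_real. Qed.

Let bind_dom A B : jcbox A B `<=` D -> exists2 Mb, 0 <= Mb &
  forall z, normc ((b z)%:C * cind (jbox A B) z) <= normc (Mb%:C * cind (jbox A B) z).
Proof.
move=> sub; have [Mb Mb0 hb] := jbox_bound sub; exists Mb => // z.
rewrite !normcM /cind indicE; have [Qz|nQ] := pselect (jbox A B z); last first.
  by rewrite memNset// !normcR normr0 !mulr0.
by rewrite mem_set// !normcR normr1 !mulr1 [leRHS]ger0_norm// hb//; exact: jcS.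
Qed.

(** Bumps tend to the indicator of the box, dominated by it, and [b] is bounded on the closed box
    since that is a compact part of D. *)
Let null_box A B : jcbox A B `<=` D ->
  null_against D v_ (fun z => (b z)%:C * cind (jbox A B) z).
Proof.
move=> sub; have [Mb Mb0 hb] := bind_dom sub.
have [L1 _] := cLfun_ind mD p'0 (mjbox A B) (jbox_fin A B).
have [LM _] := cLfunZ mD (Mb%:C) p'0 L1.
have mc : cmeas D (cind (jbox A B) : Z -> R[i]) by exact: cmeas_ind.
have mu_ k : cmeas D (fun z => (zbump A B k z)%:C).
  by apply: cmeas_real; apply: measurable_funTS; apply: continuous_within_measurable;
   [exact: openT|exact/continuous_subspaceT/rsmooth_continuous/rsmooth_bump].
have Lb : cLfun mu D p' (fun z => (b z)%:C * cind (jbox A B) z).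
  by apply: (cLfun_le mD p'0 _ LM _).1 => //; exact: cmeasM.
apply: (null_against_closed mD p'1 qp Lv vM Lb) => e e0.
pose g_ k z := (b z)%:C * cind (jbox A B) z - (b z)%:C * (zbump A B k z)%:C.
have mg k : cmeas D (g_ k) by apply: cmeasB; exact: cmeasM.
have dom k z : D z -> normc (g_ k z) <= normc (Mb%:C * cind (jbox A B) z).
  move=> _; apply: le_trans (hb z); rewrite /g_ -mulrBr !normcM ler_wpM2l ?normc_ge0//.
  rewrite /cind -rmorphB !normcR indicE; have [Qz|nQ] := pselect (jbox A B z); last first.
    by rewrite memNset// bump_off// subrr.
  by rewrite mem_set// normr1 ger0_norm ?subr_ge0 ?bump_le1// gerBl bump_ge0.
have cvg0 : {ae mu, forall z, D z -> normc (g_ k z) @[k --> \oo] --> (0 : R)}.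
  apply: nearW => z _; rewrite /g_ /cind.
  under eq_fun do rewrite -mulrBr normcM -rmorphB normcR [normc _]normcR.
  have h : (fun k => `|b z| * `|\1_(jbox A B) z - zbump A B k z|) @ \oo -->
      (`|b z| * `|\1_(jbox A B) z - \1_(jbox A B) z| : R).
    apply: cvgM; first exact: cvg_cst.
    by apply: cvg_norm; apply: cvgB; [exact: cvg_cst|exact: bump_cvg].
  by move: h; rewrite subrr normr0 mulr0.
have [k _ hk] := nrm_dct mD p'0 mg LM dom cvg0 e0.
have [Lg ng] := hk k (leqnn k).
exists (fun z => (b z)%:C * (zbump A B k z)%:C); split => //.
  have [L2 _] := cLfunB mD (ltW p'1) Lb Lg.
  by apply: (cLfun_eq mD p'0 _ L2).1 => z _; rewrite /g_ opprB addrC subrK.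
by apply: null_test; exact: test_fun_bump.
Qed.

(** The bounded factor b 1_box is absorbed into the sequence, so that density of box indicators
    applies to g alone; intersecting with a box gives a smaller box, covered by [null_box]. *)
Let null_local A B g : jcbox A B `<=` D -> cLfun mu D p' g ->
  null_against D v_ (fun z => (b z)%:C * (cind (jbox A B) z * g z)).
Proof.
move=> sub Lg; have [Mb Mb0 hb] := bind_dom sub.
have mc : cmeas D (cind (jbox A B) : Z -> R[i]) by exact: cmeas_ind.
have bM z : D z -> normc ((b z)%:C * cind (jbox A B) z) <= Mb.
  move=> _; apply: le_trans (hb z) _; rewrite normcM /cind indicE !normcR (ger0_norm Mb0).
  by case: (_ \in _); rewrite ?normr1 ?mulr1// normr0 mulr0.
pose w_ n z := ((b z)%:C * cind (jbox A B) z) * v_ n z.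
have Lw n := cLfunMb mD p0 Mb0 (cmeasM bmeas mc) bM (Lv n).
have wM n : nrm mu D p (w_ n) <= Mb * M by apply: le_trans (Lw n).2 _; rewrite ler_wpM2l.
have := @null_seq_density _ _ D p' p (Mb * M) w_ mD p'1 qp (fun n => (Lw n).1) wM.
have boxes a1 b1 a2 b2 : null_against D w_ (cind (zobox a1 b1 a2 b2)).
  pose A' : Z := (\row_i Num.max (A.1 0 i) (a1 0 i), \row_i Num.max (A.2 0 i) (a2 0 i)).
  pose B' : Z := (\row_i Num.min (B.1 0 i) (b1 0 i), \row_i Num.min (B.2 0 i) (b2 0 i)).
  have EI : jbox A' B' = jbox A B `&` zobox a1 b1 a2 b2.
    by rewrite !jboxE /zobox -setXI !oboxI.
  have sub' : jcbox A' B' `<=` D.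
    apply: subset_trans sub => z h [i|i]; [have := h (inl i)|have := h (inr i)];
    by rewrite /= !mxE ge_max le_min => /andP[/andP[-> _] /andP[-> _]].
  have := null_box sub'; congr ccvg; apply/funext => n; apply: eq_cintegral => z _.
  by rewrite /w_ EI /cind indicI rmorphM/=; ring.
move=> /(_ boxes g Lg); congr ccvg; apply/funext => n; apply: eq_cintegral => z _.
by rewrite /w_; ring.
Qed.

(* [reg j (b z)] is a bounded continuous substitute for [1 / b z]. *)
Let delt (j : nat) : R := j.+1%:R^-1.
Let reg j (t : R) : R := t / (t ^+ 2 + delt j).

Let delt0 j : 0 < delt j. Proof. by rewrite invr_gt0 ltr0n. Qed.
Let den0 j t : 0 < t ^+ 2 + delt j. Proof. by rewrite ltr_wpDl ?sqr_ge0. Qed.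

Let reg_cts j : continuous (reg j).
Proof.
move=> t; apply: cvgM; first exact: cvg_id.
apply: cvgV; first by rewrite gt_eqF.
by apply: cvgD; [exact: exprn_continuous|exact: cvg_cst].
Qed.

Let reg_bound j t : `|reg j t| <= 1 + j.+1%:R.
Proof.
rewrite /reg normrM normfV (gtr0_norm (den0 j t)) ler_pdivrMr//.
have h1 : `|t| <= 1 + t ^+ 2.
  by rewrite -real_normK ?num_real//; set x := `|t|; have := sqr_ge0 (x - 1); nra.
apply: le_trans h1 _; have e1 : j.+1%:R * delt j = 1 :> R by rewrite /delt mulfV// pnatr_eq0.
have j0 : (0 : R) <= j.+1%:R by [].
have t0 := sqr_ge0 t; have d0 := ltW (delt0 j).
rewrite mulrDl mul1r mulrDr e1 -addrA [leLHS]addrC; rewrite lerD2l.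
by rewrite addrA lerDr addr_ge0// mulr_ge0.
Qed.

(** With t = b z, 1 - t reg_j(t) = delt_j / (t^2 + delt_j) lies in [0, 1] and tends to 0 unless t =
    0. Since [b] vanishes only on a null set, g is on the box an L^{p'} limit of b reg_j(b) g, to
    which [null_local] applies. *)
Let null_cind A B g : jcbox A B `<=` D -> cLfun mu D p' g ->
  null_against D v_ (fun z => cind (jbox A B) z * g z).
Proof.
move=> sub Lg; have mc : cmeas D (cind (jbox A B) : Z -> R[i]) by exact: cmeas_ind.
have c1 z : D z -> normc (cind (jbox A B) z : R[i]) <= 1.
  by move=> _; rewrite /cind indicE normcR; case: (_ \in _); rewrite ?normr1// normr0.
have [Lc _] := cLfunMb mD p'0 ler01 mc c1 Lg.
apply: (null_against_closed mD p'1 qp Lv vM Lc) => e e0.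
have mreg j : cmeas D (fun z => (reg j (b z))%:C).
  apply: cmeas_real; apply: (measurableT_comp (f := reg j)) => //.
  exact: continuous_measurable_fun.
pose h j z := (b z)%:C * (cind (jbox A B) z * ((reg j (b z))%:C * g z)).
have r0 j : 0 <= 1 + j.+1%:R :> R by rewrite addr_ge0.
have Lr j : cLfun mu D p' (fun z => (reg j (b z))%:C * g z).
  by apply: (cLfunMb mD p'0 (r0 j) (mreg j) _ Lg).1 => z _; rewrite normcR.
have mh j : cmeas D (h j) by apply: cmeasM => //; apply: cmeasM => //; exact: cLfun_meas (Lr j).
pose g_ j z := cind (jbox A B) z * g z - h j z.
have gE j z : g_ j z = (delt j / (b z ^+ 2 + delt j))%:C * (cind (jbox A B) z * g z).
  have -> : delt j / (b z ^+ 2 + delt j) = 1 - b z * reg j (b z).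
    have x0 : b z ^+ 2 + delt j != 0 by rewrite gt_eqF.
    by rewrite /reg; field.
  have -> : (1 - b z * reg j (b z))%:C = 1 - (b z)%:C * (reg j (b z))%:C.
    by rewrite rmorphB rmorph1 rmorphM.
  by rewrite /g_ /h; ring.
have fr01 j z : 0 <= delt j / (b z ^+ 2 + delt j) <= 1.
  apply/andP; split; first by rewrite divr_ge0 ?(ltW (delt0 j)) ?(ltW (den0 j _)).
  by rewrite ler_pdivrMr// mul1r lerDr sqr_ge0.
have dom j z : D z -> normc (g_ j z) <= normc (cind (jbox A B) z * g z).
  move=> _; rewrite gE normcM ler_piMl ?normc_ge0// normcR ger0_norm; by have /andP[] := fr01 j z.
have cvg0 : {ae mu, forall z, D z -> normc (g_ k z) @[k --> \oo] --> (0 : R)}.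
  apply: negligibleS b_null => z /= /not_implyP[Dz nc]; split => //=; apply: contrapT => bz.
  apply: nc; under eq_fun do rewrite gE normcM normcR.
  have dcv : delt @ \oo --> (0 : R) by exact: cvg_harmonic.
  have b20 : b z ^+ 2 + 0 != 0 by rewrite addr0 expf_neq0//; apply/eqP.
  have h1 : (fun k => delt k / (b z ^+ 2 + delt k)) @ \oo --> (0 / (b z ^+ 2 + 0) : R).
    by apply: cvgM => //; apply: cvgV => //; apply: cvgD => //; exact: cvg_cst.
  have h2 : (fun k => `|delt k / (b z ^+ 2 + delt k)| * normc (cind (jbox A B) z * g z)) @ \oo -->
      (`|0 / (b z ^+ 2 + 0)| * normc (cind (jbox A B) z * g z) : R).
    by apply: cvgM; [exact: cvg_norm|exact: cvg_cst].
  by move: h2; rewrite mul0r normr0 mul0r.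
have [k _ hk] := nrm_dct mD p'0 (fun j => cmeasB (cLfun_meas Lc) (mh j)) Lc dom cvg0 e0.
have [Lk nk] := hk k (leqnn k).
exists (h k); split => //; last exact: null_local.
have [L2 _] := cLfunB mD (ltW p'1) Lc Lk.
by apply: (cLfun_eq mD p'0 _ L2).1 => z _; rewrite opprB addrC subrK.
Qed.

(** D is exhausted by finite unions of boxes. Adding a box replaces 1_U by 1_U + 1_Q (1 - 1_U), and
    g (1 - 1_U) is again in L^{p'}, which is why [null_cind] allows an arbitrary g. *)
Lemma null_of_test g : cLfun mu D p' g -> null_against D v_ g.
Proof.
move=> Lg; have [D0|/set0P D0] := eqVneq D set0.
  rewrite /null_against D0; apply: (@ccvg_le _ _ (fun=> 0)); first exact: cvg_cst.
  by move=> n; rewrite /cintegral !Rintegral_set0 normc0.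
have [F [hF cF]] : exists F : nat -> Z * Z, (forall k, jcbox (F k).1 (F k).2 `<=` D) /\
    D `<=` \bigcup_k jbox (F k).1 (F k).2.
  by apply: (@jbox_cover R d D (fun A B => jcbox A B `<=` D)) => // z; exact: ball_jcbox.
pose Q k := jbox (F k).1 (F k).2; pose U k := \big[setU/set0]_(i < k) Q i.
have mU k : measurable (U k) by apply: bigsetU_measurable => i _; exact: mjbox.
have mcU k : cmeas D (cind (U k) : Z -> R[i]) by exact: cmeas_ind.
have c01 (A : set Z) z : normc (cind A z : R[i]) <= 1.
  by rewrite /cind indicE normcR; case: (_ \in _); rewrite ?normr1// normr0.
have n01 (A : set Z) z : normc (1 - cind A z : R[i]) <= 1.
  have -> : 1 - cind A z = (1 - \1_A z)%:C :> R[i] by rewrite rmorphB rmorph1.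
  by rewrite normcR indicE; case: (_ \in _); rewrite ?subrr ?normr0// subr0 normr1.
have LU k := (cLfunMb mD p'0 ler01 (mcU k) (fun z _ => c01 (U k) z) Lg).1.
have Ln k := cLfunMb mD p'0 ler01 (cmeasB (cmeas_cst D 1) (mcU k)) (fun z _ => n01 (U k) z) Lg.
have nullU k : null_against D v_ (fun z => cind (U k) z * g z).
  elim: k => [|k IH].
    apply: (@ccvg_le _ _ (fun=> 0)); first exact: cvg_cst.
    move=> n; rewrite (_ : cintegral _ _ _ = 0) ?normc0//.
    rewrite -[RHS](@cintegral0 _ _ _ mu D); apply: eq_cintegral => z _.
    by rewrite /U big_ord0 /cind indicE memNset//= mul0r mulr0.
  have Lq : cLfun mu D p' (fun z => cind (Q k) z * ((1 - cind (U k) z) * g z)).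
    have mq : cmeas D (cind (Q k) : Z -> R[i]) by apply: cmeas_ind; exact: mjbox.
    exact: (cLfunMb mD p'0 ler01 mq (fun z _ => c01 (Q k) z) (Ln k).1).1.
  have := null_against_lin mD p'1 qp Lv 1 (LU k) Lq IH (null_cind (hF k) (Ln k).1).
  congr ccvg; apply/funext => n; apply: eq_cintegral => z _; congr (_ * _).
  rewrite mul1r /U big_ord_recr/= -/(U k) /cind !indicE in_setU -/(Q k).
  by case: (z \in U k); case: (z \in Q k) => /=; ring.
apply: (null_against_closed mD p'1 qp Lv vM Lg) => e e0.
have cvg0 : {ae mu, forall z, D z -> normc ((1 - cind (U k) z) * g z) @[k --> \oo] --> (0 : R)}.
  apply: nearW => z Dz; have [k _ Qz] := cF z Dz.
  apply: cvg_near_cst; exists k.+1 => // n /= kn.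
  rewrite /cind indicE mem_set ?subrr ?mul0r ?normc0//.
  by rewrite /U -bigcup_mkord; exists k.
have dom k z : D z -> normc ((1 - cind (U k) z) * g z) <= normc (g z).
  by move=> _; rewrite normcM ler_piMl ?normc_ge0.
have [k _ hk] := nrm_dct mD p'0 (fun k => cLfun_meas (Ln k).1) Lg dom cvg0 e0.
have [Lk nk] := hk k (leqnn k).
exists (fun z => cind (U k) z * g z); split => //.
rewrite (_ : (fun z => _) = (fun z => (1 - cind (U k) z) * g z))//.
by apply/funext => z; ring.
Qed.

End from_test_functions.

(** * Grids of half-open product cells *)

Section grid.
Context {R : realType} (d : nat) (k N : nat).
Local Notation E := 'rV[R]_d.
Local Notation Z := (E * E)%type.
Local Notation J := ('I_d + 'I_d)%type.
Local Notation I := {ffun J -> 'I_(2 * k * N.+1)}.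
Local Notation lam := (@lebesgue_rV R d).

(** The subdivision of [-k, k) with step 1/(N+1), hence 2 k (N+1) intervals in each direction.
    Half-open intervals make the cells disjoint, so a sum over cells has at most one nonzero term at
    each point. *)
Definition gpt (t : nat) : R := t%:R / N.+1%:R - k%:R.

Definition gcellA (m : I) : set E := [set x | forall i, gpt (m (inl i)) <= x 0 i < gpt (m (inl i)).+1].
Definition gcellB (m : I) : set E := [set x | forall i, gpt (m (inr i)) <= x 0 i < gpt (m (inr i)).+1].

Let N0 : (0 : R) < N.+1%:R. Proof. by rewrite ltr0n. Qed.

Lemma gcell_itvbox (lo hi : 'I_d -> R) :
  measurable [set x : E | forall i, lo i <= x 0 i < hi i] /\
  (lam [set x : E | forall i, (lo i <= x 0%R i < hi i)%R] < +oo)%E.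
Proof.
have -> : [set x : E | forall i, lo i <= x 0 i < hi i] = itvbox (fun i => `[lo i, hi i[%classic).
  by apply/seteqP; split => x h i; have := h i; rewrite /= in_itv.
split; first by apply: measurable_itvbox => i; exact: measurable_itv.
apply: itvbox_fin => i; first exact: measurable_itv.
by rewrite lebesgue_measure_itv/=; case: ifP => _; rewrite ?ltry// -EFinB ltry.
Qed.

Lemma measurable_gcellA m : measurable (gcellA m). Proof. by have [] := gcell_itvbox (fun i => gpt (m (inl i))) (fun i => gpt (m (inl i)).+1). Qed.
Lemma measurable_gcellB m : measurable (gcellB m). Proof. by have [] := gcell_itvbox (fun i => gpt (m (inr i))) (fun i => gpt (m (inr i)).+1). Qed.
Lemma gcellA_fin m : (lam (gcellA m) < +oo)%E. Proof. by have [] := gcell_itvbox (fun i => gpt (m (inl i))) (fun i => gpt (m (inl i)).+1). Qed.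
Lemma gcellB_fin m : (lam (gcellB m) < +oo)%E. Proof. by have [] := gcell_itvbox (fun i => gpt (m (inr i))) (fun i => gpt (m (inr i)).+1). Qed.

Definition gcell (m : I) : set Z := gcellA m `*` gcellB m.

Lemma gcellP m z : gcell m z <-> forall j, gpt (m j) <= coord j z < gpt (m j).+1.
Proof.
split; first by move=> [h1 h2] [i|i]; [exact: h1|exact: h2].
by move=> h; split => i; [exact: (h (inl i))|exact: (h (inr i))].
Qed.

Lemma cind_gcell m z : cind (gcell m) z = cind (gcellA m) z.1 * cind (gcellB m) z.2 :> R[i].
Proof.
rewrite /cind -rmorphM/= /gcell; case: z => x y /=; congr (_%:C).
by rewrite !indicE in_setX; case: (_ \in _); case: (_ \in _); rewrite ?mulr1 ?mulr0.
Qed.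

Lemma gcell_cover z : Qbox k z -> exists m, gcell m z.
Proof.
move=> /QboxP h; pose t j := Num.truncn ((coord j z + k%:R) * N.+1%:R).
have h0 j : 0 <= (coord j z + k%:R) * N.+1%:R.
  by rewrite mulr_ge0// -lerBlDr sub0r; have := h j; rewrite ltr_norml => /andP[/ltW].
have ht j := truncn_itv (h0 j).
have tM j : (t j < 2 * k * N.+1)%N.
  rewrite -(ltr_nat R); have /andP[h1 _] := ht j; apply: le_lt_trans h1 _.
  rewrite natrM ltr_pM2r// mul2n -addnn natrD ltrD2r.
  by have := h j; rewrite ltr_norml => /andP[].
exists [ffun j => Ordinal (tM j)]; apply/gcellP => j; rewrite ffunE /gpt /=.
have /andP[h1 h2] := ht j.
by rewrite lerBlDr ler_pdivrMr// h1/= ltrBrDr ltr_pdivlMr.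
Qed.

Lemma gpt_inj (x : R) (s t : nat) : gpt s <= x < gpt s.+1 -> gpt t <= x < gpt t.+1 -> s = t.
Proof.
move=> /andP[s1 s2] /andP[t1 t2].
have key u v : gpt u < gpt v.+1 -> (u <= v)%N.
  by rewrite /gpt ltrD2r ltr_pM2r ?invr_gt0// ltr_nat.
by apply/eqP; rewrite eqn_leq !key// ?(le_lt_trans s1)// (le_lt_trans t1).
Qed.

Lemma gcell_uniq m m' z : gcell m z -> gcell m' z -> m = m'.
Proof.
move=> /gcellP h /gcellP h'; apply/ffunP => j; apply/val_inj.
exact: gpt_inj (h j) (h' j).
Qed.

Lemma gcell_ball m z z' r : N.+1%:R^-1 < r -> gcell m z -> gcell m z' -> ball z r z'.
Proof.
move=> Nr /gcellP h /gcellP h'.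
have r0 : 0 < r by apply: lt_trans Nr; rewrite invr_gt0.
have key j : `|coord j z - coord j z'| < r.
  have /andP[a1 a2] := h j; have /andP[b1 b2] := h' j.
  have e : gpt (m j).+1 = gpt (m j) + N.+1%:R^-1.
    by rewrite /gpt -natr1 mulrDl mul1r addrAC.
  move: a1 a2 b1 b2; rewrite e; move: (gpt _) (coord j z) (coord j z') (N.+1%:R^-1 : R) Nr => g s t v vr a1 a2 b1 b2.
  rewrite ltr_norml; apply/andP; split; lra.
by split; apply/rV_ballP => // i; [exact: (key (inl i))|exact: (key (inr i))].
Qed.

(** The index k+1 is needed because cells contain their left ends, in particular -k, while [Qbox] is
    open. *)
Lemma gcell_Qbox m z : gcell m z -> Qbox k.+1 z.
Proof.
move=> /gcellP h; apply/QboxP => j; have /andP[h1 h2] := h j.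
have a1 : - k%:R <= gpt (m j) by rewrite /gpt lerDr divr_ge0.
have a2 : gpt (m j).+1 <= k%:R.
  rewrite /gpt lerBlDr ler_pdivrMr// -natrD -natrM ler_nat addnn -mul2n; exact: ltn_ord.
have k1 : (k.+1%:R : R) = k%:R + 1 by rewrite -natr1.
rewrite ltr_norml k1; apply/andP; split; lra.
Qed.

Lemma gcell_sum (c : I -> R[i]) m z : gcell m z -> \sum_m' c m' * cind (gcell m') z = c m.
Proof.
move=> hm; rewrite (bigD1 m)//= big1 ?addr0.
  by rewrite /cind indicE mem_set// mulr1.
move=> m' mm'; rewrite /cind indicE memNset ?mulr0// => hm'.
by move/eqP: mm'; apply; exact: gcell_uniq hm' hm.
Qed.

Lemma gcell_sum0 (c : I -> R[i]) z : (forall m, ~ gcell m z) -> \sum_m' c m' * cind (gcell m') z = 0.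
Proof.
by move=> hm; rewrite big1// => m _; rewrite /cind indicE memNset ?mulr0.
Qed.

End grid.

(** * Homogenization *)

Section homogenization.
Context {R : realType} (d : nat).
Local Notation E := 'rV[R]_d.
Local Notation Z := (E * E)%type.
Local Notation J := ('I_d + 'I_d)%type.
Local Notation mu := (@phase_measure R d).
Local Notation lam := (@lebesgue_rV R d).
Variables (p p' : R) (Omega V : set E) (a : E -> E -> E) (sigma : E -> E -> E -> R)
  (K : (E -> R[i]) -> E -> R[i]) (eps : nat -> R).
Hypotheses (p1 : 1 < p) (pq : p^-1 + p'^-1 = 1).
Hypotheses (oO : open Omega) (cO : connected Omega) (oV : open V) (cV : connected V).
Local Notation D := (Omega `*` V).
Hypothesis a_analytic : forall i : 'I_d, real_analytic D (fun z => a z.1 z.2 0 i).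
Hypothesis sigma_continuous : {within (Omega `*` [set: E]) `*` V,
     continuous (fun z : E * E * E => sigma z.1.1 z.1.2 z.2)}.
Hypothesis sigma_periodic : forall x y l (k : 'rV[int]_d), Omega x -> V l ->
     sigma x (y + map_mx intr k) l = sigma x y l.
Hypotheses (K_cts : cts_linear_Lp lam V p K)
  (K_Lp' : forall u, cLfun lam V p' u -> cLfun lam V p' (K u))
  (K_symm : symmetric_Lp lam V p p' K).
Hypotheses (eps0 : forall n, 0 < eps n) (epscvg : eps @ \oo --> (0 : R)).

Let p0 : 0 < p. Proof. exact: lt_trans p1. Qed.
Let p'1 : 1 < p'. Proof. exact: conj_gt1 p1 pq. Qed.
Let p'0 : 0 < p'. Proof. exact: lt_trans p'1. Qed.
Let qp : p'^-1 + p^-1 = 1. Proof. by rewrite addrC. Qed.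
Let oD : open D.
Proof.
by rewrite openE => z [hO hV]; exists (Omega, V) => //=; split; exact: open_nbhs_nbhs.
Qed.
Let mD : measurable D. Proof. exact: open_measurableZ. Qed.
Let mO : measurable Omega. Proof. exact: open_measurable_rV. Qed.
Let mV : measurable V. Proof. exact: open_measurable_rV. Qed.

Lemma sigma_cts_at x y l : Omega x -> V l ->
  {for (x, y, l), continuous (fun z : E * E * E => sigma z.1.1 z.1.2 z.2)}.
Proof.
move=> Ox Vl.
have oA : open ((Omega `*` [set: E]) `*` V).
  rewrite openE => -[[x' y'] l'] [[/= hO _] hV].
  exists (Omega `*` [set: E], V); last by move=> [[? ?] ?].
  split => /=; last by apply: open_nbhs_nbhs.
  exists (Omega, setT) => //=; split; last exact: filterT.
  by apply: open_nbhs_nbhs.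
have cs := sigma_continuous.
rewrite continuous_open_subspace// in cs.
by apply: cs; apply: mem_set.
Qed.

Lemma sigma_cts_y x l : Omega x -> V l -> continuous (fun y => sigma x y l).
Proof.
move=> Ox Vl y.
have c1 : {for y, continuous (fun _ : E => x)} by exact: cst_continuous.
have c2 : {for y, continuous (fun t : E => t)} by exact: cvg_id.
have c3 : {for y, continuous (fun _ : E => l)} by exact: cst_continuous.
exact: (@continuous_comp _ _ _ _ (fun z : E * E * E => sigma z.1.1 z.1.2 z.2) _
  (pair_continuous_at (pair_continuous_at c1 c2) c3) (sigma_cts_at Ox Vl)).
Qed.

(** * The coefficient multiplied by a compactly supported function *)

Section sigma_ext.
Variables (S : set Z) (g : Z -> R).
Hypotheses (cS : compact S) (SD : S `<=` D) (cg : continuous g) (g0 : forall z, ~ S z -> g z = 0).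

(** The hypotheses on [sigma] hold over D only; the compactly supported factor g makes the product
    continuous and periodic everywhere. The slow variables are grouped together, apart from the fast
    one. *)
Definition sext (zy : Z * E) : R := sigma zy.1.1 zy.2 zy.1.2 * g zy.1.

Lemma sext_continuous : continuous sext.
Proof.
have cS' : closed [set zy : Z * E | S zy.1].
  by apply: (@closed_comp _ _ fst S _ (compact_closedZ cS)) => zy _; exact: cvg_fst.
apply: (@ext_continuous _ _ [set zy : Z * E | D zy.1] _ _ cS').
- by move=> zy /= /SD.
- move=> [[x l] y] [/= Ox Vl]; apply: cvgM; last first.
    apply: (@cvg_comp _ _ _ fst g); [exact: cvg_fst|exact: cg].
  have c1 : {for (x, l, y), continuous (fun zy : Z * E => zy.1.1)}.
    by apply: (@cvg_comp _ _ _ fst fst); [exact: cvg_fst|exact: cvg_fst].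
  have c2 : {for (x, l, y), continuous (fun zy : Z * E => zy.1.2)}.
    by apply: (@cvg_comp _ _ _ fst snd); [exact: cvg_fst|exact: cvg_snd].
  have c3 : {for (x, l, y), continuous (fun zy : Z * E => zy.2)} by exact: cvg_snd.
  have c4 := pair_continuous_at (pair_continuous_at c1 c3) c2.
  exact: (@continuous_comp _ _ _ _ (fun z : E * E * E => sigma z.1.1 z.1.2 z.2) _ c4 (sigma_cts_at Ox Vl)).
- by move=> zy /= nS; rewrite /sext g0// mulr0.
Qed.

Lemma sext_periodic z y (k : 'rV[int]_d) : sext (z, y + map_mx intr k) = sext (z, y).
Proof.
rewrite /sext /=; have [Sz|nS] := pselect (S z); last by rewrite g0// !mulr0.
by have [Oz Vz] := SD Sz; rewrite sigma_periodic.
Qed.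

Lemma sext_bounded : exists2 M, 0 <= M & forall zy, `|sext zy| <= M.
Proof.
have cC : compact (S `*` cbox 0 (const_mx 1) : set (Z * E)).
  by apply: compact_setX => //; exact: compact_cbox.
have [M M0 hM] := compact_fun_bounded cC sext_continuous.
exists M => // -[z y]; have [Sz|nS] := pselect (S z); last by rewrite /sext /= g0// mulr0 normr0.
have [k hk] := cube_shift y.
by rewrite -(sext_periodic z y k); apply: hM; split.
Qed.

(** Uniformity in all y, as y = x / eps_n is unbounded: periodicity brings y into the unit cube, and
    Heine applies on S times the cube. If neither point is in S, both values vanish. *)
Lemma sext_uniform e : 0 < e -> exists2 r, 0 < r & forall z z' y, ball z r z' ->
  `|sext (z, y) - sext (z', y)| <= e.
Proof.
move=> e0; have cC : compact (S `*` cbox 0 (const_mx 1) : set (Z * E)).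
  by apply: compact_setX => //; exact: compact_cbox.
have [r r0 hr] := heine cC sext_continuous e0.
exists r => //.
have key z z' y : S z -> ball z r z' -> `|sext (z, y) - sext (z', y)| <= e.
  move=> Sz bz; have [k hk] := cube_shift y.
  rewrite -(sext_periodic z y k) -(sext_periodic z' y k).
  apply: hr; first by split.
  by split => //=; exact: ballxx.
move=> z z' y bz; have [Sz|nS] := pselect (S z); first exact: key.
have [Sz'|nS'] := pselect (S z').
  by rewrite distrC; apply: key => //; exact: ball_sym.
by rewrite /sext /= !g0// !mulr0 subrr normr0 ltW.
Qed.

Lemma sext_shift_continuous (s : R) : continuous (fun z : Z => sext (z, s *: z.1)).
Proof.
move=> z.
have c1 : {for z, continuous (fun t : Z => t)} by exact: cvg_id.
have c2 : {for z, continuous (fun t : Z => s *: t.1)} by apply: cvgZr; exact: cvg_fst.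
have c3 : {for (z, s *: z.1), continuous sext} by exact: sext_continuous.
have c4 := continuous_comp (pair_continuous_at c1 c2) c3; exact: c4.
Qed.

Lemma sext_cts_y z : continuous (fun y => sext (z, y)).
Proof.
move=> y; have c1 : {for y, continuous (fun _ : E => z)} by exact: cst_continuous.
have c2 : {for y, continuous (fun t : E => t)} by exact: cvg_id.
have c3 : {for (z, y), continuous sext} by exact: sext_continuous.
exact: (continuous_comp (pair_continuous_at c1 c2) c3).
Qed.

Local Notation Qu := (@ucube R d).

(** The zeroth Fourier coefficient times g, in a form that inherits the modulus of continuity of
    [sext]. *)
Definition smean (z : Z) : R := \int[lam]_(y in Qu) sext (z, y).

Let cube_int (h : E -> R) M : measurable_fun setT h -> (forall y, `|h y| <= M) ->
  lam.-integrable Qu (EFin \o h).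
Proof.
move=> mh hM; have := @cintegrable_cube _ _ (fun y => (h y)%:C) M.
case=> //; first by apply: cmeas_real; exact: measurable_funTS.
by move=> y _; rewrite normcR.
Qed.

Lemma smean_uniform e z z' : (forall y, `|sext (z, y) - sext (z', y)| <= e) ->
  `|smean z - smean z'| <= e.
Proof.
move=> h; have mQ := @measurable_ucube R d; have [M M0 hM] := sext_bounded.
have ms t : measurable_fun setT (fun y => sext (t, y)).
  by apply: continuous_measurable_rV; exact: sext_cts_y.
have i1 t := cube_int (ms t) (fun y => hM (t, y)).
have i2 := cube_int (measurable_funB (ms z) (ms z')) h.
have vol : \int[lam]_(y in Qu) (1 : R) = 1.
  have := @cintegral_tw R d 0; rewrite eqxx => /(congr1 (@complex.Re R)) /= h1.
  rewrite -{}[RHS]h1; apply: eq_Rintegral => y _.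
  by have := congr1 (@complex.Re R) (tw0 y).
rewrite /smean -RintegralB//; apply: le_trans (le_normr_Rintegral mQ i2) _.
have i3 : lam.-integrable Qu (EFin \o (fun=> e)) by apply: (@cube_int (fun=> e) `|e|).
apply: le_trans (le_Rintegral mQ _ i3 (fun y _ => h y)) _.
  by apply: (@cube_int (fun y => `|_|) e); [apply: measurableT_comp => //; exact: measurable_funB|move=> y; rewrite normr_id].
have -> : \int[lam]_(y in Qu) e = e * \int[lam]_(y in Qu) (1 : R).
  by rewrite -RintegralZl//; [apply: eq_Rintegral => y _; rewrite mulr1|apply: (@cube_int (fun=> 1) `|1|)].
by rewrite vol mulr1.
Qed.

Lemma smean_continuous : continuous smean.
Proof.
move=> z; apply/cvgrPdist_le => e e0; have [r r0 hr] := sext_uniform e0.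
have := nbhsx_ballx (z : Z) r r0; apply: filterS => z' bz.
by apply: smean_uniform => y; exact: hr.
Qed.

End sigma_ext.

Definition sphi (phi : Z -> R[i]) (s : R) (z : Z) : R[i] := (sigma z.1 (s *: z.1) z.2)%:C * phi z.

Lemma sphi_cLfun phi : test_fun D phi -> exists2 B, 0 <= B &
  forall s, cLfun mu D p' (sphi phi s) /\ nrm mu D p' (sphi phi s) <= B.
Proof.
move=> /test_fun_parts[S [cS SD f0 s1 s2]].
have z1 w : ~ S w -> (@complex.Re R \o phi) w = 0 by move=> nw /=; rewrite f0.
have z2 w : ~ S w -> (@complex.Im R \o phi) w = 0 by move=> nw /=; rewrite f0.
have c1 := rsmooth_continuous s1; have c2 := rsmooth_continuous s2.
have [M1 M10 h1] := sext_bounded cS SD c1 z1.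
have [M2 M20 h2] := sext_bounded cS SD c2 z2.
have [k Sk] := compact_Qbox cS.
have E1 s : @complex.Re R \o sphi phi s = (fun z => sext (@complex.Re R \o phi) (z, s *: z.1)).
  by apply/funext => z; rewrite /sphi /sext /= cReM/= mul0r subr0.
have E2 s : @complex.Im R \o sphi phi s = (fun z => sext (@complex.Im R \o phi) (z, s *: z.1)).
  by apply/funext => z; rewrite /sphi /sext /= cImM/= mul0r addr0.
exists ((M1 + M2) * nrm mu D p' (cind (Qbox k))).
  by rewrite mulr_ge0 ?addr_ge0 ?nrm_ge0.
move=> s; apply: bounded_support_cLfun => //.
- by rewrite addr_ge0.
- apply: cts_cmeas => //.
    by rewrite E1; exact: (sext_shift_continuous cS SD c1 z1).
  by rewrite E2; exact: (sext_shift_continuous cS SD c2 z2).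
- move=> z _; apply: le_trans (normc_le _) _.
  have e1 := congr1 (fun f => f z) (E1 s); have e2 := congr1 (fun f => f z) (E2 s).
  rewrite /= in e1 e2; rewrite e1 e2.
  exact: (lerD (h1 _) (h2 _)).
- by move=> z _ nQ; rewrite /sphi f0 ?mulr0// => /Sk.
Qed.

Variables (u_ : nat -> Z -> R[i]) (u : Z -> R[i]) (f_ : nat -> (Z -> R[i]) -> R[i]) (f : (Z -> R[i]) -> R[i]).
Hypothesis u_cvg : weak_Lp_cvg mu D p p' u_ u.
Hypothesis f_cvg : Wm1_loc_cvg D p' f_ f.
Variable w_ : nat -> Z -> R[i].
Hypothesis w_K : forall n, fiberwise Omega V p K (u_ n) (w_ n).
Hypothesis w_eq : forall n phi, test_fun D phi -> f_ n phi =
   - cintegral mu D (fun z => u_ n z * tdiv a phi z) +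
   cintegral mu D (fun z => (sigma z.1 ((eps n)^-1 *: z.1) z.2)%:C * w_ n z * phi z).

Let Lu_ n : cLfun mu D p (u_ n). Proof. by case: u_cvg. Qed.
Let Lu : cLfun mu D p u. Proof. by case: u_cvg. Qed.
Let Lw_ n : cLfun mu D p (w_ n). Proof. by case: (w_K n). Qed.

Lemma u_bounded : exists2 M, 0 <= M & forall n, nrm mu D p (u_ n) <= M.
Proof.
have [M hM] := weak_cvg_bounded mD p1 pq u_cvg.
by exists M => //; apply: le_trans (hM 0%N); exact: nrm_ge0.
Qed.

Lemma w_bounded : exists2 M, 0 <= M & forall n, nrm mu D p (w_ n) <= M.
Proof.
have [M M0 hM] := u_bounded; have [C C0 hC] := fiberwise_bounded mO mV p1 K_cts.
exists (C * M); first exact: mulr_ge0.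
by move=> n; apply: le_trans (hC _ _ (Lu_ n) (w_K n)) _; rewrite ler_wpM2l.
Qed.

Lemma osc_Lp r q s g : 0 < r -> cLfun mu D r g ->
  cLfun mu D r (fun z => osc q s z.1 * g z) /\
  nrm mu D r (fun z => osc q s z.1 * g z) <= nrm mu D r g.
Proof.
move=> r0 Lg; have := cLfunMb mD r0 ler01 (cmeas_osc1 q s D) _ Lg.
by rewrite mul1r; apply => z _; rewrite normc_osc.
Qed.

Lemma dotz_phi_bounded phi q : test_fun D phi -> exists2 M, 0 <= M &
  cmeas D (fun z => (dotz (a z.1 z.2) q)%:C * phi z) /\
  forall z, normc ((dotz (a z.1 z.2) q)%:C * phi z) <= M.
Proof.
move=> /test_fun_parts[S [cS SD f0 s1 s2]].
have [c1 c2] := dotz_phi_cts oD a_analytic q cS SD f0 s1 s2.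
have [M1 M10 h1] := compact_fun_bounded cS c1.
have [M2 M20 h2] := compact_fun_bounded cS c2.
exists (M1 + M2); first by rewrite addr_ge0.
split; first exact: cts_cmeas.
move=> z; have [Sz|nS] := pselect (S z); last by rewrite f0// mulr0 normc0 addr_ge0.
by apply: le_trans (normc_le _) _; apply: lerD; [exact: h1|exact: h2].
Qed.

Lemma dotz_phi_cLfun phi q r : 0 < r -> test_fun D phi ->
  cLfun mu D r (fun z => (dotz (a z.1 z.2) q)%:C * phi z).
Proof.
move=> r0 /test_fun_parts[S [cS SD f0 s1 s2]].
have [c1 c2] := dotz_phi_cts oD a_analytic q cS SD f0 s1 s2.
by apply: (cts_support_cLfun mD r0 cS) => // z nS; rewrite f0// mulr0.
Qed.

(** * Oscillating test functions in the transport equation *)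

Section test_null.
Variables (q : 'rV[int]_d) (q0 : q != 0).
Let e_ n (z : Z) : R[i] := osc q (eps n)^-1 z.1.

Lemma test_fun_osc phi n : test_fun D phi -> test_fun D (fun z => e_ n z * phi z).
Proof. by move=> tp; apply: test_funM => //; exact: smooth_osc. Qed.

(* In eps_n f_m (e_n phi) the singular factor 1 / eps_n produced by
   differentiating e_n cancels, and isolates the term in a . q. *)
Lemma eps_transport m n phi : test_fun D phi ->
  (eps n)%:C * f_ m (fun z => e_ n z * phi z) =
  (eps n)%:C * (cintegral mu D (fun z => w_ m z * (e_ n z * sphi phi (eps m)^-1 z)) -
     cintegral mu D (fun z => u_ m z * (e_ n z * tdiv a phi z))) -
  Complex 0 (2 * pi) * cintegral mu D (fun z => e_ n z * (u_ m z * ((dotz (a z.1 z.2) q)%:C * phi z))).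
Proof.
move=> tp; rewrite (w_eq m (test_fun_osc n tp)).
have Lt := (osc_Lp q (eps n)^-1 p'0 (tdiv_cLfun oD a_analytic (ltW p'1) tp)).1.
have La := (osc_Lp q (eps n)^-1 p'0 (dotz_phi_cLfun q p'0 tp)).1.
have [it _] := hoelder_cLfun mD p0 p'0 pq (Lu_ m) Lt.
have [ia _] := hoelder_cLfun mD p0 p'0 pq (Lu_ m) La.
have -> : cintegral mu D (fun z => u_ m z * tdiv a (fun z => e_ n z * phi z) z) =
    cintegral mu D (fun z => u_ m z * (e_ n z * tdiv a phi z)) +
    Complex 0 (2 * pi * (eps n)^-1) * cintegral mu D (fun z => e_ n z * (u_ m z * ((dotz (a z.1 z.2) q)%:C * phi z))).
  rewrite [X in _ * X](_ : _ = cintegral mu D (fun z => u_ m z * (e_ n z * ((dotz (a z.1 z.2) q)%:C * phi z)))); last first.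
    by apply: eq_cintegral => z _; rewrite mulrCA.
  rewrite -(cintegralZ mD _ ia) -(cintegralD mD it (cintegrableZ mD _ ia)).
  by apply: eq_cintegral => z _; rewrite (tdiv_osc a_analytic q _ z tp) mulrDr [X in _ + X]mulrCA.
have -> : cintegral mu D (fun z => (sigma z.1 ((eps m)^-1 *: z.1) z.2)%:C * w_ m z * (e_ n z * phi z)) =
    cintegral mu D (fun z => w_ m z * (e_ n z * sphi phi (eps m)^-1 z)).
  by apply: eq_cintegral => z _; rewrite /sphi; ring.
have -> : Complex 0 (2 * pi) = (eps n)%:C * Complex 0 (2 * pi * (eps n)^-1).
  have en0 : eps n != 0 by rewrite gt_eqF.
  by apply: eq_complexP; rewrite ?cReM ?cImM/=; field.
by ring.
Qed.

Let bounded_pair (g h : Z -> R[i]) M B : cLfun mu D p g -> nrm mu D p g <= M ->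
  cLfun mu D p' h -> nrm mu D p' h <= B ->
  normc (cintegral mu D (fun z => g z * h z)) <= 2 * (M * B).
Proof.
move=> Lg gM Lh hB; apply: le_trans (normc_cintegral_hoelder mD p0 p'0 pq Lg Lh) _.
by rewrite ler_wpM2l// ler_pM// nrm_ge0.
Qed.

Lemma regular_part_bounded phi : test_fun D phi -> exists B, forall m n,
  normc (cintegral mu D (fun z => w_ m z * (e_ n z * sphi phi (eps m)^-1 z)) -
     cintegral mu D (fun z => u_ m z * (e_ n z * tdiv a phi z))) <= B.
Proof.
move=> tp; have [Mu Mu0 hu] := u_bounded; have [Mw Mw0 hw] := w_bounded.
have [Bs Bs0 hs] := sphi_cLfun tp.
have Lt := tdiv_cLfun oD a_analytic (ltW p'1) tp.
exists (2 * (Mw * Bs) + 2 * (Mu * nrm mu D p' (tdiv a phi))) => m n.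
apply: le_trans (le_normcD _ _) _; rewrite normcN; apply: lerD.
  have [Ls ns] := hs (eps m)^-1; have [Lo no] := osc_Lp q (eps n)^-1 p'0 Ls.
  by apply: bounded_pair => //; exact: le_trans ns.
by have [Lo no] := osc_Lp q (eps n)^-1 p'0 Lt; apply: bounded_pair.
Qed.

(** With m frozen, u_m (a.q) phi is one fixed L^p function and its pairing with e_n tends to 0; the
    rest is eps_n times a bounded quantity. *)
Lemma fixed_null m phi : test_fun D phi ->
  ccvg (fun n => (eps n)%:C * f_ m (fun z => e_ n z * phi z)) 0.
Proof.
move=> tp; have [B hB] := regular_part_bounded tp.
have [M M0 [mg gM]] := dotz_phi_bounded q tp.
have Lh : cLfun mu D p (fun z => u_ m z * ((dotz (a z.1 z.2) q)%:C * phi z)).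
  have [L _] := cLfunMb mD p0 M0 mg (fun z _ => gM z) (Lu_ m).
  by apply: (cLfun_eq mD p0 _ L).1 => z _; rewrite mulrC.
have [S [cS SD f0 _ _]] := test_fun_parts tp; have [k Sk] := compact_Qbox cS.
have h0 z : D z -> ~ Qbox k z -> u_ m z * ((dotz (a z.1 z.2) q)%:C * phi z) = 0.
  by move=> _ nQ; rewrite f0 ?mulr0// => /Sk.
have c1 := riemann_lebesgue_on eps0 epscvg mD p1 q0 Lh h0.
have c2 := ccvg_eps eps0 epscvg (hB m).
have := ccvgD c2 (ccvgN (ccvgZ (Complex 0 (2 * pi)) c1)).
rewrite mulr0 oppr0 addr0; congr ccvg; apply/funext => n.
by rewrite eps_transport.
Qed.

(** The gradient of e_n is of order 1 / eps_n, so eps_n e_n psi stays in a fixed multiple of the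
    unit ball. *)
Lemma osc_W1 psi : test_fun D psi -> exists2 B, 0 < B & forall n,
  (W1_norm D p' (fun z => ((eps n / B)%:C * (e_ n z * psi z))%R) <= 1)%E.
Proof.
move=> tp; have [Ee Ee0 hE] : exists2 Ee, 0 <= Ee & forall n, eps n <= Ee.
  have [M hM] := cvgn_ubound (cvgP _ epscvg).
  by exists M => //; apply: le_trans (hM 0%N); exact: ltW.
pose kap (j : J) : R := match j with inl i => 2 * pi * `|(q 0 i)%:~R| | inr _ => 0 end.
have kapE n j : eps n * `|kosc q (eps n)^-1 j| = kap j.
  case: j => [i|i] /=; last by rewrite normr0 mulr0.
  rewrite normrM [`|2 * pi / eps n|]gtr0_norm; last by rewrite divr_gt0// mulr_gt0// pi_gt0.
  have en0 : eps n != 0 by rewrite gt_eqF.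
  by field.
have Lp := test_fun_cLfun mD p'0 tp; have Lj j := partial_cLfun j mD p'0 tp.
pose N0 := nrm mu D p' psi; pose Nj j := nrm mu D p' (partial j psi).
(* [Ee] bounds all eps_n, and [kap j] is eps_n times the modulus of the j-th frequency, independent
   of n. The final 1 makes B positive. *)
pose B := Ee * N0 + \sum_j (Ee * Nj j + kap j * N0) + 1.
have kap0 j : 0 <= kap j by case: j => i //=; rewrite !mulr_ge0// ltW// pi_gt0.
have B0 : 0 < B.
  rewrite ltr_wpDl// addr_ge0 ?mulr_ge0 ?nrm_ge0// sumr_ge0// => j _.
  by rewrite addr_ge0// mulr_ge0 ?nrm_ge0.
exists B => // n; have eB0 : 0 <= eps n / B by rewrite divr_ge0 ?ltW.
have P0 : cLfun mu D p' (fun z => (eps n / B)%:C * (e_ n z * psi z)) /\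
    nrm mu D p' (fun z => (eps n / B)%:C * (e_ n z * psi z)) <= eps n / B * N0.
  have [L1 n1] := osc_Lp q (eps n)^-1 p'0 Lp; have [L2 n2] := cLfunZ mD (eps n / B)%:C p'0 L1.
  by split; [exact: L2|rewrite n2 normcR ger0_norm// ler_wpM2l].
have PE j : partial j (fun z => (eps n / B)%:C * (e_ n z * psi z)) =
    (fun z => (eps n / B)%:C * (e_ n z * partial j psi z) +
       (eps n / B * kosc q (eps n)^-1 j)%:C * (Complex 0 1 * (e_ n z * psi z))).
  apply/funext => z; apply: cder_partial.
  have c0 := cder_smooth j z (smooth_cst ((eps n / B)%:C)).
  have p00 : partial j (fun _ : Z => (eps n / B)%:C) z = 0.
    by apply: eq_complexP; rewrite /partial/= derive_cst.
  have [spsi _ _] := tp.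
  have := cderM c0 (cderM (cder_osc q (eps n)^-1 j z) (cder_smooth j z spsi)).
  rewrite p00 mul0r addr0; congr cder.
  rewrite mulrDr; congr (_ + _).
  have -> : Complex 0 (kosc q (eps n)^-1 j) = (kosc q (eps n)^-1 j)%:C * Complex 0 1.
    by apply: eq_complexP; rewrite ?cReM ?cImM/=; ring.
  rewrite /e_; set x := eps n / B; set k := kosc _ _ _.
  have -> : (x * k)%:C = x%:C * k%:C by rewrite -rmorphM.
  by ring.
have Pj j : cLfun mu D p' (partial j (fun z => (eps n / B)%:C * (e_ n z * psi z))) /\
    nrm mu D p' (partial j (fun z => (eps n / B)%:C * (e_ n z * psi z))) <= (eps n * Nj j + kap j * N0) / B.
  have [L1 n1] := osc_Lp q (eps n)^-1 p'0 (Lj j); have [L2 n2] := cLfunZ mD (eps n / B)%:C p'0 L1.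
  have [L3 n3] := osc_Lp q (eps n)^-1 p'0 Lp; have [L4 n4] := cLfunZ mD (Complex 0 1) p'0 L3.
  have [L5 n5] := cLfunZ mD ((eps n / B * kosc q (eps n)^-1 j)%:C) p'0 L4.
  have [L6 n6] := cLfunD mD (ltW p'1) L2 L5.
  rewrite PE; split; first exact: L6.
  apply: le_trans n6 _; rewrite n2 n5 n4 !normcR mulrDl; apply: lerD.
    by rewrite ger0_norm// mulrAC ler_wpM2r ?invr_ge0 ?(ltW B0)// ler_wpM2l// ltW.
  have -> : normc (Complex (0 : R) 1) = 1 by rewrite normc_sqrtE/= expr0n expr1n add0r sqrtr1.
  rewrite mul1r normrM (ger0_norm eB0) -(kapE n j).
  have -> : eps n * `|kosc q (eps n)^-1 j| * N0 / B = eps n / B * `|kosc q (eps n)^-1 j| * N0 by ring.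
  apply: ler_wpM2l; last exact: n3.
  by rewrite mulr_ge0.
rewrite /W1_norm nrmE; last exact: P0.1.
under eq_bigr => j _ do rewrite (nrmE (Pj j).1).
rewrite sumEFin -EFinD lee_fin.
apply: (@le_trans _ _ (eps n / B * N0 + \sum_j (eps n * Nj j + kap j * N0) / B)).
  by apply: lerD; [exact: P0.2|apply: ler_sum => j _; exact: (Pj j).2].
rewrite -mulr_suml mulrAC -mulrDl ler_pdivrMr// mul1r /B.
apply: ler_wpDr => //; apply: lerD; first by rewrite ler_wpM2r ?nrm_ge0.
by apply: ler_sum => j _; rewrite lerD2r ler_wpM2r ?nrm_ge0.
Qed.

(* Strong convergence lets a fixed f_m replace f_n, since eps_n e_n psi stays
   bounded in W^{1,p'}; for fixed m the Riemann-Lebesgue lemma applies. *)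
Lemma diagonal_null phi : test_fun D phi ->
  ccvg (fun n => (eps n)%:C * f_ n (fun z => e_ n z * phi z)) 0.
Proof.
move=> tphi; have [chi [psi [tchi tpsi phiE]]] := cutoff_factor oD tphi.
have [B B0 hB] := osc_W1 tpsi.
have dist n : distribution_on D (f_ n) by have [h _ _] := f_cvg; case: (h n).
have distf : distribution_on D f by have [_ h _] := f_cvg; case: h.
pose Psi n z := (eps n / B)%:C * (e_ n z * psi z).
have tPsi n : test_fun D (Psi n).
  apply: test_funM; first exact: smooth_cst.
  exact: test_fun_osc.
have scale m n : f_ m (fun z => chi z * Psi n z) = (B^-1)%:C * ((eps n)%:C * f_ m (fun z => e_ n z * phi z)).
  rewrite mulrA -rmorphM/= [B^-1 * _]mulrC -(dist_scale _ (dist m) (test_fun_osc n tphi)).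
  by congr (f_ m _); apply/funext => z; rewrite /Psi phiE; ring.
suff h : ccvg (fun n => f_ n (fun z => chi z * Psi n z)) 0.
  have := ccvgZ B%:C h; rewrite mulr0; congr ccvg; apply/funext => n.
  by rewrite scale mulrA -rmorphM/= divff ?gt_eqF// rmorph1 mul1r.
move=> e e0; have e4 : 0 < e / 4 by rewrite divr_gt0.
have [m0 _ hm0] := Wm1_loc_cvg_unif f_cvg tchi e4.
have cm0 : ccvg (fun n => f_ m0 (fun z => chi z * Psi n z)) 0.
  have := ccvgZ (B^-1)%:C (fixed_null m0 tphi); rewrite mulr0; congr ccvg.
  by apply/funext => n; rewrite scale.
have h1 := cm0 _ e4.
near=> n; rewrite subr0.
have n0 : (m0 <= n)%N by near: n; exists m0.
have b1 := hm0 n n0 _ (tPsi n) (hB n).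
have b2 := hm0 m0 (leqnn _) _ (tPsi n) (hB n).
have b3 : normc (f_ m0 (fun z => chi z * Psi n z)) < e / 4.
  have : normc (f_ m0 (fun z => chi z * Psi n z) - 0) < e / 4 by near: n.
  by rewrite subr0.
set x := f_ n _ in b1 *; set y := f_ m0 _ in b2 b3; set t := f _ in b1 b2.
rewrite (_ : x = (x - t) + (t - y) + y); last by rewrite addrA subrK subrK.
apply: le_lt_trans (le_normcD _ _) _.
have := le_normcD (x - t) (t - y); rewrite (normcB t y) => b4; lra.
Unshelve. all: by end_near. Qed.

Lemma test_null phi : test_fun D phi ->
  ccvg (fun n => cintegral mu D (fun z => e_ n z * (u_ n z * ((dotz (a z.1 z.2) q)%:C * phi z)))) 0.
Proof.
move=> tp; have [B hB] := regular_part_bounded tp.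
have c1 := diagonal_null tp.
have c2 := ccvg_eps eps0 epscvg (fun n => hB n n).
have := ccvgZ (Complex 0 (2 * pi))^-1 (ccvgD c2 (ccvgN c1)).
rewrite oppr0 addr0 mulr0; congr ccvg; apply/funext => n.
have i0 : Complex 0 (2 * pi) != 0 :> R[i].
  by rewrite eq_complex/= negb_and mulf_neq0 ?orbT// gt_eqF// pi_gt0.
by rewrite eps_transport// opprB addrC subrK mulrA mulVf// mul1r.
Qed.

End test_null.

Hypothesis nondegenerate : forall q : 'rV[int]_d, q != 0 ->
     (exists x l, [/\ Omega x, V l & fourier_coef sigma x q l != 0]) ->
     exists x l, [/\ Omega x, V l & dotz (a x l) q != 0].
Variable w : Z -> R[i].
Hypothesis uw : fiberwise Omega V p K u w.
Let Lw : cLfun mu D p w. Proof. by case: uw. Qed.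

(** [null_of_test] with b = a.q and the sequence e_n u_n: [test_null] handles the test functions
    carrying the factor b, and analyticity makes the zero set of b negligible. *)
Lemma osc_null q g : q != 0 -> (exists x l, [/\ Omega x, V l & dotz (a x l) q != 0]) ->
  cLfun mu D p' g ->
  ccvg (fun n => cintegral mu D (fun z => osc q (eps n)^-1 z.1 * u_ n z * g z)) 0.
Proof.
move=> q0 [x0 [l0 [Ox Vl aq]]] Lg; have [M M0 hM] := u_bounded.
apply: (null_of_test (M := M) (b := fun z => dotz (a z.1 z.2) q) p1 pq oD _ _ _ _ _ Lg).
- by move=> z; exact: dotz_continuous.
- apply: zero_set_negligible => //; first exact: dotz_measurable.
  + move=> z j Dz.
    have := analytic_lin_dichotomy (index_enum 'I_d) (fun i => (q 0 i)%:~R) j a_analytic Dz.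
    congr zero_dichotomy; apply/funext => t.
    by apply: eq_bigr => i _; rewrite mulrC.
  + by exists (x0, l0).
- by move=> n; exact: (osc_Lp _ _ p0 (Lu_ n)).1.
- by move=> n; apply: le_trans (hM n); exact: (osc_Lp _ _ p0 (Lu_ n)).2.
- move=> phi tp; have := test_null q0 tp; congr ccvg; apply/funext => n.
  by apply: eq_cintegral => z _; rewrite mulrA.
Qed.

Lemma fourier_fcoef x q l : fourier_coef sigma x q l = fcoef (fun y => sigma x y l) q.
Proof. by apply: eq_cintegral => y _; rewrite twN. Qed.

Lemma osc_cell q A B : measurable A -> (lam A < +oo)%E -> measurable B -> (lam B < +oo)%E ->
  (q != 0 -> exists x l, [/\ Omega x, V l & fourier_coef sigma x q l != 0]) ->
  ccvg (fun n => cintegral mu D (fun z => osc q (eps n)^-1 z.1 * (cind A z.1 * cind B z.2) * w_ n z))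
    ((q == 0)%:R * cintegral mu D (fun z => cind A z.1 * cind B z.2 * w z)).
Proof.
move=> mA fA mB fB hq.
have [LB _] := cLfun_ind mV p'0 mB fB.
have LK : cLfun mu D p' (fun z => cind A z.1 * K (cind B) z.2).
  by apply: tensor_cLfun => //; exact: K_Lp'.
have mosc (s : R) : cmeas setT (osc q s) by exact: cmeas_osc.
have osc1 (s : R) x : normc (osc q s x) <= 1 by rewrite normc_osc.
have m1 : cmeas (setT : set E) (fun=> 1 : R[i]) by exact: cmeas_cst.
have n1 (x : E) : normc (1 : R[i]) <= 1 by rewrite normc1.
have E_ n := pairing mO mV p1 pq K_cts K_symm K_Lp' (mosc (eps n)^-1) ler01 (osc1 _) mA fA LB (Lu_ n) (w_K n).
under eq_fun do rewrite E_.
have [q0|q0] := eqVneq q 0; last first.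
  rewrite mul0r; have := osc_null q0 (nondegenerate q0 (hq q0)) LK.
  by congr ccvg; apply/funext => n; apply: eq_cintegral => z _; rewrite mulrAC mulrA.
(* For q = 0 there is no oscillation: weak convergence of u_n gives the limit against K 1_B, and the
   pairing is undone for [u] to express it through [w]. *)
have Ew := pairing mO mV p1 pq K_cts K_symm K_Lp' m1 ler01 n1 mA fA LB Lu uw.
have [_ _ /(_ _ LK)/ccvgP] := u_cvg; congr ccvg.
  apply/funext => n; apply: eq_cintegral => z _.
  by rewrite q0 [osc _ _ _]tw0 mul1r mulrC.
rewrite mulr1n mul1r; transitivity (cintegral mu D (fun z => 1 * (cind A z.1 * cind B z.2) * w z)).
  by rewrite Ew; apply: eq_cintegral => z _; rewrite mul1r mulrC.
by apply: eq_cintegral => z _; rewrite mul1r.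
Qed.

(** * Coefficient frozen at one point of a cell *)

Section frozen_cell.
Variables (z0 : Z) (Dz0 : D z0) (A B : set E).
Hypotheses (mA : measurable A) (fA : (lam A < +oo)%E) (mB : measurable B) (fB : (lam B < +oo)%E).
Let h y := sigma z0.1 y z0.2.
Let AB (z : Z) : R[i] := cind A z.1 * cind B z.2.

(** A vanishing Fourier coefficient kills the term whatever the oscillating integral does; a nonzero
    one has [z0] as the witness required by the nondegeneracy hypothesis. *)
Let osc_fcoef q :
  ccvg (fun n => fcoef h q * cintegral mu D (fun z => osc q (eps n)^-1 z.1 * AB z * w_ n z))
    (fcoef h q * ((q == 0)%:R * cintegral mu D (fun z => AB z * w z))).
Proof.
have [h0|h0] := eqVneq (fcoef h q) 0.
  by under eq_fun do rewrite h0 mul0r; rewrite h0 mul0r; exact: ccvg_cst.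
apply: ccvgZ; apply: osc_cell => // _; exists z0.1, z0.2; case: Dz0 => Oz Vz.
by split => //; rewrite fourier_fcoef.
Qed.

Let LAB : cLfun mu D p' AB.
Proof. by apply: tensor_cLfun => //; exact: (cLfun_ind mV p'0 mB fB).1. Qed.

Lemma fsum_cell_cLfun N' s : cLfun mu D p' (fun z => fsum N' h (s *: z.1) * AB z).
Proof.
have Lq q : cLfun mu D p' (fun z => fcoef h q * (osc q s z.1 * AB z)).
  by apply: (cLfunZ mD _ p'0 _).1; exact: (osc_Lp q s p'0 LAB).1.
have L2 := (cLfunZ mD (fwt d N')%:C p'0 (cLfun_sum mD (index_enum _) (ltW p'1) (fun al : {ffun 'I_d -> 'I_N'.+1} =>
  (cLfun_sum mD (index_enum _) (ltW p'1) (fun be : {ffun 'I_d -> 'I_N'.+1} => Lq (zrow al - zrow be))).1)).1).1.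
apply: (cLfun_eq mD p'0 _ L2).1 => z _.
rewrite /fsum -mulrA mulr_suml; congr (_ * _); apply: eq_bigr => al _.
by rewrite mulr_suml; apply: eq_bigr => be _; rewrite mulrA.
Qed.

(** The Fejer order does not appear in the limit: only the zero frequency survives, and its total
    weight in a Fejer sum is 1. *)
Lemma fsum_cell_cvg N' :
  ccvg (fun n => cintegral mu D (fun z => fsum N' h ((eps n)^-1 *: z.1) * AB z * w_ n z))
    (fcoef h 0 * cintegral mu D (fun z => AB z * w z)).
Proof.
pose I q n := cintegral mu D (fun z => osc q (eps n)^-1 z.1 * AB z * w_ n z).
have Iq q n : cintegrable mu D (fun z => osc q (eps n)^-1 z.1 * AB z * w_ n z).
  by have [] := hoelder_cLfun mD p'0 p0 qp (osc_Lp q (eps n)^-1 p'0 LAB).1 (Lw_ n).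
have E1 n : cintegral mu D (fun z => fsum N' h ((eps n)^-1 *: z.1) * AB z * w_ n z) =
    (fwt d N')%:C * \sum_(al : {ffun 'I_d -> 'I_N'.+1}) \sum_(be : {ffun 'I_d -> 'I_N'.+1}) fcoef h (zrow al - zrow be) * I (zrow al - zrow be) n.
  have i1 (al be : {ffun 'I_d -> 'I_N'.+1}) := cintegrableZ mD (fcoef h (zrow al - zrow be)) (Iq (zrow al - zrow be) n).
  have i2 al := cintegrable_sum mD (index_enum _) (i1 al).
  under [in RHS]eq_bigr => al _ do under eq_bigr => be _ do rewrite -(cintegralZ mD _ (Iq _ n)).
  under [in RHS]eq_bigr => al _ do rewrite -(cintegral_sum mD (index_enum _) (i1 al)).
  rewrite -(cintegral_sum mD (index_enum _) i2) -(cintegralZ mD _ (cintegrable_sum mD (index_enum _) i2)).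
  apply: eq_cintegral => z _; rewrite /fsum -!mulrA mulr_suml; congr (_ * _).
  by apply: eq_bigr => al _; rewrite mulr_suml; apply: eq_bigr => be _; rewrite !mulrA.
have := ccvgZ (fwt d N')%:C (ccvg_sum (index_enum _) (fun al : {ffun 'I_d -> 'I_N'.+1} =>
  ccvg_sum (index_enum _) (fun be : {ffun 'I_d -> 'I_N'.+1} => osc_fcoef (zrow al - zrow be)))).
congr ccvg; first by apply/funext => n; rewrite E1.
rewrite -[RHS](fwt_diag d N'); congr (_ * _); apply: eq_bigr => al _; apply: eq_bigr => be _.
by case: eqVneq => [->|_]; rewrite ?mul1r// !mul0r mulr0.
Qed.

End frozen_cell.

(** Identifies the coefficient of the limit equation, multiplied by a test function, with continuous
    means; its membership in L^{p'} and its uniform approximation by cells rest on this. *)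
Lemma smean_fourier S phi z : S `<=` D -> (forall z, ~ S z -> phi z = 0) ->
  fourier_coef sigma z.1 0 z.2 * phi z =
  Complex (smean (@complex.Re R \o phi) z) (smean (@complex.Im R \o phi) z).
Proof.
move=> SD f0; have [Sz|nS] := pselect (S z); last first.
  rewrite f0// mulr0; apply: eq_complexP; rewrite /= /smean -[LHS](congr1 (@complex.Re R) (cintegral0 lam (@ucube R d)));
  by apply: eq_Rintegral => y _; rewrite /sext /= f0// mulr0.
have [Oz Vz] := SD _ Sz; have cs := sigma_cts_y Oz Vz.
have [M _ hM] := periodic_bounded cs (fun y k => sigma_periodic y k Oz Vz).
have ig : cintegrable lam (@ucube R d) (fun y => (sigma z.1 y z.2)%:C).
  apply: (@cintegrable_cube _ _ _ M).
    by apply: cmeas_real; apply: measurable_funTS; exact: continuous_measurable_rV.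
  by move=> y _; rewrite normcR.
rewrite fourier_fcoef [fcoef _ _](_ : _ = cintegral lam (@ucube R d) (fun y => (sigma z.1 y z.2)%:C)); last first.
  by apply: eq_cintegral => y _; rewrite oppr0 tw0 mulr1.
rewrite mulrC -(cintegralZ (@measurable_ucube R d) _ ig); apply: eq_complexP; apply: eq_Rintegral => y _.
  by rewrite cReM /= mulr0 subr0 mulrC.
by rewrite cImM /= mulr0 add0r mulrC.
Qed.

(* On each cell of a fine grid, the coefficient is frozen in (x, lambda) and
   replaced by a Fejer sum in the fast variable. *)
Lemma oscillating_limit phi : D !=set0 -> test_fun D phi ->
  ccvg (fun n => cintegral mu D (fun z => sphi phi (eps n)^-1 z * w_ n z))
    (cintegral mu D (fun z => fourier_coef sigma z.1 0 z.2 * phi z * w z)).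
Proof.
move=> [zD DzD] tp; have [Bs _ hs] := sphi_cLfun tp.
have /test_fun_parts[S [cS SD f0 s1 s2]] := tp.
have z1 z : ~ S z -> (@complex.Re R \o phi) z = 0 by move=> nS /=; rewrite f0.
have z2 z : ~ S z -> (@complex.Im R \o phi) z = 0 by move=> nS /=; rewrite f0.
have c1 := rsmooth_continuous s1; have c2 := rsmooth_continuous s2.
have [M1 M10 h1] := compact_fun_bounded cS c1.
have [M2 M20 h2] := compact_fun_bounded cS c2.
pose M := M1 + M2; have M0 : 0 <= M by rewrite addr_ge0.
have hM z : normc (phi z) <= M.
  have [Sz|nS] := pselect (S z); last by rewrite f0// normc0.
  by apply: le_trans (normc_le _) _; apply: lerD; [exact: h1|exact: h2].
have [k Sk] := compact_Qbox cS; have [Mw Mw0 hw] := w_bounded.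
pose F z := fourier_coef sigma z.1 0 z.2 * phi z.
have FE z : F z = _ := smean_fourier z SD f0.
have LF : cLfun mu D p' F.
  apply: (cts_support_cLfun mD p'0 cS).
  - have -> : @complex.Re R \o F = smean (@complex.Re R \o phi) by apply/funext => z /=; rewrite FE.
    exact: (smean_continuous cS SD c1 z1).
  - have -> : @complex.Im R \o F = smean (@complex.Im R \o phi) by apply/funext => z /=; rewrite FE.
    exact: (smean_continuous cS SD c2 z2).
  - by move=> z nS; rewrite /F f0// mulr0.
apply: ccvg_approx => e e0.
pose Q := nrm mu D p' (cind (Qbox k.+1) : Z -> R[i]); have Q0 : 0 <= Q by exact: nrm_ge0.
pose T := Mw + nrm mu D p w; have T0 : 0 <= T by rewrite addr_ge0// nrm_ge0.
(* An error 3 del supported in [Qbox k.+1], paired with a function of norm at most T, costs at most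
   2 * 3 del Q T <= e, the 2 coming from the complex Hoelder bound. [T] covers both the w_n and
   w. *)
pose del := e / (6 * (Q * T + 1)).
have QT : 0 < 6 * (Q * T + 1) by rewrite mulr_gt0// ltr_wpDl// mulr_ge0.
have del0 : 0 < del by rewrite divr_gt0.
have d3 : 0 <= 3 * del by rewrite mulr_ge0// ltW.
have [r1 r10 hr1] := sext_uniform cS SD c1 z1 del0.
have [r2 r20 hr2] := sext_uniform cS SD c2 z2 del0.
pose r := Num.min r1 r2; have r0 : 0 < r by rewrite lt_min r10.
have [N Nr] : exists N, N.+1%:R^-1 < r.
  by have [N _ /(_ N (leqnn N))] := near_infty_natSinv_lt (PosNum r0); exists N.
pose I := {ffun 'I_d + 'I_d -> 'I_(2 * k * N.+1)}.
(* Freezing points must lie in D for continuity and nondegeneracy. If the cell misses D the default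
   [zD] is harmless, as the indicator of the cell then vanishes on D. *)
have /choice[zm hzm] : forall m : I, exists z, D z /\ ((exists2 z', D z' & gcell m z') -> gcell (R := R) m z).
  move=> m; have [[z' Dz' mz']|nz] := pselect (exists2 z', D z' & gcell (R := R) m z').
    by exists z'.
  by exists zD.
pose h m y := sigma (zm m).1 y (zm m).2.
have del' : 0 < del / (M + 1) by rewrite divr_gt0// ltr_wpDl.
(* Each of the finitely many cells gets its own Fejer order; the divisor M + 1 absorbs the factor
   phi (zm m). *)
have /choice[Nf hNf] : forall m : I, exists N', forall s, normc ((h m s)%:C - fsum N' (h m) s) <= del / (M + 1).
  move=> m; have [[Oz Vz] _] := hzm m; apply: fejer_approx => //; first exact: sigma_cts_y.
  by move=> y l; exact: sigma_periodic.
pose c m n (z : Z) := phi (zm m) * fsum (Nf m) (h m) ((eps n)^-1 *: z.1).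
pose G n (z : Z) : R[i] := \sum_(m : I) c m n z * cind (gcell (R := R) m) z.
pose G' (z : Z) : R[i] := \sum_(m : I) F (zm m) * cind (gcell (R := R) m) z.
have ball_r m z : D z -> gcell m z -> ball z r1 (zm m) /\ ball z r2 (zm m).
  move=> Dz mz; have [Dm hm] := hzm m; have bz := gcell_ball Nr mz (hm (ex_intro2 _ _ z Dz mz)).
  by split; apply: le_ball bz; rewrite ge_min lexx ?orbT.
have near_phi n z : D z -> normc (sphi phi (eps n)^-1 z - G n z) <= 3 * del.
  move=> Dz; have [[m mz]|nm] := pselect (exists m : I, gcell m z); last first.
    rewrite /G gcell_sum0; last by move=> m mz; apply: nm; exists m.
    rewrite subr0 /sphi f0 ?mulr0 ?normc0//.
    by move=> /Sk /gcell_cover -/(_ N)[m mz]; apply: nm; exists m.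
  rewrite /G (gcell_sum _ mz) /c; set s := (eps n)^-1 *: z.1.
  have [b1 b2] := ball_r m z Dz mz.
  rewrite (_ : _ - _ = (sphi phi (eps n)^-1 z - phi (zm m) * (h m s)%:C) +
    phi (zm m) * ((h m s)%:C - fsum (Nf m) (h m) s)); last by rewrite mulrBr addrA subrK.
  apply: le_trans (le_normcD _ _) _; rewrite (_ : 3 * del = del + del + del); last by ring.
  apply: lerD.
    apply: le_trans (normc_le _) _; apply: lerD.
      rewrite (_ : complex.Re _ = sext (@complex.Re R \o phi) (z, s) - sext (@complex.Re R \o phi) (zm m, s)); first exact: hr1.
      by rewrite /sext /sphi cReD cReN !cReM /= !mul0r mulr0 !subr0 [complex.Re (phi _) * _]mulrC.
    rewrite (_ : complex.Im _ = sext (@complex.Im R \o phi) (z, s) - sext (@complex.Im R \o phi) (zm m, s)); first exact: hr2.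
    by rewrite /sext /sphi cImD cImN !cImM /= !mul0r mulr0 addr0 add0r [complex.Im (phi _) * _]mulrC.
  rewrite normcM; apply: le_trans (_ : M * (del / (M + 1)) <= _).
    by rewrite ler_pM ?normc_ge0.
  by rewrite mulrCA ler_piMr ?(ltW del0)// ler_pdivrMr ?mul1r ?lerDl// ltr_wpDl.
have near_F z : D z -> normc (F z - G' z) <= 3 * del.
  move=> Dz; have [[m mz]|nm] := pselect (exists m : I, gcell m z); last first.
    rewrite /G' gcell_sum0; last by move=> m mz; apply: nm; exists m.
    rewrite subr0 /F f0 ?mulr0 ?normc0//.
    by move=> /Sk /gcell_cover -/(_ N)[m mz]; apply: nm; exists m.
  rewrite /G' (gcell_sum _ mz) !FE; have [b1 b2] := ball_r m z Dz mz.
  apply: le_trans (normc_le _) _.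
  rewrite (_ : 3 * del = del + del + del); last by ring.
  (* There is no Fejer error here, only those of the real and imaginary parts; the third del is
     slack, so that [small] serves both comparisons. *)
  apply: ler_wpDr (ltW del0) _.
  apply: lerD; rewrite ?cReD ?cReN ?cImD ?cImN /=.
    by apply: (smean_uniform cS SD c1 z1) => y; exact: hr1.
  by apply: (smean_uniform cS SD c2 z2) => y; exact: hr2.
have Lc m s : cLfun mu D p' (fun z => phi (zm m) * (fsum (Nf m) (h m) (s *: z.1) * cind (gcell m) z)).
  apply: (cLfunZ mD _ p'0 _).1.
  have [Dm _] := hzm m.
  have := fsum_cell_cLfun (zm m) (measurable_gcellA m) (gcellA_fin m) (measurable_gcellB m) (gcellB_fin m) (Nf m) s.
  by under eq_fun do rewrite -cind_gcell.
have LG n : cLfun mu D p' (G n).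
  have := (cLfun_sum mD (index_enum I) (ltW p'1) (fun m => Lc m (eps n)^-1)).1.
  by congr cLfun; apply/funext => z; apply: eq_bigr => m _; rewrite mulrA.
have Lg m : cLfun mu D p' (cind (gcell (R := R) (m : I)) : Z -> R[i]).
  have LB := (cLfun_ind mV p'0 (measurable_gcellB (R := R) m) (gcellB_fin m)).1.
  have := tensor_cLfun mO mV p'0 (measurable_gcellA m) (gcellA_fin m) LB.
  by congr cLfun; apply/funext => z; rewrite cind_gcell.
have LG' : cLfun mu D p' G'.
  by have [] := cLfun_sum mD (index_enum I) (ltW p'1) (fun m => (cLfunZ mD (F (zm m)) p'0 (Lg m)).1).
exists (fun n => cintegral mu D (fun z => G n z * w_ n z)), (cintegral mu D (fun z => G' z * w z)).
have small (g1 g2 wf : Z -> R[i]) (T1 : R) : cLfun mu D p' g1 -> cLfun mu D p' g2 -> cLfun mu D p wf ->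
    nrm mu D p wf <= T1 -> T1 <= T -> (forall z, D z -> normc (g1 z - g2 z) <= 3 * del) ->
    (forall z, D z -> ~ Qbox k.+1 z -> g1 z - g2 z = 0) ->
    normc (cintegral mu D (fun z => g1 z * wf z) - cintegral mu D (fun z => g2 z * wf z)) <= e.
  move=> Lf Lg1 Lwf wT TT fg fg0.
  have [if1 _] := hoelder_cLfun mD p'0 p0 qp Lf Lwf; have [ig1 _] := hoelder_cLfun mD p'0 p0 qp Lg1 Lwf.
  have [Lfg _] := cLfunB mD (ltW p'1) Lf Lg1.
  have [_ nfg] := bounded_support_cLfun mD p'0 d3 (cLfun_meas Lfg) fg fg0.
  rewrite -(cintegralB mD if1 ig1).
  rewrite (eq_cintegral mu (g := fun z => (g1 z - g2 z) * wf z)); last by move=> z _; rewrite mulrBl.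
  apply: le_trans (normc_cintegral_hoelder mD p'0 p0 qp Lfg Lwf) _.
  have n1 : nrm mu D p' (fun z => g1 z - g2 z) * nrm mu D p wf <= 3 * del * Q * T.
    by rewrite ler_pM ?nrm_ge0// (le_trans wT).
  apply: le_trans (_ : 2 * (3 * del * Q * T) <= _); first by rewrite ler_wpM2l.
  rewrite (_ : 2 * (3 * del * Q * T) = e * (6 * (Q * T)) / (6 * (Q * T + 1))); last by rewrite /del; ring.
  by rewrite -mulrA ler_piMr ?(ltW e0)// ler_pdivrMr// mul1r ler_wpM2l// lerDl ler01.
have off m z : ~ Qbox k.+1 z -> ~ gcell (R := R) (m : I) z by move=> nQ /gcell_Qbox.
have offphi z : ~ Qbox k.+1 z -> phi z = 0.
  move=> nQ; apply: f0 => /Sk /QboxP hz; apply: nQ; apply/QboxP => j.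
  by apply: lt_trans (hz j) _; rewrite ltr_nat.
split.
- have -> : cintegral mu D (fun z => G' z * w z) =
      \sum_m phi (zm m) * (fcoef (h m) 0 * cintegral mu D (fun z => cind (gcellA m) z.1 * cind (gcellB m) z.2 * w z)).
    have im m := (hoelder_cLfun mD p'0 p0 qp (Lg m) Lw).1.
    rewrite (eq_cintegral mu (g := fun z => \sum_m F (zm m) * (cind (gcell m) z * w z))); last first.
      by move=> z _; rewrite mulr_suml; apply: eq_bigr => m _; rewrite mulrA.
    rewrite (cintegral_sum mD (index_enum I) (fun m => cintegrableZ mD (F (zm m)) (im m))).
    apply: eq_bigr => m _; rewrite (cintegralZ mD _ (im m)) /F fourier_fcoef mulrA [phi _ * _]mulrC; congr (_ * _).
    by apply: eq_cintegral => z _; rewrite cind_gcell.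
  have E1 n : cintegral mu D (fun z => G n z * w_ n z) = \sum_m phi (zm m) *
      cintegral mu D (fun z => fsum (Nf m) (h m) ((eps n)^-1 *: z.1) * (cind (gcellA m) z.1 * cind (gcellB m) z.2) * w_ n z).
    have Lc' m := fsum_cell_cLfun (zm m) (measurable_gcellA m) (gcellA_fin m) (measurable_gcellB m) (gcellB_fin m) (Nf m) (eps n)^-1.
    have im m := (hoelder_cLfun mD p'0 p0 qp (Lc' m) (Lw_ n)).1.
    under eq_bigr => m _ do rewrite -(cintegralZ mD _ (im m)).
    rewrite -(cintegral_sum mD (index_enum I) (fun m => cintegrableZ mD (phi (zm m)) (im m))).
    apply: eq_cintegral => z _; rewrite mulr_suml; apply: eq_bigr => m _.
    by rewrite cind_gcell /c !mulrA.
  rewrite (funext E1).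
  apply: ccvg_sum => m; apply: ccvgZ; have [Dm _] := hzm m.
  by apply: (fsum_cell_cvg Dm) => //;
    [exact: measurable_gcellA|exact: gcellA_fin|exact: measurable_gcellB|exact: gcellB_fin].
- move=> n; apply: (small _ _ _ Mw) => //; first by have [] := hs (eps n)^-1.
  + by rewrite lerDl nrm_ge0.
  + exact: near_phi.
  + move=> z _ nQ; rewrite /sphi offphi// mulr0 sub0r /G gcell_sum0 ?oppr0// => m; exact: off.
- apply: (small _ _ _ (nrm mu D p w)) => //.
  + by rewrite lerDr.
  + move=> z _ nQ; rewrite /F offphi// mulr0 sub0r /G' gcell_sum0 ?oppr0// => m; exact: off.
Qed.

Lemma dist_cvg phi : test_fun D phi -> ccvg (fun n => f_ n phi) (f phi).
Proof.
move=> tp; have [chi [psi [tchi tpsi phiE]]] := cutoff_factor oD tp.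
have [B B0 hB] : exists2 B, 0 < B & (W1_norm D p' (fun z => (B%:C * psi z)%R) <= 1)%E.
  (* At q = 0 the exponential is 1, so the bound for n = 0 normalizes psi itself. *)
  have [B B0 hB] := osc_W1 0 tpsi; exists (eps 0%N / B); first exact: divr_gt0.
  by have := hB 0%N; under eq_fun do rewrite [osc _ _ _]tw0 mul1r.
have tB : test_fun D (fun z => B%:C * psi z) by apply: test_funM => //; exact: smooth_cst.
have [hf_ hf _] := f_cvg.
have scale g : distribution_on D g -> g phi = (B^-1)%:C * g (fun z => chi z * (B%:C * psi z)).
  move=> dg; rewrite -(dist_scale _ dg); last by apply: test_funM => //; case: tchi.
  congr g; apply/funext => z; rewrite phiE.
  have b1 : B%:C * (B^-1)%:C = 1 :> R[i] by rewrite -rmorphM divff ?gt_eqF// rmorph1.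
  by rewrite mulrCA [(B^-1)%:C * _]mulrA [(B^-1)%:C * _]mulrC b1 mul1r.
rewrite (scale f hf.1); under eq_fun do rewrite (scale (f_ _) (hf_ _).1).
apply: ccvgZ => e e0; have e2 : 0 < e / 2 by rewrite divr_gt0.
have := Wm1_loc_cvg_unif f_cvg tchi e2; apply: filterS => n hn.
by apply: le_lt_trans (hn _ tB hB) _; rewrite ltr_pdivrMr// ltr_pMr// ltr1n.
Qed.

Lemma limit_equation phi : D !=set0 -> test_fun D phi ->
  f phi = - cintegral mu D (fun z => u z * tdiv a phi z) +
    cintegral mu D (fun z => fourier_coef sigma z.1 0 z.2 * w z * phi z).
Proof.
move=> D0 tp; apply: ccvg_unique (dist_cvg tp) _.
have Lt := tdiv_cLfun oD a_analytic (ltW p'1) tp.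
have [_ _ /(_ _ Lt)/ccvgP c1] := u_cvg.
have := ccvgD (ccvgN c1) (oscillating_limit D0 tp); congr ccvg.
  apply/funext => n; rewrite w_eq//; congr (_ + _).
  by apply: eq_cintegral => z _; rewrite /sphi mulrAC.
by congr (_ + _); apply: eq_cintegral => z _; rewrite mulrAC.
Qed.

End homogenization.

Theorem theorem4 (R : realType) (d : nat) (p p' : R)
  (Omega V : set 'rV[R]_d)
  (a : 'rV[R]_d -> 'rV[R]_d -> 'rV[R]_d)
  (sigma : 'rV[R]_d -> 'rV[R]_d -> 'rV[R]_d -> R)
  (K : ('rV[R]_d -> R[i]) -> 'rV[R]_d -> R[i])
  (eps : nat -> R)
  (p_range : 1 < p < 2) (p_conj : p^-1 + p'^-1 = 1)
  (Omega_domain : [/\ Omega !=set0, open Omega & connected Omega])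
  (V_domain : [/\ V !=set0, open V, connected V & bounded_set V])
  (a_analytic : forall i : 'I_d,
     real_analytic (Omega `*` V) (fun z => a z.1 z.2 0 i))
  (sigma_continuous : {within (Omega `*` [set: 'rV[R]_d]) `*` V,
     continuous (fun z : 'rV[R]_d * 'rV[R]_d * 'rV[R]_d =>
       sigma z.1.1 z.1.2 z.2)})
  (sigma_periodic : forall x y l (k : 'rV[int]_d), Omega x -> V l ->
     sigma x (y + map_mx intr k) l = sigma x y l)
  (K_continuous : cts_linear_Lp (lebesgue_rV d) V p K)
  (K_Lp' : forall u, cLfun (lebesgue_rV d) V p' u ->
     cLfun (lebesgue_rV d) V p' (K u))
  (K_symmetric : symmetric_Lp (lebesgue_rV d) V p p' K)
  (eps_gt0 : forall n, 0 < eps n) (eps_cvg0 : eps @ \oo --> (0 : R))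
  (nondegenerate : forall q : 'rV[int]_d, q != 0 ->
     (exists x l, [/\ Omega x, V l & fourier_coef sigma x q l != 0]) ->
     exists x l, [/\ Omega x, V l & dotz (a x l) q != 0])
  (u_ : nat -> 'rV[R]_d * 'rV[R]_d -> R[i]) (u : 'rV[R]_d * 'rV[R]_d -> R[i])
  (f_ : nat -> ('rV[R]_d * 'rV[R]_d -> R[i]) -> R[i])
  (f : ('rV[R]_d * 'rV[R]_d -> R[i]) -> R[i])
  (u_cvg : weak_Lp_cvg (phase_measure d) (Omega `*` V) p p' u_ u)
  (f_cvg : Wm1_loc_cvg (Omega `*` V) p' f_ f)
  (Lu_f : forall n, transport_eq Omega V p a
     (fun x l => (sigma x ((eps n)^-1 *: x) l)%:C) K (u_ n) (f_ n)) :
  transport_eq Omega V p a (fun x l => fourier_coef sigma x 0 l) K u f.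
Proof.
have /andP[p1 _] := p_range.
have [[x0 Ox0] oO cO] := Omega_domain; have [[l0 Vl0] oV cV _] := V_domain.
have [_ Lu _] := u_cvg.
(* The witness is built from [u] alone and not as a limit of the images of the u_n, to which it is
   related only through the symmetry of [K]. *)
have [w uw] := fiberwise_ex (open_measurable_rV oO) (open_measurable_rV oV) p1 K_continuous Lu.
have /choice[w_ hw] : forall n, exists w, fiberwise Omega V p K (u_ n) w /\
    forall phi, test_fun (Omega `*` V) phi -> f_ n phi =
      - cintegral (phase_measure d) (Omega `*` V) (fun z => u_ n z * tdiv a phi z) +
      cintegral (phase_measure d) (Omega `*` V)
        (fun z => (sigma z.1 ((eps n)^-1 *: z.1) z.2)%:C * w z * phi z).
  by move=> n; have [v hv hv'] := Lu_f n; exists v.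
exists w => // phi tp.
apply: (limit_equation p1 p_conj oO cO oV cV a_analytic sigma_continuous
  sigma_periodic K_continuous K_Lp' K_symmetric eps_gt0 eps_cvg0 u_cvg f_cvg
  (fun n => (hw n).1) (fun n => (hw n).2) nondegenerate uw _ tp).
by exists (x0, l0).
Qed.
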